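(* Let $f:\mathbb{N}_+\to(0,\infty)$ be a non-decreasing preferential attachment function that is constant on $[\kappa,\infty)$, for some $\kappa\in\mathbb{N}_+$, such that the matrix $A_\kappa$ satisfies $\Re\lambda_2(A_\kappa)<\lambda_1(A_\kappa)/2$. Then there exists a probability distribution $(p_k)_{k\ge1}$ on $\mathbb{N}_+$ such that, in the preferential attachment model with function $f$, the sequence $$\sqrt n\,\bigl(P_1(n)-p_1,\dots,P_\kappa(n)-p_\kappa,\ P_{>\kappa}(n)-p_{>\kappa}\bigr)$$ converges in distribution, as $n\to\infty$, to a centered normal distribution. If the preferential attachment function depends continuously on a parameter $\theta$, pointwise, then $p_k$ and the covariance matrix of the limit depend continuously on $\theta$ as well. If the condition $\Re\lambda_2(A_\kappa)<\lambda_1(A_\kappa)/2$ holds for every sufficiently large $\kappa$, then the sequence $\bigl(\sqrt n(P_k(n)-p_k);\ k=1,2,\dots\bigr)$ converges in distribution in $\mathbb{R}^\infty$ (with the product topology).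
   Context: Preferential attachment (PA) tree with PA function $f$: at time $1$ there is a single node $v_1$, of degree $1$ (a root with a loose edge). Given the tree at time $n$ with nodes $v_1,\dots,v_n$ of degrees $d_1(n),\dots,d_n(n)$, a new node $v_{n+1}$ of degree $1$ is attached by an edge to the node $v_i$ with conditional probability $f(d_i(n))/\sum_{j=1}^n f(d_j(n))$ given the past; the degree of the chosen node increases by $1$. $N_k(n)$ is the number of nodes of degree $k$ at time $n$, $P_k(n)=N_k(n)/n$, $P_{>k}(n)=\sum_{l>k}P_l(n)$, and $p_{>k}=\sum_{l>k}p_l$. For $\kappa\in\mathbb{N}_+$, $A_\kappa$ is the $(\kappa+1)\times(\kappa+1)$ matrix whose nonzero entries are: $(A_\kappa)_{1,j}=f(j)$ for $2\le j\le\kappa+1$; $(A_\kappa)_{i,i-1}=f(i-1)$ for $2\le i\le\kappa+1$; $(A_\kappa)_{i,i}=-f(i)$ for $2\le i\le\kappa$ (and $(A_\kappa)_{1,1}=(A_\kappa)_{\kappa+1,\kappa+1}=0$). Its eigenvalues (with multiplicity) are ordered by real part, $\lambda_1>\Re\lambda_2\ge\Re\lambda_3\ge\cdots$, where $\lambda_1>0$ is real. *)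

(* Defs.v *)
From HB Require Import structures.
From mathcomp Require Import all_boot all_order all_algebra.
From mathcomp Require Import complex.
From mathcomp Require Import all_classical all_reals all_analysis.

Set Implicit Arguments.
Unset Strict Implicit.
Unset Printing Implicit Defensive.

Import Order.TTheory GRing.Theory Num.Theory.
Import numFieldNormedType.Exports.

Local Open Scope classical_set_scope.
Local Open Scope ring_scope.

(* Functions on the positive integers are functions on nat whose value at 0
   is never used. *)

Section Spectrum.
Variable R : realType.

(* The eigenvalues of A in R[i], with multiplicity, by nonincreasing real part:
   lambda_i(A) is the entry at index i - 1. *)
Definition eigenvalues n (A : 'M[R]_n) : seq R[i] :=
  sort (fun z w : R[i] => complex.Re w <= complex.Re z)
    (sval (closed_field_poly_normal (char_poly (map_mx (real_complex R) A)))).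

Definition A_mx (f : nat -> R) (kappa : nat) : 'M[R]_kappa.+1 :=
  \matrix_(i0 < kappa.+1, j0 < kappa.+1)
    let i := i0.+1 in let j := j0.+1 in
    if (i == 1)%N && (2 <= j)%N then f j
    else if (2 <= i)%N && (j == i.-1)%N then f i.-1
    else if [&& 2 <= i, i <= kappa & j == i]%N then - f i
    else 0.

(* lambda_1(A_kappa) is real, so it is equal to its real part. *)
Definition spectral_gap (f : nat -> R) (kappa : nat) : Prop :=
  complex.Re (eigenvalues (A_mx f kappa))`_1
    < complex.Re (eigenvalues (A_mx f kappa))`_0 / 2.

Definition pa_function (f : nat -> R) : Prop :=
  (forall k, (1 <= k)%N -> 0 < f k) /\
  (forall j k, (1 <= j)%N -> (j <= k)%N -> f j <= f k).

Definition constant_from (f : nat -> R) (kappa : nat) : Prop :=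
  forall k, (kappa <= k)%N -> f k = f kappa.

End Spectrum.

Section Model.
Variable R : realType.

(* A tree is given by its attachment history h: for m >= 1, the node v_(m+1)
   is attached to v_(h m).  The degree of v_i at time n, for 1 <= i <= n, is 1
   (the edge to its parent, or the loose edge of the root) plus the number of
   its children. *)
Definition deg (h : nat -> nat) (i n : nat) : nat :=
  (1 + \sum_(1 <= m < n) (h m == i))%N.

Definition deg_count (h : nat -> nat) (k n : nat) : nat :=
  (\sum_(1 <= i < n.+1) (deg h i n == k))%N.

Definition deg_prop (h : nat -> nat) (n k : nat) : R :=
  (deg_count h k n)%:R / n%:R.

Definition tail (u : nat -> R) (k : nat) : R :=
  limn (fun n => \sum_(k.+1 <= l < n) u l).

Definition is_distribution (p : nat -> R) : Prop :=
  (forall k, (1 <= k)%N -> 0 <= p k) /\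
  (fun n => \sum_(1 <= k < n) p k) @ \oo --> (1 : R).

Definition same_past d (T : measurableType d) (c : nat -> T -> nat)
    (h : nat -> nat) (n : nat) : set T :=
  [set w | forall m, (1 <= m)%N -> (m < n)%N -> c m w = h m].

(* c is the random attachment history.  The tree at time n takes countably many
   values, so the conditional law of c n given the past is prescribed by its
   values given each possible past. *)
Definition pa_process d (T : measurableType d) (P : probability T R)
    (f : nat -> R) (c : nat -> {RV P >-> nat}) : Prop :=
  forall (h : nat -> nat) (n i : nat), (1 <= i)%N -> (i <= n)%N ->
    P (same_past c h n `&` [set w | c n w = i]) =
    (P (same_past c h n) *
      (f (deg h i n) / \sum_(1 <= j < n.+1) f (deg h j n))%:E)%E.

Definition finite_fluctuations (p : nat -> R) (kappa : nat) (h : nat -> nat)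
    (n : nat) : 'rV[R]_kappa.+1 :=
  \row_(i < kappa.+1)
    (Num.sqrt n%:R *
      (if (i < kappa)%N then deg_prop h n i.+1 - p i.+1
       else tail (deg_prop h n) kappa - tail p kappa)).

(* The coordinate at index k belongs to the degree k + 1. *)
Definition fluctuations (p : nat -> R) (h : nat -> nat) (n : nat) :
    {ptws nat -> R} :=
  fun k => Num.sqrt n%:R * (deg_prop h n k.+1 - p k.+1).

End Model.

(* The topological and pointed structures exist; this adds their join, so that
   {ptws nat -> R} is a ptopologicalType. *)
HB.instance Definition _ (I : Type) (T : I -> ptopologicalType) :=
  Pointed.on (prod_topology T).

Definition borel (S : ptopologicalType) := g_sigma_algebraType (@open S).

Definition cvg_in_distribution (R : realType) d (T : measurableType d)
    (P : probability T R) (S : ptopologicalType) (X : nat -> T -> S)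
    (mu : probability (borel S) R) : Prop :=
  forall g : S -> R, continuous g -> (exists M, forall x, `|g x| <= M) ->
    ((fun n => 'E_P[g \o X n]) @ \oo --> 'E_mu[g])%E.

(* All linear functionals have a centered normal law, possibly degenerate.
   normal_prob is a normal law only for nonzero standard deviation. *)
Definition centered_normal (R : realType) k
    (mu : probability (borel 'rV[R]_k.+1) R) : Prop :=
  forall a : 'cV[R]_k.+1, exists2 s : R, 0 <= s &
    forall B : set R, measurable B ->
      mu [set x : 'rV[R]_k.+1 | B ((x *m a) 0 0)] =
      if s == 0 then \d_(0 : R) B else normal_prob 0 s B.

Definition covariance_mx (R : realType) k
    (mu : probability (borel 'rV[R]_k.+1) R) : 'M[R]_k.+1 :=
  \matrix_(i, j) fine (covariance mu (fun x : 'rV[R]_k.+1 => x 0 i)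
                                     (fun x : 'rV[R]_k.+1 => x 0 j)).

(* Main.v *)
(* The degree counts, truncated at kappa, form an urn X(n) whose mean drift is
   X(n) A^T / (X(n) f), with A = A_kappa.  Perron's theorem gives lambda_1 =
   lam and a left eigenvector v with entries p_1, ..., p_kappa, p_(>kappa), so
   the fluctuation D(n) = X(n) - n v satisfies E[D(n+1) | past] = D(n) + D(n)
   M / n up to smaller terms, where M = B / lam, B = A^T - f v, has all its
   eigenvalues of real part < 1/2 by the spectral gap.  A quadratic form G
   adapted to B makes the last condition effective: G(xB, x) <= b G(x, x) with
   b < lam / 2.  It yields E G(D(n)) = O(n) and, for the dual norm N, the
   contraction N(t + t M^T / n) <= (1 + a / n) N(t) with a < 1/2.  The
   characteristic functions F_n(t) of D(n) satisfy F_(n+1)(t) = (1 - Gam(t) /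
   2) F_n(t + t M^T / n) + error, and so does T_n(t) = exp(- n Sig(t) / 2),
   where Sig solves the Lyapunov equation Sig = Sig M + M^T Sig + Gam.
   Iterating the recursion for F_n - T_n along the contraction gives
   convergence at t / sqrt n.  Sig is a rational function of lam, p and f,
   hence continuous in the parameter.  Convergence in distribution follows
   from convergence of characteristic functions because a bounded continuous
   function on R^infty is approximated on boxes by trigonometric polynomials
   (Bernstein polynomials in 1 + sin).  Uniqueness of the limit makes the
   covariances obtained for different kappa consistent, which gives the
   infinite-dimensional limit. *)
Require Import Defs.
From HB Require Import structures.
From mathcomp Require Import all_boot all_order all_algebra.
From mathcomp Require Import complex ring lra zify.
From mathcomp Require Import all_classical all_reals all_analysis.
From mathcomp Require Import measurable_realfun.

Set Implicit Arguments.
Unset Strict Implicit.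
Unset Printing Implicit Defensive.

Import Order.TTheory GRing.Theory Num.Theory.
Import numFieldNormedType.Exports.

Local Open Scope classical_set_scope.
Local Open Scope ring_scope.

(** * Gaussian measures *)

(** The obstacle to moment bounds is the random total weight in the denominator of the drift. The
    right eigenvector [urow] removes it: in the ratio of [G] to [dotv X urow], the drift of the
    numerator and the growth of the denominator carry the same factor 1 / weight, so the sign of 2 b
    - lam decides and no law of large numbers for the weight is needed first. The frequency expands
    along n steps like n^a, and a step costs |t|^3 + |t|^2 / sqrt n + |t| / n; a rate strictly above
    the contraction rate pays for this cost. Gaussian measures on R^infty are built from one uniform
    variable: its binary digits are dealt out to two independent uniform variables, iteration gives
    a sequence, a quantile makes it normal and a Cholesky factor correlates it. Finite-dimensional
    limits are images of these measures, so that one continuity theorem serves both statements.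
    Means over histories are finite sums; measurability enters only when a process on an arbitrary
    space is compared with them. Since p has to be one function of f for all kappa, lam is defined
    as the root of an equation that does not depend on the truncation. *)

Lemma cvg_invn (R : realType) : (fun n : nat => n%:R^-1 : R) @ \oo --> (0 : R).
Proof. by rewrite -(cvg_shiftS _); exact: cvg_harmonic. Qed.

Lemma continuous_cos_affine (R : realType) (t b : R) :
  continuous (fun x : R => cos (t * x + b)).
Proof.
move=> x; apply: continuous_comp; last exact: continuous_cos.
by apply: cvgD; [exact: mulrl_continuous|exact: cvg_cst].
Qed.

Lemma continuous_sin_affine (R : realType) (t b : R) :
  continuous (fun x : R => sin (t * x + b)).
Proof.
move=> x; apply: continuous_comp; last exact: continuous_sin.
by apply: cvgD; [exact: mulrl_continuous|exact: cvg_cst].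
Qed.

Lemma cvg_Rintegral_dominated d (T : measurableType d) (R : realType)
    (mu : {measure set T -> \bar R}) (f_ : nat -> T -> R) (f g : T -> R) :
  (forall n, measurable_fun setT (f_ n)) -> measurable_fun setT f ->
  (forall x, f_ ^~ x @ \oo --> f x) ->
  mu.-integrable setT (EFin \o g) ->
  (forall n x, `|f_ n x| <= g x) ->
  (fun n => \int[mu]_x f_ n x) @ \oo --> \int[mu]_x f x.
Proof.
move=> mf_ mf f_f ig f_g.
have cv : {ae mu, forall x, setT x -> (fun n => (EFin \o f_ n) x) @ \oo --> (EFin \o f) x}.
  by apply: aeW => x _; apply/cvg_EFin; [exact: nearW|exact: f_f].
have bd : {ae mu, forall x n, setT x -> (`|(EFin \o f_ n) x| <= (EFin \o g) x)%E}.
  by apply: aeW => x n _; rewrite lee_fin.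
have mEf_ n : measurable_fun setT (EFin \o f_ n) by exact/measurable_EFinP.
have mEf : measurable_fun setT (EFin \o f) by exact/measurable_EFinP.
have [If _ H] := dominated_convergence measurableT mEf_ mEf cv ig bd.
apply: fine_cvg; rewrite fineK//.
by apply: integrable_fin_num If.
Qed.

Lemma cvg_Rintegral_symmetric (R : realType) (h : R -> R) :
  (@lebesgue_measure R).-integrable setT (EFin \o h) ->
  (fun n : nat => \int[@lebesgue_measure R]_(x in `[- n.+1%:R, n.+1%:R]) h x) @ \oo
    --> \int[@lebesgue_measure R]_x h x.
Proof.
move=> ih.
have mh : measurable_fun setT h by have /measurable_int/measurable_EFinP := ih.
under eq_fun do rewrite Rintegral_mkcond.
apply: (@cvg_Rintegral_dominated _ _ R lebesgue_measure
  (fun n => h \_ `[- n.+1%:R, n.+1%:R]) h (fun x => `|h x|)) => //.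
- by move=> n; apply/(measurable_restrictT _ _).1 => //; exact: measurable_funTS.
- move=> x; apply: cvg_near_cst; near=> n.
  rewrite /restrict mem_set// /= in_itv/= -ler_norml.
  rewrite (@le_trans _ _ n%:R)// ?ler_nat//.
  by near: n; exact: nbhs_infty_ger.
- exact: (integrable_norm ih).
- by move=> n x; rewrite /restrict; case: ifP => _; rewrite ?normr0.
Unshelve. all: by end_near. Qed.

(** * Characteristic function of the normal law *)

Section NormalCf.
Variables (R : realType) (s : R).
Hypothesis s0 : s != 0.
Notation leb := (@lebesgue_measure R).
Notation w := (normal_pdf 0 s).

Lemma normal_pdf0E (r : R) : r != 0 ->
  normal_pdf 0 r = (fun x => normal_peak r * expR (- x ^+ 2 / (r ^+ 2 *+ 2))).
Proof. by move=> r0; rewrite normal_pdfE//; apply/funext => x; rewrite /normal_fun subr0. Qed.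

Lemma is_derive_normal_pdf (x : R) : is_derive x 1 w (- (x / s ^+ 2) * w x).
Proof.
rewrite (normal_pdf0E s0) /=; set c := normal_peak s; clearbody c.
apply: is_derive_eq.
set e := expR _; clearbody e.

rewrite /GRing.scale/=; field.
by rewrite s0.
Qed.

(** Doubling the standard deviation leaves a spare factor [expR (- (3 / 8 * (x / s) ^+ 2))], which
    absorbs [|x|]. This one bound yields both the integrability of [x * w x] and the decay of [w] at
    infinity. *)
Lemma normal_pdf_id_le : exists2 C : R, 0 <= C &
  forall x : R, `|x| * w x <= C * normal_pdf 0 (2 * s) x.
Proof.
have s20 : 2 * s != 0 by rewrite mulf_neq0.
have p0 : 0 < normal_peak (2 * s) by exact: normal_peak_gt0.
exists (`|s| * normal_peak s / normal_peak (2 * s)) => [|x].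
  by rewrite !mulr_ge0 ?normal_peak_ge0 ?invr_ge0 ?normal_peak_ge0.
rewrite !normal_pdf0E// !mulrA divfK ?gt_eqF// mulrAC [leRHS]mulrAC.
rewrite ler_wpM2r ?normal_peak_ge0//.
have -> : - x ^+ 2 / (s ^+ 2 *+ 2) =
   - x ^+ 2 / ((2 * s) ^+ 2 *+ 2) - 3 / 8 * (x / s) ^+ 2.
  by field; rewrite s0.
rewrite expRD mulrA [leLHS]mulrAC ler_wpM2r ?expR_ge0//.
rewrite expRN ler_pdivrMr ?expR_gt0//.
have s1 : 0 < `|s| by rewrite normr_gt0.
rewrite -ler_pdivrMl//.
have -> : `|s|^-1 * `|x| = `|x / s| by rewrite normrM normfV mulrC.
apply: le_trans (expR_ge1Dx _).
(* For [y = |x / s|] the claim is [y <= 1 + 3 / 8 * y ^+ 2]; the two sides are closest at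
   [y = 4 / 3]. *)
rewrite -(real_normK (num_real (x / s))).
by have := sqr_ge0 (`|x / s| - 4 / 3); nra.
Qed.

Lemma cvg_normal_pdf : (fun n : nat => w n%:R) @ \oo --> (0 : R).
Proof.
have [C C0 H] := normal_pdf_id_le.
have H0 : (fun n : nat => (C * normal_peak (2 * s)) * (n%:R)^-1 : R) @ \oo --> (0 : R).
  rewrite -[X in _ --> X](mulr0 (C * normal_peak (2 * s))).
  apply: cvgMl_tmp.
  exact: cvg_invn.
apply: (@squeeze_cvgr _ _ _ _ (fun=> 0) _ _ _ _ _ H0); last exact: cvg_cst.
near=> n; rewrite normal_pdf_ge0/=.
rewrite ler_pdivlMr; last by rewrite ltr0n; near: n; exists 1%N.
rewrite mulrC; have := H n%:R; rewrite ger0_norm// => /le_trans; apply.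
by rewrite ler_wpM2l// normal_pdf_ub// mulf_neq0.
Unshelve. all: by end_near. Qed.

Lemma integrable_bounded_normal (g : R -> R) : measurable_fun setT g ->
  (exists M, forall x, `|g x| <= M) -> leb.-integrable setT (fun x => (g x * w x)%:E).
Proof.
move=> mg [M gM].
apply: (@le_integrable _ _ _ leb setT _ _ (fun x => (M%:E * (w x)%:E)%E)) => //.
- by apply/measurable_EFinP; apply: measurable_funM => //; exact: measurable_normal_pdf.
- move=> x _; rewrite -EFinM !abse_EFin lee_fin !normrM.
  by rewrite ler_pM// (le_trans (gM x))// ler_norm.
- apply: integrableZl => //; exact: integrable_normal_pdf.
Qed.

Lemma integrable_id_normal (g : R -> R) : measurable_fun setT g ->
  (exists M, forall x, `|g x| <= M * `|x|) ->
  leb.-integrable setT (fun x => (g x * w x)%:E).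
Proof.
move=> mg [M gM]; have [C C0 H] := normal_pdf_id_le.
apply: (@le_integrable _ _ _ leb setT _ _ (fun x => ((M * C)%:E * (normal_pdf 0 (2 * s) x)%:E)%E)) => //.
- by apply/measurable_EFinP; apply: measurable_funM => //; exact: measurable_normal_pdf.
- move=> x _; rewrite -EFinM !abse_EFin lee_fin !normrM.
  rewrite !(ger0_norm (normal_pdf_ge0 _ _ _)) [`|C|]ger0_norm//.
  rewrite -mulrA (le_trans _ (ler_wpM2l _ (H x)))//.
  by rewrite mulrA ler_wpM2r ?normal_pdf_ge0// (le_trans (gM x))// ler_wpM2r// ler_norm.
- apply: integrableZl => //; exact: integrable_normal_pdf.
Qed.

(** Since [x * w x] is [- s ^+ 2] times the derivative of [w], the function [h] below is the
    derivative of [sin (t * x + b) * w x]. The fundamental theorem on symmetric intervals leaves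
    boundary terms that vanish with [w]. *)
Lemma normal_integral_by_parts (t b : R) :
  \int[leb]_x (x * sin (t * x + b) * w x) =
  s ^+ 2 * t * \int[leb]_x (cos (t * x + b) * w x).
Proof.
have msin : measurable_fun setT (fun x : R => sin (t * x + b)).
  by apply: continuous_measurable_fun; exact: continuous_sin_affine.
have mcos : measurable_fun setT (fun x : R => cos (t * x + b)).
  by apply: continuous_measurable_fun; exact: continuous_cos_affine.
pose h x := t * (cos (t * x + b) * w x) - (s ^+ 2)^-1 * (x * sin (t * x + b) * w x).
have ic : leb.-integrable setT (fun x => (cos (t * x + b) * w x)%:E).
  by apply: integrable_bounded_normal => //; exists 1 => x; exact: cos_max.
have iss : leb.-integrable setT (fun x => (x * sin (t * x + b) * w x)%:E).
  apply: integrable_id_normal; first exact: measurable_funM.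
  by exists 1 => x; rewrite normrM mul1r ler_piMr// sin_max.
have ih : leb.-integrable setT (EFin \o h).
  rewrite (_ : _ \o _ = (fun x => (t%:E * (cos (t * x + b) * w x)%:E)
     - ((s ^+ 2)^-1%:E * (x * sin (t * x + b) * w x)%:E))%E) //.
  by apply: integrableB => //; apply: integrableZl.
have dh (x : R) : is_derive x (1 : R) (fun x : R => sin (t * x + b) * w x) (h x).
  have dw := is_derive_normal_pdf x.
  apply: is_derive_eq; rewrite /h /GRing.scale/=; field.
  by rewrite s0.
have ch : continuous h.
  move=> x; have cw : {for x, continuous w} by exact: continuous_normal_pdf.
  rewrite /h; apply: cvgB; apply: cvgM; try exact: cvg_cst; apply: cvgM => //.
  - exact: continuous_cos_affine.
  - apply: cvgM; first exact: cvg_id.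
    exact: continuous_sin_affine.
have cH : continuous (fun x : R => sin (t * x + b) * w x).
  by move=> x; apply: cvgM; [exact: continuous_sin_affine|exact: continuous_normal_pdf].
have I0 : \int[leb]_x h x = 0.
  have In (n : nat) : \int[leb]_(x in `[- n.+1%:R, n.+1%:R]) h x =
      (sin (t * n.+1%:R + b) * w n.+1%:R) - (sin (t * - n.+1%:R + b) * w (- n.+1%:R)).
    rewrite /Rintegral (@continuous_FTC2 _ h (fun x => sin (t * x + b) * w x)) /=.
    - by [].
    - by rewrite gtrN// ltr0Sn.
    - by apply: continuous_subspaceT.
    - split.
      + by move=> x _; exact: @ex_derive _ _ _ _ _ _ _ (dh x).
      + by apply: cvg_at_right_filter; exact: cH.
      + by apply: cvg_at_left_filter; exact: cH.
    - by move=> x _; rewrite derive1E (@derive_val _ _ _ _ _ _ _ (dh x)).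
  have c1 := cvg_Rintegral_symmetric ih.
  have c2 : (fun n : nat => \int[leb]_(x in `[- n.+1%:R, n.+1%:R]) h x) @ \oo --> (0 : R).
    have wn : (fun n : nat => 2 * w n.+1%:R) @ \oo --> (0 : R).
      rewrite -[X in _ --> X](mulr0 2); apply: cvgMl_tmp.
      by rewrite (cvg_shiftS (fun n => w n%:R)); exact: cvg_normal_pdf.
    apply: norm_cvg0; apply: (@squeeze_cvgr _ _ _ _ (fun=> 0) _ _ _ _ _ wn); last exact: cvg_cst.
    apply: nearW => n; rewrite normr_ge0/= In.
    have -> : w (- n.+1%:R) = w n.+1%:R by rewrite !normal_pdf0E// sqrrN.
    rewrite (le_trans (ler_normB _ _))// !normrM [in leRHS]mulr2n mulrDl !mul1r.
    by rewrite (ger0_norm (normal_pdf_ge0 _ _ _)) lerD// ler_piMl ?normal_pdf_ge0// sin_max.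
  exact: (cvg_unique _ c1 c2).
have : \int[leb]_x h x = t * \int[leb]_x (cos (t * x + b) * w x) -
    (s ^+ 2)^-1 * \int[leb]_x (x * sin (t * x + b) * w x).
  rewrite RintegralB//; [|exact: (integrableZl _ (_ : R) ic)|exact: (integrableZl _ (_ : R) iss)].
  by rewrite !RintegralZl.
rewrite I0 => /eqP; rewrite eq_sym subr_eq0 => /eqP E.
rewrite -mulrA E mulrA divff ?mul1r// expf_neq0//.
Qed.

(** Differentiation under the integral and integration by parts give the equation F' = - s^2 t F, so
    [F t * expR (s ^+ 2 * t ^+ 2 / 2)] is constant. The phase [b] keeps everything real: the sine
    transform is the case [b = - pi / 2]. *)
Lemma normal_cf (t b : R) :
  \int[leb]_x (cos (t * x + b) * w x) = cos b * expR (- (s ^+ 2 * t ^+ 2 / 2)).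
Proof.
pose f (t x : R) := cos (t * x + b) * w x.
pose F (t : R) := \int[leb]_x f t x.
have if_ a : leb.-integrable setT (EFin \o f a).
  apply: integrable_bounded_normal; last by exists 1 => x; exact: cos_max.
  by apply: continuous_measurable_fun; exact: continuous_cos_affine.
have df (a x : R) : is_derive a (1 : R) (f ^~ x) (- (x * sin (a * x + b) * w x)).
  rewrite /f; move: (w x) => c.
  by apply: is_derive_eq; rewrite /GRing.scale/=; ring.
have d1f (a x : R) : ((f ^~ x)^`())%classic a = - (x * sin (a * x + b) * w x).
  by rewrite derive1E (@derive_val _ _ _ _ _ _ _ (df a x)).
have iG : leb.-integrable setT (EFin \o (fun x : R => `|x| * w x)).
  by apply: integrable_id_normal => //; exists 1 => x; rewrite normr_id mul1r.
have Ia (a : R) : `]a - 1, a + 1[%classic a by rewrite /= in_itv/= ltrBlDr ltrDl ltr01.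
have G0 (x : R) : 0 <= `|x| * w x by rewrite mulr_ge0// normal_pdf_ge0.
have Gub a (y x : R) : `]a - 1, a + 1[%classic y -> setT x ->
    `|((f ^~ x)^`())%classic y| <= `|x| * w x.
  move=> _ _; rewrite d1f normrN !normrM (ger0_norm (normal_pdf_ge0 _ _ _)).
  by rewrite ler_wpM2r ?normal_pdf_ge0// ler_piMr// sin_max.
have dF (a : R) : is_derive a (1 : R) F (- (s ^+ 2 * a) * F a).
  have D1 := @derivable_under_integral R _ _ leb f setT measurableT a (a - 1) (a + 1) (Ia a)
    (fun x _ => if_ x) (fun x y _ _ => @ex_derive _ _ _ _ _ _ _ (df x y))
    (fun x => `|x| * w x) G0 iG (Gub a).
  have D2 := @differentiation_under_integral R _ _ leb f setT measurableT a (a - 1) (a + 1) (Ia a)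
    (fun x _ => if_ x) (fun x y _ _ => @ex_derive _ _ _ _ _ _ _ (df x y))
    (fun x => `|x| * w x) G0 iG (Gub a).
  apply: DeriveDef => //; rewrite -derive1E D2.
  rewrite mulNr -normal_integral_by_parts.
  rewrite -mulN1r -RintegralZl//; last first.
    apply: integrable_id_normal.
      apply: measurable_funM => //.
      by apply: continuous_measurable_fun; exact: continuous_sin_affine.
    by exists 1 => x; rewrite normrM mul1r ler_piMr// sin_max.
  by apply: eq_Rintegral => x _; rewrite mulN1r; exact: d1f.
pose H (a : R) := F a * expR (s ^+ 2 * a ^+ 2 / 2).
have dH (a : R) : is_derive a (1 : R) H 0.
  rewrite /H; have dFa := dF a.
  apply: is_derive_eq; move: (expR _) => e.
  by rewrite /GRing.scale/=; field.
have := @is_derive_0_is_cst _ _ t 0 dH.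
rewrite /H expr0n mulr0 mul0r expR0 mulr1 => /(congr1 ( *%R^~ (expR (- (s ^+ 2 * t ^+ 2 / 2))))).
rewrite -(mulrA (F t)) -expRD subrr expR0 mulr1 -/(F t) => ->; congr (_ * _).
rewrite /F /f; under eq_Rintegral do rewrite mul0r add0r.
rewrite RintegralZl//; last exact: integrable_normal_pdf.
by rewrite /Rintegral integral_normal_pdf mulr1.
Qed.

End NormalCf.

(** The Radon-Nikodym derivative and the explicit density have equal integrals over all measurable
    sets, hence agree almost everywhere. *)
Lemma ge0_integral_normal_prob (R : realType) (s : R) (g : R -> \bar R) :
  (forall x, 0 <= g x)%E -> measurable_fun setT g ->
  (\int[normal_prob 0 s]_x g x = \int[lebesgue_measure]_x (g x * (normal_pdf 0 s x)%:E))%E.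
Proof.
move=> g0 mg.
have dom := normal_prob_dominates (0 : R) s.
rewrite -(Radon_Nikodym_SigmaFinite.change_of_variables dom)//.
have fi := Radon_Nikodym_SigmaFinite.f_integral dom.
have H : ae_eq lebesgue_measure setT (Radon_Nikodym_SigmaFinite.f (normal_prob 0 s) lebesgue_measure)
   (fun x => (normal_pdf 0 s x)%:E).
  apply: integral_ae_eq => //.
  - exact: Radon_Nikodym_SigmaFinite.f_integrable.
  - by apply/measurable_EFinP; exact: measurable_normal_pdf.
  - by move=> E _ mE; rewrite -fi.
apply: ae_eq_integral => //.
- apply: emeasurable_funM => //; apply: measurable_int.
  exact: (Radon_Nikodym_SigmaFinite.f_integrable dom).
- apply: emeasurable_funM => //.
  by apply/measurable_EFinP; exact: measurable_normal_pdf.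
- by apply: filterS H => x /= /(_ I) -> _.
Qed.

Section Law.
Context d d' (T : measurableType d) (T' : measurableType d') (R : realType).

Definition law (P : probability T R) (f : T -> T') (mf : measurable_fun setT f)
  : probability T' R := distribution P (mfun_Sub (mem_set mf)).

Lemma lawE (P : probability T R) (f : T -> T') (mf : measurable_fun setT f) A :
  law P mf A = P (f @^-1` A).
Proof. by []. Qed.

End Law.

Lemma bounded_integrable d (T : measurableType d) (R : realType)
    (P : probability T R) (h : T -> R) :
  measurable_fun setT h -> (exists M, forall x, `|h x| <= M) ->
  P.-integrable setT (EFin \o h).
Proof.
move=> mh [M hM]; apply: measurable_bounded_integrable => //.
  exact: (le_lt_trans (probability_le1 P measurableT) (ltry 1)).
by exists M; split => [|r Mr x _ /=]; rewrite ?num_real// (le_trans (hM x))// ltW.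
Qed.

Lemma Rintegral_law d d' (T : measurableType d) (T' : measurableType d') (R : realType)
    (P : probability T R) (f : T -> T') (mf : measurable_fun setT f) (h : T' -> R) :
  measurable_fun setT h -> (exists M, forall x, `|h x| <= M) ->
  \int[law P mf]_x h x = \int[P]_x h (f x).
Proof.
move=> mh [M hM]; rewrite /Rintegral; congr fine.
rewrite /law integral_distribution//; first exact/measurable_EFinP.
apply: bounded_integrable; last by exists M => x; exact: hM.
exact: measurableT_comp.
Qed.

Lemma cst_Rintegral_prob d (T : measurableType d) (R : realType)
  (P : probability T R) (c : R) : \int[P]_x c = c.
Proof.
rewrite Rintegral_cst// -[RHS]mulr1; congr (_ * _).
by rewrite -[RHS]/(fine 1%E); congr fine; exact: probability_setT.
Qed.

Lemma Rintegral_normal_prob (R : realType) (s : R) (g : R -> R) : s != 0 ->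
  measurable_fun setT g -> (exists M, forall x, `|g x| <= M) ->
  \int[normal_prob 0 s]_x g x = \int[lebesgue_measure]_x (g x * normal_pdf 0 s x).
Proof.
move=> s0 mg [M gM].
have M0 : 0 <= M := le_trans (normr_ge0 _) (gM 0).
(* The change of density was obtained for nonnegative functions; shifting [g] by its bound reduces
   to them. *)
have gM0 x : 0 <= g x + M.
  by rewrite -lerBlDr sub0r; have := gM x; rewrite ler_norml => /andP[].
have mgM : measurable_fun setT (fun x => g x + M) by exact: measurable_funD.
have ig : (normal_prob 0 s).-integrable setT (EFin \o g).
  by apply: bounded_integrable => //; exists M.
have iM : (normal_prob 0 s).-integrable setT (EFin \o cst M).
  by apply: bounded_integrable => //; exists M => x; rewrite ger0_norm.
have E : \int[normal_prob 0 s]_x (g x + M) =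
    \int[lebesgue_measure]_x ((g x + M) * normal_pdf 0 s x).
  rewrite /Rintegral; congr fine.
  have g0 x : (0 <= (g x + M)%:E)%E by rewrite lee_fin.
  have mE : measurable_fun setT (fun x => (g x + M)%:E) by exact/measurable_EFinP.
  by rewrite (ge0_integral_normal_prob s g0 mE).
move: E; rewrite RintegralD// cst_Rintegral_prob.
under [in X in _ = X -> _]eq_Rintegral do rewrite mulrDl.
rewrite RintegralD//.
- rewrite RintegralZl//; last exact: integrable_normal_pdf.
  rewrite [X in M * X](_ : _ = 1); last by rewrite /Rintegral integral_normal_pdf.
  rewrite mulr1.
  by move=> /(congr1 (fun x => x - M)); rewrite !addrK.
- by apply: integrable_bounded_normal => //; exists M.
- by apply: integrable_bounded_normal => //; exists M => x; rewrite ger0_norm.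
Qed.

Lemma normal_prob_cf (R : realType) (s t b : R) : s != 0 ->
  \int[normal_prob 0 s]_x cos (t * x + b) = cos b * expR (- (s ^+ 2 * t ^+ 2 / 2)).
Proof.
move=> s0; rewrite -normal_cf// Rintegral_normal_prob//.
  by apply: continuous_measurable_fun; exact: continuous_cos_affine.
by exists 1 => x; exact: cos_max.
Qed.

(** Half-open intervals are differences of rays, and finiteness on rays allows the subtraction.
    Total masses other than 1 are allowed because the lemma is applied to laws restricted to an
    event. *)
Lemma measure_unique_rays (R : realType)
    (m1 m2 : {measure set (measurableTypeR R) -> \bar R}) :
  (forall x : R, m1 `]-oo, x]%classic = m2 `]-oo, x]%classic) ->
  (forall x : R, (m1 `]-oo, x]%classic < +oo)%E) ->
  forall A, measurable A -> m1 A = m2 A.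
Proof.
move=> m12 m1oo.
apply: (@measure_unique _ R (measurableTypeR R) (@ocitv R) (fun n : nat => `]- n%:R, n%:R]%classic)).
- by [].
- exact: ocitvI.
- by move=> n; exact: is_ocitv.
- exact: bigcup_itvT.
- move=> _ [[a b] _ <-] /=; have [ab|ba] := leP a b; last first.
    by rewrite set_itv_ge ?measure0// bnd_simp -leNgt ltW.
  have -> : `]a, b]%classic = `]-oo, b] `\` `]-oo, a].
    by rewrite -[RHS]setCK setCD setCitvl setUC -[LHS]setCK setCitv.
  have m2oo x : (m2 `]-oo, x]%classic < +oo)%E by rewrite -m12.
  rewrite [LHS]measureD//; last exact: m1oo.
  rewrite [RHS]measureD//; last exact: m2oo.
  have -> : `]-oo, b] `&` `]-oo, a] = `]-oo, a]%classic :> set R.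
    by rewrite setIidr//; exact: subset_itvl.
  by congr (_ - _)%E; exact: m12.
- move=> n; apply: le_lt_trans (m1oo n%:R); apply: le_measure; rewrite ?inE//.
  by move=> x /=; rewrite !in_itv/= => /andP[].
Qed.

Lemma integral_measurable_eq d (T : measurableType d) (R : realType)
    (m1 m2 : {measure set T -> \bar R}) (h : T -> R) :
  (forall A, measurable A -> m1 A = m2 A) -> \int[m1]_x h x = \int[m2]_x h x.
Proof.
move=> E; rewrite /Rintegral; congr fine.
by apply: eq_measure_integral => A mA _; exact: E.
Qed.

Lemma Rintegral_addcst d (T : measurableType d) (R : realType)
    (P : probability T R) (h : T -> R) (M : R) :
  measurable_fun setT h -> (exists M, forall x, `|h x| <= M) ->
  \int[P]_x (h x + M) = \int[P]_x h x + M.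
Proof.
move=> mh bh; rewrite RintegralD//; first by rewrite cst_Rintegral_prob.
- exact: bounded_integrable.
- by apply: (@bounded_integrable _ _ _ P (fun=> M)) => //; exists `|M|.
Qed.

Section JointMeasure.
Context d d' (T : measurableType d) (T' : measurableType d') (R : realType).
Variables (P : probability T R) (f : T -> T') (mf : measurable_fun setT f).
Variables (B : set T) (mB : measurable B).

(** The law of [f] restricted to the event [B]. The measurability proofs are arguments so that the
    measure structure can be attached to the term. *)
Definition joint_measure of measurable_fun setT f & measurable B : set T' -> \bar R :=
  fun A => P (f @^-1` A `&` B).

Notation jm := (joint_measure mf mB).

Let jm0 : jm set0 = 0%E.
Proof. by rewrite /joint_measure preimage_set0 set0I measure0. Qed.

Let jm_ge0 A : (0 <= jm A)%E.
Proof. exact: measure_ge0. Qed.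

Let jm_sigma_additive : semi_sigma_additive jm.
Proof.
have mp A : measurable A -> measurable (f @^-1` A).
  by move=> mA; rewrite -[X in measurable X]setTI; exact: mf.
move=> F mF tF mUF; rewrite /joint_measure preimage_bigcup setI_bigcupl.
apply: measure_semi_sigma_additive.
- by move=> n; apply: measurableI => //; exact: mp.
- apply/trivIsetP => /= i j _ _ ij; rewrite setIACA setIid -preimage_setI.
  by move/trivIsetP : tF => /(_ _ _ _ _ ij) ->//; rewrite preimage_set0 set0I.
- by apply: bigcup_measurable => n _; apply: measurableI => //; exact: mp.
Qed.

HB.instance Definition _ := isMeasure.Build _ _ _ jm jm0 jm_ge0 jm_sigma_additive.

End JointMeasure.

(** * The uniform law and the splitting of its binary digits *)

Section Unif.
Variable R : realType.

Definition unif : probability (measurableTypeR R) R := uniform_prob (@ltr01 R).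

(** The distribution function of [unif]. Composed with affine maps it also gives the Lipschitz ramps
    that approximate indicators of rays. *)
Definition clip (x : R) : R := Num.max 0 (Num.min 1 x).

Lemma unifE A : measurable A -> unif A = lebesgue_measure (A `&` `[0, 1]%classic).
Proof.
move=> mA; have mf : measurable_fun setT (fun x => (\1_A x)%:E : \bar R).
  by apply/measurable_EFinP; exact: measurable_indic.
have := integral_uniform (@ltr01 R) mf (fun x => _).
rewrite integral_indic// setIT subr0 invr1 mul1e integral_indic// => -> //.
Qed.

Lemma unif_ray (x : R) : unif `]-oo, x]%classic = (clip x)%:E.
Proof.
rewrite unifE// (_ : _ `&` _ = `[0, Num.min 1 x]%classic).
  rewrite lebesgue_measure_itv/= lte_fin /clip maxC; case: ltP => [x0|x0].
    by rewrite EFinN sube0.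
  by [].
apply/seteqP; split => y /=; rewrite !in_itv/= le_min.
  by move=> [-> /andP[-> ->]].
by move=> /andP[-> /andP[-> ->]].
Qed.

Lemma Rintegral_unif_eq (h1 h2 : R -> R) :
  measurable_fun setT h1 -> measurable_fun setT h2 ->
  (forall x, 0 < x < 1 -> h1 x = h2 x) -> \int[unif]_x h1 x = \int[unif]_x h2 x.
Proof.
move=> m1 m2 h12; rewrite /Rintegral; congr fine.
apply: ae_eq_integral => //; [exact/measurable_EFinP|exact/measurable_EFinP|].
exists (~` `]0, 1[%classic); split => //.
- exact: measurableC.
- have mC : measurable (~` `]0, 1[%classic : set (measurableTypeR R)) by exact: measurableC.
  suff : lebesgue_measure ((~` `]0, 1[%classic : set (measurableTypeR R)) `&` `[0, 1]%classic) = 0%E.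
    by move=> <-; exact: unifE.
  apply: countable_lebesgue_measure0.
  apply: (@sub_countable _ _ _ [set (0 : R); 1]); last exact: finite_set_countable.
  apply: subset_card_le => x /=; rewrite !in_itv/= => -[/negP].
  rewrite negb_and -!leNgt => /orP[x0|x1] /andP[x0' x1'].
    by left; apply/le_anti; rewrite x0.
  by right; apply/le_anti; rewrite x1'.
- move=> x /= H; rewrite in_itv/= => x01; apply: H => _.
  by rewrite h12.
Qed.

Lemma measurable_affine2 (c : R) :
  @measurable_fun _ _ (measurableTypeR R) (measurableTypeR R) setT (fun y => (c + y) / 2).
Proof. by apply: measurable_funM => //; exact: measurable_funD. Qed.

(** The first binary digit is a fair coin independent of the others: [unif] is half the sum of its
    images under [y / 2] and [(1 + y) / 2], as a comparison on rays shows. *)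
Lemma unif_doubling (h : R -> R) :
  measurable_fun setT h -> (exists M, forall x, `|h x| <= M) ->
  \int[unif]_x h x =
  (\int[unif]_x h ((0 + x) / 2) + \int[unif]_x h ((1 + x) / 2)) / 2.
Proof.
have half0 : 0 <= 2^-1 :> R by [].
pose m0 : {measure set (measurableTypeR R) -> \bar R} := mscale (NngNum half0) (law unif (measurable_affine2 0)).
pose m1 : {measure set (measurableTypeR R) -> \bar R} := mscale (NngNum half0) (law unif (measurable_affine2 1)).
have ray (c x : R) : (fun y : R => (c + y) / 2) @^-1` `]-oo, x] = `]-oo, 2 * x - c]%classic.
  by apply/seteqP; split => y /=; rewrite !in_itv/= => H; lra.
have E A : measurable A -> unif A = measure_add m0 m1 A.
  apply: (@measure_unique_rays R unif (measure_add m0 m1)) => x; last first.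
    by apply: (le_lt_trans (_ : _ <= (clip x)%:E)%E); [rewrite -unif_ray|exact: ltry].
  apply: (etrans (unif_ray x)); apply: esym; apply: (etrans (measure_addE m0 m1 _)).
  have lE c : law unif (measurable_affine2 c) `]-oo, x]%classic = (clip (2 * x - c))%:E.
    by rewrite -unif_ray -ray.
  transitivity ((2^-1)%:E * (clip (2 * x - 0))%:E + (2^-1)%:E * (clip (2 * x - 1))%:E)%E.
    by congr (_ + _)%E; congr (_ * _)%E; exact: lE.
  rewrite -!EFinM -EFinD; congr EFin.
  rewrite /clip; have [x0|x0] := leP x 0.
    by rewrite !min_r ?max_l; lra.
  have [x1|x1] := leP x 2^-1.
    by rewrite !min_r ?(@max_r _ _ 0 x) ?(@max_r _ _ 0 (2 * x - 0)) ?max_l; lra.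
  rewrite (@min_l _ _ 1 (2 * x - 0)) ?(@max_r _ _ 0 1); [|lra|lra].
  have [x2|x2] := leP 1 x; first by rewrite min_l ?max_r; lra.
  by rewrite min_r ?max_r; lra.
have pos (g : R -> R) : measurable_fun setT g -> (exists M, forall x, `|g x| <= M) ->
    (forall x, 0 <= g x) ->
    \int[unif]_x g x = (\int[unif]_x g ((0 + x) / 2) + \int[unif]_x g ((1 + x) / 2)) / 2.
  move=> mg bg g0; rewrite (integral_measurable_eq _ E).
  have mE : measurable_fun setT (EFin \o g) by exact/measurable_EFinP.
  have gE x : (0 <= (EFin \o g) x)%E by rewrite lee_fin.
  have I c : (\int[law unif (measurable_affine2 c)]_x (g x)%:E =
     (\int[unif]_x (g ((c + x) / 2)))%:E)%E.
    rewrite -(Rintegral_law unif (measurable_affine2 c) mg bg) /Rintegral fineK//.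
    by apply: integrable_fin_num => //; exact: bounded_integrable.
  have J0 : (\int[m0]_x (g x)%:E = (2^-1)%:E * (\int[unif]_x (g ((0 + x) / 2)))%:E)%E.
    by rewrite -I; apply: ge0_integral_mscale => // x _; exact: gE.
  have J1 : (\int[m1]_x (g x)%:E = (2^-1)%:E * (\int[unif]_x (g ((1 + x) / 2)))%:E)%E.
    by rewrite -I; apply: ge0_integral_mscale => // x _; exact: gE.
  transitivity (fine (\int[m0]_x (g x)%:E + \int[m1]_x (g x)%:E)%E).
    by rewrite /Rintegral; congr fine; apply: ge0_integral_measure_add => // x _; exact: gE.
  by rewrite J0 J1 -!EFinM -EFinD /=; lra.
move=> mh [M hM].
have mM : measurable_fun setT (fun x => h x + M) by exact: measurable_funD.
have mC (c : R) : measurable_fun setT (fun x : R => h ((c + x) / 2)).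
  by apply: (measurableT_comp mh); exact: measurable_affine2.
have bC (c : R) : exists M, forall x, `|h ((c + x) / 2)| <= M by exists M.
have b1 : exists M', forall x, `|h x + M| <= M'.
  by exists (M + M) => x; rewrite (le_trans (ler_normD _ _))// lerD// ger0_norm// (le_trans _ (hM 0)).
have p1 x : 0 <= h x + M.
  by rewrite -lerBlDr sub0r; have := hM x; rewrite ler_norml => /andP[].
have H : \int[unif]_x (h x + M) = (\int[unif]_x (h ((0 + x) / 2) + M) +
  \int[unif]_x (h ((1 + x) / 2) + M)) / 2 := pos _ mM b1 p1.
move: H; rewrite (Rintegral_addcst unif M mh (ex_intro _ M hM)).
rewrite (Rintegral_addcst unif M (mC 0) (bC 0)) (Rintegral_addcst unif M (mC 1) (bC 1)).
by move=> H; lra.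
Qed.

End Unif.

Section Splitting.
Variable R : realType.
Notation u := (@unif R).

Lemma clip_ge0 (x : R) : 0 <= clip x. Proof. by rewrite /clip le_max lexx. Qed.

Lemma clip_le1 (x : R) : clip x <= 1.
Proof. by rewrite /clip ge_max ler01 ge_min lexx. Qed.

Lemma clip_id (x : R) : 0 <= x <= 1 -> clip x = x.
Proof. by case/andP=> x0 x1; rewrite /clip min_r// max_r. Qed.

Lemma clip_lip (x y : R) : `|clip x - clip y| <= `|x - y|.
Proof.
wlog xy : x y / x <= y.
  by move=> H; case: (leP x y) => [/H//|/ltW/H]; rewrite distrC (distrC y).
rewrite distrC (distrC x) (@ger0_norm _ (y - x)) ?subr_ge0//.
rewrite /clip; case: (leP 1 x); case: (leP 1 y); rewrite ?[Num.max 0 1]max_r//;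
  case: (leP 0 x); case: (leP 0 y) => *; rewrite ler_norml; lra.
Qed.

Definition bit (x : R) : R := (2^-1 <= x)%R%:R.

(* The first k binary digits of x, those of even and of odd rank giving the
   two coordinates. *)
Fixpoint split_digits (k : nat) (x : R) : R * R :=
  if k is k'.+1 then
    let p := split_digits k' (2 * x - bit x) in ((bit x + p.2) / 2, p.1)
  else (0, 0).

Lemma split_digits_itv k x : [/\ 0 <= (split_digits k x).1, (split_digits k x).1 <= 1,
  0 <= (split_digits k x).2 & (split_digits k x).2 <= 1].
Proof.
elim: k x => [|k IH] x /=; first by split.
have [? ? ? ?] := IH (2 * x - bit x).
have : 0 <= bit x <= 1 by rewrite /bit; case: (2^-1 <= x); rewrite /= ?lexx ?ler01.
by case/andP => b0 b1; split => //; lra.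
Qed.

Lemma split_digits_ndecr k x : (split_digits k x).1 <= (split_digits k.+1 x).1 /\
  (split_digits k x).2 <= (split_digits k.+1 x).2.
Proof.
elim: k x => [|k IH] x.
  by have [? _ ? _] := split_digits_itv 1 x; split.
have [h1 h2] := IH (2 * x - bit x).
split; last exact: h1.
by rewrite /= ler_pM2r// lerD2l; exact: h2.
Qed.

Lemma measurable_bit : measurable_fun setT bit.
Proof.
rewrite (_ : bit = \1_(`[2^-1, +oo[%classic)); first exact: measurable_indic.
apply/funext => x; rewrite /bit indicE; congr (_%:R); congr nat_of_bool.
by apply/idP/idP; rewrite inE /= in_itv/= andbT.
Qed.

Lemma measurable_split_digits k : measurable_fun setT (fun x => (split_digits k x).1) /\
  measurable_fun setT (fun x => (split_digits k x).2).
Proof.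
elim: k => [|k [m1 m2]] /=; first by split.
have mT : measurable_fun setT (fun x : R => 2 * x - bit x).
  by apply: measurable_funB; [exact: measurable_funM|exact: measurable_bit].
split; last exact: (measurableT_comp m1 mT).
apply: measurable_funM => //; apply: measurable_funD; first exact: measurable_bit.
exact: (measurableT_comp m2 mT).
Qed.

Lemma split_digits_half k (y : R) : 0 <= y < 1 ->
  split_digits k.+1 ((0 + y) / 2) = ((0 + (split_digits k y).2) / 2, (split_digits k y).1).
Proof.
move=> y01; rewrite /= (_ : bit ((0 + y) / 2) = 0).
  by rewrite (_ : 2 * ((0 + y) / 2) - 0 = y)//; lra.
by rewrite /bit; case: (leP 2^-1 _) => // H; exfalso; lra.
Qed.

Lemma split_digits_half1 k (y : R) : 0 <= y < 1 ->
  split_digits k.+1 ((1 + y) / 2) = ((1 + (split_digits k y).2) / 2, (split_digits k y).1).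
Proof.
move=> y01; rewrite /= (_ : bit ((1 + y) / 2) = 1).
  by rewrite (_ : 2 * ((1 + y) / 2) - 1 = y)//; lra.
by rewrite /bit; case: (leP 2^-1 _) => // H; exfalso; lra.
Qed.

(** Test functions for the induction on digits: the class is stable under [x |-> (c + x) / 2], which
    halves the Lipschitz constant. *)
Definition lip1 (a : R) (phi : R -> R) :=
  (forall x, `|phi x| <= 1) /\ (forall x y, `|phi x - phi y| <= a * `|x - y|).

Lemma lip1_continuous a phi : lip1 a phi -> continuous phi.
Proof.
move=> [_ L] x; apply/cvgrPdist_le => e e0.
have a1 : 0 < `|a| + 1 by rewrite ltr_wpDl.
near=> y.
rewrite (le_trans (L x y))// (@le_trans _ _ ((`|a| + 1) * `|x - y|))//.
  by rewrite ler_wpM2r// (le_trans (ler_norm a))// lerDl.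
rewrite -ler_pdivlMl//; near: y.
by apply: cvgr_dist_le => //; rewrite mulr_gt0 ?invr_gt0.
Unshelve. all: by end_near. Qed.

Lemma lip1_measurable a phi : lip1 a phi -> measurable_fun setT phi.
Proof. by move=> /lip1_continuous; exact: continuous_measurable_fun. Qed.

Lemma lip1_half a c phi : lip1 a phi -> lip1 (a / 2) (fun x => phi ((c + x) / 2)).
Proof.
move=> [B L]; split=> [x|x y]; first exact: B.
rewrite (le_trans (L _ _))// -mulrA.
have -> : (c + x) / 2 - (c + y) / 2 = 2^-1 * (x - y) by lra.
by rewrite normrM (@ger0_norm _ 2^-1).
Qed.

Lemma lip1_cst_dist a phi : 0 <= a -> lip1 a phi -> `|phi 0 - \int[u]_x phi x| <= a.
Proof.
move=> a0 Lp; have mp := lip1_measurable Lp; move: Lp => [B L].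
have mc : measurable_fun setT (fun x => phi (clip x)).
  apply: (measurableT_comp mp).
  apply: continuous_measurable_fun => x.
  by apply: (lip1_continuous (a := 1)); split => [z|z z']; rewrite ?mul1r ?clip_lip// ger0_norm ?clip_ge0 ?clip_le1.
rewrite (@Rintegral_unif_eq _ phi (fun x => phi (clip x)))//; last first.
  by move=> x /andP[/ltW x0 /ltW x1]; rewrite clip_id ?x0.
have b1 : exists M, forall x, `|phi (clip x)| <= M by exists 1 => x.
rewrite distrC -(Rintegral_addcst u)//.
apply: le_trans (le_normr_Rintegral _ _) _ => //.
  apply: bounded_integrable; first exact: measurable_funD.
  by exists (1 + 1) => x; rewrite (le_trans (ler_normD _ _))// lerD// normrN.
rewrite -[leRHS](cst_Rintegral_prob u); apply: le_Rintegral => //.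
- apply: bounded_integrable; first by apply: measurableT_comp => //; exact: measurable_funD.
  by exists (1 + 1) => x; rewrite normr_id (le_trans (ler_normD _ _))// lerD// normrN.
- by apply: (@bounded_integrable _ _ _ u (fun=> a)) => //; exists `|a|.
- move=> x _; rewrite (le_trans (L _ _))// ler_piMr// subr0 ger0_norm ?clip_ge0//.
  exact: clip_le1.
Qed.

(** Conditioning on one digit exchanges the two coordinates, hence [phi] and [psi], and halves the
    Lipschitz constant of [phi]. With weights [3 / 4] and [1] on the constants, the passage from
    [(a, c)] to [(c, a / 2)] contracts the bound by [3 / 4], because [1 / 2 <= 9 / 16]. *)
Lemma split_digits_indep k : forall (a c : R) (phi psi : R -> R), 0 <= a -> 0 <= c ->
  lip1 a phi -> lip1 c psi ->
  `|\int[u]_x (phi (split_digits k x).1 * psi (split_digits k x).2)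
    - (\int[u]_x phi x) * (\int[u]_x psi x)| <= 2 * (3 / 4) ^+ k * (3 / 4 * a + c).
Proof.
have prod_meas a c phi psi k' : lip1 a phi -> lip1 c psi ->
    measurable_fun setT (fun x => phi (split_digits k' x).1 * psi (split_digits k' x).2).
  move=> L1 L2; have [m1 m2] := measurable_split_digits k'.
  by apply: measurable_funM; [apply: (measurableT_comp (lip1_measurable L1))|apply: (measurableT_comp (lip1_measurable L2))].
have prod_bd a c phi psi x y : lip1 a phi -> lip1 c psi -> `|phi x * psi y| <= 1.
  by move=> [B1 _] [B2 _]; rewrite normrM mulr_ile1.
elim: k => [|k IH] a c phi psi a0 c0 L1 L2.
  rewrite /= cst_Rintegral_prob expr0 mulr1.
  set p := \int[u]_x phi x; set q := \int[u]_x psi x.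
  have dp := lip1_cst_dist a0 L1; have dq := lip1_cst_dist c0 L2.
  have q1 : `|q| <= 1.
    apply: le_trans (le_normr_Rintegral _ _) _ => //.
      by apply: bounded_integrable; [exact: lip1_measurable L2|exists 1; case: L2].
    rewrite -[leRHS](cst_Rintegral_prob u); apply: le_Rintegral => //.
    - apply: bounded_integrable; first by apply: measurableT_comp => //; exact: lip1_measurable L2.
      by exists 1 => x; rewrite normr_id; case: L2.
    - by apply: (@bounded_integrable _ _ _ u (fun=> 1)) => //; exists 1 => _; rewrite normr1.
    - by move=> x _; case: L2.
  have -> : phi 0 * psi 0 - p * q = phi 0 * (psi 0 - q) + (phi 0 - p) * q by ring.
  rewrite (le_trans (ler_normD _ _))// !normrM.
  have : `|phi 0| * `|psi 0 - q| <= c by rewrite -[leRHS]mul1r ler_pM//; case: L1.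
  have : `|phi 0 - p| * `|q| <= a by rewrite -[leRHS]mulr1 ler_pM.
  lra.
have mk := prod_meas _ _ _ _ k.+1 L1 L2.
rewrite unif_doubling//; last by exists 1 => x; exact: prod_bd L1 L2.
have E c' (cc : c' = 0 \/ c' = 1) :
  \int[u]_x (phi (split_digits k.+1 ((c' + x) / 2)).1 * psi (split_digits k.+1 ((c' + x) / 2)).2) =
  \int[u]_x (psi (split_digits k x).1 * phi ((c' + (split_digits k x).2) / 2)).
  apply: Rintegral_unif_eq.
  - exact: (measurableT_comp mk (measurable_affine2 _)).
  - exact: (prod_meas _ _ _ _ _ L2 (lip1_half c' L1)).
  - move=> x /andP[/ltW x0 x1]; have x01 : 0 <= x < 1 by rewrite x0.
    case: cc => ->; rewrite mulrC.
    + by rewrite split_digits_half.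
    + by rewrite split_digits_half1.
rewrite !E; [|by right|by left].
rewrite (@unif_doubling _ phi); [|exact: lip1_measurable L1|by exists 1; case: L1].
have a20 : 0 <= a / 2 by lra.
have := IH _ _ _ _ c0 a20 L2 (lip1_half 0 L1).
have := IH _ _ _ _ c0 a20 L2 (lip1_half 1 L1).
set I1 := \int[u]_x (psi _ * _); set I0 := \int[u]_x (psi _ * _).
set q := \int[u]_x psi x; set p1 := \int[u]_x phi _; set p0 := \int[u]_x phi _.
set e := (3 / 4) ^+ k => H1 H0.
have -> : (I0 + I1) / 2 - (p0 + p1) / 2 * q = (I0 - q * p0) / 2 + (I1 - q * p1) / 2 by lra.
rewrite (le_trans (ler_normD _ _))// !normrM (@ger0_norm _ 2^-1)// exprSr -/e.
have e0 : 0 <= e by rewrite exprn_ge0.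
have : 0 <= e * a by rewrite mulr_ge0.
nra.
Qed.

(** The truncated coordinates increase with the number of digits, so they have measurable limits;
    dominated convergence transfers the product formula while its error tends to 0. *)
Lemma indep_split : exists U V : R -> R, [/\ measurable_fun setT U, measurable_fun setT V &
  forall a c phi psi, 0 <= a -> 0 <= c -> lip1 a phi -> lip1 c psi ->
   \int[u]_x (phi (U x) * psi (V x)) = (\int[u]_x phi x) * (\int[u]_x psi x)].
Proof.
have cU x : cvgn (fun k => (split_digits k x).1).
  apply: nondecreasing_is_cvgn.
    by apply/nondecreasing_seqP => k; case: (split_digits_ndecr k x).
  by exists 1 => _ [k _ <-]; case: (split_digits_itv k x).
have cV x : cvgn (fun k => (split_digits k x).2).
  apply: nondecreasing_is_cvgn.
    by apply/nondecreasing_seqP => k; case: (split_digits_ndecr k x).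
  by exists 1 => _ [k _ <-]; case: (split_digits_itv k x).
pose U x := limn (fun k => (split_digits k x).1).
pose V x := limn (fun k => (split_digits k x).2).
have mU : measurable_fun setT U.
  apply: (measurable_fun_cvg (h := fun k x => (split_digits k x).1)) => [k|x _].
    by case: (measurable_split_digits k).
  exact: cU.
have mV : measurable_fun setT V.
  apply: (measurable_fun_cvg (h := fun k x => (split_digits k x).2)) => [k|x _].
    by case: (measurable_split_digits k).
  exact: cV.
exists U, V; split => // a c phi psi a0 c0 L1 L2.
have lim1 : (fun k => \int[u]_x (phi (split_digits k x).1 * psi (split_digits k x).2)) @ \oo
    --> \int[u]_x (phi (U x) * psi (V x)).
  apply: (@cvg_Rintegral_dominated _ _ _ u
    (fun k x => phi (split_digits k x).1 * psi (split_digits k x).2)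
    (fun x => phi (U x) * psi (V x)) (fun=> 1)).
  - move=> k; have [m1 m2] := measurable_split_digits k.
    by apply: measurable_funM; [apply: (measurableT_comp (lip1_measurable L1))|apply: (measurableT_comp (lip1_measurable L2))].
  - by apply: measurable_funM; [apply: (measurableT_comp (lip1_measurable L1))|apply: (measurableT_comp (lip1_measurable L2))].
  - move=> x; apply: cvgM.
    + by apply: (cvg_comp _ _ (cU x)); exact: (lip1_continuous L1).
    + by apply: (cvg_comp _ _ (cV x)); exact: (lip1_continuous L2).
  - by apply: (@bounded_integrable _ _ _ u (fun=> 1)) => //; exists 1 => _; rewrite normr1.
  - move=> k x; case: L1 => B1 _; case: L2 => B2 _; by rewrite normrM mulr_ile1.
have lim2 : (fun k => \int[u]_x (phi (split_digits k x).1 * psi (split_digits k x).2)) @ \oo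
    --> (\int[u]_x phi x) * (\int[u]_x psi x).
  apply/cvgrPdist_le => e e0.
  have : (fun k => 2 * (3 / 4) ^+ k * (3 / 4 * a + c)) @ \oo --> (0 : R).
    rewrite -[X in _ --> X](mul0r (3 / 4 * a + c)); apply: cvgMr_tmp.
    rewrite -[X in _ --> X](mulr0 2); apply: cvgMl_tmp.
    by apply: cvg_expr; rewrite ger0_norm//; lra.
  move=> /cvgrPdist_le/(_ e e0); apply: filterS => k.
  rewrite sub0r normrN distrC => H.
  rewrite (le_trans (split_digits_indep k a0 c0 L1 L2))//.
  by rewrite (le_trans (ler_norm _)).
exact: (cvg_unique _ lim1 lim2).
Qed.

(** The offset 1 makes every ramp equal to 1 on the whole closed ray, endpoint included. *)
Lemma cvg_ramp (x y : R) :
  (fun n : nat => clip (n%:R * (x - y) + 1)) @ \oo --> (\1_(`]-oo, x]%classic) y : R).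
Proof.
apply: cvg_near_cst; rewrite indicE; have [yx|xy] := leP y x.
  rewrite mem_set ?in_itv//=; near=> n.
  rewrite /clip min_l ?max_r// lerDr mulr_ge0//; lra.
rewrite memNset; last by rewrite /= in_itv/= => H; lra.
near=> n.
have H : n%:R * (x - y) + 1 <= 0.
  have : (y - x)^-1 <= n%:R by near: n; exact: nbhs_infty_ger.
  have d0 : 0 < y - x by rewrite subr_gt0.
  by rewrite -(ler_pM2r d0) mulVf ?gt_eqF//; lra.
rewrite /clip min_r ?max_l//; lra.
Unshelve. all: by end_near. Qed.

Lemma lip1_ramp (x : R) (n : nat) : lip1 n%:R (fun y => clip (n%:R * (x - y) + 1)).
Proof.
split=> [y|y z]; first by rewrite ger0_norm ?clip_ge0 ?clip_le1.
rewrite (le_trans (clip_lip _ _))//.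
have -> : n%:R * (x - y) + 1 - (n%:R * (x - z) + 1) = n%:R * (z - y) by ring.
by rewrite normrM ger0_norm// distrC.
Qed.

Lemma exists_indep_split : exists U V : measurableTypeR R -> measurableTypeR R,
  [/\ measurable_fun setT U, measurable_fun setT V &
   forall A B, measurable A -> measurable B ->
     u (U @^-1` A `&` V @^-1` B) = (u A * u B)%E].
Proof.
have [U [V [mU' mV' H]]] := indep_split.
have mU : @measurable_fun _ _ (measurableTypeR R) (measurableTypeR R) setT U := mU'.
have mV : @measurable_fun _ _ (measurableTypeR R) (measurableTypeR R) setT V := mV'.
exists U, V; split => //.
have rays x y : u (U @^-1` `]-oo, x] `&` V @^-1` `]-oo, y]) = (u `]-oo, x]%classic * u `]-oo, y]%classic)%E.
  pose f n z := clip (n%:R * (x - z) + 1); pose g n z := clip (n%:R * (y - z) + 1).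
  have mf n : measurable_fun setT (f n) := lip1_measurable (lip1_ramp x n).
  have mg n : measurable_fun setT (g n) := lip1_measurable (lip1_ramp y n).
  have i1 : u.-integrable setT (EFin \o (fun=> 1)).
    by apply: (@bounded_integrable _ _ _ u (fun=> 1)) => //; exists 1 => _; rewrite normr1.
  have bf n z : `|f n z| <= 1 by exact: (lip1_ramp x n).1.
  have bg n z : `|g n z| <= 1 by exact: (lip1_ramp y n).1.
  have cf : (fun n => \int[u]_z f n z) @ \oo --> \int[u]_z (\1_(`]-oo, x]%classic) z : R).
    apply: (@cvg_Rintegral_dominated _ _ _ u f _ (fun=> 1)) => //.
    by move=> z; exact: cvg_ramp.
  have cg : (fun n => \int[u]_z g n z) @ \oo --> \int[u]_z (\1_(`]-oo, y]%classic) z : R).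
    apply: (@cvg_Rintegral_dominated _ _ _ u g _ (fun=> 1)) => //.
    by move=> z; exact: cvg_ramp.
  have mA : measurable (U @^-1` `]-oo, x]) by rewrite -[X in measurable X]setTI; exact: mU.
  have mB : measurable (V @^-1` `]-oo, y]) by rewrite -[X in measurable X]setTI; exact: mV.
  have cfg : (fun n => \int[u]_z (f n (U z) * g n (V z))) @ \oo -->
      \int[u]_z (\1_(U @^-1` `]-oo, x] `&` V @^-1` `]-oo, y]) z : R).
    apply: (@cvg_Rintegral_dominated _ _ _ u (fun n z => f n (U z) * g n (V z)) _ (fun=> 1)) => //.
    - by move=> n; apply: measurable_funM; [exact: (measurableT_comp (mf n))|exact: (measurableT_comp (mg n))].
    - by apply: measurable_indic; exact: measurableI.
    - move=> z; rewrite indicI/=; apply: cvgM; exact: cvg_ramp.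
    - by move=> n z; rewrite normrM mulr_ile1.
  have ind (D : set (measurableTypeR R)) : measurable D -> \int[u]_z (\1_D z : R) = fine (u D).
    by move=> mD; rewrite /Rintegral integral_indic// setIT.
  have cfcg : (fun n => \int[u]_z (f n (U z) * g n (V z))) @ \oo -->
      \int[u]_z (\1_(`]-oo, x]%classic) z : R) * \int[u]_z (\1_(`]-oo, y]%classic) z : R).
    under eq_fun do rewrite (H _ _ _ _ _ _ (lip1_ramp x _) (lip1_ramp y _))//.
    exact: cvgM.
  have K : \int[u]_z (\1_(U @^-1` `]-oo, x] `&` V @^-1` `]-oo, y]) z : R) =
      \int[u]_z (\1_(`]-oo, x]%classic) z : R) * \int[u]_z (\1_(`]-oo, y]%classic) z : R).
    exact: (cvg_unique _ cfg cfcg).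
  move: K; rewrite !ind//; last exact: measurableI.
  have fin (D : set (measurableTypeR R)) : measurable D -> u D \is a fin_num.
    by move=> mD; exact: fin_num_measure.
  have mAB := measurableI _ _ mA mB.
  by move=> K; rewrite -(fineK (fin _ mAB)) K EFinM !fineK//; exact: fin.
(* Rays are replaced by arbitrary measurable sets one factor at a time: with the other event fixed,
   both sides are finite measures of the free set. *)
have step y (A : set (measurableTypeR R)) : measurable A ->
    u (U @^-1` A `&` V @^-1` `]-oo, y]) = (u A * u `]-oo, y]%classic)%E.
  move=> mA.
  have mB : measurable (V @^-1` `]-oo, y]) by rewrite -[X in measurable X]setTI; exact: mV.
  have [b B0 uBE] : exists2 b, 0 <= b & u `]-oo, y]%classic = b%:E.
    by exists (fine (u `]-oo, y]%classic)); [exact: fine_ge0|rewrite fineK ?fin_num_measure].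
  have E : forall A : set (measurableTypeR R), measurable A -> joint_measure u mU mB A = mscale (NngNum B0) u A.
    apply: (@measure_unique_rays R (joint_measure u mU mB) (mscale (NngNum B0) u)) => x.
      by apply: (etrans (rays x y)); rewrite muleC uBE.
    by apply: (le_lt_trans (probability_le1 u _) (ltry 1)); apply: measurableI => //;
      rewrite -[X in measurable X]setTI; exact: mU.
  by apply: (etrans (E A mA)); rewrite muleC uBE.
move=> A B mA mB.
have mUA : measurable (U @^-1` A) by rewrite -[X in measurable X]setTI; exact: mU.
have [a A0 uAE] : exists2 a, 0 <= a & u A = a%:E.
  by exists (fine (u A)); [exact: fine_ge0|rewrite fineK ?fin_num_measure].
have E : forall B : set (measurableTypeR R), measurable B -> joint_measure u mV mUA B = mscale (NngNum A0) u B.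
  apply: (@measure_unique_rays R (joint_measure u mV mUA) (mscale (NngNum A0) u)) => x.
    by rewrite /joint_measure /= setIC; apply: (etrans (step x A mA)); rewrite uAE.
  by apply: (le_lt_trans (probability_le1 u _) (ltry 1)); apply: measurableI => //;
    rewrite -[X in measurable X]setTI; exact: mV.
by rewrite setIC; apply: (etrans (E B mB)); rewrite uAE.
Qed.

End Splitting.

Section Quantile.
Variables (R : realType) (N : probability (measurableTypeR R) R).
Notation u := (@unif R).

(** [Q] is the generalised inverse of the distribution function [F]: on [(0, 1)], right continuity
    makes [Q p <= x] equivalent to [p <= F x], so rays have the same mass under the law of [Q] and
    under [N]. *)
Lemma exists_quantile : exists2 Q : R -> R, measurable_fun setT Q &
  forall h : R -> R, measurable_fun setT h -> (exists M, forall x, `|h x| <= M) ->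
    \int[u]_x h (Q x) = \int[N]_x h x.
Proof.
pose X : {RV N >-> R} := mfun_Sub (mem_set
  (@measurable_id _ (measurableTypeR R) setT :
    measurable_fun setT (fun x : measurableTypeR R => x : R))).
pose F := cdf X.
have F0 x : (0 <= F x)%E := cdf_ge0 X x.
have F1 x : (F x <= 1)%E := cdf_le1 X x.
have nF : {homo F : x y / x <= y >-> (x <= y)%E} := @cdf_nondecreasing _ _ _ _ X.
pose E (p : R) := [set x : R | (p%:E <= F x)%E].
have Ene p : 0 < p < 1 -> E p !=set0.
  move=> /andP[_ p1].
  have : \forall x \near +oo, (p%:E < F x)%E.
    by have /(_ [set y | (p%:E < y)%E]) := cvg_cdfy1 X; apply; apply: open_ereal_gt'; rewrite lte_fin.
  move=> [M [_ HM]]; exists (M + 1); apply/ltW; apply: HM.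
  by rewrite ltrDl.
have Elb p : 0 < p < 1 -> has_lbound (E p).
  move=> /andP[p0 _].
  have : \forall x \near -oo, (F x < p%:E)%E.
    by have /(_ [set y | (y < p%:E)%E]) := cvg_cdfNy0 X; apply; apply: open_ereal_lt'; rewrite lte_fin.
  move=> [M [_ HM]]; exists M => x Ex; rewrite leNgt; apply/negP => /HM.
  by rewrite ltNge Ex.
(* Outside [(0, 1)] the set [E p] may be empty or unbounded below; the value 0 there sits on a null
   set of [unif]. *)
pose Q p := if 0 < p < 1 then inf (E p) else 0.
have QE p x : 0 < p < 1 -> (Q p <= x) = (p%:E <= F x)%E.
  move=> p01; rewrite /Q p01; apply/idP/idP => [H|H]; last exact: inf_lbound (Elb _ p01) _ H.
  have c := @cdf_right_continuous _ _ _ _ X x.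
  rewrite -/F in c; rewrite -(cvg_lim _ c)//.
  apply: lime_ge; first by apply/cvg_ex; exists (F x).
  near=> y.
  have xy : x < y by near: y; exact: nbhs_right_gt.
  have [e Ee ey] : exists2 e, E p e & e < y.
    have := @inf_adherent _ (E p) (y - inf (E p)) _ (conj (Ene _ p01) (Elb _ p01)).
    rewrite subrKC => H'; apply: H'; rewrite subr_gt0.
    exact: le_lt_trans xy.
  by apply: le_trans Ee _; apply: nF; exact: ltW.
have preQ x : Q @^-1` `]-oo, x] =
    (`]0, 1[ `&` `]-oo, fine (F x)]) `|` (if 0 <= x then ~` `]0, 1[ else set0).
  have Ffin : F x = (fine (F x))%:E.
    by rewrite fineK// ge0_fin_numE//; apply: le_lt_trans (F1 x) (ltry _).
  apply/seteqP; split => p /=; rewrite !in_itv/=.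
    have [p01|p01] := boolP (0 < p < 1).
      by rewrite QE// Ffin lee_fin => H; left.
    by rewrite /Q (negbTE p01) => ->; right; rewrite /= in_itv/= (negbTE p01).
  move=> [[p01 H]|]; first by rewrite QE// Ffin.
  by case: ifP => // x0 /=; rewrite in_itv/= /Q => /negP/negbTE ->.
have mpreQ x : measurable (Q @^-1` `]-oo, x]).
  rewrite preQ; apply: measurableU; first exact: measurableI.
  by case: ifP => // _; exact: measurableC.
have mQ : measurable_fun setT (Q : measurableTypeR R -> measurableTypeR R).
  apply: (measurability _ (RGenOInfty.measurableE R)) => _ [_ [x ->] <-].
  rewrite setTI -[X in measurable X]setCK; apply: measurableC.
  rewrite (_ : ~` _ = Q @^-1` `]-oo, x]); first exact: mpreQ.
  apply/seteqP; split => y /=; rewrite !in_itv/= andbT; first by move/negP; rewrite -leNgt.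
  by rewrite leNgt => /negP.
exists Q => // h mh bh.
rewrite -(Rintegral_law u mQ mh bh); apply: integral_measurable_eq.
apply: measure_unique_rays => x; last first.
  by apply: le_lt_trans (probability_le1 _ _) (ltry _).
have mray : measurable (`]-oo, fine (F x)]%classic : set (measurableTypeR R)) by [].
have ind (D : set (measurableTypeR R)) : measurable D -> u D = (\int[u]_z (\1_D z : R))%:E.
  move=> mD; rewrite /Rintegral fineK ?integral_indic// ?setIT//.
  exact: fin_num_measure.
have LE : law u mQ `]-oo, x]%classic = u `]-oo, fine (F x)]%classic.
  rewrite lawE (ind _ (mpreQ x)) (ind _ mray); congr EFin.
  apply: Rintegral_unif_eq; [exact: measurable_indic|exact: measurable_indic|].
  move=> p p01; rewrite !indicE; congr (_%:R); congr nat_of_bool.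
  have -> : (p \in Q @^-1` `]-oo, x]) = (Q p <= x).
    by apply/idP/idP; rewrite inE /= in_itv.
  have -> : (p \in `]-oo, fine (F x)]%classic) = (p <= fine (F x)).
    by apply/idP/idP; rewrite inE /= in_itv.
  rewrite QE// -lee_fin fineK// ge0_fin_numE//; apply: le_lt_trans (F1 x) (ltry _).
have Ff : (fine (F x))%:E = F x.
  by rewrite fineK// ge0_fin_numE//; apply: le_lt_trans (F1 x) (ltry _).
apply: (etrans LE); apply: (etrans (unif_ray _)); rewrite clip_id ?Ff//.
by rewrite -!lee_fin Ff F0 F1.
Unshelve. all: by end_near. Qed.

End Quantile.

(** Agreement on rectangles identifies the law of the pair [(U, V)] with the product measure; then
    Fubini applies. *)
Lemma Rintegral_indep_split (R : realType) (U V : measurableTypeR R -> measurableTypeR R)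
    (f : R -> R -> R) :
  measurable_fun setT U -> measurable_fun setT V ->
  (forall A B, measurable A -> measurable B ->
     unif R (U @^-1` A `&` V @^-1` B) = (unif R A * unif R B)%E) ->
  measurable_fun setT (fun p : measurableTypeR R * measurableTypeR R => f p.1 p.2) ->
  (forall x y, `|f x y| <= 1) ->
  \int[unif R]_x f (U x) (V x) = \int[unif R]_y \int[unif R]_x f x y.
Proof.
set u := unif R => mU mV UV mf f1.
have mUV : measurable_fun setT (fun x => (U x, V x)) by exact: measurable_fun_pair.
have bf (T : Type) (g : T -> R * R) : exists M, forall x, `|f (g x).1 (g x).2| <= M by exists 1.
have E : forall A, measurable A -> (u \x u)%E A = law u mUV A.
  by apply: (@product_measure_unique _ _ _ _ _ u u (law u mUV)) => A B mA mB; exact: UV.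
rewrite -(Rintegral_law u mUV mf (bf _ id)).
rewrite -(integral_measurable_eq _ E).
have fi : (u \x u)%E.-integrable setT (EFin \o (fun p => f p.1 p.2)).
  apply: measurable_bounded_integrable => //.
    apply: (@le_lt_trans _ _ (law u mUV setT)); last first.
      exact: le_lt_trans (probability_le1 _ _) (ltry _).
    by rewrite -E.
  by exists 1; split => // r r1 x _ /=; rewrite (le_trans (f1 _ _))// ltW.
rewrite /Rintegral -integral21_prod_meas1//; congr fine; apply: eq_integral => y _.
rewrite /fubini_G /= fineK//; apply: integrable_fin_num => //.
apply: bounded_integrable; last by exists 1.
exact: (measurableT_comp mf (measurable_fun_pair (@measurable_id _ _ _) (measurable_cst y))).
Qed.

(** One uniform variable carries the whole sequence: [U] feeds the current term, while [V], uniform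
    and independent of [U], is split again. In the induction the first term is integrated out and
    the remaining sum is the same expression at [V x]. *)
Lemma exists_gauss_seq (R : realType) : exists xi : nat -> R -> R,
  (forall j, measurable_fun setT (xi j)) /\
  forall m (t : nat -> R) b,
    \int[unif R]_x cos (\sum_(j < m) t j * xi j x + b) =
    cos b * expR (- ((\sum_(j < m) t j ^+ 2) / 2)).
Proof.
have [U [V [mU mV UV]]] := exists_indep_split R.
have [Q mQ QN] := exists_quantile (normal_prob (0 : R) 1).
have miV j : measurable_fun setT (iter j V).
  elim: j => [|j IH]; first exact: measurable_id.
  exact: (measurableT_comp mV IH).
pose xi j x := Q (U (iter j V x)).
have mxi j : measurable_fun setT (xi j).
  exact: (measurableT_comp mQ (measurableT_comp mU (miV j))).
exists xi; split => // m; elim: m => [|m IH] t b.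
  rewrite big_ord0 mul0r oppr0 expR0 mulr1.
  under eq_Rintegral do rewrite big_ord0 add0r.
  by rewrite cst_Rintegral_prob.
pose G y := \sum_(j < m) t j.+1 * xi j y + b.
have mG : measurable_fun setT G.
  apply: measurable_funD => //; apply: measurable_sum => j.
  exact: measurable_funM.
pose f (x y : R) := cos (t 0%N * Q x + G y).
have -> : \int[unif R]_x cos (\sum_(j < m.+1) t j * xi j x + b) = \int[unif R]_x f (U x) (V x).
  apply: eq_Rintegral => x _; rewrite big_ord_recl/= /f /G addrA; congr (cos (_ + _ + _)).
  by apply: eq_bigr => j _; rewrite /xi /= -iterSr.
have mcos : measurable_fun setT (@cos R).
  by apply: continuous_measurable_fun; exact: continuous_cos.
rewrite (@Rintegral_indep_split _ U V f)//; last 2 first.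
- apply: (measurableT_comp mcos); apply: measurable_funD.
    apply: measurable_funM => //; exact: (measurableT_comp mQ).
  exact: (measurableT_comp mG).
- by move=> x y; exact: cos_max.
have inner y : \int[unif R]_x f x y = expR (- (t 0%N ^+ 2 / 2)) * cos (G y).
  rewrite /f (QN (fun z => cos (t 0%N * z + G y))); last by exists 1 => x; exact: cos_max.
    by rewrite normal_prob_cf ?oner_eq0// expr1n mul1r mulrC.
  by apply: continuous_measurable_fun; exact: continuous_cos_affine.
under eq_Rintegral do rewrite inner.
rewrite RintegralZl//; last first.
  apply: (@bounded_integrable _ _ _ (unif R) (fun y => cos (G y))); first exact: (measurableT_comp mcos).
  by exists 1 => x; exact: cos_max.
rewrite /G (IH (fun j => t j.+1)) mulrCA -expRD big_ord_recl/=.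
by congr (_ * expR _); lra.
Qed.

(** * Neighbourhoods and Borel sets of R^infty *)

Section Cylinders.
Variable R : realType.
Notation RN := {ptws nat -> R}.

(** The index [n] controls both how many coordinates are tested and how closely, so that a single
    sequence of sets is a neighbourhood base at [x]. *)
Definition cyl (x : nat -> R) (n : nat) : set RN :=
  [set z | forall i, (i <= n)%N -> `|x i - z i| < n.+1%:R^-1].

Lemma continuous_coord (k : nat) : continuous (fun x : RN => x k).
Proof. exact: (@proj_continuous nat (fun=> R) k). Qed.

Lemma cyl_nbhs (x : RN) n : nbhs x (cyl x n).
Proof.
have H : \forall z \near x, forall i : 'I_n.+1, `|x (i : nat) - (z : RN) (i : nat)| < n.+1%:R^-1.
  have := @filter_forall RN 'I_n.+1
    (fun i => [set z : RN | `|x (i : nat) - z (i : nat)| < n.+1%:R^-1]) (nbhs x) _.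
  apply => i.
  have c : (fun z : RN => z (i : nat)) @ nbhs x --> x (i : nat) := @continuous_coord i x.
  by move/cvgrPdist_lt : c; apply; rewrite invr_gt0 ltr0Sn.
by apply: filterS H => z Hz i ilen; exact: (Hz (Ordinal (ilen : (i < n.+1)%N))).
Qed.

Lemma le_invn (m n : nat) : (m <= n)%N -> n.+1%:R^-1 <= m.+1%:R^-1 :> R.
Proof. by move=> mn; rewrite lef_pV2 ?posrE ?ltr0Sn// ler_nat ltnS. Qed.

(** The filter generated by the cylinders converges to [x] in every coordinate, hence in the product
    topology. *)
Lemma nbhs_cyl (x : RN) A : nbhs x A -> exists n, cyl x n `<=` A.
Proof.
pose F : set_system RN := filter_from setT (cyl x).
have FF : Filter F.
  apply: filter_from_filter; first by exists 0%N.
  move=> i j _ _; exists (maxn i j) => // z Hz; split => k ki.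
    apply: lt_le_trans (Hz k _) (le_invn (leq_maxl _ _)).
    exact: leq_trans ki (leq_maxl _ _).
  apply: lt_le_trans (Hz k _) (le_invn (leq_maxr _ _)).
  exact: leq_trans ki (leq_maxr _ _).
have : {ptws, F --> (x : nat -> R)}.
  apply/pointwise_cvgP => t; apply/cvgrPdist_lt => e e0.
  have [n ne] : exists n : nat, n.+1%:R^-1 < e.
    have /cvgr0_norm_lt/(_ e e0)[n _ H] := @cvg_harmonic R.
    by exists n; have := H n (leqnn n); rewrite /= ger0_norm.
  exists (maxn n t) => // z Hz /=.
  apply: lt_trans (lt_le_trans (Hz t (leq_maxr _ _)) _) ne.
  by apply: le_invn; exact: leq_maxl.
by move=> /[apply] -[n _ H]; exists n.
Qed.

(** [borel] is generated by all open sets. Each of them is a countable union of cylinders with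
    rational centres, and a cylinder constrains finitely many coordinates. *)
Lemma measurable_to_RN d (T : measurableType d) (Phi : T -> borel RN) :
  (forall i, measurable_fun setT (fun w => (Phi w : RN) i)) -> measurable_fun setT Phi.
Proof.
move=> mPhi; apply: (@measurability _ _ T (borel RN) setT Phi (@open RN) erefl) => _ [U oU <-]; rewrite setTI.
pose C (p : seq rat * nat) : set RN :=
  [set z | forall i : 'I_p.2.+1, `|ratr (nth 0 p.1 i) - z i| < p.2.+1%:R^-1].
have -> : Phi @^-1` U = \bigcup_(p : seq rat * nat)
    (Phi @^-1` (C p `&` [set z | C p `<=` U])).
  apply/seteqP; split => [w Uw|w [p _ [Cw CU]]]; last exact: CU.
  have [N HN] : exists N, cyl (Phi w) N `<=` U.
    by apply: nbhs_cyl; apply: open_nbhs_nbhs; split.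
  (* [n + 1] is twice [N + 1], so two errors below [1 / (n + 1)] stay below [1 / (N + 1)]. *)
  pose n := (2 * N).+1.
  have n0 : 0 < n.+1%:R^-1 :> R by rewrite invr_gt0 ltr0Sn.
  have q i : {q : rat | `|ratr q - (Phi w : RN) i| < n.+1%:R^-1}.
    have /rat_in_itvoo/cid[q] : (Phi w : RN) i - n.+1%:R^-1 < (Phi w : RN) i + n.+1%:R^-1.
      by rewrite ltrD2l gtrN.
    by rewrite in_itv/= -ltr_distl => Hq; exists q.
  pose s := mkseq (fun i => sval (q i)) n.+1.
  have sE (i : 'I_n.+1) : nth 0 s i = sval (q i) by rewrite nth_mkseq.
  exists (s, n) => //; split => /=.
    by move=> i; rewrite sE; exact: (svalP (q i)).
  move=> z Hz; apply: HN => i iN.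
  have ni : (i < n.+1)%N by rewrite /n; lia.
  have := Hz (Ordinal ni); rewrite sE /= => H1.
  have H2 := svalP (q i).
  have -> : (Phi w : RN) i - z i = ratr (sval (q i)) - z i - (ratr (sval (q i)) - (Phi w : RN) i) by ring.
  rewrite (le_lt_trans (ler_normB _ _))// (lt_le_trans (ltrD H1 H2))//.
  have -> : n.+1%:R = 2 * N.+1%:R :> R by rewrite -natrM /n; congr (_%:R); lia.
  have inv2 (a : R) : (2 * a)^-1 + (2 * a)^-1 = a^-1 by rewrite invfM; lra.
  by rewrite inv2.
apply: countable_bigcupT_measurable; first exact: countableP.
move=> p; have [CU|CU] := pselect (C p `<=` U); last first.
  by rewrite (_ : _ @^-1` _ = set0)//; apply/seteqP; split => // w [].
rewrite (_ : _ @^-1` _ = \bigcap_(i in [set: 'I_p.2.+1])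
    (fun w => (Phi w : RN) i) @^-1` (ball (ratr (nth 0 p.1 i) : R) p.2.+1%:R^-1)); last first.
  apply/seteqP; split => w /=; first by move=> [H _] i _; exact: H.
  by move=> H; split => // i; exact: H.
apply: fin_bigcap_measurable; first exact: finite_finset.
move=> i _; rewrite -[X in measurable X]setTI; apply: mPhi => //.
exact: measurable_ball.
Qed.

End Cylinders.

Section BorelContinuous.
Variable R : realType.

Lemma continuous_borel_fun (S : ptopologicalType) (g : S -> R) :
  continuous g -> measurable_fun (setT : set (borel S)) g.
Proof.
move=> /continuousP cg.
apply: (measurability _ (RGenOInfty.measurableE R)) => _ [_ [x ->] <-]; rewrite setTI.
by apply: sub_sigma_algebra; apply: cg; rewrite set_itvoy; exact: open_gt.
Qed.

Lemma continuous_borel_map (S S' : ptopologicalType) (g : S -> S') :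
  continuous g -> measurable_fun (setT : set (borel S)) (g : borel S -> borel S').
Proof.
move=> /continuousP cg.
apply: (@measurability _ _ (borel S) (borel S') setT g (@open S') erefl) => _ [U oU <-]; rewrite setTI.
by apply: sub_sigma_algebra; exact: cg.
Qed.

End BorelContinuous.

(** * Cholesky factors of infinite covariance arrays *)

Section Cholesky.
Variable R : realType.

Definition qform (C : nat -> nat -> R) (m : nat) (t : nat -> R) : R :=
  \sum_(i < m) \sum_(j < m) C i j * t i * t j.

Definition psd (C : nat -> nat -> R) : Prop :=
  (forall i j, C i j = C j i) /\ (forall m t, 0 <= qform C m t).

(* A zero pivot makes its whole row vanish, so dividing by it (which gives 0) is
   harmless. *)
Fixpoint schur (C : nat -> nat -> R) (m : nat) : nat -> nat -> R :=
  if m is k.+1 then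
    fun i j => schur C k i j - schur C k i k * schur C k k j / schur C k k k
  else C.

Definition chol (C : nat -> nat -> R) (i l : nat) : R :=
  schur C l i l / Num.sqrt (schur C l l l).

Lemma qform_widen C m n t : (m <= n)%N ->
  qform C m t = qform C n (fun i => if (i < m)%N then t i else 0).
Proof.
move=> mn; rewrite /qform (big_ord_widen n (fun i => \sum_(j < m) C i j * t i * t j) mn).
rewrite [LHS]big_mkcond/=; apply: eq_bigr => i _; case: ifP => im; last first.
  by rewrite big1// => j _; rewrite mulr0 mul0r.
rewrite (big_ord_widen n (fun j => C i j * t i * t j) mn) big_mkcond/=.
by apply: eq_bigr => j _; case: ifP; rewrite ?mulr0.
Qed.

Lemma qform_shift C m (t : nat -> R) k s : (forall i j, C i j = C j i) -> (k < m)%N ->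
  qform C m (fun i => t i + s * (i == k)%:R) =
  qform C m t + 2 * s * (\sum_(j < m) C k j * t j) + s ^+ 2 * C k k.
Proof.
move=> sC km; pose k' := Ordinal km.
have E (F : nat -> R) : \sum_(i < m) F i * (i == k :> nat)%:R = F k.
  rewrite (bigD1 k')//= eqxx mulr1 big1 ?addr0// => i ik.
  by rewrite (_ : (i == k :> nat) = false) ?mulr0//; apply/negbTE.
rewrite /qform.
transitivity (\sum_(i < m) \sum_(j < m) C i j * t i * t j
  + (\sum_(i < m) (\sum_(j < m) (C i j * t i * s) * (j == k :> nat)%:R))
  + (\sum_(i < m) (\sum_(j < m) C i j * t j * s) * (i == k :> nat)%:R)
  + \sum_(i < m) (\sum_(j < m) (C i j * s * s) * (j == k :> nat)%:R) * (i == k :> nat)%:R).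
  rewrite -!big_split/=; apply: eq_bigr => i _.
  rewrite !mulr_suml -!big_split/=; apply: eq_bigr => j _; ring.
rewrite (E (fun i => \sum_(j < m) C i j * t j * s)).
rewrite (E (fun i => \sum_(j < m) (C i j * s * s) * (j == k :> nat)%:R)).
rewrite (E (fun j => C k j * s * s)).
under [X in _ + X + _ + _]eq_bigr => i _ do rewrite (E (fun j => C i j * t i * s)) sC.
rewrite -!mulr_suml; ring.
Qed.

Lemma psd_diag_ge0 C k : psd C -> 0 <= C k k.
Proof.
move=> [sC pC]; have := pC k.+1 (fun i => 0 + 1 * (i == k)%:R).
rewrite qform_shift// /qform.
rewrite big1 ?add0r; last by move=> i _; rewrite big1// => j _; rewrite mulr0.
by rewrite big1 ?mulr0 ?add0r ?expr1n ?mul1r// => j _; rewrite mulr0.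
Qed.

(** Along [e_j + s e_k] the form is affine in [s] with slope [2 * C k j]. A nonzero slope would make
    it negative; the [s] chosen below gives -1. *)
Lemma psd_diag0 C k j : psd C -> C k k = 0 -> C k j = 0.
Proof.
move=> pC Ck0; have [->//|jk] := eqVneq j k.
apply/eqP; apply: contraT => Ckj.
pose m := (maxn k j).+1.
have km : (k < m)%N by rewrite ltnS leq_maxl.
have jm : (j < m)%N by rewrite ltnS leq_maxr.
pose t s := fun i => (0 + 1 * (i == j)%:R : R) + s * (i == k)%:R.
have H s : qform C m (t s) = 2 * s * C k j + C j j.
  have [sC _] := pC; rewrite /t qform_shift// Ck0 mulr0 addr0.
  rewrite qform_shift// expr1n mul1r [qform C m _]big1 ?add0r; last first.
    by move=> i _; rewrite big1// => j' _; rewrite mulr0.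
  rewrite [X in 2 * 1 * X]big1 ?mulr0 ?add0r; last by move=> i _; rewrite mulr0.
  rewrite addrC; congr (_ * _ + _).
  rewrite (bigD1 (Ordinal jm))//= eqxx add0r !mulr1 big1 ?addr0// => i ij.
  by rewrite (_ : (i == j :> nat) = false) ?mulr0 ?add0r ?mulr0//; apply/negbTE.
have := pC.2 m (t (- (C j j + 1) / (2 * C k j))).
rewrite H; have -> : 2 * (- (C j j + 1) / (2 * C k j)) * C k j + C j j = - 1 by field.
lra.
Qed.

(** The complement at [t] equals [C] at the vector obtained by moving the [k]-th coordinate of [t]
    to its minimiser, so it inherits nonnegativity. Padding with zeros first makes room for the
    index [k]. *)
Lemma psd_schur_step C k : psd C ->
  psd (fun i j => C i j - C i k * C k j / C k k).
Proof.
move=> pC; have [sC posC] := pC; split.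
  by move=> i j; rewrite (sC i j) (sC i k) (sC k j) (mulrC (C k i)).
move=> m t; have [Ck0|Ck0] := eqVneq (C k k) 0.
  rewrite (_ : (fun i j => _) = C)//; apply/funext => i; apply/funext => j.
  by rewrite Ck0 invr0 mulr0 subr0.
have mn : (m <= maxn m k.+1)%N by exact: leq_maxl.
rewrite (qform_widen _ _ mn); set n := maxn m k.+1; set t' := (fun i => if (i < m)%N then t i else 0).
have kn : (k < n)%N by exact: leq_maxr.
set b := \sum_(j < n) C k j * t' j.
have -> : qform (fun i j => C i j - C i k * C k j / C k k) n t' =
  qform C n (fun i => t' i + (- b / C k k) * (i == k)%:R).
  rewrite qform_shift// -/b.
  have -> : qform (fun i j => C i j - C i k * C k j / C k k) n t' =
      qform C n t' - b * b / C k k.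
    rewrite /qform /b mulr_suml mulr_suml -sumrB; apply: eq_bigr => i _.
    rewrite mulr_sumr mulr_suml -sumrB; apply: eq_bigr => j _.
    by rewrite (sC i k); ring.
  by field.
exact: posC.
Qed.

Lemma psd_schur C m : psd C -> psd (schur C m).
Proof. by move=> pC; elim: m => [//|m IH] /=; exact: psd_schur_step. Qed.

(** Each elimination clears its own row, through [psd_diag0] if the pivot is 0, and preserves the
    rows cleared before. This is why [chol] is lower triangular. *)
Lemma schur0 C m i j : psd C -> (i < m)%N -> schur C m i j = 0.
Proof.
move=> pC; elim: m => [//|m IH] in i j *; rewrite ltnS leq_eqVlt => /predU1P[->|im] /=.
  have [C0|C0] := eqVneq (schur C m m m) 0.
    by rewrite C0 invr0 mulr0 subr0; exact: psd_diag0 (psd_schur m pC) C0.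
  by field.
by rewrite (IH i j im) (IH i m im) !mul0r subr0.
Qed.

Lemma cholP C m i j : psd C -> C i j = \sum_(l < m) chol C i l * chol C j l + schur C m i j.
Proof.
move=> pC; elim: m => [|m IH]; first by rewrite big_ord0 add0r.
rewrite big_ord_recr/= {1}IH -!addrA; congr (_ + _).
have p := psd_schur m pC; have [s _] := p; have d0 := psd_diag_ge0 m p.
rewrite /chol (s m j).
have -> : schur C m i m / Num.sqrt (schur C m m m) * (schur C m j m / Num.sqrt (schur C m m m))
   = schur C m i m * schur C m j m / schur C m m m.
  by rewrite mulrACA -invfM -expr2 sqr_sqrtr.
by rewrite addrC subrK.
Qed.

Lemma chol0 C i l : psd C -> (i < l)%N -> chol C i l = 0.
Proof. by move=> pC il; rewrite /chol schur0// mul0r. Qed.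

End Cholesky.

Section GaussMeasure.
Variable R : realType.
Notation RN := {ptws nat -> R}.

Lemma continuous_lin (m : nat) (t : nat -> R) (b : R) :
  continuous (fun x : RN => \sum_(j < m) t j * x j + b).
Proof.
move=> x.
have H (n : nat) : (fun z : RN => \sum_(j < n) t j * z j) @ nbhs x --> \sum_(j < n) t j * x j.
  elim: n => [|n IH].
    rewrite big_ord0 (_ : (fun z => _) = fun=> 0); first exact: cvg_cst.
    by apply/funext => z; rewrite big_ord0.
  rewrite big_ord_recr/= (_ : (fun z => _) = fun z : RN => \sum_(j < n) t j * z j + t n * z n).
    apply: (@cvgD R R RN (nbhs x) (nbhs_filter x) _ (fun z : RN => t n * z n)) => //.
    apply: (@cvgMl_tmp R RN (nbhs x) (nbhs_filter x) (fun z : RN => z n)).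
    exact: continuous_coord.
  by apply/funext => z; rewrite big_ord_recr.
apply: (@cvgD R R RN (nbhs x) (nbhs_filter x) _ (fun=> b)) => //.
exact: cvg_cst.
Qed.

(** The law of the Cholesky factor applied to the independent normal sequence. Triangularity makes
    every coordinate a finite sum, and after [m] eliminations the remainder in [cholP] vanishes on
    the first [m] indices. *)
Lemma exists_gauss_measure (C : nat -> nat -> R) : psd C ->
  exists mu : probability (borel RN) R, forall m (t : nat -> R) b,
    \int[mu]_x cos (\sum_(j < m) t j * (x : RN) j + b) = cos b * expR (- (qform C m t / 2)).
Proof.
move=> pC; have [xi [mxi Hxi]] := exists_gauss_seq R.
pose Phi (w : measurableTypeR R) : borel RN := (fun i => \sum_(l < i.+1) chol C i l * xi l w : R).
have mPhi : measurable_fun setT Phi.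
  apply: measurable_to_RN => i; apply: measurable_sum => l.
  by apply: measurable_funM; [exact: measurable_cst|exact: mxi].
exists (law (unif R) mPhi) => m t b.
rewrite (Rintegral_law (unif R) mPhi (h := fun x : borel RN => cos (\sum_(j < m) t j * (x : RN) j + b))); last 2 first.
- apply: (continuous_borel_fun (S := RN)) => x.
  by apply: continuous_comp; [exact: continuous_lin|exact: continuous_cos].
- by exists 1 => x; exact: cos_max.
pose s l := \sum_(i < m) t i * chol C i l.
have lE w : \sum_(j < m) t j * (Phi w : RN) j = \sum_(l < m) s l * xi l w.
  rewrite /s; under [RHS]eq_bigr do rewrite mulr_suml.
  rewrite [RHS]exchange_big/=; apply: eq_bigr => j _.
  rewrite /Phi (big_ord_widen m (fun l => chol C j l * xi l w)) ?ltn_ord//.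
  rewrite big_mkcond mulr_sumr; apply: eq_bigr => l _.
  case: ifPn => [_|]; first by rewrite mulrA.
  by rewrite -leqNgt => jl; rewrite (chol0 pC jl) !(mulr0, mul0r).
under eq_Rintegral do rewrite lE.
rewrite Hxi; congr (_ * expR (- (_ / 2))).
rewrite /qform /s.
transitivity (\sum_(l < m) \sum_(i < m) \sum_(j < m) (t i * chol C i l) * (t j * chol C j l)).
  apply: eq_bigr => l _; rewrite expr2 mulr_suml; apply: eq_bigr => i _.
  by rewrite mulr_sumr.
rewrite exchange_big/=; apply: eq_bigr => i _; rewrite exchange_big/=; apply: eq_bigr => j _.
rewrite (cholP m i j pC) schur0// addr0 !mulr_suml; apply: eq_bigr => l _; ring.
Qed.

End GaussMeasure.

(** * Continuity theorem for characteristic functions *)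

Section Expect.
Variable R : realType.

(** Abstracts means over finitely many outcomes, which need no measurability. Binomial means and
    means over attachment histories both fit. *)
Definition expect_op (H : Type) (E : (H -> R) -> R) : Prop :=
  [/\ forall phi psi, E (fun h => phi h + psi h) = E phi + E psi,
      forall c phi, E (fun h => c * phi h) = c * E phi,
      forall phi psi, (forall h, phi h <= psi h) -> E phi <= E psi &
      forall c, E (fun=> c) = c].

Lemma expect_opB H (E : (H -> R) -> R) phi psi : expect_op E ->
  E (fun h => phi h - psi h) = E phi - E psi.
Proof.
move=> [eD eZ _ _]; rewrite -mulN1r -eZ -eD; congr E.
by apply/funext => h; rewrite mulN1r.
Qed.

Lemma expect_op_sum H (E : (H -> R) -> R) I (r : seq I) (phi : I -> H -> R) : expect_op E ->
  E (fun h => \sum_(i <- r) phi i h) = \sum_(i <- r) E (phi i).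
Proof.
move=> [eD eZ _ e1]; elim: r => [|i r IH].
  by rewrite big_nil -[RHS](e1 0); congr E; apply/funext => h; rewrite big_nil.
rewrite big_cons -IH -eD; congr E; apply/funext => h; by rewrite big_cons.
Qed.

Lemma expect_op_norm H (E : (H -> R) -> R) phi : expect_op E ->
  `|E phi| <= E (fun h => `|phi h|).
Proof.
move=> [eD eZ eM e1]; rewrite ler_norml -mulN1r -eZ !eM// => h.
  by rewrite ler_norm.
by rewrite mulN1r lerNl -normrN ler_norm.
Qed.

(** The mean of [phi] at the number of successes in [N] trials of probability [y], conditioned on
    one trial at a time. As a function of [y] it is a Bernstein polynomial. *)
Fixpoint binE (y : R) (N : nat) (phi : nat -> R) : R :=
  if N is N'.+1 then y * binE y N' (fun k => phi k.+1) + (1 - y) * binE y N' phi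
  else phi 0%N.

Lemma binE_expect y N : 0 <= y <= 1 -> expect_op (binE y N).
Proof.
move=> /andP[y0 y1]; have y1' : 0 <= 1 - y by rewrite subr_ge0.
elim: N => [|N [eD eZ eM e1]]; first by split => //= phi psi; exact.
split => [phi psi|c phi|phi psi le|c] /=.
- by rewrite !eD; ring.
- by rewrite !eZ; ring.
- by apply: lerD; apply: ler_wpM2l => //; apply: eM.
- by rewrite !e1; ring.
Qed.

Lemma binE_le y N phi psi : 0 <= y <= 1 -> (forall k, (k <= N)%N -> phi k <= psi k) ->
  binE y N phi <= binE y N psi.
Proof.
move=> /andP[y0 y1]; have y1' : 0 <= 1 - y by rewrite subr_ge0.
elim: N => [|N IH] in phi psi * => /= le; first exact: le.
apply: lerD; apply: ler_wpM2l => //; apply: IH => k kN; apply: le => //.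
exact: leq_trans kN _.
Qed.

Lemma binE_var y N a : binE y N (fun k => (k%:R - a) ^+ 2) =
  (N%:R * y - a) ^+ 2 + N%:R * y * (1 - y).
Proof.
elim: N a => [|N IH] a /=; first by rewrite !mul0r addr0.
have -> : (fun k : nat => (k.+1%:R - a) ^+ 2) = (fun k => (k%:R - (a - 1)) ^+ 2).
  by apply/funext => k; rewrite -natr1; congr (_ ^+ 2); ring.
by rewrite !IH -natr1; ring.
Qed.

(* Independent binomial variables with N trials and success probabilities
   y 0, ..., y (m - 1). *)
Fixpoint multE (y : nat -> R) (N m : nat) (phi : (nat -> nat) -> R) : R :=
  if m is m'.+1 then
    binE (y m') N (fun k => multE y N m' (fun j => phi (fun i => if i == m' then k else j i)))
  else phi (fun=> 0%N).

Lemma multE_expect y N m : (forall i, 0 <= y i <= 1) -> expect_op (multE y N m).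
Proof.
move=> y01; elim: m => [|m [eD eZ eM e1]]; first by split => //= phi psi; exact.
have [bD bZ bM b1] := binE_expect N (y01 m).
split => [phi psi|c phi|phi psi le|c] /=.
- by rewrite -bD; congr binE; apply/funext => k; rewrite eD.
- by rewrite -bZ; congr binE; apply/funext => k; rewrite eZ.
- by apply: bM => k; apply: eM.
- by rewrite -[RHS]b1; congr binE; apply/funext => k; rewrite e1.
Qed.

Lemma multE_le y N m phi psi : (forall i, 0 <= y i <= 1) ->
  (forall j, (forall i, (j i <= N)%N) -> phi j <= psi j) -> multE y N m phi <= multE y N m psi.
Proof.
move=> y01; elim: m => [|m IH] in phi psi * => /= le; first exact: le.
apply: binE_le => // k kN; apply: IH => j jN; apply: le => i.
by case: ifP.
Qed.

Lemma multE_marginal y N m i h : (forall i, 0 <= y i <= 1) -> (i < m)%N ->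
  multE y N m (fun j => h (j i)) = binE (y i) N h.
Proof.
move=> y01; elim: m => [//|m IH]; rewrite ltnS leq_eqVlt => /predU1P[->|im] /=.
  congr binE; apply/funext => k; rewrite eqxx.
  by have [_ _ _ ->] := multE_expect N m y01.
have [_ _ _ b1] := binE_expect N (y01 m).
rewrite -[RHS]b1; congr binE; apply/funext => k.
by rewrite -IH//; congr multE; apply/funext => j; rewrite (ltn_eqF im).
Qed.

End Expect.

Section TrigPoly.
Variable R : realType.

Definition trig (m : nat) (g : (nat -> R) -> R) : Prop :=
  exists s : seq (R * (nat -> R) * R), forall x,
    g x = \sum_(e <- s) e.1.1 * cos (\sum_(j < m) e.1.2 j * x j + e.2).

Lemma trig_ext m g g' : g =1 g' -> trig m g -> trig m g'.
Proof. by move=> E [s H]; exists s => x; rewrite -E. Qed.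

Lemma trig_cst m c : trig m (fun=> c).
Proof.
exists [:: (c, fun=> 0, 0)] => x; rewrite big_seq1/= addr0 big1 ?cos0 ?mulr1// => j _.
by rewrite mul0r.
Qed.

Lemma trigD m g h : trig m g -> trig m h -> trig m (fun x => g x + h x).
Proof. by move=> [s gs] [s' hs]; exists (s ++ s') => x; rewrite big_cat/= gs hs. Qed.

Lemma trigM m g h : trig m g -> trig m h -> trig m (fun x => g x * h x).
Proof.
move=> [s gs] [s' hs].
exists ([seq (e.1.1 * e'.1.1 / 2, fun j => e.1.2 j + e'.1.2 j, e.2 + e'.2) | e <- s, e' <- s'] ++
        [seq (e.1.1 * e'.1.1 / 2, fun j => e.1.2 j - e'.1.2 j, e.2 - e'.2) | e <- s, e' <- s']) => x.
rewrite big_cat/= !big_allpairs_dep/= gs hs mulr_suml -big_split/=; apply: eq_bigr => e _.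
rewrite mulr_sumr -big_split/=; apply: eq_bigr => e' _.
set u := \sum_(j < m) e.1.2 j * x j + e.2; set v := \sum_(j < m) e'.1.2 j * x j + e'.2.
have -> : \sum_(j < m) (e.1.2 j + e'.1.2 j) * x j + (e.2 + e'.2) = u + v.
  by under eq_bigr do rewrite mulrDl; rewrite big_split/= /u /v; ring.
have -> : \sum_(j < m) (e.1.2 j - e'.1.2 j) * x j + (e.2 - e'.2) = u - v.
  by under eq_bigr do rewrite mulrBl; rewrite sumrB /u /v; ring.
by rewrite (cosD u v) (cosB u v); field.
Qed.

Lemma trig_sin m i r : (i < m)%N -> trig m (fun x => (1 + sin (x i / r)) / 2).
Proof.
move=> im.
apply: (@trig_ext _ (fun x => 2^-1 + 2^-1 * cos (x i / r - pi / 2))).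
  by move=> x; rewrite cosBpihalf; field.
apply: trigD; first exact: trig_cst.
exists [:: (2^-1, fun j => (j == i)%:R / r, - (pi / 2))] => x.
rewrite big_seq1/=; congr (_ * cos (_ + _)).
rewrite (bigD1 (Ordinal im))//= eqxx mul1r mulrC big1 ?addr0// => j ji.
by rewrite (_ : (j == i :> nat) = false) ?mul0r//; apply/negbTE.
Qed.

Lemma trig_binE m N y (phi : (nat -> R) -> nat -> R) : trig m y ->
  (forall k, trig m (phi ^~ k)) -> trig m (fun x => binE (y x) N (phi x)).
Proof.
move=> ty; elim: N => [|N IH] in phi * => /= tp; first exact: tp.
apply: trigD; apply: trigM => //.
- by apply: (IH (fun x k => phi x k.+1)).
- apply: trigD; first exact: trig_cst.
  by apply: (@trig_ext _ (fun x => -1 * y x)) => [x|]; [rewrite mulN1r|apply: trigM => //; exact: trig_cst].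
- exact: IH.
Qed.

Lemma trig_multE m n N (y : (nat -> R) -> nat -> R) phi : (forall i, (i < n)%N -> trig m (y ^~ i)) ->
  trig m (fun x => multE (y x) N n phi).
Proof.
elim: n => [|n IH] in phi * => /= ty; first exact: trig_cst.
apply: (@trig_binE m N (y ^~ n) (fun x k => multE (y x) N n
  (fun j => phi (fun i => if i == n then k else j i)))); first exact: ty.
by move=> k; apply: IH => i iN; apply: ty; exact: ltnW.
Qed.

End TrigPoly.

(** * Trigonometric approximation on boxes *)

Section Approximation.
Variable R : realType.
Notation RN := {ptws nat -> R}.

(** The derivative of [sin] is at least [cos 1] on [[-1, 1]]; so an error in [sin] costs at most a
    factor [1 / cos 1] when it is carried back to the angle. *)
Lemma sin_sub_lower (a b : R) : -1 <= a -> a <= b -> b <= 1 ->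
  cos 1 * (b - a) <= sin b - sin a.
Proof.
move=> a1; rewrite le_eqVlt => /predU1P[->|ab] b1; first by rewrite !subrr mulr0.
have ds x : x \in `]a, b[ -> is_derive x (1 : R) (@sin R) (cos x) by move=> _; exact: is_derive_sin.
have cs : {within `[a, b], continuous (@sin R)}.
  by apply: continuous_subspaceT => x; exact: continuous_sin.
have [c + ->] := MVT ab ds cs.
rewrite in_itv/= => /andP[ac cb].
rewrite ler_wpM2r ?subr_ge0 ?(ltW ab)// -(cos_norm c).
have c1 : `|c| <= 1 by rewrite ler_norml; apply/andP; split; lra.
have pi1 : 1 <= pi :> R by have := @pi_ge2 R; lra.
rewrite leNgt; apply/negP; rewrite ltr_cos; last 2 first.
- by rewrite in_itv/= ler01.
- by rewrite in_itv/= normr_ge0 (le_trans c1).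
by rewrite ltNge c1.
Qed.

(** Success frequencies fill the whole of [[-1, 1]] after rescaling, while angles in [[-1, 1]] have
    sines in a smaller interval; clipping [asin] brings the surplus back without increasing the
    distance to such angles. *)
Definition node (s : R) : R := Num.max (-1) (Num.min 1 (asin s)).

Lemma node_dist (s theta : R) : -1 <= s <= 1 -> `|theta| <= 1 ->
  `|node s - theta| <= `|s - sin theta| / cos 1.
Proof.
move=> s1; rewrite ler_norml => /andP[t1 t2].
have c0 : 0 < cos 1 :> R := cos1_gt0 R.
rewrite ler_pdivlMr//.
have sa : sin (asin s) = s by rewrite asinK// in_itv.
have a1 := asin_geNpi2 s1; have a2 := asin_lepi2 s1.
have p2 := @pi_ge2 R.
have msin : forall x y : R, - (pi / 2) <= x <= pi / 2 -> - (pi / 2) <= y <= pi / 2 -> x < y -> sin x < sin y.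
  by move=> x y hx hy xy; rewrite ltr_sin// in_itv.
rewrite -{2}sa; set a := asin s in a1 a2 *; rewrite /node -/a.
have [a3|a3] := leP 1 a.
  have -> : Num.max (-1) 1 = 1 :> R by rewrite max_r//; lra.
  rewrite ger0_norm ?subr_ge0//.
  have := sin_sub_lower t1 t2 (lexx 1).
  have : sin 1 <= sin a.
    by move: a3; rewrite le_eqVlt => /predU1P[->//|a3]; apply/ltW/msin; lra.
  move=> h1 h2; rewrite mulrC; apply: le_trans h2 _; apply: le_trans (ler_norm _); lra.
have [a4|a4] := leP (-1) a; last first.
  rewrite ler0_norm; last lra.
  have := sin_sub_lower (lexx (-1)) t1 t2.
  have : sin a <= sin (-1) by apply/ltW/msin; lra.
  move=> h1 h2; rewrite distrC; apply: le_trans (ler_norm _); lra.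
have [at_|ta] := leP theta a.
  rewrite ger0_norm ?subr_ge0// mulrC.
  by apply: le_trans (sin_sub_lower _ _ _) (ler_norm _) => //; exact: ltW.
rewrite distrC (distrC (sin a)) ger0_norm ?subr_ge0 ?(ltW ta)// mulrC.
by apply: le_trans (sin_sub_lower _ _ _) (ler_norm _) => //; exact: ltW.
Qed.

(** Uniform continuity on a box that is compact by Tychonoff. The second point only has to be close
    in the first coordinates and may leave the box, which is what truncated points need. *)
Lemma near_uniform (g : RN -> R) (M : nat -> R) (eps : R) : continuous g -> 0 < eps ->
  exists n, forall x z, (forall k, `|x k| <= M k) -> cyl x n z -> `|g x - g z| <= eps.
Proof.
move=> cg e0.
have cK : compact [set x : RN | forall k, `[- M k, M k]%classic (x k)].
  exact: (@tychonoff nat (fun=> R) (fun k => `[- M k, M k]%classic) (fun k => @segment_compact R (- M k) (M k))).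
move/compact_near_coveringP : cK => cK.
have [|n _ Hn] := cK nat \oo (fun n (x : RN) => forall z, cyl x n z -> `|g x - g z| <= eps) _.
  move=> x _.
  have [N HN] : exists N, cyl x N `<=` [set z | `|g x - g z| < eps / 2].
    apply: nbhs_cyl; have /cvgrPdist_lt := cg x; apply; rewrite divr_gt0//.
  pose n := (2 * N).+1.
  exists (cyl x n, [set k | (n <= k)%N]); first by split => /=; [exact: cyl_nbhs|exists n].
  move=> [x' k] /= [xx' nk] z x'z.
  have le2 : n.+1%:R^-1 + k.+1%:R^-1 <= N.+1%:R^-1 :> R.
    have := le_invn R nk.
    have -> : n.+1%:R = 2 * N.+1%:R :> R by rewrite -natrM /n; congr (_%:R); lia.
    by rewrite (invfM 2); move: (N.+1%:R^-1) (k.+1%:R^-1) => u v; lra.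
  have h1 : `|g x - g x'| < eps / 2.
    apply: HN => i iN; apply: lt_le_trans (xx' i _) _; first by rewrite /n; lia.
    apply: le_trans le2; rewrite lerDl invr_ge0//.
  have h2 : `|g x - g z| < eps / 2.
    apply: HN => i iN; rewrite -(subrKA (x' i)).
    rewrite (le_lt_trans (ler_normD _ _))//; apply: lt_le_trans le2.
    by apply: ltrD; [apply: xx'|apply: x'z]; move: nk iN; rewrite /n => *; lia.
  rewrite -(subrKA (g x)); rewrite (le_trans (ler_normD _ _))// distrC; lra.
exists n => x z xM; apply: (Hn n (leqnn n)) => k /=.
by rewrite in_itv/= -ler_norml.
Qed.

(** Bernstein approximation in the variables [(1 + sin (x i / M i)) / 2]. Since [T x] is a mean of
    values of [g], the bound [B] holds for [T] everywhere and not only on the box; the tail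
    estimates rely on this. *)
Lemma trig_approx (g : RN -> R) (B : R) (M : nat -> R) (eps : R) : continuous g ->
  (forall x, `|g x| <= B) -> (forall k, 0 < M k) -> 0 < eps ->
  exists m T, [/\ trig m T, forall x, `|T x| <= B &
    forall x, (forall k, `|x k| <= M k) -> `|g x - T x| <= eps].
Proof.
move=> cg gB M0 e0.
have B0 : 0 <= B := le_trans (normr_ge0 _) (gB (fun=> 0)).
have e20 : 0 < eps / 2 by rewrite divr_gt0.
have [n Hn] := near_uniform M cg e20.
pose m := n.+1.
pose S := \sum_(i < m) M i.
have MS (i : 'I_m) : M i <= S.
  by rewrite /S (bigD1 i)//= lerDl sumr_ge0// => j _; exact: ltW.
have S0 : 0 <= S by apply: sumr_ge0 => i _; exact: ltW.
have c0 : 0 < cos 1 :> R := cos1_gt0 R.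
(* Tolerance on success frequencies: an error [dd] moves coordinate [i] by at most
   [M i * (2 * dd / cos 1)], which is below the radius [1 / (n + 1)] of [cyl x n]. *)
pose dd := cos 1 / (2 * (S + 1) * (n.+1%:R + 1)).
have dd0 : 0 < dd by rewrite divr_gt0// !mulr_gt0// ltr_wpDl.
have ddE : dd = cos 1 / (2 * (S + 1) * (n.+1%:R + 1)) by [].
clearbody dd.
(* Sized for Chebyshev: [m] variances of at most [N] each, a deviation threshold [N * dd], and a
   loss of [2 * B] beyond it. *)
have [N [N0 NN]] : exists N : nat, (0 < N)%N /\ 2 * B * m%:R / dd ^+ 2 / N%:R <= eps / 2.
  exists (Num.truncn (2 * B * m%:R / dd ^+ 2 / (eps / 2))).+1; split => //.
  rewrite ler_pdivrMr ?ltr0Sn// -ler_pdivrMl// mulrC.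
  by apply/ltW; exact: Num.Theory.truncnS_gt.
have N0' : 0 < N%:R :> R by rewrite ltr0n.
have k0 : 0 <= 2 * B / (dd ^+ 2 * N%:R ^+ 2) by rewrite divr_ge0 ?mulr_ge0 ?exprn_ge0 ?(ltW dd0).
pose y (x : nat -> R) i := (1 + sin (x i / M i)) / 2.
have y01 x i : 0 <= y x i <= 1.
  by have := sin_max (x i / M i); rewrite ler_norml /y => /andP[? ?]; apply/andP; split; lra.
pose pt (j : nat -> nat) : RN := fun i => if (i < m)%N then M i * node (2 * ((j i)%:R / N%:R) - 1) else 0.
pose T x := multE (y x) N m (fun j => g (pt j)).
have ET x := multE_expect N m (y01 x).
exists m, T; split.
- by apply: trig_multE => i im; exact: trig_sin.
- move=> x; rewrite (le_trans (expect_op_norm _ (ET x)))//.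
  have [_ _ eM e1] := ET x; rewrite -[leRHS](e1 B); exact: eM.
move=> x xM.
have [eD eZ eM e1] := ET x.
rewrite -{1}(e1 (g x)) /T -expect_opB//.
rewrite (le_trans (expect_op_norm _ (ET x)))//.
(* Either all frequencies are within [dd] and uniform continuity applies, or one deviation term
   alone exceeds the trivial bound [2 * B]. *)
have point (j : nat -> nat) : (forall i, (j i <= N)%N) ->
  `|g x - g (pt j)| <= eps / 2 + \sum_(i < m) (2 * B / (dd ^+ 2 * N%:R ^+ 2)) * ((j i)%:R - N%:R * y x i) ^+ 2.
  move=> jN.
  have sum0 : 0 <= \sum_(i < m) (2 * B / (dd ^+ 2 * N%:R ^+ 2)) * ((j i)%:R - N%:R * y x i) ^+ 2.
    by apply: sumr_ge0 => i _; rewrite mulr_ge0 ?sqr_ge0.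
  have [H|] := pselect (forall i : 'I_m, `|(j i)%:R / N%:R - y x i| <= dd).
    rewrite (le_trans (Hn x (pt j) xM _)) ?lerDl// => i ilen.
    have im : (i < m)%N by rewrite ltnS.
    have Mi := M0 i; have Hi := H (Ordinal im).
    rewrite /pt im.
    have -> : x i - M i * node (2 * ((j i)%:R / N%:R) - 1) =
        - (M i * (node (2 * ((j i)%:R / N%:R) - 1) - x i / M i)) by field; rewrite gt_eqF.
    rewrite normrN normrM (gtr0_norm Mi).
    have nd : `|node (2 * ((j i)%:R / N%:R) - 1) - x i / M i| <=
        `|2 * ((j i)%:R / N%:R) - 1 - sin (x i / M i)| / cos 1.
      apply: node_dist.
        have : 0 <= ((j i)%:R / N%:R : R) <= 1.
          by rewrite divr_ge0//= ler_pdivrMr// mul1r ler_nat.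
        by move=> /andP[? ?]; apply/andP; split; lra.
      by rewrite normrM normfV (gtr0_norm Mi) ler_pdivrMr// mul1r.
    have eq2 : 2 * ((j i)%:R / N%:R) - 1 - sin (x i / M i) = 2 * ((j i)%:R / N%:R - y x i).
      by rewrite /y; field; rewrite !gt_eqF.
    rewrite eq2 normrM (ger0_norm (_ : 0 <= 2))// in nd.
    have nd2 : `|node (2 * ((j i)%:R / N%:R) - 1) - x i / M i| <= 2 * dd / cos 1.
      by apply: le_trans nd _; rewrite ler_wpM2r ?invr_ge0 ?(ltW c0)// ler_wpM2l.
    apply: (@le_lt_trans _ _ (S * (2 * dd / cos 1))).
      by apply: ler_pM => //; [exact: ltW|exact: (MS (Ordinal im))].
    have -> : S * (2 * dd / cos 1) = S / (S + 1) / (n.+1%:R + 1).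
      by rewrite ddE; field; rewrite !gt_eqF// ltr_wpDl.
    rewrite ltr_pdivrMr ?ltr_wpDl// (@le_lt_trans _ _ 1)//.
      by rewrite ler_pdivrMr ?ltr_wpDl// mul1r lerDl.
    by rewrite mulrDr mulVf ?pnatr_eq0// mulr1 ltrDl invr_gt0 ltr0Sn.
  move=> /existsNP[i /negP]; rewrite -ltNge => Hi.
  apply: (@le_trans _ _ (2 * B)).
    by rewrite (le_trans (ler_normB _ _))// mulr_natl mulr2n lerD.
  have bi : 2 * B <= (2 * B / (dd ^+ 2 * N%:R ^+ 2)) * ((j i)%:R - N%:R * y x i) ^+ 2.
    have -> : (j i)%:R - N%:R * y x i = N%:R * ((j i)%:R / N%:R - y x i) by field; rewrite gt_eqF.
    rewrite -(real_normK (num_real (N%:R * _))) normrM (gtr0_norm N0').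
    set d := `|_ - y x i| in Hi *.
    have -> : 2 * B / (dd ^+ 2 * N%:R ^+ 2) * (N%:R * d) ^+ 2 = 2 * B * (d ^+ 2 / dd ^+ 2).
      by field; rewrite !gt_eqF.
    rewrite ler_peMr ?mulr_ge0// ler_pdivlMr ?exprn_gt0// mul1r.
    by rewrite lerXn2r ?nnegrE ?normr_ge0 ?ltW.
  apply: le_trans bi _; apply: ler_wpDl; first exact: ltW.
  rewrite (bigD1 i)//= lerDl sumr_ge0// => k _.
  by rewrite mulr_ge0 ?sqr_ge0.
apply: le_trans (multE_le _ (y01 x) point) _.
rewrite eD e1 (expect_op_sum _ _ (ET x)).
rewrite (le_trans _ (_ : eps / 2 + eps / 2 <= eps))//; last by lra.
rewrite lerD2l; apply: le_trans NN.
apply: (@le_trans _ _ (\sum_(i < m) 2 * B / (dd ^+ 2 * N%:R))); last first.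
  rewrite sumr_const card_ord -mulr_natr.
  by rewrite le_eqVlt; apply/orP; left; apply/eqP; field; rewrite !gt_eqF.
apply: ler_sum => i _; rewrite eZ.
rewrite (multE_marginal N (fun k => (k%:R - N%:R * y x i) ^+ 2) (y01 x) (ltn_ord i)) binE_var.
rewrite subrr expr0n add0r.
have -> : 2 * B / (dd ^+ 2 * N%:R) = 2 * B / (dd ^+ 2 * N%:R ^+ 2) * N%:R by field; rewrite !gt_eqF.
rewrite ler_wpM2l//.
by have /andP[? ?] := y01 x i; rewrite -mulrA ler_piMr// ?(ltW N0')// mulr_ile1//; lra.
Qed.

End Approximation.

Section Levy.
Variable R : realType.
Notation RN := {ptws nat -> R}.

Lemma tight_fun d (T : measurableType d) (P : probability T R) (f : T -> R) (eps : R) :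
  measurable_fun setT f -> 0 < eps ->
  exists2 M : nat, (0 < M)%N & (P [set w | (M%:R < `|f w|)%R] <= eps%:E)%E.
Proof.
move=> mf e0.
pose F (n : nat) := [set w | n%:R < `|f w|].
have mF n : measurable (F n).
  rewrite (_ : F n = (fun w => `|f w|) @^-1` `]n%:R, +oo[%classic); last first.
    by apply/seteqP; split => w /=; rewrite in_itv/= andbT.
  by rewrite -[X in measurable X]setTI; apply: measurableT_comp.
have F0 : \bigcap_n F n = set0.
  apply/seteqP; split => // w H; have := H (Num.truncn `|f w|).+1 I.
  by rewrite /F /= ltNge ltW// Num.Theory.truncnS_gt.
have niF : {homo F : n m / (n <= m)%N >-> (n >= m)%O}.
  move=> n m nm; apply/subsetPset => w; apply: le_lt_trans.
  by rewrite ler_nat.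
have := @nonincreasing_cvg_mu _ _ _ P F _ mF _ niF.
rewrite F0 measure0 => /(_ _ _) H.
have {H} : P \o F @ \oo --> 0%E.
  apply: H; first exact: le_lt_trans (probability_le1 P (mF 0%N)) (ltry _).
  by [].
move=> /fine_cvgP[_ /cvgr0_norm_le/(_ _ e0)[n _ H]].
exists n.+1 => //; have := H n.+1 (leqnSn n); rewrite /= => H'.
rewrite -(fineK (fin_num_measure P _ (mF n.+1))) lee_fin.
exact: le_trans (ler_norm _) H'.
Qed.

Lemma trig_continuous m (T : RN -> R) : trig m T -> continuous T.
Proof.
move=> [s Ts]; rewrite (_ : T = fun x => \sum_(e <- s) e.1.1 * cos (\sum_(j < m) e.1.2 j * x j + e.2)); last first.
  by apply/funext => x; exact: Ts.
move=> x; elim: s {Ts} => [|e s IH].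
  have -> : (fun z : RN => \sum_(e <- [::] : seq (R * (nat -> R) * R)) e.1.1 * cos (\sum_(j < m) e.1.2 j * z j + e.2)) = fun=> 0.
    by apply/funext => z; rewrite big_nil.
  exact: (@cst_continuous RN R 0 x).
rewrite /continuous_at big_cons (_ : (fun _ => _) = fun z : RN => e.1.1 * cos (\sum_(j < m) e.1.2 j * z j + e.2) +
  \sum_(e <- s) e.1.1 * cos (\sum_(j < m) e.1.2 j * z j + e.2)); last first.
  by apply/funext => z; rewrite big_cons.
apply: (@cvgD R R RN (nbhs x) (nbhs_filter x) (fun z : RN => e.1.1 * cos (\sum_(j < m) e.1.2 j * z j + e.2))) => //.
apply: (@cvgMl_tmp R RN (nbhs x) (nbhs_filter x) (fun z : RN => cos (\sum_(j < m) e.1.2 j * z j + e.2))).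
by apply: (@continuous_comp RN R R (fun z : RN => \sum_(j < m) e.1.2 j * z j + e.2) (@cos R) x);
  [exact: continuous_lin|exact: continuous_cos].
Qed.

Lemma Rintegral_trig d (T : measurableType d) (P : probability T R) (Y : T -> nat -> R)
    m (s : seq (R * (nat -> R) * R)) : (forall k, measurable_fun setT (Y ^~ k)) ->
  \int[P]_w (\sum_(e <- s) e.1.1 * cos (\sum_(j < m) e.1.2 j * Y w j + e.2)) =
  \sum_(e <- s) e.1.1 * \int[P]_w cos (\sum_(j < m) e.1.2 j * Y w j + e.2).
Proof.
move=> mY.
have mc (e : R * (nat -> R) * R) : measurable_fun setT (fun w => cos (\sum_(j < m) e.1.2 j * Y w j + e.2)).
  apply: (@measurableT_comp _ _ _ _ R R (@cos R)).
    by apply: continuous_measurable_fun; exact: continuous_cos.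
  apply: measurable_funD => //; apply: measurable_sum => j.
  by apply: measurable_funM.
have ic (e : R * (nat -> R) * R) : P.-integrable setT (EFin \o (fun w => cos (\sum_(j < m) e.1.2 j * Y w j + e.2))).
  by apply: bounded_integrable => //; exists 1 => w; exact: cos_max.
elim: s => [|e s IH].
  by rewrite big_nil; under eq_Rintegral do rewrite big_nil; rewrite cst_Rintegral_prob.
rewrite big_cons -IH; under eq_Rintegral do rewrite big_cons.
rewrite RintegralD//.
- by rewrite RintegralZl.
- apply: bounded_integrable; first by apply: measurable_funM.
  by exists `|e.1.1| => w; rewrite normrM ler_piMr// cos_max.
- apply: bounded_integrable.
    by apply: measurable_sum => e'; apply: measurable_funM.
  exists (\sum_(e <- s) `|e.1.1|) => w; apply: le_trans (ler_norm_sum _ _ _) _.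
  by apply: ler_sum => e' _; rewrite normrM ler_piMr// cos_max.
Qed.

Lemma Rintegral_dist_le d (T : measurableType d) (P : probability T R) (f g : T -> R)
    (A : set T) (e B b : R) : measurable_fun setT f -> measurable_fun setT g ->
  (forall w, `|f w| <= B) -> (forall w, `|g w| <= B) -> measurable A -> 0 <= e -> (P A <= b%:E)%E ->
  (forall w, ~ A w -> `|f w - g w| <= e) ->
  `|\int[P]_w f w - \int[P]_w g w| <= e + 2 * B * b.
Proof.
move=> mf mg fB gB mA e0 PA H.
have ifun (h : T -> R) c : measurable_fun setT h -> (forall w, `|h w| <= c) -> P.-integrable setT (EFin \o h).
  by move=> mh hc; apply: bounded_integrable => //; exists c.
have B0 : 0 <= B := le_trans (normr_ge0 _) (fB point).
have mfg : measurable_fun setT (fun w => f w - g w) by exact: measurable_funB.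
have bfg w : `|f w - g w| <= 2 * B by rewrite (le_trans (ler_normB _ _))// mulr_natl mulr2n lerD.
have mind : measurable_fun setT (fun w => e + 2 * B * (\1_A w)).
  by apply: measurable_funD => //; apply: measurable_funM => //; exact: measurable_indic.
rewrite -RintegralB//; [|exact: ifun fB|exact: ifun gB].
apply: le_trans (le_normr_Rintegral _ _) _ => //; first exact: ifun bfg.
apply: (@le_trans _ _ (\int[P]_w (e + 2 * B * \1_A w))).
  apply: le_Rintegral => //.
  - by apply: (ifun _ (2 * B)) => [|w]; [exact: measurableT_comp|rewrite normr_id].
  - apply: (ifun _ (e + 2 * B)) => // w; rewrite indicE ger0_norm ?addr_ge0 ?mulr_ge0//.
    by rewrite lerD2l ler_piMr ?mulr_ge0// lern1 leq_b1.
  - move=> w _; rewrite indicE; case: (boolP (w \in A)) => wA.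
      by rewrite mulr1 ler_wpDl.
    by rewrite mulr0 addr0; apply: H; move: wA; rewrite notin_setE.
rewrite RintegralD//; last 2 first.
- by apply: (ifun _ `|e|).
- apply: (ifun _ (2 * B)) => [|w]; first by apply: measurable_funM => //; exact: measurable_indic.
  by rewrite indicE ger0_norm ?mulr_ge0// ler_piMr ?mulr_ge0// lern1 leq_b1.
rewrite cst_Rintegral_prob lerD2l RintegralZl//; last first.
  by apply: (ifun _ 1) => [|w]; [exact: measurable_indic|rewrite indicE ger0_norm// lern1 leq_b1].
rewrite ler_wpM2l ?mulr_ge0// /Rintegral integral_indic// setIT -lee_fin fineK//.
exact: fin_num_measure.
Qed.

(** Coordinate [k] receives the share [eps / 2 ^+ k.+1] of the mass. The conclusion covers all
    larger boxes because the box is enlarged later to suit the approximating sequence. *)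
Lemma measure_union_tight (mu : probability (borel RN) R) (eps : R) : 0 < eps ->
  exists M : nat -> R, forall M', (forall k, M k <= M' k) ->
    measurable [set x : borel RN | exists k, M' k < `|(x : RN) k|] /\
    (mu [set x : borel RN | exists k, (M' k < `|(x : RN) k|)%R] <= eps%:E)%E.
Proof.
move=> e0.
have mcoord k : measurable_fun setT (fun x : borel RN => (x : RN) k).
  by apply: (continuous_borel_fun (S := RN)); exact: continuous_coord.
have H k : exists2 M : nat, (0 < M)%N &
    (mu [set x : borel RN | (M%:R < `|(x : RN) k|)%R] <= (eps / 2 ^+ k.+1)%:E)%E.
  by apply: tight_fun => //; rewrite divr_gt0// exprn_gt0.
exists (fun k => (sval (cid2 (H k)))%:R) => M' MM'.
pose F k := [set x : borel RN | M' k < `|(x : RN) k|].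
have mF k : measurable (F k).
  rewrite (_ : F k = (fun x : borel RN => `|(x : RN) k|) @^-1` `]M' k, +oo[%classic); last first.
    by apply/seteqP; split => w /=; rewrite in_itv/= andbT.
  by rewrite -[X in measurable X]setTI; apply: measurableT_comp.
have -> : [set x : borel RN | exists k, M' k < `|(x : RN) k|] = \bigcup_k F k.
  by apply/seteqP; split => x [k]; [exists k|move=> _ ?; exists k].
split; first exact: bigcup_measurable.
apply: (@le_trans _ _ (\sum_(k <oo) mu (F k))%E).
  apply: (@measure_sigma_subadditive _ R (borel RN) mu (\bigcup_k F k) F mF _ _) => //; exact: bigcup_measurable.
apply: (@le_trans _ _ (\sum_(k <oo) (eps / 2 ^+ k.+1)%:E)%E); last first.
  rewrite (eq_eseriesr (g := fun k => (eps / (2 ^ k.+1)%:R)%:E)); last by move=> k _; rewrite natrX.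
  exact: (epsilon_trick0 xpredT (ltW e0)).
apply: lee_nneseries => // k _.
rewrite /F; have := MM' k; case: cid2 => N /= _ Hk NM'.
apply: le_trans Hk; apply: le_measure; rewrite ?inE //; first exact: (mF k).
  rewrite (_ : [set x : borel RN | N%:R < `|(x : RN) k|] = (fun x : borel RN => `|(x : RN) k|) @^-1` `]N%:R, +oo[%classic); last first.
    by apply/seteqP; split => w /=; rewrite in_itv/= andbT.
  by rewrite -[X in measurable X]setTI; apply: measurableT_comp.
by move=> x; apply: le_lt_trans.
Qed.

(** Second moments give tightness through Chebyshev, and trigonometric sums pass to the limit by
    hypothesis. An [expect_op] is only finitely additive, so the union over coordinates has to be
    finite for each [n]: the bound by 1 on late coordinates ensures this, without uniformity in
    [n]. *)
Theorem levy_continuity (H : nat -> Type) (E : forall n, (H n -> R) -> R)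
    (Y : forall n, H n -> nat -> R) (Cv : nat -> R) (mu : probability (borel RN) R) :
  (forall n, expect_op (E n)) ->
  (forall n k, E n (fun h => Y n h k ^+ 2) <= Cv k) ->
  (forall n, exists m, forall h k, (m <= k)%N -> `|Y n h k| <= 1) ->
  (forall m (t : nat -> R) b,
     (fun n => E n (fun h => cos (\sum_(j < m) t j * Y n h j + b))) @ \oo -->
     \int[mu]_x cos (\sum_(j < m) t j * (x : RN) j + b)) ->
  forall g : RN -> R, continuous g -> (exists B, forall x, `|g x| <= B) ->
    (fun n => E n (fun h => g (Y n h))) @ \oo --> \int[mu]_x g x.
Proof.
move=> EE EY Ytail Ecf g cg [B gB].
have B0 : 0 <= B := le_trans (normr_ge0 _) (gB (fun=> 0)).
apply/cvgrPdist_le => e e0.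
pose e1 := e / (16 * (B + 1)).
have B1 : 0 < B + 1 by rewrite ltr_wpDl.
have e10 : 0 < e1 by rewrite divr_gt0// mulr_gt0.
have Be1 : 2 * B * e1 <= e / 8.
  have -> : e / 8 = 2 * (B + 1) * e1 by rewrite /e1; field; rewrite gt_eqF.
  by rewrite ler_wpM2r ?(ltW e10)// ler_wpM2l// lerDl.
have [M0 HM0] := measure_union_tight mu e10.
have Cv0 k : 0 <= Cv k.
  apply: le_trans (EY 0%N k); have [_ _ eM e1'] := EE 0%N.
  by rewrite -[leLHS](e1' 0); apply: eM => h; exact: sqr_ge0.
(* The three terms serve the tightness of [mu], the bound 1 on late coordinates, and a Chebyshev
   estimate whose sum over [k] is at most [e1]. *)
pose M k := Num.max (M0 k) (Num.max 1 ((Cv k + 1) * 2 ^+ k.+1 / e1)).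
have M1 k : 1 <= M k by rewrite /M !le_max lexx orbT.
have Mpos k : 0 < M k := lt_le_trans ltr01 (M1 k).
have MM0 k : M0 k <= M k by rewrite /M le_max lexx.
have [mA muA] := HM0 M MM0.
have e40 : 0 < e / 4 by rewrite divr_gt0.
have [m [T [trT TB HT]]] := trig_approx cg gB Mpos e40.
have cT := trig_continuous trT.
have D1 : `|\int[mu]_x g x - \int[mu]_x T x| <= e / 4 + 2 * B * e1.
  apply: (Rintegral_dist_le (A := [set x : borel RN | exists k, M k < `|(x : RN) k|])) => //.
  - by apply: (continuous_borel_fun (S := RN)).
  - by apply: (continuous_borel_fun (S := RN)).
  - exact: ltW.
  - move=> x /forallNP Hx; apply: HT => k; rewrite leNgt; apply/negP; exact: Hx.
have D2 n : `|E n (fun h => g (Y n h)) - E n (fun h => T (Y n h))| <= e / 4 + 2 * B * e1.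
  have [eD eZ eM e1'] := EE n.
  have [p Hp] := Ytail n.
  rewrite -expect_opB// (le_trans (expect_op_norm _ (EE n)))//.
  apply: (@le_trans _ _ (E n (fun h => e / 4 + \sum_(k < p) (2 * B / M k ^+ 2) * Y n h k ^+ 2))).
    apply: eM => h.
    have S0 : 0 <= \sum_(k < p) (2 * B / M k ^+ 2) * Y n h k ^+ 2.
      apply: sumr_ge0 => k _; apply: mulr_ge0; last exact: sqr_ge0.
      by apply: divr_ge0; [exact: mulr_ge0|exact: sqr_ge0].
    have [hK|] := pselect (forall k, `|Y n h k| <= M k).
      by rewrite (le_trans (HT _ hK))// lerDl.
    move=> /existsNP[k /negP]; rewrite -ltNge => Hk.
    have kp : (k < p)%N.
      rewrite ltnNge; apply/negP => pk; have := Hp h k pk.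
      by rewrite leNgt (le_lt_trans (M1 k) Hk).
    apply: (@le_trans _ _ (2 * B)).
      by rewrite (le_trans (ler_normB _ _))// mulr_natl mulr2n lerD.
    apply: ler_wpDl; first exact: ltW.
    rewrite (bigD1 (Ordinal kp))//=; apply: ler_wpDr.
      apply: sumr_ge0 => k' _; apply: mulr_ge0; last exact: sqr_ge0.
      by apply: divr_ge0; [exact: mulr_ge0|exact: sqr_ge0].
    rewrite -mulrA ler_peMr ?mulr_ge0// mulrC ler_pdivlMr ?exprn_gt0// mul1r.
    by rewrite -[leRHS]real_normK ?num_real// lerXn2r ?nnegrE ?(ltW (Mpos k))// ltW.
  rewrite eD e1' lerD2l (expect_op_sum _ _ (EE n)).
  apply: (@le_trans _ _ (\sum_(k < p) 2 * B * (e1 / 2 ^+ k.+1))).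
    apply: ler_sum => k _; rewrite eZ -[leLHS]mulrA; apply: ler_wpM2l; first exact: mulr_ge0.
    rewrite mulrC ler_pdivrMr ?exprn_gt0// (le_trans (EY n k))//.
    have h1 : (Cv k + 1) * 2 ^+ k.+1 / e1 <= M k by rewrite /M !le_max lexx !orbT.
    have p2 : 0 < 2 ^+ k.+1 :> R by rewrite exprn_gt0.
    have h2 : Cv k + 1 <= e1 / 2 ^+ k.+1 * M k.
      have -> : Cv k + 1 = e1 / 2 ^+ k.+1 * ((Cv k + 1) * 2 ^+ k.+1 / e1) by field; rewrite !gt_eqF.
      by apply: ler_wpM2l => //; apply: divr_ge0; exact: ltW.
    apply: (@le_trans _ _ (e1 / 2 ^+ k.+1 * M k)); first by apply: le_trans h2; rewrite lerDl.
    apply: ler_wpM2l; first by apply: divr_ge0; exact: ltW.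
    by rewrite expr2 ler_peMl// ltW.
  rewrite -mulr_sumr ler_wpM2l ?mulr_ge0//.
  have -> : \sum_(k < p) e1 / 2 ^+ k.+1 = e1 * (1 - 1 / 2 ^+ p).
    clear Hp; elim: p => [|p IH]; first by rewrite big_ord0 expr0 divr1 subrr mulr0.
    rewrite big_ord_recr/= IH exprS; field; rewrite expf_neq0//.
  by rewrite ler_piMr ?(ltW e10)// gerBl divr_ge0// exprn_ge0.
have cvT : (fun n => E n (fun h => T (Y n h))) @ \oo --> \int[mu]_x T x.
  have [s Ts] := trT.
  have -> : \int[mu]_x T x = \sum_(e <- s) e.1.1 * \int[mu]_x cos (\sum_(j < m) e.1.2 j * (x : RN) j + e.2).
    rewrite -(Rintegral_trig mu (Y := fun x : borel RN => (x : RN))); last first.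
      by move=> k; apply: (continuous_borel_fun (S := RN)); exact: continuous_coord.
    by apply: eq_Rintegral => x _; exact: Ts.
  have -> : (fun n => E n (fun h => T (Y n h))) = (fun n => \sum_(e <- s)
      e.1.1 * E n (fun h => cos (\sum_(j < m) e.1.2 j * Y n h j + e.2))).
    apply/funext => n; have [_ eZ _ _] := EE n.
    under [RHS]eq_bigr do rewrite -eZ; rewrite -(expect_op_sum _ _ (EE n)).
    by congr (E n); apply/funext => h; exact: Ts.
  elim: s {Ts} => [|[[c t] b] s IH].
    rewrite big_nil (_ : (fun _ => _) = fun=> 0); first exact: cvg_cst.
    by apply/funext => n; rewrite big_nil.
  rewrite big_cons (_ : (fun _ => _) = fun n => c * E n (fun h => cos (\sum_(j < m) t j * Y n h j + b)) +
    \sum_(e <- s) e.1.1 * E n (fun h => cos (\sum_(j < m) e.1.2 j * Y n h j + e.2))); last first.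
    by apply/funext => n; rewrite big_cons.
  by apply: cvgD => //; apply: cvgMl_tmp; exact: Ecf.
move/cvgrPdist_le : cvT => /(_ _ e40); apply: filterS => n Hn.
have := D2 n; rewrite distrC => D2n /=.
set a := \int[mu]_x g x in D1 *; set a' := \int[mu]_x T x in D1 Hn *.
rewrite /= in Hn.
set b' := E n (fun h => T (Y n h)) in D2n Hn; set b := E n (fun h => g (Y n h)) in D2n *.
have -> : a - b = (a - a') + (a' - b') + (b' - b) by rewrite !subrKA.
rewrite (le_trans (ler_normD _ _))// (le_trans (lerD (ler_normD _ _) (lexx _)))//.
lra.
Qed.

End Levy.

(** * Taylor bounds for cosine, sine and the exponential *)

Section TaylorBounds.
Variable R : realType.
Implicit Types x y a b h : R.

(** Monotonicity from the sign of the derivative. The bounds that follow climb one degree at a time: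
    the derivative of each is the previous one. *)
Lemma ge0_is_derive (f df : R -> R) : (forall x, is_derive x 1 f (df x)) -> 0 <= f 0 ->
  (forall x, 0 <= x -> 0 <= df x) -> forall x, 0 <= x -> 0 <= f x.
Proof.
move=> Df f0 df0 x x0.
have [|c] := @MVT_segment R f df 0 x x0 (fun y _ => Df y).
  apply: continuous_subspaceT => y; apply/differentiable_continuous/derivable1_diffP.
  by have [] := Df y.
rewrite in_itv/= => /andP[c0 _] E.
by move: (mulr_ge0 (df0 c c0) x0) f0; rewrite -[x in _ * x]subr0 -E; lra.
Qed.

Lemma sin_le_id x : 0 <= x -> sin x <= x.
Proof.
move=> x0; rewrite -subr_ge0.
apply: (@ge0_is_derive (fun y => y - sin y) (fun y => 1 - cos y)) => //.
by rewrite sin0 subr0.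
Qed.

Lemma cos_sub_le x : 0 <= x -> 1 - cos x <= x ^+ 2 / 2.
Proof.
move=> x0; rewrite -subr_ge0.
apply: (@ge0_is_derive (fun y => y ^+ 2 / 2 - (1 - cos y)) (fun y => y - sin y)) => //.
- move=> y; apply: is_derive_eq.
  by rewrite /GRing.scale/=; field.
- by rewrite expr0n mul0r cos0 subrr subr0.
- by move=> y /sin_le_id; rewrite subr_ge0.
Qed.

Lemma id_sub_sin_le x : 0 <= x -> x - sin x <= x ^+ 3 / 6.
Proof.
move=> x0; rewrite -subr_ge0.
apply: (@ge0_is_derive (fun y => y ^+ 3 / 6 - (y - sin y)) (fun y => y ^+ 2 / 2 - (1 - cos y))) => //.
- move=> y; apply: is_derive_eq.
  by rewrite /GRing.scale/=; field.
- by rewrite expr0n mul0r sin0 subrr subr0.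
- by move=> y /cos_sub_le; rewrite subr_ge0.
Qed.

Lemma cos_taylor4 x : 0 <= x -> cos x - 1 + x ^+ 2 / 2 <= x ^+ 4 / 24.
Proof.
move=> x0; rewrite -subr_ge0.
apply: (@ge0_is_derive (fun y => y ^+ 4 / 24 - (cos y - 1 + y ^+ 2 / 2)) (fun y => y ^+ 3 / 6 - (y - sin y))) => //.
- move=> y; apply: is_derive_eq.
  by rewrite /GRing.scale/=; field.
- by rewrite !expr0n !mul0r cos0 subrr addr0 subr0.
- by move=> y /id_sub_sin_le; rewrite subr_ge0.
Qed.

Lemma cos_norm x : cos `|x| = cos x.
Proof. by have [//|//] := ler0P x; rewrite cosN. Qed.

Lemma sin_norm x : `|sin `|x| | = `|sin x|.
Proof. by have [//|//] := ler0P x; rewrite sinN normrN. Qed.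

Lemma sin_bound x : `|sin x| <= `|x|.
Proof.
have H (y : R) : 0 <= y -> `|sin y| <= y.
  move=> y0; rewrite ler_norml sin_le_id// andbT lerNl -sinN.
  have : 0 <= sin y + y.
    apply: (@ge0_is_derive (fun y => sin y + y) (fun y => cos y + 1)) => //.
      by rewrite sin0 addr0.
  by rewrite sinN; lra.
by rewrite -sin_norm; exact: H.
Qed.

Lemma cos_bound x : 0 <= 1 - cos x <= x ^+ 2 / 2.
Proof.
rewrite -cos_norm -(real_normK (num_real x)) subr_ge0 cos_le1/=.
exact: cos_sub_le.
Qed.

Lemma sin_taylor x : `|sin x - x| <= `|x| ^+ 3 / 6.
Proof.
have H (y : R) : 0 <= y -> `|sin y - y| <= y ^+ 3 / 6.
  by move=> y0; rewrite distrC ger0_norm ?id_sub_sin_le// subr_ge0 sin_le_id.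
have [x0|x0] := ler0P x; last by apply: H; exact: ltW.
have -> : sin x - x = - (sin (- x) - - x) by rewrite sinN; ring.
by rewrite normrN; apply: H; rewrite oppr_ge0.
Qed.

Lemma cos_taylor x : `|cos x - 1 + x ^+ 2 / 2| <= `|x| ^+ 3.
Proof.
have /andP[_ H] := cos_bound x.
rewrite -(real_normK (num_real x)) -cos_norm in H *.
have := cos_taylor4 (normr_ge0 x); have := cos_le1 `|x|.
move: H; set y := `|x|; have : 0 <= y by exact: normr_ge0.
move=> y0 H c1 c4; rewrite ger0_norm; last by lra.
have [y1|y1] := leP y 1.
  apply: le_trans c4 _; rewrite ler_pdivrMr// exprSr.
  have y3 : 0 <= y ^+ 3 by rewrite exprn_ge0.
  by apply: ler_wpM2l => //; lra.
have : y ^+ 2 <= y ^+ 3 by rewrite ler_weXn2l// ltW.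
by have := sqr_ge0 y; lra.
Qed.

Lemma MVT_bound (f df : R -> R) a b M : (forall x, is_derive x 1 f (df x)) ->
  (forall x, `|df x| <= M) -> `|f b - f a| <= M * `|b - a|.
Proof.
move=> Df dM; wlog ab : a b / a <= b => [H|].
  by have [/H//|/ltW/H] := leP a b; rewrite distrC (distrC a).
have [|c _ ->] := @MVT_segment R f df a b ab (fun y _ => Df y).
  apply: continuous_subspaceT => y; apply/differentiable_continuous/derivable1_diffP.
  by have [] := Df y.
by rewrite normrM ler_wpM2r.
Qed.

Lemma cosD_lip a h : `|cos (a + h) - cos a| <= `|h|.
Proof.
have := @MVT_bound (@cos R) (fun x => - sin x) a (a + h) 1 (fun x => is_derive_cos x).
by rewrite addrAC subrr add0r mul1r; apply => x; rewrite normrN sin_max.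
Qed.

Lemma cosD_taylor1 a h : `|cos (a + h) - cos a + h * sin a| <= 2 * h ^+ 2.
Proof.
have [h1|h1] := leP `|h| 1; last first.
  have h2 : `|h| <= `|h| ^+ 2 by rewrite expr2 ler_peMr// ltW.
  rewrite -(real_normK (num_real h)) (le_trans (ler_normD _ _))// normrM.
  have := cosD_lip a h; have := sin_max a; have := normr_ge0 h => h0 s1 c1.
  have : `|h| * `|sin a| <= `|h| by rewrite ler_piMr.
  by lra.
have -> : cos (a + h) - cos a + h * sin a = - (cos a * (1 - cos h)) - sin a * (sin h - h).
  by rewrite cosD; ring.
rewrite (le_trans (ler_normB _ _))// normrN !normrM.
have /andP[c0 c1] := cos_bound h.
have s3 := sin_taylor h.
have : `|cos a| * `|1 - cos h| <= h ^+ 2 / 2.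
  by rewrite (ger0_norm c0) (le_trans _ c1)// ler_piMl// cos_max.
have : `|sin a| * `|sin h - h| <= h ^+ 2 / 6.
  apply: le_trans (_ : `|sin h - h| <= _); first by rewrite ler_piMl// sin_max.
  apply: le_trans s3 _; rewrite ler_wpM2r// exprS -(real_normK (num_real h)).
  by rewrite ler_piMl// exprn_ge0.
by have := sqr_ge0 h; lra.
Qed.

Lemma cosD_taylor2 a h : `|cos (a + h) - cos a + h * sin a + h ^+ 2 / 2 * cos a| <= 2 * `|h| ^+ 3.
Proof.
have -> : cos (a + h) - cos a + h * sin a + h ^+ 2 / 2 * cos a =
  cos a * (cos h - 1 + h ^+ 2 / 2) - sin a * (sin h - h) by rewrite cosD; field.
rewrite (le_trans (ler_normB _ _))// !normrM.
have : `|cos a| * `|cos h - 1 + h ^+ 2 / 2| <= `|h| ^+ 3.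
  by apply: le_trans (cos_taylor h); rewrite ler_piMl// cos_max.
have : `|sin a| * `|sin h - h| <= `|h| ^+ 3 / 6.
  by apply: le_trans (sin_taylor h); rewrite ler_piMl// sin_max.
by have : 0 <= `|h| ^+ 3 by []; lra.
Qed.

Lemma expRN_lip x y : 0 <= x -> 0 <= y -> `|expR (- x) - expR (- y)| <= `|x - y|.
Proof.
wlog xy : x y / x <= y => [H|] x0 y0.
  by have [/H->//|/ltW/H] := leP x y; rewrite distrC (distrC x); exact.
rewrite ger0_norm; last by rewrite subr_ge0 ler_expR lerN2.
rewrite distrC ger0_norm ?subr_ge0//.
have -> : - y = - x - (y - x) by ring.
rewrite expRD -[X in X - _]mulr1 -mulrBr.
have := expR_ge1Dx (- (y - x)); have := expR_gt0 (- x).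
have : expR (- x) <= 1 by rewrite expR_le1 oppr_le0.
set e := expR (- x); set e' := expR _ => e1 e0 H.
apply: (@le_trans _ _ (e * (y - x))); first by rewrite ler_pM2l//; lra.
by rewrite ler_piMl// subr_ge0.
Qed.

Lemma expRN_taylor x : 0 <= x -> `|expR (- x) - 1 + x| <= x ^+ 2.
Proof.
move=> x0; have := expR_ge1Dx (- x) => H1.
have H2 : expR (- x) <= (1 + x)^-1.
  by rewrite expRN lef_pV2 ?posrE ?expR_gt0 ?expR_ge1Dx//; lra.
rewrite ger0_norm; last by lra.
suff : (1 + x)^-1 <= 1 - x + x ^+ 2 by lra.
rewrite -div1r ler_pdivrMr; last by lra.
have -> : (1 - x + x ^+ 2) * (1 + x) = 1 + x ^+ 3 by ring.
by rewrite lerDl exprn_ge0.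
Qed.

End TaylorBounds.

Lemma cvg_rate (R : realType) (u : nat -> R) (l C : R) :
  (forall n, `|u n - l| <= C * n.+1%:R^-1) -> u @ \oo --> l.
Proof.
move=> H; apply/cvgrPdist_le => e e0.
have : (fun n : nat => `|C| * n.+1%:R^-1) @ \oo --> (0 : R).
  rewrite -(mulr0 `|C|); apply: cvgMl_tmp.
  by move: (@cvg_invn R); rewrite -cvg_shiftS.
move=> /cvgr0_norm_le/(_ e e0); apply: filterS => n Hn.
rewrite distrC (le_trans (H n))// (le_trans _ Hn)// normrM normr_id.
by rewrite (ger0_norm (_ : 0 <= n.+1%:R^-1)) ?invr_ge0// ler_wpM2r ?invr_ge0// ler_norm.
Qed.

(** * Laws determined by characteristic functions *)

Section CharacteristicFunction.
Variable R : realType.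
Notation RN := {ptws nat -> R}.
Notation mR := (measurableTypeR R).

(** The line is embedded in R^infty as coordinate 0, where [trig_approx] applies; on it a
    trigonometric polynomial keeps only the frequencies of that coordinate, and its integrals agree
    by hypothesis. *)
Lemma cf_unique_Rintegral (mu1 mu2 : probability mR R) :
  (forall t b : R, \int[mu1]_x cos (t * x + b) = \int[mu2]_x cos (t * x + b)) ->
  forall g : R -> R, continuous g -> (exists B, forall x, `|g x| <= B) ->
  \int[mu1]_x g x = \int[mu2]_x g x.
Proof.
move=> Ecf g cg [B gB].
have B0 : 0 <= B := le_trans (normr_ge0 _) (gB 0).
have mid : measurable_fun setT (fun x : mR => x : R) by [].
apply/eqP; rewrite -subr_eq0 -normr_le0; apply/ler_addgt0Pr => e e0; rewrite add0r.
have F (z : R) : z <= e / 4 -> e / 4 + z + (e / 4 + z) <= e by move=> ?; lra.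
pose e1 := e / (8 * (B + 1)).
have B1 : 0 < B + 1 by rewrite ltr_wpDl.
have e10 : 0 < e1 by rewrite divr_gt0// mulr_gt0.
have Be1 : 2 * B * e1 <= e / 4.
  have -> : e / 4 = 2 * (B + 1) * e1 by rewrite /e1; field; rewrite gt_eqF.
  by rewrite ler_wpM2r ?(ltW e10)// ler_wpM2l// lerDl.
have [M1 M1p HM1] := tight_fun mu1 mid e10.
have [M2 M2p HM2] := tight_fun mu2 mid e10.
pose M := (maxn M1 M2)%:R : R.
have Mp (k : nat) : 0 < (fun=> M) k by rewrite /M ltr0n leq_max M1p.
have cg' : continuous (fun x : RN => g (x 0%N)).
  move=> x; apply: (@continuous_comp RN R R (fun x : RN => x 0%N) g x); [exact: continuous_coord|exact: cg].
have e40 : 0 < e / 4 by rewrite divr_gt0.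
have [m [T [trT TB HT]]] := trig_approx cg' (fun x => gB (x 0%N)) Mp e40.
pose iota (y : R) : nat -> R := fun k => if k == 0%N then y else 0.
have [s Ts] := trT.
have TE y : T (iota y) = \sum_(e <- s) e.1.1 * cos ((if m is 0 then 0 else e.1.2 0%N) * y + e.2).
  rewrite Ts; apply: eq_bigr => -[[c t] b] _ /=; congr (_ * cos (_ + _)).
  case: m {trT HT Ts} => [|m]; first by rewrite big_ord0 mul0r.
  by rewrite big_ord_recl /iota /= big1 ?addr0// => i _; rewrite mulr0.
have mcos t b : measurable_fun setT (fun y : mR => cos (t * y + b) : R).
  by apply: continuous_measurable_fun; exact: continuous_cos_affine.
have mT : measurable_fun setT (fun y : mR => T (iota y)).
  rewrite (_ : (fun y => _) = fun y => \sum_(e <- s) e.1.1 * cos ((if m is 0 then 0 else e.1.2 0%N) * y + e.2)); last first.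
    by apply/funext => y; exact: TE.
  by apply: measurable_sum => e'; apply: measurable_funM => //; exact: mcos.
have intT (mu : probability mR R) : \int[mu]_y T (iota y) =
    \sum_(e <- s) e.1.1 * \int[mu]_y cos ((if m is 0 then 0 else e.1.2 0%N) * y + e.2).
  under eq_Rintegral do rewrite TE.
  elim: (s) => [|e' s' IH].
    by rewrite big_nil; under eq_Rintegral do rewrite big_nil; rewrite cst_Rintegral_prob.
  rewrite big_cons -IH; under eq_Rintegral do rewrite big_cons.
  rewrite RintegralD//.
  - rewrite RintegralZl//; apply: bounded_integrable; first exact: mcos.
    by exists 1 => w; exact: cos_max.
  - apply: bounded_integrable; first by apply: measurable_funM => //; exact: mcos.
    by exists `|e'.1.1| => w; rewrite normrM ler_piMr// cos_max.
  - apply: bounded_integrable.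
      by apply: measurable_sum => e''; apply: measurable_funM => //; exact: mcos.
    exists (\sum_(e <- s') `|e.1.1|) => w; apply: le_trans (ler_norm_sum _ _ _) _.
    by apply: ler_sum => e'' _; rewrite normrM ler_piMr// cos_max.
have mg : measurable_fun setT (g : mR -> R) by exact: continuous_measurable_fun.
have D (mu : probability mR R) (N : nat) : (N <= maxn M1 M2)%N ->
    (mu [set w : mR | (N%:R < `|(w : R)|)%R] <= e1%:E)%E ->
    `|\int[mu]_x g x - \int[mu]_x T (iota x)| <= e / 4 + 2 * B * e1.
  move=> NM HN.
  have mA : measurable [set w : mR | (N%:R < `|(w : R)|)%R].
    rewrite (_ : [set w : mR | _] = (fun x : mR => `|(x : R)|) @^-1` `]N%:R, +oo[%classic); last first.
      by apply/seteqP; split => w /=; rewrite in_itv/= andbT.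
    by rewrite -[X in measurable X]setTI; apply: measurableT_comp.
  apply: (Rintegral_dist_le (A := [set w : mR | (N%:R < `|(w : R)|)%R])) => //; first exact: ltW.
  move=> w /= /negP; rewrite -leNgt => wN; rewrite -[w in g w]/(iota w 0%N).
  apply: HT => k; rewrite /iota; case: eqP => _; last by rewrite normr0 /M.
  by rewrite (le_trans wN)// /M ler_nat.
have D1 := D mu1 M1 (leq_maxl _ _) HM1.
have D2 := D mu2 M2 (leq_maxr _ _) HM2.
have E12 : \int[mu1]_x T (iota x) = \int[mu2]_x T (iota x).
  by rewrite !intT; apply: eq_bigr => e' _; rewrite Ecf.
rewrite -E12 distrC in D2.
rewrite -(subrKA (\int[mu1]_x T (iota x)) (\int[mu1]_x g x)) (le_trans (ler_normD _ _))//.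
exact: le_trans (lerD D1 D2) (F _ Be1).
Qed.

Lemma cf_unique (mu1 mu2 : probability mR R) :
  (forall t b : R, \int[mu1]_x cos (t * x + b) = \int[mu2]_x cos (t * x + b)) ->
  forall A, measurable A -> mu1 A = mu2 A.
Proof.
move=> Ecf; apply: measure_unique_rays => [x|x]; last first.
  apply: le_lt_trans (ltry 1); apply: probability_le1; exact: measurable_itv.
have ramp (mu : probability mR R) :
    (fun n : nat => \int[mu]_y clip (n%:R * (x - y) + 1)) @ \oo --> \int[mu]_y (\1_(`]-oo, x]%classic) y : R).
  apply: (@cvg_Rintegral_dominated _ _ _ mu _ _ (fun=> 1)) => //.
  - by move=> n; apply: lip1_measurable (lip1_ramp x n).
  - by move=> y; exact: cvg_ramp.
  - by apply: bounded_integrable => //; exists 1 => _; rewrite normr1.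
  - by move=> n y; rewrite ger0_norm ?clip_ge0 ?clip_le1.
have E : \int[mu1]_y (\1_(`]-oo, x]%classic) y : R) = \int[mu2]_y (\1_(`]-oo, x]%classic) y : R).
  apply: (cvg_unique _ (ramp mu1)) => //.
  rewrite (_ : (fun n : nat => _) = (fun n : nat => \int[mu2]_y clip (n%:R * (x - y) + 1))); first exact: ramp.
  apply/funext => n; apply: cf_unique_Rintegral => //.
    by apply: lip1_continuous (lip1_ramp x n).
  by exists 1 => y; rewrite ger0_norm ?clip_ge0 ?clip_le1.
move: E; rewrite /Rintegral !integral_indic//; [|exact: measurable_itv..].
rewrite !setIT => E.
have f1 := fin_num_measure mu1 _ (measurable_itv `]-oo, x]).
have f2 := fin_num_measure mu2 _ (measurable_itv `]-oo, x]).
exact: etrans (esym (fineK f1)) (etrans (congr1 EFin E) (fineK f2)).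
Qed.

(** Both cases follow from uniqueness; for [q = 0] the transform is the constant [cos b], that of
    the point mass at 0. *)
Lemma gauss_cf_law (rho : probability mR R) (q : R) : 0 <= q ->
  (forall t b : R, \int[rho]_x cos (t * x + b) = cos b * expR (- (t ^+ 2 * q / 2))) ->
  forall A, measurable A ->
  rho A = if Num.sqrt q == 0 then \d_(0 : R) A else normal_prob 0 (Num.sqrt q) A.
Proof.
move=> q0 cf A mA; case: eqVneq => [sq0|sq0].
  apply: (cf_unique (mu2 := (\d_(0 : mR)) : probability mR R)) => // t b.
  rewrite cf; have -> : q = 0 by apply/eqP; rewrite eq_le q0 andbT -sqrtr_eq0 sq0.
  rewrite mulr0 mul0r oppr0 expR0 mulr1 /Rintegral integral_dirac//; last first.
    apply/measurable_EFinP; apply: continuous_measurable_fun; exact: continuous_cos_affine.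
  by rewrite diracT mul1e /= mulr0 add0r.
apply: (cf_unique (mu2 := normal_prob 0 (Num.sqrt q) : probability mR R)) => // t b.
apply: etrans (cf t b) _; apply/esym; apply: etrans (normal_prob_cf t b sq0) _.
by rewrite sqr_sqrtr// (mulrC q).
Qed.

End CharacteristicFunction.

(** * Moments read off a Gaussian characteristic function *)

Section GaussianMoments.
Variable R : realType.
Notation RN := {ptws nat -> R}.
Variables (d : measure_display) (T : measurableType d) (mu : probability T R) (Y : T -> R) (q : R).
Hypothesis mY : measurable_fun setT Y.
Hypothesis cf : forall t b : R, \int[mu]_x cos (t * Y x + b) = cos b * expR (- (t ^+ 2 * q / 2)).
Hypothesis q0 : 0 <= q.

(** A second difference quotient of the characteristic function at 0: it stays below [Y x ^+ 2],
    converges to it, and its mean is explicit. No integrability of [Y] is presupposed. *)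
Let h (n : nat) (x : T) : R := 2 * n.+1%:R ^+ 2 * (1 - cos (n.+1%:R^-1 * Y x)).

Let mcos t b : measurable_fun setT (fun x => cos (t * Y x + b)).
Proof.
apply: (@measurableT_comp _ _ _ _ R R (@cos R)).
  by apply: continuous_measurable_fun; exact: continuous_cos.
by apply: measurable_funD => //; exact: measurable_funM.
Qed.

Let mh n : measurable_fun setT (h n).
Proof.
apply: measurable_funM => //; apply: measurable_funB => //.
have := mcos n.+1%:R^-1 0.
by under eq_fun do rewrite addr0.
Qed.

Let h0 n x : 0 <= h n x.
Proof. by rewrite /h mulr_ge0// subr_ge0 cos_le1. Qed.

Let hY n x : h n x <= Y x ^+ 2.
Proof.
have /andP[_ H] := cos_bound (n.+1%:R^-1 * Y x).
rewrite /h (le_trans (ler_wpM2l _ H))//.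
by rewrite exprMn exprVn le_eqVlt; apply/orP; left; apply/eqP; field.
Qed.

Let cvg_h x : h ^~ x @ \oo --> Y x ^+ 2.
Proof.
have B n : Y x ^+ 2 - `|Y x| ^+ 3 * 2 * n.+1%:R^-1 <= h n x <= Y x ^+ 2.
  rewrite hY andbT.
  have := cos_taylor (n.+1%:R^-1 * Y x); rewrite ler_norml => /andP[_].
  rewrite normrM exprMn -lerBrDr; set c := cos _.
  rewrite gtr0_norm ?invr_gt0// /h -/c => H.
  have N0 : 0 < (n.+1%:R : R) by [].
  have : 0 <= 2 * n.+1%:R ^+ 2 * (n.+1%:R^-1 ^+ 3 * `|Y x| ^+ 3 - (n.+1%:R^-1 * Y x) ^+ 2 / 2 - (c - 1)) :> R.
    by apply: mulr_ge0 => //; rewrite subr_ge0; move: H; rewrite !exprMn.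
  have -> : 2 * n.+1%:R ^+ 2 * (n.+1%:R^-1 ^+ 3 * `|Y x| ^+ 3 - (n.+1%:R^-1 * Y x) ^+ 2 / 2 - (c - 1)) =
     2 * n.+1%:R ^+ 2 * (1 - c) - (Y x ^+ 2 - `|Y x| ^+ 3 * 2 * n.+1%:R^-1) by field.
  by rewrite subr_ge0.
apply: (cvg_rate (C := `|Y x| ^+ 3 * 2)) => n; have /andP[B1 B2] := B n.
have : 0 <= `|Y x| ^+ 3 * 2 * n.+1%:R^-1 by rewrite mulr_ge0 ?mulr_ge0 ?exprn_ge0 ?invr_ge0.
by move=> c0; rewrite ler_distl B1 (le_trans B2)// lerDl.
Qed.

Let int_h n : \int[mu]_x h n x = 2 * n.+1%:R ^+ 2 * (1 - expR (- (n.+1%:R^-1 ^+ 2 * q / 2))).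
Proof.
have := cf n.+1%:R^-1 0; rewrite cos0 mul1r => <-.
rewrite /h RintegralZl//; last first.
  apply: bounded_integrable.
    by apply: measurable_funB => //; under eq_fun do rewrite -(addr0 (_ * Y _)); exact: mcos.
  by exists 2 => x; have := cos_max (n.+1%:R^-1 * Y x); rewrite !ler_norml => /andP[? ?]; apply/andP; split; lra.
rewrite RintegralB//.
- rewrite cst_Rintegral_prob; congr (_ * (_ - _)).
  by apply: eq_Rintegral => x _; rewrite addr0.
- by apply: bounded_integrable => //; exists 1 => _; rewrite normr1.
- apply: bounded_integrable; first by under eq_fun do rewrite -(addr0 (_ * Y _)); exact: mcos.
  by exists 1 => x; exact: cos_max.
Qed.

Let int_hq n : 0 <= \int[mu]_x h n x <= q.
Proof.
apply/andP; split; first by apply: Rintegral_ge0 => // x _.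
rewrite int_h; set e := n.+1%:R^-1 ^+ 2 * q / 2.
have : 1 - expR (- e) <= e by have := expR_ge1Dx (- e); lra.
move=> /(ler_wpM2l (_ : 0 <= 2 * n.+1%:R ^+ 2)) H; apply: le_trans (H _) _ => //.
by rewrite le_eqVlt; apply/orP; left; apply/eqP; rewrite /e; field.
Qed.

Let cvg_int_h : (fun n => \int[mu]_x h n x) @ \oo --> q.
Proof.
have B n : q - q ^+ 2 / 2 * n.+1%:R^-1 <= \int[mu]_x h n x <= q.
  have /andP[_ ->] := int_hq n; rewrite andbT int_h.
  set u : R := n.+1%:R^-1; have u0 : 0 < u by rewrite invr_gt0.
  have u1 : u <= 1 by rewrite invf_le1// ler1n.
  have -> : n.+1%:R = u^-1 :> R by rewrite invrK.
  have e0 : 0 <= u ^+ 2 * q / 2 by rewrite divr_ge0// mulr_ge0// sqr_ge0.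
  have := expRN_taylor e0; rewrite ler_norml => /andP[_].
  set e := expR _ => H.
  have : 0 <= 2 * u^-1 ^+ 2 * ((u ^+ 2 * q / 2) ^+ 2 - (e - 1 + u ^+ 2 * q / 2)).
    by apply: mulr_ge0; [rewrite mulr_ge0 ?sqr_ge0|rewrite subr_ge0].
  have -> : 2 * u^-1 ^+ 2 * ((u ^+ 2 * q / 2) ^+ 2 - (e - 1 + u ^+ 2 * q / 2)) =
     2 * u^-1 ^+ 2 * (1 - e) - (q - q ^+ 2 / 2 * u ^+ 2) by field; rewrite gt_eqF.
  rewrite subr_ge0; apply: le_trans; rewrite lerD2l lerN2 ler_wpM2l ?divr_ge0 ?sqr_ge0//.
  by rewrite expr2 ler_piMr// ltW.
apply: (cvg_rate (C := q ^+ 2 / 2)) => n; have /andP[B1 B2] := B n.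
have : 0 <= q ^+ 2 / 2 * n.+1%:R^-1 by rewrite mulr_ge0 ?divr_ge0 ?sqr_ge0 ?invr_ge0.
by move=> c0; rewrite ler_distl B1 (le_trans B2)// lerDl.
Qed.

Let ih n : mu.-integrable setT (EFin \o h n).
Proof.
apply: bounded_integrable => //; exists (4 * n.+1%:R ^+ 2) => x; rewrite ger0_norm// /h.
have := cos_geN1 (n.+1%:R^-1 * Y x); have : 0 <= n.+1%:R ^+ 2 :> R by [].
by move=> n0 c0; nra.
Qed.

(** Fatou along [h]. Once [Y x ^+ 2] is integrable it dominates [h], and the second moment is the
    limit of the means. *)
Lemma gauss_sqr_integrable : mu.-integrable setT (EFin \o (fun x => Y x ^+ 2)).
Proof.
have mY2 : measurable_fun setT (EFin \o (fun x => Y x ^+ 2)).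
  by apply/measurable_EFinP; exact: measurable_funX.
apply/integrableP; split => //.
under eq_integral => x _ do rewrite /= ger0_norm ?sqr_ge0//.
apply: (@le_lt_trans _ _ q%:E); last exact: ltry.
have EF (u : nat -> R) l : u @ \oo --> l -> (fun n => (u n)%:E) @ \oo --> l%:E.
  by move=> ul; apply/fine_cvgP; split => //; exact: nearW.
have -> : (\int[mu]_x (Y x ^+ 2)%:E = \int[mu]_x (limn_einf (fun n => (h n x)%:E)))%E.
  by apply: eq_integral => x _; rewrite (cvg_limn_einf_sup (EF _ _ (@cvg_h x))).1.
apply: le_trans (fatou _ _ _ _) _ => //.
- by move=> n; apply/measurable_EFinP.
- by move=> n x _; rewrite lee_fin.
under eq_fun => n do rewrite -(fineK (integrable_fin_num measurableT (ih n))).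
by rewrite (cvg_limn_einf_sup (EF _ _ cvg_int_h)).1.
Qed.

Lemma gauss_sqr_mean : \int[mu]_x (Y x ^+ 2) = q.
Proof.
apply: (cvg_unique _ _ cvg_int_h) => //.
apply: (@cvg_Rintegral_dominated _ _ _ mu _ _ (fun x => Y x ^+ 2)) => //.
- exact: measurable_funX.
- exact: gauss_sqr_integrable.
- by move=> n x; rewrite ger0_norm.
Qed.

Lemma gauss_integrable : mu.-integrable setT (EFin \o Y).
Proof.
have i1 : mu.-integrable setT (EFin \o (fun x => 1 + Y x ^+ 2)).
  have i0 : mu.-integrable setT (EFin \o cst 1).
    by apply: bounded_integrable => //; exists 1 => x; rewrite normr1.
  exact: (integrableD measurableT i0 gauss_sqr_integrable).
apply: (le_integrable measurableT _ _ i1); first exact/measurable_EFinP.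
move=> x _; rewrite /= lee_fin (ger0_norm (_ : 0 <= 1 + _)) ?addr_ge0 ?sqr_ge0//.
rewrite -(real_normK (num_real (Y x))).
by have := sqr_ge0 (`|Y x| - 1); have := normr_ge0 (Y x); set y := `|Y x| => y0; nra.
Qed.

(** The sine of a small multiple of [Y] is a cosine with phase [- pi / 2], so its mean is 0;
    rescaled, it converges to [Y] and is dominated by [|Y|]. *)
Lemma gauss_mean : \int[mu]_x Y x = 0.
Proof.
pose s n x := n.+1%:R * sin (n.+1%:R^-1 * Y x).
have sE n x : s n x = n.+1%:R * cos (n.+1%:R^-1 * Y x - pi / 2).
  by rewrite /s cosB cos_pihalf sin_pihalf mulr0 add0r mulr1.
have ms n : measurable_fun setT (s n).
  by rewrite (_ : s n = fun x => n.+1%:R * cos (n.+1%:R^-1 * Y x - pi / 2));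
    [apply: measurable_funM => //; exact: mcos|apply/funext => x; exact: sE].
have s0 n : \int[mu]_x s n x = 0.
  under eq_Rintegral do rewrite sE.
  rewrite RintegralZl//; last first.
    by apply: bounded_integrable; [exact: mcos|exists 1 => x; exact: cos_max].
  by rewrite cf cosN cos_pihalf mul0r mulr0.
have cs x : s ^~ x @ \oo --> Y x.
  apply: (cvg_rate (C := `|Y x| ^+ 3 / 6)) => n; rewrite /s.
  have u0 : 0 < n.+1%:R^-1 :> R by rewrite invr_gt0.
  have u1 : n.+1%:R^-1 <= 1 :> R by rewrite invf_le1// ler1n.
  have uE : n.+1%:R = (n.+1%:R^-1)^-1 :> R by rewrite invrK.
  move: u0 u1 uE; set u : R := n.+1%:R^-1 => u0 u1 ->.
  have -> : u^-1 * sin (u * Y x) - Y x = u^-1 * (sin (u * Y x) - u * Y x) by field; rewrite gt_eqF.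
  rewrite normrM (gtr0_norm (_ : 0 < u^-1)) ?invr_gt0//.
  rewrite mulrC ler_pdivrMr// (le_trans (sin_taylor _))// normrM (gtr0_norm u0) exprMn.
  have y3 : 0 <= `|Y x| ^+ 3 by rewrite exprn_ge0.
  have : u ^+ 3 <= u * u by rewrite exprS ler_wpM2l ?(ltW u0)// expr2 ler_piMr// ltW.
  by move: y3; set y := `|Y x| ^+ 3; nra.
have H : (fun n => \int[mu]_x s n x) @ \oo --> \int[mu]_x Y x.
  apply: (@cvg_Rintegral_dominated _ _ _ mu _ _ (fun x => `|Y x|)) => //.
  - by have := integrable_norm gauss_integrable.
  - move=> n x; rewrite /s normrM ger0_norm// -ler_pdivlMl//.
    by rewrite (le_trans (sin_bound _))// normrM gtr0_norm ?invr_gt0.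
apply: (cvg_unique _ H) => //.
by rewrite (_ : (fun n => _) = fun=> 0); [exact: cvg_cst|apply/funext => n; exact: s0].
Qed.

End GaussianMoments.

Section GaussianVector.
Variable R : realType.
Notation RN := {ptws nat -> R}.

Lemma psd0 : psd (fun _ _ => 0 : R).
Proof. by split => // m t; apply: sumr_ge0 => i _; apply: sumr_ge0 => j _; rewrite !mul0r. Qed.

(** Total in [C]: an array that is not positive semidefinite gets the law of the zero array. The
    limit law can then be a function of [f] with no proof argument. *)
Definition gauss_measure (C : nat -> nat -> R) : probability (borel RN) R :=
  match pselect (psd C) with
  | left p => sval (cid (exists_gauss_measure p))
  | right _ => sval (cid (exists_gauss_measure psd0))
  end.

Lemma gauss_measure_cf C m (t : nat -> R) b : psd C ->
  \int[gauss_measure C]_x cos (\sum_(j < m) t j * (x : RN) j + b) =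
  cos b * expR (- (qform C m t / 2)).
Proof.
by rewrite /gauss_measure => pC; case: pselect => // p; exact: (svalP (cid (exists_gauss_measure p))).
Qed.

Definition to_row k (x : nat -> R) : 'rV[R]_k.+1 := \row_i x i.

Lemma continuous_to_row k : continuous (to_row k : RN -> 'rV[R]_k.+1).
Proof.
move=> x A [P PN sA]; apply: (@filterS _ (nbhs x) _ (fun y : RN => forall j, P 0 j (y j))).
  by move=> y Py; apply: sA => i j; rewrite mxE ord1.
apply: (@filter_forall _ _ (fun j (y : RN) => P 0 j (y j)) (nbhs x)) => j.
have PN' : nbhs (x j) (P 0 j) by have := PN 0 j; rewrite mxE.
exact: (@continuous_coord R j x _ PN').
Qed.

Definition gauss_row k (C : nat -> nat -> R) : probability (borel 'rV[R]_k.+1) R :=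
  law (gauss_measure C) (continuous_borel_map (@continuous_to_row k)).

Lemma gauss_row_integral k C (g : 'rV[R]_k.+1 -> R) : continuous g ->
  (exists B, forall x, `|g x| <= B) ->
  \int[gauss_row k C]_x g x = \int[gauss_measure C]_x g (to_row k x).
Proof.
move=> cg bg; apply: (Rintegral_law (gauss_measure C) _ (h := g : borel _ -> R)) => //.
exact: (continuous_borel_fun (S := 'rV[R]_k.+1)).
Qed.

Lemma continuous_row_lin k (t : nat -> R) :
  continuous (fun x : 'rV[R]_k.+1 => \sum_(j < k.+1) t j * x 0 j).
Proof.
move=> x.
have H (s : seq 'I_k.+1) : (fun z : 'rV[R]_k.+1 => \sum_(j <- s) t j * z 0 j) @ nbhs x --> \sum_(j <- s) t j * x 0 j.
  elim: s => [|j s IH].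
    rewrite big_nil (_ : (fun z => _) = fun=> 0); first exact: cvg_cst.
    by apply/funext => z; rewrite big_nil.
  rewrite big_cons (_ : (fun z => _) = fun z : 'rV[R]_k.+1 => t j * z 0 j + \sum_(j <- s) t j * z 0 j).
    by apply: cvgD => //; apply: cvgMl_tmp; exact: coord_continuous.
  by apply/funext => z; rewrite big_cons.
exact: H.
Qed.

Lemma measurable_row_lin k (t : nat -> R) :
  measurable_fun setT (fun x : borel 'rV[R]_k.+1 => \sum_(j < k.+1) t j * (x : 'rV[R]_k.+1) 0 j).
Proof. by apply: (continuous_borel_fun (S := 'rV[R]_k.+1)); exact: continuous_row_lin. Qed.

Lemma qformZ C m (t : nat -> R) s : qform C m (fun j => s * t j) = s ^+ 2 * qform C m t.
Proof.
rewrite /qform mulr_sumr; apply: eq_bigr => i _; rewrite mulr_sumr; apply: eq_bigr => j _; ring.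
Qed.

Lemma gauss_row_cf k C (t : nat -> R) s b : psd C ->
  \int[gauss_row k C]_x cos (s * (\sum_(j < k.+1) t j * (x : 'rV[R]_k.+1) 0 j) + b) =
  cos b * expR (- (s ^+ 2 * qform C k.+1 t / 2)).
Proof.
move=> pC.
rewrite (@gauss_row_integral k C (fun x => cos (s * (\sum_(j < k.+1) t j * x 0 j) + b))); last 2 first.
- move=> x; apply: (@continuous_comp _ _ _ (fun x : 'rV[R]_k.+1 => \sum_(j < k.+1) t j * x 0 j) (fun y => cos (s * y + b))).
    exact: continuous_row_lin.
  exact: continuous_cos_affine.
- by exists 1 => x; exact: cos_max.
rewrite -qformZ -gauss_measure_cf//; apply: eq_Rintegral => x _.
congr (cos (_ + _)); rewrite mulr_sumr; apply: eq_bigr => j _.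
by rewrite mxE mulrA.
Qed.

Lemma centered_normal_gauss_row k C : psd C -> centered_normal (gauss_row k C).
Proof.
move=> pC a; pose t j := if (j < k.+1)%N then a (inord j) 0 else 0.
have q0 : 0 <= qform C k.+1 t by have [_] := pC; exact.
exists (Num.sqrt (qform C k.+1 t)); first exact: sqrtr_ge0.
move=> B mB.
have mL : @measurable_fun _ _ (borel 'rV[R]_k.+1) (measurableTypeR R) setT
    (fun x => \sum_(j < k.+1) t j * (x : 'rV[R]_k.+1) 0 j) := @measurable_row_lin k t.
pose rho : probability (measurableTypeR R) R := law (gauss_row k C) mL.
have := @gauss_cf_law R rho _ q0 _ B mB.
rewrite /rho; move=> <-.
  rewrite lawE; congr (gauss_row k C _); rewrite /preimage; apply/funext => x /=; congr B.
  by rewrite mxE; apply: eq_bigr => j _; rewrite /t ltn_ord inord_val mulrC.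
move=> s b; rewrite -gauss_row_cf//.
rewrite (Rintegral_law (gauss_row k C) mL (h := fun y : measurableTypeR R => cos (s * y + b)))//.
  by apply: continuous_measurable_fun; exact: continuous_cos_affine.
by exists 1 => x; exact: cos_max.
Qed.

(** Polarisation: the product of two coordinates is a combination of squares of linear forms, whose
    means come from [gauss_sqr_mean]. For [i = j] the sum is twice the coordinate and the same
    formula holds. *)
Lemma gauss_row_covariance k C i j : psd C ->
  covariance_mx (gauss_row k C) i j = C i j.
Proof.
move=> pC; pose e (i : nat) (l : nat) : R := (l == i)%:R.
have Xe (i' : 'I_k.+1) (x : 'rV[R]_k.+1) : \sum_(l < k.+1) e i' l * x 0 l = x 0 i'.
  rewrite (bigD1 i')//= /e eqxx mul1r big1 ?addr0// => l li.
  by rewrite (_ : (l == i' :> nat) = false) ?mul0r//; apply/negbTE.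
pose e2 (l : nat) : R := e i l + 1 * (l == j)%:R.
have Xe2 (x : 'rV[R]_k.+1) : \sum_(l < k.+1) e2 l * x 0 l = x 0 i + x 0 j.
  rewrite -(Xe i) -(Xe j) -big_split/=; apply: eq_bigr => l _; rewrite /e2 /e; ring.
have mX t := measurable_row_lin (k := k) t.
have cX t := fun s b => @gauss_row_cf k C t s b pC.
have q0 t : 0 <= qform C k.+1 t by have [_] := pC; exact.
pose X (i' : 'I_k.+1) (x : borel 'rV[R]_k.+1) := (x : 'rV[R]_k.+1) 0 i'.
have mean (i' : 'I_k.+1) : \int[gauss_row k C]_x X i' x = 0.
  rewrite -[RHS](gauss_mean (mX (e i')) (cX (e i')) (q0 _)).
  by apply: eq_Rintegral => x _; rewrite Xe.
have qe (i' : 'I_k.+1) : qform C k.+1 (e i') = C i' i'.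
  have := @qform_shift R C k.+1 (fun=> 0) i' 1 pC.1 (ltn_ord i').
  rewrite big1 ?mulr0 ?addr0; last by move=> l _; rewrite mulr0.
  rewrite expr1n mul1r [qform C _ (fun=> 0)]big1 ?add0r; last first.
    by move=> l _; rewrite big1// => l' _; rewrite mulr0.
  by under eq_fun do rewrite add0r mul1r.
have qe2 : qform C k.+1 e2 = C i i + 2 * C i j + C j j.
  rewrite /e2 (qform_shift _ _ pC.1 (ltn_ord j)) qe expr1n mul1r mulr1; congr (_ + 2 * _ + _).
  rewrite (bigD1 i)//= /e eqxx mulr1 pC.1 big1 ?addr0// => l li.
  by rewrite (_ : (l == i :> nat) = false) ?mulr0//; apply/negbTE.
have sq (i' : 'I_k.+1) : \int[gauss_row k C]_x (X i' x ^+ 2) = C i' i'.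
  rewrite -qe -(gauss_sqr_mean (mX (e i')) (cX (e i')) (q0 _)).
  by apply: eq_Rintegral => x _; rewrite Xe.
have isq (i' : 'I_k.+1) : (gauss_row k C).-integrable setT (EFin \o (fun x => X i' x ^+ 2)).
  have := gauss_sqr_integrable (mX (e i')) (cX (e i')) (q0 _).
  by congr (integrable _ _ (EFin \o _)); apply/funext => x; rewrite Xe.
have sq2 : \int[gauss_row k C]_x ((X i x + X j x) ^+ 2) = C i i + 2 * C i j + C j j.
  rewrite -qe2 -(gauss_sqr_mean (mX e2) (cX e2) (q0 _)).
  by apply: eq_Rintegral => x _; rewrite Xe2.
have isq2 : (gauss_row k C).-integrable setT (EFin \o (fun x => (X i x + X j x) ^+ 2)).
  have := gauss_sqr_integrable (mX e2) (cX e2) (q0 _).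
  by congr (integrable _ _ (EFin \o _)); apply/funext => x; rewrite Xe2.
rewrite mxE unlock.
rewrite !unlock.
transitivity (\int[gauss_row k C]_x (X i x * X j x)).
  rewrite /Rintegral; congr fine; apply: eq_integral => x _.
  have E (i' : 'I_k.+1) : fine (\int[gauss_row k C]_w ((w : 'rV[R]_k.+1) 0 i')%:E)%E = 0.
    exact: mean.
  rewrite -[LHS]/((((x : 'rV[R]_k.+1) 0 i - fine (\int[gauss_row k C]_w ((w : 'rV[R]_k.+1) 0 i)%:E)%E) *
    ((x : 'rV[R]_k.+1) 0 j - fine (\int[gauss_row k C]_w ((w : 'rV[R]_k.+1) 0 j)%:E)%E))%:E).
  by rewrite !E !subr0.
transitivity (\int[gauss_row k C]_x (2^-1 * (((X i x + X j x) ^+ 2 - X i x ^+ 2) - X j x ^+ 2))).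
  by apply: eq_Rintegral => x _; field.
have i1 : (gauss_row k C).-integrable setT (EFin \o (fun x => (X i x + X j x) ^+ 2 - X i x ^+ 2)).
  exact: (integrableB measurableT isq2 (isq i)).
rewrite RintegralZl//; last exact: (integrableB measurableT i1 (isq j)).
by rewrite RintegralB// RintegralB// sq2 !sq; field.
Qed.

End GaussianVector.

(** * Expectations over attachment histories *)

Section History.
Variables (R : realType) (f : nat -> R).
Hypothesis f_gt0 : forall k, (1 <= k)%N -> 0 < f k.
Implicit Types (h : nat -> nat) (phi psi : (nat -> nat) -> R).

Definition upd h n i : nat -> nat := fun m => if m == n then i else h m.

Definition pa_weight h n : R := \sum_(1 <= j < n.+1) f (deg h j n).

Definition pa_prob h n i : R := f (deg h i n) / pa_weight h n.

Definition pa_step n phi h : R := \sum_(1 <= i < n.+1) pa_prob h n i * phi (upd h n i).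

(* The expectation of a function of the tree at time k + 1. *)
Fixpoint EH k phi : R :=
  if k is k'.+1 then EH k' (pa_step k phi) else phi (fun=> 0%N).

Definition valid k h := forall m, (1 <= m <= k)%N -> (1 <= h m <= m)%N.

Definition past_eq k h h' := forall m, (1 <= m <= k)%N -> h m = h' m.

Lemma f_deg_gt0 h i n : 0 < f (deg h i n).
Proof. exact: f_gt0. Qed.

Lemma pa_weight_gt0 h n : (1 <= n)%N -> 0 < pa_weight h n.
Proof.
move=> n1; rewrite /pa_weight big_nat_recl//.
by apply: ltr_pwDl; [exact: f_deg_gt0|apply: sumr_ge0 => i _; exact: ltW (f_deg_gt0 _ _ _)].
Qed.

Lemma pa_prob_ge0 h n i : 0 <= pa_prob h n i.
Proof.
apply: divr_ge0; first exact: ltW (f_deg_gt0 _ _ _).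
by apply: sumr_ge0 => j _; exact: ltW (f_deg_gt0 _ _ _).
Qed.

Lemma pa_prob_sum h n : (1 <= n)%N -> \sum_(1 <= i < n.+1) pa_prob h n i = 1.
Proof. by move=> n1; rewrite -mulr_suml mulfV// gt_eqF// pa_weight_gt0. Qed.

Lemma upd_valid k h i : valid k h -> (1 <= i <= k.+1)%N -> valid k.+1 (upd h k.+1 i).
Proof.
move=> vh ik m /andP[m1 mk]; rewrite /upd; case: eqP => [->//|/eqP mk'].
by apply: vh; rewrite m1/= -ltnS ltn_neqAle mk'.
Qed.

Lemma EH_le k phi psi : (forall h, valid k h -> phi h <= psi h) -> EH k phi <= EH k psi.
Proof.
elim: k phi psi => [|k IH] phi psi H /=.
  by apply: H => m; rewrite leqn0 => /andP[m1 /eqP m0]; rewrite m0 in m1.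
apply: IH => h vh; rewrite /pa_step big_nat_cond [leRHS]big_nat_cond; apply: ler_sum => i /andP[ik _].
by rewrite ler_wpM2l ?pa_prob_ge0//; apply: H; apply: upd_valid.
Qed.

Lemma EH_eq k phi psi : (forall h, valid k h -> phi h = psi h) -> EH k phi = EH k psi.
Proof.
by move=> H; apply/eqP; rewrite eq_le; apply/andP; split; apply: EH_le => h vh; rewrite H.
Qed.

Lemma EH_expect k : expect_op (EH k).
Proof.
elim: k => [|k [eD eZ eM e1]] /=; first by split.
split=> [phi psi|c phi|phi psi H|c].
- rewrite -eD; congr EH; apply/funext => h; rewrite /pa_step -big_split/=.
  by apply: eq_bigr => i _; rewrite mulrDr.
- rewrite -eZ; congr EH; apply/funext => h; rewrite /pa_step mulr_sumr/=.
  by apply: eq_bigr => i _; rewrite mulrCA.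
- by apply: eM => h; apply: ler_sum => i _; rewrite ler_wpM2l ?pa_prob_ge0.
- rewrite -[RHS]e1; congr EH; apply/funext => h.
  by rewrite /pa_step -mulr_suml pa_prob_sum// mul1r.
Qed.

Lemma eq_deg h h' i k : past_eq k h h' -> deg h i k.+1 = deg h' i k.+1.
Proof.
by move=> hh; congr (1 + _)%N; apply: eq_big_nat => m mk; rewrite hh.
Qed.

(** [EH] peels off the last step, whereas [pa_process] conditions on the past and peels off the
    first one after time [k + 1]. This is the mean in the latter order, from a given history [h]. *)
Fixpoint forward r k phi h : R :=
  if r is r'.+1 then \sum_(1 <= i < k.+2) pa_prob h k.+1 i * forward r' k.+1 phi (upd h k.+1 i)
  else phi h.

Lemma forward_step r k phi h : forward r.+1 k phi h = forward r k (pa_step (k + r).+1 phi) h.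
Proof.
elim: r k h => [|r IH] k h; first by rewrite addn0.
rewrite [LHS]/=; under eq_bigr => i _ do rewrite -[X in _ * X]/(forward r.+1 k.+1 phi _) IH.
by rewrite addSnnS.
Qed.

Lemma EH_forward k phi : EH k phi = forward k 0 phi (fun=> 0%N).
Proof. by elim: k phi => [//|k IH] phi; rewrite forward_step add0n -IH. Qed.

Section Process.
Variables (d : measure_display) (T : measurableType d) (P : probability T R).
Variable c : nat -> {RV P >-> nat}.
Hypothesis pa : pa_process f c.

Lemma measurable_nat2 d' (S : measurableType d') (X Y : T -> nat) (g : nat -> nat -> S) :
  measurable_fun setT X -> measurable_fun setT Y -> measurable_fun setT (fun w => g (X w) (Y w)).
Proof.
move=> mX mY _ B mB; rewrite setTI.
rewrite (_ : _ @^-1` B = \bigcup_a \bigcup_b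
  (if `[< B (g a b) >] then (X @^-1` [set a]) `&` (Y @^-1` [set b]) else set0)); last first.
  apply/seteqP; split => w /=.
    by move=> Bw; exists (X w) => //; exists (Y w) => //; case: asboolP.
  by move=> [a _ [b _]]; case: asboolP => // Bab [/= -> ->].
apply: bigcup_measurable => a _; apply: bigcup_measurable => b _.
case: asboolP => _ //; apply: measurableI.
- by rewrite -[X in measurable X]setTI; exact: mX.
- by rewrite -[X in measurable X]setTI; exact: mY.
Qed.

(** Finite histories are coded by one natural number, so every function of the past, with values in
    any measurable space, is a function of a countably valued variable and hence measurable. *)
Fixpoint hist_code n (w : T) : nat :=
  if n is n'.+1 then pickle (hist_code n' w, c n w) else 0%N.

Fixpoint hist_decode n (x : nat) : nat -> nat :=
  if n is n'.+1 then
    if unpickle x is Some (a, b) then upd (hist_decode n' (a : nat)) n (b : nat) else fun=> 0%N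
  else fun=> 0%N.

Lemma measurable_hist_code n : measurable_fun setT (hist_code n).
Proof.
elim: n => [|n IH] /=; first exact: measurable_cst.
by apply: (measurable_nat2 (fun a b => pickle (a, b) : nat)).
Qed.

Lemma hist_codeK n w : past_eq n (c ^~ w) (hist_decode n (hist_code n w)).
Proof.
elim: n => [|n IH] m /andP[m1 mn] /=; first by move: m1; rewrite (eqP (_ : m == 0%N)) -?leqn0.
rewrite pickleK /upd; case: eqP => [->//|/eqP mn'].
by apply: IH; rewrite m1/= -ltnS ltn_neqAle mn'.
Qed.

Definition past_fun (U : Type) k (phi : (nat -> nat) -> U) := forall h h', past_eq k h h' -> phi h = phi h'.

Lemma measurable_past_fun d' (S : measurableType d') k (phi : (nat -> nat) -> S) :
  past_fun k phi -> measurable_fun setT (fun w => phi (c ^~ w)).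
Proof.
move=> dphi; rewrite (_ : (fun w => _) = fun w => phi (hist_decode k (hist_code k w))).
  exact: (measurable_nat2 (fun a _ => phi (hist_decode k a)) (measurable_hist_code k) (measurable_hist_code k)).
by apply/funext => w; apply: dphi; exact: hist_codeK.
Qed.

Let A h k := same_past c h k.+1.

Lemma past_indic h k : (\1_(A h k) : T -> R) = fun w => (`[< past_eq k (c ^~ w) h >])%:R.
Proof.
apply/funext => w; rewrite indicE; congr (nat_of_bool _)%:R.
apply/idP/asboolP => [/set_mem H m /andP[m1 mk]|H]; first exact: H.
by apply/mem_set => m m1 mk; apply: H; rewrite m1.
Qed.

Lemma measurable_same_past h k : measurable (A h k).
Proof.
have : measurable_fun setT (fun w => `[< past_eq k (c ^~ w) h >]).
  apply: (@measurable_past_fun _ bool k (fun h' => `[< past_eq k h' h >])) => h1 h2 h12.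
  by apply/asbool_equiv_eq; split => H m mk; rewrite -?H//; have := h12 m mk => ->.
move=> /(_ measurableT [set true] I); rewrite setTI; congr measurable.
apply/seteqP; split => w /=.
  by move=> /asboolP H m m1 mk; apply: H; rewrite m1.
by move=> H; apply/asboolP => m /andP[m1 mk]; exact: H.
Qed.

Lemma same_past_upd h k i : A (upd h k.+1 i) k.+1 = A h k `&` [set w | c k.+1 w = i].
Proof.
apply/seteqP; split => w.
  move=> H; split; last by rewrite /= (H k.+1)// /upd eqxx.
  by move=> m m1 mk; rewrite (H m m1 (leqW mk)) /upd ltn_eqF.
move=> [H ci] m m1; rewrite ltnS leq_eqVlt => /orP[/eqP->|mk]; first by rewrite /upd eqxx.
by rewrite /upd ltn_eqF// H.
Qed.

Lemma prob_indic B : measurable B -> \int[P]_w (\1_B w : R) = fine (P B).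
Proof. by move=> mB; rewrite /Rintegral integral_indic// setIT. Qed.

Variables (phi : (nat -> nat) -> R) (n : nat) (M : R).
Hypothesis dphi : past_fun n phi.
Hypothesis bphi : forall h, `|phi h| <= M.

Let mphi : measurable_fun setT (fun w => phi (c ^~ w)) := measurable_past_fun dphi.

Let I h k : R := \int[P]_w (\1_(A h k) w * phi (c ^~ w)).

Lemma integrable_past_indic B (psi : T -> R) : measurable B -> measurable_fun setT psi ->
  (forall w, `|psi w| <= M) -> P.-integrable setT (EFin \o (fun w => \1_B w * psi w)).
Proof.
move=> mB mpsi bpsi; apply: bounded_integrable.
  by apply: measurable_funM => //; exact: measurable_indic.
by exists M => w; rewrite normrM (le_trans _ (bpsi w))// ler_piMl// indicE normr_nat lern1 leq_b1.
Qed.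

(** [pa_process] prescribes the probabilities of the parents [1, ..., k + 1]; they exhaust the mass
    of the past event, so the event [N] that [c] takes another value is null. *)
Lemma same_past_split h k : exists2 N, measurable N & P N = 0%E /\
  forall w, (\1_(A h k) w : R) = \sum_(1 <= i < k.+2) \1_(A (upd h k.+1 i) k.+1) w + \1_N w.
Proof.
pose N := A h k `&` [set w | ~~ (1 <= c k.+1 w < k.+2)%N].
have mN : measurable N.
  apply: measurableI; first exact: measurable_same_past.
  have /(_ measurableT [set true] Logic.I) := measurable_nat2 (fun a _ => ~~ (1 <= a < k.+2)%N) (measurable_funPT (c k.+1)) (measurable_funPT (c k.+1)).
  by rewrite setTI; congr measurable.
have E w : (\1_(A h k) w : R) = \sum_(1 <= i < k.+2) \1_(A (upd h k.+1 i) k.+1) w + \1_N w.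
  under eq_bigr do rewrite same_past_upd indicI /= .
  rewrite /N indicI /=.
  under eq_bigr => i _ do rewrite [in X in _ * X]indicE.
  rewrite -mulr_sumr -mulrDr; set a := \1_(A h k) w.
  suff -> : \sum_(1 <= i < k.+2) (w \in [set w | c k.+1 w = i])%:R +
     \1_[set w | ~~ (1 <= c k.+1 w < k.+2)%N] w = 1 :> R by rewrite mulr1.
  have EE i : (w \in [set w | c k.+1 w = i]) = (c k.+1 w == i).
    by apply/idP/eqP => [/set_mem//|H]; apply/mem_set.
  under eq_bigr do rewrite EE.
  rewrite indicE (_ : (w \in _) = ~~ (1 <= c k.+1 w < k.+2)%N); last first.
    by apply/idP/idP => [/set_mem//|H]; apply/mem_set.
  case: (boolP (1 <= c k.+1 w < k.+2)%N) => H /=.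
    rewrite addr0 (bigD1_seq (c k.+1 w)) ?iota_uniq ?mem_index_iota//= eqxx.
    by rewrite big1 ?addr0// => i /negbTE; rewrite eq_sym => ->.
  rewrite big_nat_cond big1 ?add0r// => i /andP[ik _]; case: eqP => // ci.
  by move: H; rewrite ci ik.
exists N => //; split => //.
have iA h' k' : P.-integrable setT (EFin \o (\1_(A h' k') : T -> R)).
  apply: bounded_integrable; first by apply: measurable_indic; exact: measurable_same_past.
  by exists 1 => w; rewrite indicE normr_nat lern1 leq_b1.
have iN : P.-integrable setT (EFin \o (\1_N : T -> R)).
  apply: bounded_integrable; first exact: measurable_indic.
  by exists 1 => w; rewrite indicE normr_nat lern1 leq_b1.
have : \int[P]_w (\1_N w : R) = \int[P]_w (\1_(A h k) w : R) - \sum_(1 <= i < k.+2) \int[P]_w (\1_(A (upd h k.+1 i) k.+1) w : R).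
  apply/eqP; rewrite eq_sym subr_eq addrC; apply/eqP.
  have S (s : seq nat) : \int[P]_w (\sum_(i <- s) \1_(A (upd h k.+1 i) k.+1) w : R) =
      \sum_(i <- s) \int[P]_w (\1_(A (upd h k.+1 i) k.+1) w : R) /\
      P.-integrable setT (EFin \o (fun w => (\sum_(i <- s) \1_(A (upd h k.+1 i) k.+1) w : R))).
    elim: s => [|i s [IH1 IH2]].
      split; first by rewrite big_nil; under eq_Rintegral do rewrite big_nil; rewrite cst_Rintegral_prob.
      apply: bounded_integrable; first by under eq_fun do rewrite big_nil; exact: measurable_cst.
      by exists 0 => w; rewrite big_nil normr0.
    split; last first.
      under [fun w => _]funext do rewrite big_cons.
      exact: (integrableD measurableT (iA _ _) IH2).
    rewrite big_cons -IH1; under eq_Rintegral do rewrite big_cons.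
    by rewrite RintegralD//; exact: iA.
  have [S1 S2] := S (index_iota 1 k.+2).
  rewrite -S1 -RintegralD//.
  by apply: eq_Rintegral => w _; exact: E.
rewrite prob_indic// prob_indic; last exact: measurable_same_past.
under eq_big_nat => i /andP[i1 ik].
  rewrite prob_indic; last exact: measurable_same_past.
  rewrite same_past_upd /A (pa h i1 ik) fineM ?fin_num_measure//; last exact: measurable_same_past.
  rewrite [fine _%:E]/= -/(pa_weight h k.+1) -/(pa_prob h k.+1 i).
  over.
rewrite -mulr_sumr pa_prob_sum// mulr1 subrr => H.
by rewrite -(fineK (fin_num_measure P _ mN)) H.
Qed.

Lemma I_split h k : I h k = \sum_(1 <= i < k.+2) I (upd h k.+1 i) k.+1.
Proof.
have [N mN [PN E]] := same_past_split h k.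
have iA h' k' := integrable_past_indic (measurable_same_past h' k') mphi (fun w => bphi _).
have S (s : seq nat) : \int[P]_w (\sum_(i <- s) \1_(A (upd h k.+1 i) k.+1) w * phi (c ^~ w)) =
      \sum_(i <- s) I (upd h k.+1 i) k.+1 /\
      P.-integrable setT (EFin \o (fun w => (\sum_(i <- s) \1_(A (upd h k.+1 i) k.+1) w * phi (c ^~ w)))).
  elim: s => [|i s [IH1 IH2]].
    split; first by rewrite big_nil; under eq_Rintegral do rewrite big_nil; rewrite cst_Rintegral_prob.
    apply: bounded_integrable; first by under eq_fun do rewrite big_nil; exact: measurable_cst.
    by exists 0 => w; rewrite big_nil normr0.
  split; last first.
    under [fun w => _]funext do rewrite big_cons.
    exact: (integrableD measurableT (iA _ _) IH2).
  rewrite big_cons -IH1; under eq_Rintegral do rewrite big_cons.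
  by rewrite RintegralD//; exact: iA.
have [S1 S2] := S (index_iota 1 k.+2).
have iN := integrable_past_indic mN mphi (fun w => bphi _).
have -> : I h k = \int[P]_w (\sum_(1 <= i < k.+2) \1_(A (upd h k.+1 i) k.+1) w * phi (c ^~ w) + \1_N w * phi (c ^~ w)).
  by apply: eq_Rintegral => w _; rewrite E mulrDl mulr_suml.
rewrite RintegralD// S1; apply/eqP; rewrite -subr_eq0 addrAC subrr add0r.
rewrite -normr_le0 (le_trans (le_normr_Rintegral _ iN))//.
have M0 : 0 <= M := le_trans (normr_ge0 _) (bphi (fun=> 0%N)).
apply: (@le_trans _ _ (\int[P]_w (\1_N w * M))).
  apply: le_Rintegral => //.
  - exact: (integrable_norm iN).
  - by apply: (integrable_past_indic mN (psi := fun=> M)) => // _; rewrite ger0_norm.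
  - move=> w _; rewrite normrM (ger0_norm (_ : 0 <= \1_N w)) ?indicE//.
    by rewrite ler_wpM2l.
under eq_Rintegral do rewrite mulrC.
rewrite RintegralZl//.
  by rewrite prob_indic// PN mulr0.
apply: bounded_integrable; first exact: measurable_indic.
by exists 1 => w; rewrite indicE normr_nat lern1 leq_b1.
Qed.

(** Induction on the number [r] of steps left: [I_split] branches over the next parent, and
    [pa_process] supplies the factor of each branch. At [r = 0] the past determines [phi]. *)
Lemma I_forward r k h : (r + k)%N = n -> I h k = fine (P (A h k)) * forward r k phi h.
Proof.
elim: r k h => [|r IH] k h rk /=.
  rewrite -prob_indic; last exact: measurable_same_past.
  rewrite mulrC -RintegralZl//; last first.
    apply: bounded_integrable; first by apply: measurable_indic; exact: measurable_same_past.
    by exists 1 => w; rewrite indicE normr_nat lern1 leq_b1.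
  apply: eq_Rintegral => w _; rewrite past_indic; case: asboolP => [H|_]; last by rewrite mul0r mulr0.
  by rewrite mul1r mulr1; apply: dphi; rewrite -rk.
rewrite I_split mulr_sumr; apply: eq_big_nat => i /andP[i1 ik].
rewrite IH ?addnS// mulrA; congr (_ * _).
rewrite same_past_upd /A (pa h i1 ik) fineM ?fin_num_measure//; exact: measurable_same_past.
Qed.

Theorem pa_expectation : ('E_P[fun w => phi (c ^~ w)] = (EH n phi)%:E)%E.
Proof.
have : I (fun=> 0%N) 0 = fine (P (A (fun=> 0%N) 0)) * forward n 0 phi (fun=> 0%N).
  by apply: I_forward; rewrite addn0.
have -> : A (fun=> 0%N) 0 = setT by apply/seteqP; split => // w _ m m1; rewrite ltnS leqNgt m1.
rewrite probability_setT mul1r -EH_forward => <-.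
rewrite unlock /I -[LHS]fineK; last first.
  by apply: integrable_fin_num => //; apply: bounded_integrable => //; exists M.
congr (_%:E); apply: eq_Rintegral => w _.
rewrite (_ : A _ _ = setT) ?indicT ?mul1r//.
by apply/seteqP; split => // w' _ m m1; rewrite ltnS leqNgt m1.
Qed.

End Process.

End History.

(** * Quadratic forms and the Lyapunov equation *)

Section Forms.
Variables (R : realType) (n : nat).
Implicit Types (x y z t : 'rV[R]_n) (A S : 'M[R]_n) (c : R).

Definition dotv x y : R := \sum_i x 0 i * y 0 i.

Definition bil S x y : R := dotv (x *m S) y.

Lemma dotvC x y : dotv x y = dotv y x.
Proof. by apply: eq_bigr => i _; rewrite mulrC. Qed.

Lemma dotvDl x y z : dotv (x + y) z = dotv x z + dotv y z.
Proof. by rewrite -big_split; apply: eq_bigr => i _; rewrite mxE mulrDl. Qed.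

Lemma dotvZl c x y : dotv (c *: x) y = c * dotv x y.
Proof. by rewrite mulr_sumr; apply: eq_bigr => i _; rewrite mxE mulrA. Qed.

Lemma dotvDr x y z : dotv z (x + y) = dotv z x + dotv z y.
Proof. by rewrite dotvC dotvDl !(dotvC z). Qed.

Lemma dotvZr c x y : dotv y (c *: x) = c * dotv y x.
Proof. by rewrite dotvC dotvZl (dotvC y). Qed.

Lemma dotvNl x y : dotv (- x) y = - dotv x y.
Proof. by rewrite -scaleN1r dotvZl mulN1r. Qed.

Lemma dotvNr x y : dotv x (- y) = - dotv x y.
Proof. by rewrite dotvC dotvNl dotvC. Qed.

Lemma dotv0 x : dotv x 0 = 0.
Proof. by apply: big1 => i _; rewrite mxE mulr0. Qed.

Lemma dot0v x : dotv 0 x = 0.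
Proof. by rewrite dotvC dotv0. Qed.

Lemma dotv_sumr x (I : Type) (r : seq I) (F : I -> 'rV[R]_n) :
  dotv x (\sum_(i <- r) F i) = \sum_(i <- r) dotv x (F i).
Proof.
by elim: r => [|i r IH]; rewrite ?big_nil ?dotv0// !big_cons dotvDr IH.
Qed.

Lemma dotv_delta x i : dotv x (delta_mx 0 i) = x 0 i.
Proof.
rewrite /dotv (bigD1 i)//= mxE !eqxx mulr1 big1 ?addr0// => j ji.
by rewrite mxE (negbTE ji) andbF mulr0.
Qed.

Lemma dotv_mul A x y : dotv (x *m A) y = dotv x (y *m A^T).
Proof.
rewrite /dotv; under eq_bigr do rewrite mxE mulr_suml.
rewrite exchange_big/=; apply: eq_bigr => i _.
rewrite mxE mulr_sumr; apply: eq_bigr => j _; rewrite mxE; ring.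
Qed.

Lemma dotvv_ge0 x : 0 <= dotv x x.
Proof. by apply: sumr_ge0 => i _; rewrite -expr2 sqr_ge0. Qed.

Lemma bilDl S x y z : bil S (x + y) z = bil S x z + bil S y z.
Proof. by rewrite /bil mulmxDl dotvDl. Qed.

Lemma bilDr S x y z : bil S z (x + y) = bil S z x + bil S z y.
Proof. by rewrite /bil dotvDr. Qed.

Lemma bilZl S c x y : bil S (c *: x) y = c * bil S x y.
Proof. by rewrite /bil -scalemxAl dotvZl. Qed.

Lemma bilZr S c x y : bil S x (c *: y) = c * bil S x y.
Proof. by rewrite /bil dotvZr. Qed.

Lemma bil_sym S x y : S^T = S -> bil S x y = bil S y x.
Proof. by move=> sS; rewrite /bil dotv_mul sS dotvC. Qed.

Lemma bil0 S x : bil S 0 x = 0.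
Proof. by rewrite /bil mul0mx dot0v. Qed.

Lemma bil_addM S x y c : S^T = S ->
  bil S (x + c *: y) (x + c *: y) = bil S x x + 2 * c * bil S x y + c ^+ 2 * bil S y y.
Proof.
move=> sS; rewrite bilDl !bilDr !bilZl !bilZr (bil_sym y x sS); ring.
Qed.

Lemma bilE S x y : bil S x y = \sum_i \sum_j S i j * x 0 i * y 0 j.
Proof.
rewrite /bil /dotv; under eq_bigr do rewrite mxE mulr_suml.
rewrite exchange_big/=; apply: eq_bigr => i _; apply: eq_bigr => j _; ring.
Qed.

Lemma bil_delta S i j : bil S (delta_mx 0 i) (delta_mx 0 j) = S i j.
Proof. by rewrite /bil dotv_delta -rowE mxE. Qed.

End Forms.

Section Lyapunov.
Variables (R : realType) (n : nat) (G : 'M[R]_n).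
Hypothesis Gsym : G^T = G.
Hypothesis Gpos : forall x : 'rV[R]_n, x != 0 -> 0 < bil G x x.
Implicit Types (x y z t : 'rV[R]_n) (A S : 'M[R]_n) (c h : R).

Lemma Gge0 x : 0 <= bil G x x.
Proof. by have [->|/Gpos/ltW//] := eqVneq x 0; rewrite bil0. Qed.

Lemma Gunit : G \in unitmx.
Proof.
rewrite -row_free_unit -kermx_eq0; apply/rowV0P => x /sub_kermxP xG.
by apply/eqP; apply: contraT => /Gpos; rewrite /bil xG dot0v ltxx.
Qed.

(** The square of the norm dual to [bil G]; deviations are measured by [G], frequencies by [N2]. *)
Definition N2 t : R := dotv (t *m invmx G) t.

Lemma N2E t : N2 t = bil G (t *m invmx G) (t *m invmx G).
Proof. by rewrite /bil -mulmxA mulVmx ?Gunit// mulmx1 /N2 dotvC. Qed.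

Lemma N2_ge0 t : 0 <= N2 t.
Proof. by rewrite N2E Gge0. Qed.

Lemma dotv_bil t x : dotv t x = bil G (t *m invmx G) x.
Proof. by rewrite /bil -mulmxA mulVmx ?Gunit// mulmx1. Qed.

Lemma G_cauchy_schwarz x y : bil G x y ^+ 2 <= bil G x x * bil G y y.
Proof.
have [->|/Gpos y0] := eqVneq y 0.
  by rewrite (bil_sym x 0 Gsym) !bil0 mulr0 expr0n.
have := Gge0 (x + (- (bil G x y / bil G y y)) *: y).
rewrite bil_addM// => H.
have := mulr_ge0 H (ltW y0).
have -> : (bil G x x + 2 * - (bil G x y / bil G y y) * bil G x y +
  (- (bil G x y / bil G y y)) ^+ 2 * bil G y y) * bil G y y =
  bil G x x * bil G y y - bil G x y ^+ 2 by field; rewrite gt_eqF.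
by rewrite subr_ge0.
Qed.

Lemma N2_cauchy_schwarz t x : dotv t x ^+ 2 <= N2 t * bil G x x.
Proof. by rewrite dotv_bil N2E; exact: G_cauchy_schwarz. Qed.

(** An operator and its adjoint have the same norm: Cauchy-Schwarz is applied at the vector [x] that
    represents [t *m A^T], for which [bil G x x = N2 (t *m A^T)]. *)
Lemma N2_adjoint A c : 0 <= c -> (forall x, bil G (x *m A) (x *m A) <= c * bil G x x) ->
  forall t, N2 (t *m A^T) <= c * N2 t.
Proof.
move=> c0 H t; pose t' := t *m A^T; pose x := t' *m invmx G.
have E : N2 t' = dotv t (x *m A).
  by rewrite /N2 -/x dotvC [RHS]dotvC dotv_mul dotvC.
have := N2_cauchy_schwarz t (x *m A); rewrite -E.
have N2x : bil G x x = N2 t' by rewrite N2E.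
have := ler_wpM2l (N2_ge0 t) (H x); rewrite N2x => H1 H2.
have [N0|N0] := leP (N2 t') 0; first by rewrite (le_trans N0)// mulr_ge0// N2_ge0.
rewrite -(ler_pM2r N0) -expr2 (le_trans H2)// (le_trans H1)//.
by rewrite mulrCA mulrA.
Qed.

Lemma coord_sqr_le x i : x 0 i ^+ 2 <= N2 (delta_mx 0 i) * bil G x x.
Proof. by have := N2_cauchy_schwarz (delta_mx 0 i) x; rewrite dotvC dotv_delta. Qed.

Lemma coord_sqr_le_dual t i : t 0 i ^+ 2 <= bil G (delta_mx 0 i) (delta_mx 0 i) * N2 t.
Proof. by have := N2_cauchy_schwarz t (delta_mx 0 i); rewrite dotv_delta mulrC. Qed.

Lemma bil_bound_of (q : 'rV[R]_n -> R) (b : 'I_n -> R) S : (forall x, 0 <= q x) -> (forall i, 0 <= b i) ->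
  (forall x i, x 0 i ^+ 2 <= b i * q x) ->
  exists2 c, 0 <= c & forall x, `|bil S x x| <= c * q x.
Proof.
move=> q0 b0 H; exists (\sum_i \sum_j `|S i j| * (b i + b j)).
  by apply: sumr_ge0 => i _; apply: sumr_ge0 => j _; rewrite mulr_ge0// addr_ge0.
move=> x; rewrite bilE mulr_suml (le_trans (ler_norm_sum _ _ _))//; apply: ler_sum => i _.
rewrite mulr_suml (le_trans (ler_norm_sum _ _ _))//; apply: ler_sum => j _.
rewrite -mulrA normrM -mulrA ler_wpM2l// normrM.
have := H x i; have := H x j; rewrite -(real_normK (num_real (x 0 i))) -(real_normK (num_real (x 0 j))).
have := sqr_ge0 (`|x 0 i| - `|x 0 j|); have := normr_ge0 (x 0 i); have := normr_ge0 (x 0 j).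
by set u := `|_|; set w := `|_|; nra.
Qed.

Lemma bil_bound S : exists2 c, 0 <= c & forall x, `|bil S x x| <= c * bil G x x.
Proof.
apply: (bil_bound_of S Gge0 (b := fun i => N2 (delta_mx 0 i))) => [i|x i]; first exact: N2_ge0.
exact: coord_sqr_le.
Qed.

Lemma bil_bound_dual S : exists2 c, 0 <= c & forall t, `|bil S t t| <= c * N2 t.
Proof.
apply: (bil_bound_of S N2_ge0 (b := fun i => bil G (delta_mx 0 i) (delta_mx 0 i))) => [i|x i]; first exact: Gge0.
exact: coord_sqr_le_dual.
Qed.

Section Contraction.
Variables (M : 'M[R]_n) (b : R).
Hypothesis b0 : 0 <= b.
Hypothesis b12 : b < 1 / 2.
Hypothesis GM : forall x, bil G (x *m M) x <= b * bil G x x.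

Lemma bil_mulmx2 S A x y : bil S (x *m A) (y *m A) = bil (A *m S *m A^T) x y.
Proof. by rewrite /bil -!mulmxA dotvC dotv_mul dotvC -!mulmxA. Qed.

(** Moving the frequency is the adjoint of [1%:M + h *: M]. Expanding the form there, the term
    linear in [h] is controlled by [b] alone, and the quadratic one costs a constant. *)
Lemma N2_contraction : exists2 c, 0 <= c & forall h t, 0 <= h ->
  N2 (t + h *: (t *m M^T)) <= (1 + 2 * b * h + c * h ^+ 2) * N2 t.
Proof.
have [c c0 Hc] := bil_bound (M *m G *m M^T).
exists c => // h t h0.
have -> : t + h *: (t *m M^T) = t *m (1%:M + h *: M)^T.
  by rewrite linearD/= linearZ/= trmx1 mulmxDr mulmx1 -scalemxAr.
apply: N2_adjoint => [|x].
  by rewrite addr_ge0 ?mulr_ge0 ?sqr_ge0// addr_ge0// mulr_ge0// mulr_ge0.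
rewrite mulmxDr mulmx1 -scalemxAr bil_addM// bil_mulmx2 (bil_sym x _ Gsym).
have A1 : h * bil G (x *m M) x <= h * (b * bil G x x) by rewrite ler_wpM2l.
have A2 : h ^+ 2 * bil (M *m G *m M^T) x x <= h ^+ 2 * (c * bil G x x).
  by rewrite ler_wpM2l ?sqr_ge0// (le_trans _ (Hc x))// ler_norm.
lra.
Qed.

(** Replaces the integral of the matrix exponential. If [bil S] is bounded below by [- L * N2],
    evaluating it at [t + h t M^T] improves [L] to about [L (1 + 2 b h) / (1 + h)], up to a term of
    order [h ^+ 2]. As [2 * b < 1], the infimum of admissible [L] is 0. *)
Lemma psd_lyapunov S : S^T = S ->
  (forall t, 0 <= bil S t t - 2 * bil S t (t *m M^T)) -> forall t, 0 <= bil S t t.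
Proof.
move=> sS H.
have [c1 c10 H1] := N2_contraction.
have [c2 c20 H2] := bil_bound_dual (M^T *m S *m M^T^T).
have [c3 c30 H3] := bil_bound_dual S.
pose E := [set L : R | 0 <= L /\ forall t, - L * N2 t <= bil S t t].
have E3 : E c3.
  by split => // t; have := H3 t; rewrite ler_norml mulNr => /andP[].
have Eshrink h L : 0 < h -> E L -> E ((L * (1 + 2 * b * h + c1 * h ^+ 2) + h ^+ 2 * c2) / (1 + h)).
  move=> h0 [L0 EL].
  have f0 : 0 <= 1 + 2 * b * h + c1 * h ^+ 2.
    by have := mulr_ge0 b0 (ltW h0); have := mulr_ge0 c10 (sqr_ge0 h); lra.
  have h1 : 0 < 1 + h by rewrite ltr_wpDl.
  split.
    by apply: divr_ge0; [apply: addr_ge0; apply: mulr_ge0 => //; exact: sqr_ge0|exact: ltW].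
  move=> t; have A := EL (t + h *: (t *m M^T)).
  have B := ler_wpM2l L0 (H1 h t (ltW h0)).
  have C := H2 t; rewrite -bil_mulmx2 in C.
  have {}C : h ^+ 2 * bil S (t *m M^T) (t *m M^T) <= h ^+ 2 * (c2 * N2 t).
    by rewrite ler_wpM2l ?sqr_ge0// (le_trans (ler_norm _)).
  rewrite bil_addM// in A.
  have D := mulr_ge0 (ltW h0) (H t).
  rewrite mulNr mulrAC -mulNr ler_pdivrMr//.
  move: A B C D; set q := bil S t t; set q1 := bil S t _; set q2 := bil S (t *m _) _.
  set N' := N2 (_ + _); set N := N2 t => A B C D.
  have -> : - ((L * (1 + 2 * b * h + c1 * h ^+ 2) + h ^+ 2 * c2) * N) =
    - (L * ((1 + 2 * b * h + c1 * h ^+ 2) * N)) - h ^+ 2 * (c2 * N) by ring.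
  have -> : q * (1 + h) = (q + 2 * h * q1 + h ^+ 2 * q2) + h * (q - 2 * q1) - h ^+ 2 * q2 by ring.
  rewrite mulNr in A; lra.
pose Ls := inf E.
have hE : has_inf E by split; [exists c3|exists 0 => L []].
have Ls0 : 0 <= Ls by apply: lb_le_inf; [exists c3|move=> L []].
have LsE : E Ls.
  split => // t; have [N0|N0] := leP (N2 t) 0.
    have -> : N2 t = 0 by apply/eqP; rewrite eq_le N0 N2_ge0.
    by rewrite mulr0; have [_ /(_ t)] := E3; rewrite (_ : N2 t = 0) ?mulr0//; apply/eqP; rewrite eq_le N0 N2_ge0.
  rewrite mulNr lerNl -ler_pdivrMr//.
  by apply: lb_le_inf; [exists c3|move=> L [_ /(_ t)]; rewrite ler_pdivrMr// mulNr lerNl].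
(* The infimum is itself admissible and cannot be improved by a step; letting [h] be small then
   contradicts [Ls > 0]. *)
have key h : 0 < h -> Ls * (1 - 2 * b) <= h * (Ls * c1 + c2).
  move=> h0; have := ge_inf hE.2 (Eshrink h Ls h0 LsE); rewrite -/Ls ler_pdivlMr ?ltr_wpDl// => K.
  rewrite -(ler_pM2l h0); move: K.
  by lra.
have Ls_le0 : Ls <= 0.
  rewrite leNgt; apply/negP => Lp.
  have d0 : 0 < Ls * (1 - 2 * b) by apply: mulr_gt0 => //; move: b12; rewrite ltr_pdivlMr//; lra.
  have e0 : 0 < Ls * c1 + c2 + 1 by rewrite ltr_wpDl// addr_ge0// mulr_ge0.
  have := key (Ls * (1 - 2 * b) / (Ls * c1 + c2 + 1)) (divr_gt0 d0 e0).
  rewrite mulrAC ler_pdivlMr// ler_pM2l//; lra.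
move=> t; have [_ /(_ t)] := LsE; apply: le_trans.
have -> : Ls = 0 by apply/eqP; rewrite eq_le Ls_le0 Ls0.
by rewrite oppr0 mul0r.
Qed.

End Contraction.
End Lyapunov.

Section LyapunovEquation.
Variables (R : realType) (n : nat).
Implicit Types (M S : 'M[R]_n).

(* The summand [S - S^T] makes the operator injective on all matrices, symmetric
   or not, so that its matrix can be inverted. *)
Definition lyap_op M S : 'M[R]_n := (S - S^T) + ((S + S^T) - (S + S^T) *m M - M^T *m (S + S^T)).

Lemma lyap_op_linear M : linear (lyap_op M).
Proof.
move=> c S S'; rewrite /lyap_op !linearD/= !linearZ/= !mulmxDl -?scalemxAl.
by apply/matrixP => i j; rewrite !mxE; ring.
Qed.

HB.instance Definition _ M := GRing.isLinear.Build R 'M[R]_n 'M[R]_n _ (lyap_op M) (lyap_op_linear M).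

(** A preimage [S] of a symmetric [Gam] under [lyap_op] is symmetric, so the solution of the
    Lyapunov equation is [S + S^T = S *+ 2]. The inverse matrix makes rationality in the entries
    visible. *)
Definition lyap M (Gam : 'M[R]_n) : 'M[R]_n :=
  vec_mx (mxvec Gam *m invmx (lin_mx (lyap_op M))) *+ 2.

Variables (G M Gam : 'M[R]_n) (b : R).
Hypothesis Gsym : G^T = G.
Hypothesis Gpos : forall x : 'rV[R]_n, x != 0 -> 0 < bil G x x.
Hypothesis b0 : 0 <= b.
Hypothesis b12 : b < 1 / 2.
Hypothesis GM : forall x : 'rV[R]_n, bil G (x *m M) x <= b * bil G x x.

Lemma lyap_quad S (t : 'rV[R]_n) : S^T = S ->
  bil (S - S *m M - M^T *m S) t t = bil S t t - 2 * bil S t (t *m M^T).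
Proof.
move=> sS; rewrite /bil !mulmxBr !dotvDl !dotvNl !mulmxA.
have -> : dotv (t *m S *m M) t = dotv (t *m S) (t *m M^T) by rewrite dotv_mul.
have -> : dotv (t *m M^T *m S) t = dotv (t *m S) (t *m M^T) by rewrite dotv_mul sS dotvC.
ring.
Qed.

Lemma bil_eq0 S : S^T = S -> (forall t : 'rV[R]_n, bil S t t = 0) -> S = 0.
Proof.
move=> sS H; apply/matrixP => i j; rewrite mxE.
have := H (delta_mx 0 i + 1 *: delta_mx 0 j).
rewrite bil_addM// !H bil_delta; lra.
Qed.

(** [psd_lyapunov] applies to [S] and to [- S], so the quadratic form of [S] vanishes. *)
Lemma lyap_sym_inj S : S^T = S -> S - S *m M - M^T *m S = 0 -> S = 0.
Proof.
move=> sS E; apply: bil_eq0 => // t; apply/eqP; rewrite eq_le.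
have H (S' : 'M[R]_n) : S'^T = S' -> S' - S' *m M - M^T *m S' = 0 -> forall t : 'rV[R]_n, 0 <= bil S' t t.
  move=> sS' E' t'; apply: (psd_lyapunov Gsym Gpos b0 b12 GM) => // u.
  by rewrite -lyap_quad// E' /bil mulmx0 dot0v.
rewrite H// andbT -oppr_ge0.
have -> : - bil S t t = bil (- S) t t by rewrite /bil mulmxN dotvNl.
apply: H; first by rewrite linearN/= sS.
have -> : - S - - S *m M - M^T *m - S = - (S - S *m M - M^T *m S).
  by rewrite mulNmx mulmxN !opprB; apply/matrixP => i j; rewrite !mxE; ring.
by rewrite E oppr0.
Qed.

Lemma lyap_op_unsym S E : E^T = E -> lyap_op M S = E -> S^T = S /\ S *+ 2 - (S *+ 2) *m M - M^T *m (S *+ 2) = E.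
Proof.
move=> sE H; have [T TE] : {T | T = S + S^T} by exists (S + S^T).
have sT : T^T = T by rewrite TE linearD/= trmxK addrC.
have := congr1 (fun A : 'M[R]_n => A - A^T) H; rewrite sE subrr /lyap_op -TE.
have -> : (S - S^T + (T - T *m M - M^T *m T))^T = - (S - S^T) + (T - T *m M - M^T *m T).
  rewrite !linearD/= !linearN/= !trmx_mul !trmxK sT.
  by apply/matrixP => i j; rewrite !mxE; ring.
move=> H2; have SS : S^T = S.
  apply/matrixP => i j; move: (congr1 (fun A : 'M[R]_n => A i j) H2); rewrite !mxE; lra.
split => //; move: H; by rewrite /lyap_op SS subrr add0r -mulr2n.
Qed.

Lemma lyap_op_unit : lin_mx (lyap_op M) \in unitmx.
Proof.
rewrite -row_free_unit -kermx_eq0; apply/rowV0P => x /sub_kermxP H.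
have E : lyap_op M (vec_mx x) = 0.
  by apply: (can_inj mxvecK); rewrite linear0 -H -[in RHS](vec_mxK x) mul_vec_lin.
have [sx E2] := lyap_op_unsym (trmx0 _ _ _) E.
have /eqP : vec_mx x *+ 2 = 0 :> 'M[R]_n.
  by apply: lyap_sym_inj E2; rewrite linearMn/= sx.
rewrite -scaler_nat scaler_eq0 pnatr_eq0/= => /eqP x0.
by rewrite -(vec_mxK x) x0 linear0.
Qed.

Lemma lyapP : Gam^T = Gam -> (lyap M Gam)^T = lyap M Gam /\
  lyap M Gam = lyap M Gam *m M + M^T *m lyap M Gam + Gam.
Proof.
move=> sG; set S := vec_mx (mxvec Gam *m invmx (lin_mx (lyap_op M))).
have E : lyap_op M S = Gam.
  apply: (can_inj mxvecK); rewrite -mul_vec_lin /S vec_mxK -mulmxA mulVmx ?lyap_op_unit//.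
  by rewrite mulmx1.
have [sS E2] := lyap_op_unsym sG E.
rewrite /lyap -/S; split; first by rewrite linearMn/= sS.
by rewrite -E2; apply/matrixP => i j; rewrite !mxE; ring.
Qed.

Lemma lyap_psd : Gam^T = Gam -> (forall t : 'rV[R]_n, 0 <= bil Gam t t) -> forall t : 'rV[R]_n, 0 <= bil (lyap M Gam) t t.
Proof.
move=> sG pG; have [sS E] := lyapP sG.
apply: (psd_lyapunov Gsym Gpos b0 b12 GM) => // t.
rewrite -lyap_quad//.
have -> : lyap M Gam - lyap M Gam *m M - M^T *m lyap M Gam = Gam; last exact: pG.
by rewrite {1}E; apply/matrixP => i j; rewrite !mxE; ring.
Qed.

End LyapunovEquation.

(** * Spectral gap *)

Section RealChain.
Variables (R : realType) (n m : nat).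
Variables (At B : 'M[R]_n) (v f : 'rV[R]_n) (lam rho : R).
Variables (Rr Jj : nat -> 'M[R]_n) (a b : nat -> R).
Hypothesis BE : B = At - f^T *m v.
Hypothesis vAt : v *m At = lam *: v.
Hypothesis sumv : dotv v (const_mx 1) = 1.
Hypothesis At1 : const_mx 1 *m At^T = f.
Hypothesis simple : forall x : 'rV[R]_n, x *m At = lam *: x -> dotv x (const_mx 1) = 0 -> x = 0.
Hypothesis m0 : (0 < m)%N.
Hypothesis R0 : Rr 0%N = At - lam%:M.
Hypothesis J0 : Jj 0%N = 0.
Hypothesis Rm : Rr m = 0.
Hypothesis Jm : Jj m = 0.
Hypothesis RS : forall i, (i < m)%N -> At *m Rr i = Rr i.+1 + a i *: Rr i - b i *: Jj i.
Hypothesis JS : forall i, (i < m)%N -> At *m Jj i = Jj i.+1 + a i *: Jj i + b i *: Rr i.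
Hypothesis a_le : forall i, (i < m)%N -> a i <= rho.

(** [v] is killed by the factor [At - lam%:M] and the recursion preserves this. So the rank-one
    correction in [B] is invisible on the chain, where [B] acts as [At]. *)
Let v0 i : (i <= m)%N -> v *m Rr i = 0 /\ v *m Jj i = 0.
Proof.
elim: i => [_|i IH im].
  by rewrite R0 J0 mulmx0 mulmxBr vAt mul_mx_scalar subrr.
have [vR vJ] := IH (ltnW im); split.
  have -> : Rr i.+1 = At *m Rr i - a i *: Rr i + b i *: Jj i by rewrite RS//; apply/matrixP => p q; rewrite !mxE; ring.
  by rewrite mulmxDr mulmxBr mulmxA vAt -!scalemxAr -scalemxAl vR vJ !scaler0 subrr addr0.
have -> : Jj i.+1 = At *m Jj i - a i *: Jj i - b i *: Rr i by rewrite JS//; apply/matrixP => p q; rewrite !mxE; ring.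
by rewrite !mulmxBr mulmxA vAt -!scalemxAr -scalemxAl vR vJ !scaler0 !subr0.
Qed.

Let BR i : (i <= m)%N -> B *m Rr i = At *m Rr i /\ B *m Jj i = At *m Jj i.
Proof.
by move=> im; have [vR vJ] := v0 im; rewrite BE !mulmxBl -!mulmxA vR vJ !mulmx0 !subr0.
Qed.

Lemma B1 x : dotv (x *m B) (const_mx 1) = 0.
Proof.
rewrite BE mulmxBr dotvDl dotvNl dotv_mul At1 mulmxA.
rewrite (_ : x *m f^T = (dotv x f)%:M); last first.
  by rewrite [LHS]mx11_scalar; congr _%:M; rewrite mxE; apply: eq_bigr => i _; rewrite mxE.
by rewrite mul_scalar_mx dotvZl sumv mulr1 subrr.
Qed.

Let nn (x : 'rV[R]_n) i := dotv (x *m Rr i) (x *m Rr i) + dotv (x *m Jj i) (x *m Jj i).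

(* [Rr i] and [Jj i] are the real and imaginary parts of the product of
   [A^T - s_j], j <= i, over the eigenvalues s_j. For large q the term of rank
   i + 1 absorbs its coupling with the term of rank i. *)
Definition chain_form (q : R) : 'M[R]_n :=
  const_mx 1 + \sum_(i < m) q ^+ i *: (Rr i *m (Rr i)^T + Jj i *m (Jj i)^T).

Lemma chain_form_sym q : (chain_form q)^T = chain_form q.
Proof.
rewrite /chain_form linearD/= trmx_const linear_sum/=; congr (_ + _).
by apply: eq_bigr => i _; rewrite linearZ/= linearD/= !trmx_mul !trmxK.
Qed.

Lemma chain_formE q x y : bil (chain_form q) x y = dotv x (const_mx 1) * dotv y (const_mx 1) +
  \sum_(i < m) q ^+ i * (dotv (x *m Rr i) (y *m Rr i) + dotv (x *m Jj i) (y *m Jj i)).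
Proof.
rewrite /bil /chain_form mulmxDr dotvDl; congr (_ + _).
  rewrite /dotv mulr_sumr; apply: eq_bigr => i _; rewrite !mxE; congr (_ * _).
    by apply: eq_bigr => j _; rewrite !mxE.
  by rewrite mulr1.
rewrite mulmx_sumr dotvC dotv_sumr; apply: eq_bigr => i _.
rewrite -scalemxAr dotvZr mulmxDr dotvDr !mulmxA dotvC (dotvC y); congr (_ * (_ + _)).
  by rewrite [LHS]dotv_mul trmxK.
by rewrite [LHS]dotv_mul trmxK.
Qed.

Lemma dotv_eq0 (x : 'rV[R]_n) : dotv x x = 0 -> x = 0.
Proof.
move=> H; apply/rowP => i; rewrite mxE; apply/eqP; rewrite -sqrf_eq0 eq_le sqr_ge0 andbT -H.
by rewrite /dotv (bigD1 i)//= -expr2 lerDl sumr_ge0// => j _; rewrite -expr2 sqr_ge0.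
Qed.

Let nn_ge0 x i : 0 <= nn x i.
Proof. by rewrite addr_ge0// dotvv_ge0. Qed.

(** The term of rank 0 vanishes only on the [lam]-eigenspace of [At]; the square of
    [dotv x (const_mx 1)] contributed by [const_mx 1] is positive there, by simplicity. *)
Lemma chain_form_pos q x : 0 < q -> x != 0 -> 0 < bil (chain_form q) x x.
Proof.
move=> q0 x0; rewrite chain_formE lt_neqAle.
have S0 : 0 <= \sum_(i < m) q ^+ i * nn x i.
  by apply: sumr_ge0 => i _; rewrite mulr_ge0// exprn_ge0// ltW.
rewrite addr_ge0 ?andbT// -?expr2 ?sqr_ge0//.
apply/eqP => /esym/eqP; rewrite paddr_eq0// ?sqr_ge0// sqrf_eq0 => /andP[/eqP x1].
rewrite psumr_eq0 => [/allP/(_ (Ordinal m0) (mem_index_enum _))/=|i _]; last first.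
  by rewrite mulr_ge0 ?nn_ge0// exprn_ge0// ltW.
rewrite expr0 mul1r R0 J0 mulmx0 dotv0 addr0 => /eqP/dotv_eq0.
rewrite mulmxBr mul_mx_scalar => /eqP; rewrite subr_eq0 => /eqP xA.
by move/eqP: x0; apply; exact: simple.
Qed.

Let dot_young e (x y : 'rV[R]_n) : 0 < e -> dotv x y <= e / 2 * dotv y y + dotv x x / (2 * e).
Proof.
move=> e0; have := dotvv_ge0 (x - e *: y).
rewrite dotvDl !dotvDr !dotvNl !dotvNr !dotvZl !dotvZr (dotvC y) => H.
rewrite -subr_ge0; have -> : e / 2 * dotv y y + dotv x x / (2 * e) - dotv x y =
  (dotv x x - e * dotv x y + (- (e * dotv x y) - - (e * (e * dotv y y)))) / (2 * e).
  by field; rewrite gt_eqF.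
by rewrite divr_ge0// mulr_ge0// ltW.
Qed.

(** The imaginary parts [b i] cancel between [Rr] and [Jj]. Young's inequality splits each coupling
    into [e / 2] times two consecutive terms, exactly because [q = e ^- 2]; summing, the shift costs
    another [e / 2]. The total-mass term has no drift by [B1]. *)
Lemma chain_lyapunov e c : 0 < e -> 0 <= c -> rho + e <= c ->
  forall x, bil (chain_form (e ^- 2)) (x *m B) x <= c * bil (chain_form (e ^- 2)) x x.
Proof.
move=> e0 c0 rc x; rewrite !chain_formE B1 mul0r add0r.
set q := e ^- 2; have q0 : 0 < q by rewrite invr_gt0 exprn_gt0.
have term (i : 'I_m) : q ^+ i * (dotv (x *m B *m Rr i) (x *m Rr i) + dotv (x *m B *m Jj i) (x *m Jj i))
   <= (rho + e / 2) * (q ^+ i * nn x i) + e / 2 * (q ^+ i.+1 * nn x i.+1).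
  have [BRi BJi] := BR (ltnW (ltn_ord i)).
  rewrite -!mulmxA BRi BJi RS ?JS//.
  rewrite mulmxBr !mulmxDr -!scalemxAr !dotvDl !dotvNl !dotvZl (dotvC (x *m Jj i) (x *m Rr i)).
  have -> : q ^+ i.+1 * nn x i.+1 = q ^+ i * (nn x i.+1 / e ^+ 2) by rewrite exprS /q; field; rewrite gt_eqF.
  rewrite !(mulrCA _ (q ^+ i)) -mulrDr ler_pM2l ?exprn_gt0//.
  have D1 := dot_young (x *m Rr i.+1) (x *m Rr i) e0.
  have D2 := dot_young (x *m Jj i.+1) (x *m Jj i) e0.
  have D3 : a i * nn x i <= rho * nn x i by rewrite ler_wpM2r ?nn_ge0// a_le.
  have D4 : e / 2 * (nn x i.+1 / e ^+ 2) = nn x i.+1 / (2 * e) by field; rewrite gt_eqF.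
  rewrite D4; move: D1 D2 D3; rewrite /nn !(mulrDl _ _ (2 * e)^-1).
  lra.
apply: le_trans (ler_sum _ (fun i _ => term i)) _.
rewrite big_split/= -!mulr_sumr.
have shift : \sum_(i < m) q ^+ i.+1 * nn x i.+1 <= \sum_(i < m) q ^+ i * nn x i.
  have -> : \sum_(i < m) q ^+ i.+1 * nn x i.+1 = \sum_(i < m.+1) q ^+ i * nn x i - q ^+ 0 * nn x 0.
    by rewrite big_ord_recl/= addrC addrA addNr add0r; apply: eq_bigr.
  rewrite big_ord_recr/= {2}/nn Rm Jm !mulmx0 !dotv0 addr0 mulr0 addr0 gerBl.
  by rewrite mulr_ge0 ?nn_ge0.
have S0 : 0 <= \sum_(i < m) q ^+ i * nn x i.
  by apply: sumr_ge0 => i _; rewrite mulr_ge0 ?nn_ge0// exprn_ge0// ltW.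
apply: (@le_trans _ _ ((rho + e) * \sum_(i < m) q ^+ i * nn x i)).
  rewrite (_ : rho + e = (rho + e / 2) + e / 2); last by field.
  by rewrite [leRHS]mulrDl lerD2l ler_wpM2l// divr_ge0// ltW.
rewrite mulrDr ler_wpDl//; last exact: ler_wpM2r.
by rewrite mulr_ge0// -expr2 sqr_ge0.
Qed.

End RealChain.

Lemma char_poly_tr (F : comNzRingType) n (A : 'M[F]_n) : char_poly A^T = char_poly A.
Proof.
rewrite /char_poly -det_tr; congr (\det _); apply/matrixP => i j.
by rewrite !mxE eq_sym.
Qed.

(** * Complex eigenvalues and the chain of partial products *)

Section ComplexChain.
Variables (R : realType) (k : nat) (A : 'M[R]_k.+1) (lam : R).
Local Notation toC := (real_complex R).
Local Notation Re := complex.Re.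
Local Notation Im := complex.Im.
Let s := eigenvalues A.
Let AC := map_mx toC A.

Lemma eigenvalues_perm :
  perm_eq s (sval (closed_field_poly_normal (char_poly AC))).
Proof. by rewrite /s /eigenvalues perm_sort. Qed.

Lemma char_poly_eigenvalues : char_poly AC = \prod_(z <- s) ('X - z%:P).
Proof.
rewrite (perm_big _ eigenvalues_perm)/=; case: closed_field_poly_normal => r /= {1}->.
by rewrite (monicP (char_poly_monic _)) scale1r.
Qed.

Lemma size_eigenvalues : size s = k.+1.
Proof.
have := size_char_poly AC; rewrite char_poly_eigenvalues.
by rewrite size_prod_XsubC => -[].
Qed.

Lemma mem_eigenvalues z : (z \in s) = root (char_poly AC) z.
Proof. by rewrite char_poly_eigenvalues root_prod_XsubC. Qed.

Lemma eigenvalues_sorted i j : (i <= j)%N -> (j < k.+1)%N -> Re s`_j <= Re s`_i.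
Proof.
move=> ij jk.
have tot : total (fun z w : R[i] => Re w <= Re z) by move=> z w; exact: le_total.
have tr : transitive (fun z w : R[i] => Re w <= Re z).
  by move=> y z w H1 H2; exact: le_trans H2 H1.
have := sort_sorted tot (sval (closed_field_poly_normal (char_poly AC))).
rewrite -/(eigenvalues A) -/s => /(sorted_leq_nth tr (fun z => lexx (Re z))) H.
by apply: (H 0 i j); rewrite ?inE ?size_eigenvalues// (leq_ltn_trans ij).
Qed.

(* Perron: a positive left eigenvector v bounds every eigenvalue, because
   [|z + c| sum v_i |w_i| <= (lam + c) sum v_i |w_i|] for the nonnegative matrix
   A^T + c and every eigenvector w. *)
Lemma perron_bound (v : 'rV[R]_k.+1) : (forall i, 0 < v 0 i) -> v *m A^T = lam *: v ->
  (forall i j, i != j -> 0 <= A i j) -> forall z, z \in s -> Re z <= lam.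
Proof.
move=> vp vA A0 z; rewrite mem_eigenvalues -eigenvalue_root_char => /eigenvalueP[w wA w0].
pose c := \sum_i `|A i i|.
have Ac i j : 0 <= A i j + (i == j)%:R * c.
  case: eqVneq => [<-|ij]; last by rewrite mul0r addr0 A0.
  rewrite mul1r /c (bigD1 i)//= addrA addr_ge0//.
    by rewrite addrC -lerBlDr sub0r -normrN ler_norm.
  exact: sumr_ge0.
pose nw i := complex.Re `|w 0 i|.
have nwE i : `|w 0 i| = (nw i)%:C%C by rewrite /nw RRe_real// ger0_real.
have nw0 i : 0 <= nw i by have := normr_ge0 (w 0 i); rewrite nwE ler0c.
have step j : complex.Re `|z + c%:C%C| * nw j <= \sum_i nw i * (A i j + (i == j)%:R * c).
  have E : (z + c%:C%C) * w 0 j = \sum_i w 0 i * (A i j + (i == j)%:R * c)%:C%C.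
    rewrite mulrDl -[z * _](_ : (w *m AC) 0 j = _); last by rewrite wA mxE.
    rewrite mxE (_ : c%:C%C * w 0 j = \sum_i w 0 i * ((i == j)%:R * c)%:C%C).
      rewrite -big_split/=; apply: eq_bigr => i _; rewrite mxE -mulrDr; congr (_ * _).
      by rewrite -rmorphD.
    rewrite (bigD1 j)//= eqxx mul1r big1 ?addr0 1?mulrC// => i ij.
    by rewrite (negbTE ij) mul0r rmorph0 mulr0.
  have := ler_norm_sum (index_enum _) (fun i => w 0 i * (A i j + (i == j)%:R * c)%:C%C) xpredT.
  rewrite -E normrM nwE.
  under [X in _ <= X -> _]eq_bigr => i _.
    rewrite normrM nwE (ger0_norm (_ : 0 <= (A i j + (i == j)%:R * c)%:C%C)) ?ler0c//.
    rewrite -rmorphM/=; over.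
  rewrite -rmorph_sum/= -(RRe_real (ger0_real (normr_ge0 (z + _)))) -rmorphM/= lecR.
  by [].
have S0 : 0 < \sum_j v 0 j * nw j.
  have [j wj] : exists j, w 0 j != 0.
    by apply/existsP; apply: contraR w0; rewrite negb_exists => /forallP H; apply/eqP/rowP => j; rewrite mxE; apply/eqP; rewrite -[_ == _]negbK; exact: H.
  rewrite (bigD1 j)//= ltr_wpDr//.
    by apply: sumr_ge0 => i _; rewrite mulr_ge0// ltW.
  by rewrite mulr_gt0// lt_neqAle nw0 andbT eq_sym; apply: contra wj => /eqP nwj; rewrite -normr_eq0 nwE nwj.
have main : complex.Re `|z + c%:C%C| * (\sum_j v 0 j * nw j) <= (lam + c) * (\sum_j v 0 j * nw j).
  rewrite [leLHS]mulr_sumr; apply: (@le_trans _ _ (\sum_j v 0 j * \sum_i nw i * (A i j + (i == j)%:R * c))).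
    by apply: ler_sum => j _; rewrite mulrCA ler_wpM2l// ltW.
  under eq_bigr do rewrite mulr_sumr; rewrite exchange_big/= [leRHS]mulr_sumr.
  rewrite le_eqVlt; apply/orP; left; apply/eqP; apply: eq_bigr => i _.
  have vi : \sum_j v 0 j * A i j = lam * v 0 i.
    have := congr1 (fun M : 'rV[R]_k.+1 => M 0 i) vA; rewrite !mxE => <-.
    by apply: eq_bigr => j _; rewrite mxE.
  transitivity (nw i * (\sum_j v 0 j * A i j + c * \sum_j v 0 j * (i == j)%:R)).
    rewrite mulrDr !mulr_sumr -big_split/=; apply: eq_bigr => j _; ring.
  rewrite vi (bigD1 i)//= eqxx mulr1 big1 ?addr0.
    by ring.
  by move=> j ij; rewrite eq_sym (negbTE ij) mulr0.
rewrite ler_pM2r// in main.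
have := normc_ge_Re (z + c%:C%C); rewrite -(RRe_real (ger0_real (normr_ge0 (z + _)))) lecR => H.
have := le_trans H main; rewrite raddfD/= => H2.
have := le_trans (ler_norm _) H2; lra.
Qed.

(** [lam] is an eigenvalue and no real part exceeds it. At an index above 0 it would force
    [lam <= Re s_1], against the gap, since [Re s_0 <= lam]. *)
Lemma top_eigenvalue (v : 'rV[R]_k.+1) : (forall i, 0 < v 0 i) -> v *m A^T = lam *: v ->
  (forall i j, i != j -> 0 <= A i j) -> (0 < k)%N -> Re s`_1 < Re s`_0 / 2 -> 0 < lam ->
  s`_0 = lam%:C%C /\ Re s`_1 < lam / 2.
Proof.
move=> vp vA A0 k0 gap l0.
have lams : lam%:C%C \in s.
  rewrite mem_eigenvalues -char_poly_tr -eigenvalue_root_char.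
  apply/eigenvalueP; exists (map_mx toC v).
    have -> : AC^T = map_mx toC A^T by apply/matrixP => i j; rewrite !mxE.
    by rewrite -map_mxM vA map_mxZ.
  apply/eqP => /rowP/(_ 0); rewrite !mxE => /complexI v00.
  by have := vp 0; rewrite v00 ltxx.
have s0l : Re s`_0 <= lam.
  by apply: (perron_bound vp vA A0); rewrite mem_nth// size_eigenvalues.
have [i ik si] : exists2 i, (i < k.+1)%N & s`_i = lam%:C%C.
  by exists (index lam%:C%C s); rewrite ?nth_index// -size_eigenvalues index_mem.
case: i ik si => [|i] ik si.
  by split => //; move: gap; rewrite si.
have : lam <= Re s`_1.
  rewrite -[lam]/(Re lam%:C%C) -si; exact: eigenvalues_sorted.
by lra.
Qed.

Let W i := horner_mx AC (\prod_(z <- take i.+1 s) ('X - z%:P)).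

(** Real and imaginary parts of the transposed partial products over the eigenvalues, evaluated at
    the matrix. Cayley-Hamilton makes the full product vanish, so the chain ends at rank [k]. *)
Lemma chain_exists : s`_0 = lam%:C%C ->
  exists Rr Jj : nat -> 'M[R]_k.+1, [/\ Rr 0%N = A^T - lam%:M, Jj 0%N = 0, Rr k = 0, Jj k = 0 &
  forall i, (i < k)%N ->
   A^T *m Rr i = Rr i.+1 + Re s`_i.+1 *: Rr i - Im s`_i.+1 *: Jj i /\
   A^T *m Jj i = Jj i.+1 + Re s`_i.+1 *: Jj i + Im s`_i.+1 *: Rr i].
Proof.
move=> s0; exists (fun i => map_mx (@Re R) (W i)^T), (fun i => map_mx (@Im R) (W i)^T).
have W0 : W 0 = AC - lam%:C%C%:M.
  rewrite /W (take_nth 0) ?size_eigenvalues// take0 /= big_seq1 s0.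
  by rewrite rmorphB/= horner_mx_X horner_mx_C.
have Wk : W k = 0.
  by rewrite /W take_oversize ?size_eigenvalues// -char_poly_eigenvalues Cayley_Hamilton.
have WS i : (i < k)%N -> W i.+1 = W i *m AC - s`_i.+1 *: W i.
  move=> ik; rewrite /W (take_nth 0); last by rewrite size_eigenvalues.
  rewrite big_rcons/= rmorphM/= rmorphB/= horner_mx_X horner_mx_C.
  by rewrite mulrBr -!mulmxE mul_mx_scalar.
split.
- apply/matrixP => i j; rewrite W0 !mxE raddfB/=; congr (_ - _).
  by rewrite eq_sym; case: eqP => _; rewrite ?mulr1n ?mulr0n.
- apply/matrixP => i j; rewrite W0 !mxE raddfB/=.
  by case: eqP => _; rewrite ?mulr1n ?mulr0n /= subr0.
- by apply/matrixP => i j; rewrite Wk !mxE.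
- by apply/matrixP => i j; rewrite Wk !mxE.
move=> i ik; have E a b : \sum_c W i b c * AC c a = W i.+1 b a + s`_i.+1 * W i b a.
  by rewrite (WS i ik) !mxE subrK.
split; apply/matrixP => a b; rewrite !mxE.
  transitivity (Re (\sum_c W i b c * AC c a)).
    rewrite raddf_sum/=; apply: eq_bigr => c _; rewrite !mxE.
    by case: (W i b c) => x y /=; ring.
  rewrite E raddfD/= -addrA; congr (_ + _).
  by case: (s`_i.+1) => x y; case: (W i b a) => x' y' /=.
transitivity (Im (\sum_c W i b c * AC c a)).
  rewrite raddf_sum/=; apply: eq_bigr => c _; rewrite !mxE.
  by case: (W i b c) => x y /=; ring.
rewrite E raddfD/= -addrA; congr (_ + _).
by case: (s`_i.+1) => x y; case: (W i b a) => x' y' /=; ring.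
Qed.

End ComplexChain.

(** * The eigenvalue [lam] and the limiting degree distribution *)

Section Lambda.
Variable R : realType.
Implicit Types (f : nat -> R) (l : R) (k m : nat).

(** For [l = lam f] this is the limiting proportion of nodes of degree above [m]: in the balance
    equation, a node of degree [j] moves on at rate [f j] while the population grows at rate [l]. *)
Definition pim f l m : R := \prod_(1 <= j < m.+1) (f j / (l + f j)).

(* The sum of [pim f l m] over all m >= 1, when f is constant from k on. *)
Definition Qk f k l : R := \sum_(1 <= m < k.+1) pim f l m + pim f l k * f k / l.

Definition fpos f := forall k, (1 <= k)%N -> 0 < f k.

Lemma pim0 f l : pim f l 0 = 1.
Proof. by rewrite /pim big_nil. Qed.

Lemma pimS f l m : pim f l m.+1 = pim f l m * (f m.+1 / (l + f m.+1)).
Proof. by rewrite /pim big_nat_recr. Qed.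

Lemma pim_factor f l j : fpos f -> 0 < l -> (1 <= j)%N -> 0 < f j / (l + f j) < 1.
Proof.
move=> fp l0 j1; have fj := fp j j1.
by rewrite divr_gt0 ?addr_gt0//= ltr_pdivrMr ?addr_gt0// mul1r ltrDr.
Qed.

Lemma pim_gt0 f l m : fpos f -> 0 < l -> 0 < pim f l m.
Proof.
move=> fp l0; elim: m => [|m IH]; first by rewrite pim0.
by rewrite pimS mulr_gt0//; have /andP[] := pim_factor fp l0 (ltn0Sn m).
Qed.

Lemma pim_decr f l m : fpos f -> 0 < l -> pim f l m.+1 < pim f l m.
Proof.
move=> fp l0; rewrite pimS gtr_pMr ?pim_gt0//.
by have /andP[] := pim_factor fp l0 (ltn0Sn m).
Qed.

Lemma pim_le1 f l m : fpos f -> 0 < l -> pim f l m <= 1.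
Proof.
move=> fp l0; elim: m => [|m IH]; first by rewrite pim0.
by apply: le_trans IH; apply/ltW/pim_decr.
Qed.

Lemma pim_antimono f l l' m : fpos f -> 0 < l -> l < l' -> pim f l' m <= pim f l m.
Proof.
move=> fp l0 ll'; elim: m => [|m IH]; first by rewrite !pim0.
have l'0 := lt_trans l0 ll'; have fm := fp m.+1 isT.
rewrite !pimS ler_pM ?(ltW (pim_gt0 _ _ _))//.
  by rewrite divr_ge0 ?addr_ge0 ?ltW.
by rewrite ler_pM2l// lef_pV2 ?posrE ?addr_gt0// lerD2r ltW.
Qed.

Lemma Qk_decr f k l l' : fpos f -> (1 <= k)%N -> 0 < l -> l < l' -> Qk f k l' < Qk f k l.
Proof.
move=> fp k1 l0 ll'; have l'0 := lt_trans l0 ll'.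
rewrite /Qk ler_ltD//.
  by apply: ler_sum => m _; exact: pim_antimono.
rewrite -!mulrA; apply: (@le_lt_trans _ _ (pim f l k * (f k / l'))).
  by rewrite ler_pM2r ?divr_gt0 ?fp// pim_antimono.
by rewrite ltr_pM2l ?pim_gt0// ltr_pM2l ?fp// ltf_pV2 ?posrE.
Qed.

Lemma Qk_inj f k l l' : fpos f -> (1 <= k)%N -> 0 < l -> 0 < l' -> Qk f k l = Qk f k l' -> l = l'.
Proof.
move=> fp k1 l0 l'0 E; have [ll'|ll'|//] := ltgtP l l'.
  by have := Qk_decr fp k1 l0 ll'; rewrite E ltxx.
by have := Qk_decr fp k1 l'0 ll'; rewrite E ltxx.
Qed.

Lemma QkS f k l : fpos f -> 0 < l -> constant_from f k -> Qk f k.+1 l = Qk f k l.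
Proof.
move=> fp l0 cf; rewrite /Qk big_nat_recr//= -addrA; congr (_ + _).
case: k cf => [|k] cf.
  rewrite pimS pim0 mul1r; have f1 := fp 1%N isT; rewrite (cf 1%N)// in f1 *.
  by field; rewrite !gt_eqF ?addr_gt0.
rewrite pimS (cf k.+2)//; have fk := fp k.+1 isT.
by field; rewrite !gt_eqF ?addr_gt0.
Qed.

(** Past the point where [f] is constant the series is geometric, and its closed form in [Qk]
    absorbs further terms. Hence the root depends on [f] alone. *)
Lemma Qk_const f k k' l : fpos f -> 0 < l -> constant_from f k -> (k <= k')%N -> Qk f k' l = Qk f k l.
Proof.
move=> fp l0 cf; elim: k' => [|k' IH]; first by rewrite leqn0 => /eqP->.
rewrite leq_eqVlt => /orP[/eqP->//|kk']; have kk : (k <= k')%N := kk'.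
by rewrite QkS ?IH// => m km; rewrite (cf k' kk) (cf m (leq_trans kk km)).
Qed.

Section Continuity.
Variables (T : Type) (F : set_system T) (FF : Filter F).
Variables (fs : T -> nat -> R) (ls : T -> R) (f : nat -> R) (l : R).
Hypothesis fp : fpos f.
Hypothesis l0 : 0 < l.
Hypothesis cvf : forall j, (1 <= j)%N -> (fun x => fs x j) @ F --> f j.
Hypothesis cvl : ls @ F --> l.

Lemma cvg_pim m : (fun x => pim (fs x) (ls x) m) @ F --> pim f l m.
Proof.
elim: m => [|m IH].
  by rewrite pim0; under eq_fun do rewrite pim0; exact: cvg_cst.
rewrite pimS; under eq_fun do rewrite pimS.
apply: cvgM => //; apply: cvgM; first exact: cvf.
apply: cvgV; first by rewrite gt_eqF// addr_gt0// fp.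
by apply: cvgD => //; exact: cvf.
Qed.

Lemma cvg_Qk k : (1 <= k)%N -> (fun x => Qk (fs x) k (ls x)) @ F --> Qk f k l.
Proof.
move=> k1; apply: cvgD; last first.
  apply: cvgM; last by apply: cvgV => //; rewrite gt_eqF.
  by apply: cvgM; [exact: cvg_pim|exact: cvf].
elim: {k1} k => [|k IH].
  by rewrite big_nil; under eq_fun do rewrite big_nil; exact: cvg_cst.
rewrite big_nat_recr//=; under eq_fun do rewrite big_nat_recr//=.
by apply: cvgD => //; exact: cvg_pim.
Qed.

End Continuity.

Lemma Qk_root f k : fpos f -> (1 <= k)%N -> exists2 l, 0 < l & Qk f k l = 1.
Proof.
move=> fp k1.
pose c := pim f 1 k * f k.
have c0 : 0 < c by rewrite mulr_gt0 ?pim_gt0 ?fp.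
(* Below 1, [pim f lo k] is at least [pim f 1 k], so the last term of [Qk] alone is at least
   [c / lo >= 1]. *)
pose lo := Num.min (1 / 2) c.
have lo0 : 0 < lo by rewrite lt_min c0 divr_gt0.
have lo1 : lo < 1 by rewrite gt_min ltr_pdivrMr// mul1r ltr1n.
have loc : lo <= c by rewrite ge_min lexx orbT.
(* Every factor product is at most [f 1 / hi], so [Qk] is at most [(k * f 1 + f k) / hi]. *)
pose hi := k%:R * f 1%N + f k + 1.
have f1 := fp 1%N isT; have fk := fp k k1.
have hi1 : 1 < hi by rewrite /hi ltrDr addr_gt0// mulr_gt0// ltr0n.
have lohi : lo <= hi by apply: ltW; exact: lt_trans hi1.
have Qlo : 1 <= Qk f k lo.
  apply: (@le_trans _ _ (pim f lo k * f k / lo)).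
    rewrite ler_pdivlMr// mul1r (le_trans loc)// ler_pM2r//.
    exact: pim_antimono.
  by rewrite lerDr sumr_ge0// => m _; exact/ltW/pim_gt0.
have hi0 : 0 < hi by exact: lt_trans hi1.
have pim1 m : (1 <= m)%N -> pim f hi m <= f 1%N / hi.
  elim: m => [//|m IH] _; case: m IH => [|m] IH.
    have hf : 0 < hi + f 1%N by exact: addr_gt0.
    by rewrite pimS pim0 mul1r ler_pM2l// lef_pV2 ?posrE// lerDl ltW.
  by rewrite (le_trans _ (IH isT))// ltW// pim_decr.
have Qhi : Qk f k hi <= 1.
  apply: (@le_trans _ _ (\sum_(1 <= m < k.+1) f 1%N / hi + f k / hi)).
    rewrite lerD//.
      by rewrite big_nat_cond [leRHS]big_nat_cond; apply: ler_sum => m /andP[/andP[m1 _] _]; exact: pim1.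
    by rewrite -mulrA; apply: ler_piMl; [exact/ltW/divr_gt0|exact: pim_le1].
  rewrite sumr_const_nat subn1/= -mulr_natl mulrA -mulrDl ler_pdivrMr// mul1r.
  by rewrite /hi lerDl.
have [||l] := @IVT R (Qk f k) lo hi 1 lohi.
- apply: continuous_in_subspaceT => l; rewrite inE/= in_itv/= => /andP[lol _].
  have l0 : 0 < l by exact: lt_le_trans lol.
  by apply: (@cvg_Qk R (nbhs l) _ (fun=> f) id f l fp l0 _ _ k k1) => // j _; exact: cvg_cst.
- by rewrite ge_min le_max Qlo Qhi !orbT.
rewrite in_itv/= => /andP[lol _] E; exists l => //; exact: lt_le_trans lol.
Qed.

(** The truncation [k] is quantified inside the choice, so that [lam], and with it [pdist], takes
    only [f] as argument; [lam_unique] shows that every admissible [k] gives the same root. *)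
Definition lam f : R := xget 0 [set l | 0 < l /\
  exists k, [/\ (1 <= k)%N, constant_from f k & Qk f k l = 1]].

Lemma lam_unique f k l : fpos f -> (1 <= k)%N -> constant_from f k -> 0 < l -> Qk f k l = 1 -> lam f = l.
Proof.
move=> fp k1 cf l0 Ql; apply: xget_unique; first by split => //; exists k.
move=> l' [l'0 [k' [k'1 cf' Ql']]].
have E l2 : 0 < l2 -> Qk f k l2 = Qk f k' l2.
  move=> l20; have [kk'|/ltnW k'k] := leqP k k'; first by rewrite (Qk_const fp l20 cf kk').
  by rewrite (Qk_const fp l20 cf' k'k).
by apply: (Qk_inj fp k1) => //; rewrite E// Ql' Ql.
Qed.

Lemma lamP f k : fpos f -> (1 <= k)%N -> constant_from f k -> 0 < lam f /\ Qk f k (lam f) = 1.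
Proof.
move=> fp k1 cf; have [l l0 Ql] := Qk_root fp k1.
by rewrite (lam_unique fp k1 cf l0 Ql).
Qed.

(** [Qk] is strictly decreasing in [l]: its values at [lam f - e'] and [lam f + e'] lie strictly on
    either side of 1, stay so for nearby functions, and enclose their roots. *)
Lemma cvg_lam (T : Type) (F : set_system T) (FF : Filter F) (fs : T -> nat -> R) f k :
  fpos f -> (1 <= k)%N -> constant_from f k ->
  (forall x, fpos (fs x)) -> (forall x, constant_from (fs x) k) ->
  (forall j, (1 <= j)%N -> (fun x => fs x j) @ F --> f j) ->
  (fun x => lam (fs x)) @ F --> lam f.
Proof.
move=> fp k1 cf fsp csf cvf; have [l0 Ql] := lamP fp k1 cf.
apply/cvgrPdist_le => e e0; pose e' := Num.min e (lam f / 2).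
have e'0 : 0 < e' by rewrite lt_min e0 divr_gt0.
have e'e : e' <= e by rewrite ge_min lexx.
have e'l : e' <= lam f / 2 by rewrite ge_min lexx orbT.
have lo0 : 0 < lam f - e' by lra.
have hi0 : 0 < lam f + e' by lra.
have Qlo : 1 < Qk f k (lam f - e') by rewrite -Ql Qk_decr// gtrBl.
have Qhi : Qk f k (lam f + e') < 1 by rewrite -[ltRHS]Ql Qk_decr// ltrDl.
have cvlo : (fun x => Qk (fs x) k (lam f - e')) @ F --> Qk f k (lam f - e').
  by apply: (cvg_Qk FF fp lo0 cvf _ k1); exact: cvg_cst.
have cvhi : (fun x => Qk (fs x) k (lam f + e')) @ F --> Qk f k (lam f + e').
  by apply: (cvg_Qk FF fp hi0 cvf _ k1); exact: cvg_cst.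
have Nlo := cvgr_gt _ cvlo _ Qlo.
have Nhi := cvgr_lt _ cvhi _ Qhi.
apply: filterS2 (Nlo FF) (Nhi FF) => x Hlo Hhi.
have [lx0 Qlx] := lamP (fsp x) k1 (csf x).
have H1 : lam f - e' <= lam (fs x).
  rewrite leNgt; apply/negP => H; have := Qk_decr (fsp x) k1 lx0 H.
  by rewrite Qlx; move: Hlo => /= ? ?; lra.
have H2 : lam (fs x) <= lam f + e'.
  rewrite leNgt; apply/negP => H; have := Qk_decr (fsp x) k1 hi0 H.
  by rewrite Qlx; move: Hhi => /= ? ?; lra.
by rewrite ler_distl; apply/andP; split; lra.
Qed.

Definition pdist f (k : nat) : R := pim f (lam f) k.-1 - pim f (lam f) k.

Lemma cvg_pim0 f l k : fpos f -> 0 < l -> constant_from f k -> (1 <= k)%N -> pim f l @ \oo --> (0 : R).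
Proof.
move=> fp l0 cf k1; pose r := f k / (l + f k).
have /andP[r0 r1] := pim_factor fp l0 k1.
have E m : pim f l (m + k) = pim f l k * r ^+ m.
  elim: m => [|m IH]; first by rewrite expr0 mulr1.
  by rewrite addSn pimS IH (cf (m + k).+1 (leqW (leq_addl m k))) exprSr [RHS]mulrA.
rewrite -(cvg_shiftn k); under eq_fun do rewrite E.
have H : (fun m => pim f l k * r ^+ m) @ \oo --> pim f l k * 0.
  by apply: cvgMl_tmp; apply: cvg_expr; rewrite ger0_norm ?ltW.
by move: H; rewrite mulr0.
Qed.

Lemma pdist_sum f m n : (m <= n)%N -> \sum_(m.+1 <= k < n.+1) pdist f k = pim f (lam f) m - pim f (lam f) n.
Proof.
elim: n => [|n IH]; first by rewrite leqn0 => /eqP->; rewrite big_geq ?subrr.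
rewrite leq_eqVlt => /orP[/eqP->|mn]; first by rewrite big_geq ?subrr.
by rewrite big_nat_recr/= ?IH// /pdist /= ?subrKA.
Qed.

Lemma pdist_distribution f k : fpos f -> (1 <= k)%N -> constant_from f k -> is_distribution (pdist f).
Proof.
move=> fp k1 cf; have [l0 Ql] := lamP fp k1 cf.
split=> [[//|j] _|]; first by rewrite subr_ge0 ltW// pim_decr.
rewrite -(cvg_shiftS (fun n => \sum_(1 <= k0 < n) pdist f k0)).
rewrite (_ : [sequence _]_n = fun n => 1 - pim f (lam f) n); last first.
  by apply/funext => n /=; rewrite (pdist_sum _ (leq0n _)) pim0.
by have := cvgB (cvg_cst (1 : R)) (cvg_pim0 fp l0 cf k1); rewrite subr0; exact.
Qed.

Lemma pdist_tail f k : fpos f -> (1 <= k)%N -> constant_from f k -> tail (pdist f) k = pim f (lam f) k.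
Proof.
move=> fp k1 cf; have [l0 Ql] := lamP fp k1 cf.
apply: cvg_lim => //.
rewrite -(cvg_shiftn k.+1).
rewrite (_ : [sequence _]_n = fun n => pim f (lam f) k - pim f (lam f) (n + k)); last first.
  by apply/funext => n /=; rewrite addnS pdist_sum ?leq_addl.
have H : (fun n => pim f (lam f) (n + k)) @ \oo --> (0 : R).
  by rewrite (cvg_shiftn k (pim f (lam f))); exact: cvg_pim0 cf k1.
by have := cvgB (cvg_cst (pim f (lam f) k)) H; rewrite subr0; exact.
Qed.

End Lambda.

Section SpectralData.
Variables (R : realType) (f : nat -> R) (k : nat).
Hypothesis k1 : (1 <= k)%N.
Hypothesis fp : fpos f.
Hypothesis cf : constant_from f k.
Let l := lam f.
Let l0 : 0 < l := (lamP fp k1 cf).1.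
Let Ql : Qk f k l = 1 := (lamP fp k1 cf).2.

Definition act : 'rV[R]_k.+1 := \row_j f j.+1.

Definition At : 'M[R]_k.+1 := (A_mx f k)^T.

Definition nxt (j : 'I_k.+1) : 'I_k.+1 := inord (minn j.+1 k).

(** The change of the urn when a node of class [j] is chosen: a new leaf in class 0, and one node
    moved up. Class [j < k] means degree [j + 1]; class [k] collects all larger degrees and is never
    left. *)
Definition Del (j : 'I_k.+1) : 'rV[R]_k.+1 :=
  delta_mx 0 0 + delta_mx 0 (nxt j) - delta_mx 0 j.

Definition vrow : 'rV[R]_k.+1 := \row_j (if (j < k)%N then pdist f j.+1 else pim f l k).

Lemma nxtE (j : 'I_k.+1) : nxt j = minn j.+1 k :> nat.
Proof. by rewrite inordK// ltnS geq_minr. Qed.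

Lemma row_At j : row j At = f j.+1 *: Del j.
Proof.
apply/rowP => i; rewrite !mxE/= !eqSS/= -!val_eqE/= nxtE /=.
have jk := ltn_ord j; have ik := ltn_ord i; rewrite ltnS in jk ik.
have [i0|i0] := posnP i.
  rewrite i0 /= [(0 == minn _ _)%N](_ : _ = false); last by apply/eqP; lia.
  rewrite addr0; case: (posnP j) => [->|j0] /=; first by rewrite subrr mulr0.
  by rewrite !ltnS j0 (_ : (0 == j)%N = false) ?subr0 ?mulr1//; apply/eqP; lia.
have i0' : (i == 0 :> nat) = false by apply/eqP; lia.
rewrite ?i0' !ltnS i0 /= add0r.
have [ij|ij] := eqVneq (j.+1) (i : nat).
  rewrite -ij (_ : (j.+1 == minn j.+1 k)%N = true); last by apply/eqP; lia.
  by rewrite (_ : (j.+1 == j)%N = false) ?subr0 ?mulr1//; apply/eqP; lia.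
have [ij'|ij'] := eqVneq (j : nat) i.
  rewrite -ij' ?andbT; have [jk'|jk'] := ltnP j k.
    rewrite (_ : (nat_of_ord j == minn j.+1 k)%N = false) ?sub0r ?mulrN1//; apply/eqP; lia.
  rewrite (_ : (nat_of_ord j == minn j.+1 k)%N = true) ?subrr ?mulr0//; apply/eqP; lia.
rewrite (_ : (i == minn j.+1 k :> nat)%N = false); last by apply/eqP; lia.
by rewrite subrr mulr0 andbF.
Qed.

Lemma mul_At x : x *m At = \sum_j (x 0 j * f j.+1) *: Del j.
Proof. by rewrite mulmx_sum_row; apply: eq_bigr => j _; rewrite row_At scalerA. Qed.

Lemma Del_sum j : dotv (Del j) (const_mx 1) = 1.
Proof.
by rewrite dotvC !dotvDr dotvNr !dotv_delta !mxE addrK.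
Qed.

Lemma mul_At_sum x : dotv (x *m At) (const_mx 1) = dotv x act.
Proof.
rewrite mul_At dotvC dotv_sumr; apply: eq_bigr => j _.
by rewrite dotvZr dotvC Del_sum mulr1 mxE.
Qed.

Lemma mul_At_coord (x : 'rV[R]_k.+1) i : (0 < i <= k)%N -> (x *m At) 0 (inord i) =
  x 0 (inord i.-1) * f i - (i < k)%N%:R * (x 0 (inord i) * f i.+1).
Proof.
move=> /andP[i0 ik].
have i'k : (i.-1 < k.+1)%N by lia.
have ik1 : (i < k.+1)%N by lia.
have E (j : 'I_k.+1) : (Del j) 0 (inord i) = (j == inord i.-1)%:R - (i < k)%N%:R * (j == inord i)%:R :> R.
  rewrite !mxE/= -!val_eqE/= nxtE !inordK//.
  rewrite (_ : (i == 0)%N = false) ?add0r; last by apply/eqP; lia.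
  have jk := ltn_ord j; rewrite ltnS in jk.
  have [ik'|ik'] := ltnP i k.
    rewrite mul1r [(i == j :> nat)%N]eq_sym; congr ((_ : bool)%:R - _).
    by apply/eqP/eqP; lia.
  rewrite mul0r subr0.
  have -> : i = k by lia.
  have [jE|jk'] := eqVneq (j : nat) k.
    rewrite jE (_ : (k == minn k.+1 k)%N = true); last by apply/eqP; lia.
    by rewrite ?eqxx subrr (_ : (k == k.-1)%N = false)//; apply/eqP; lia.
  rewrite subr0.
  by congr ((_ : bool)%:R); apply/eqP/eqP; lia.
rewrite mul_At summxE.
under eq_bigr => j _ do rewrite mxE E mulrBr.
rewrite sumrB; congr (_ - _).
  by rewrite (bigD1 (inord i.-1))//= eqxx mulr1 big1 ?addr0 ?(inordK i'k) ?(prednK i0)// => j /negbTE->; rewrite mulr0.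
rewrite (bigD1 (inord i))//= eqxx mulr1 big1 ?addr0 ?inordK//; first by rewrite mulrC.
by move=> j /negbTE->; rewrite !mulr0.
Qed.

Lemma vrow_gt0 j : 0 < vrow 0 j.
Proof. by rewrite mxE; case: ifP => _; rewrite ?pim_gt0// subr_gt0 pim_decr. Qed.

Lemma vrow_sum : dotv vrow (const_mx 1) = 1.
Proof.
rewrite /dotv; under eq_bigr do rewrite !mxE mulr1.
rewrite big_ord_recr/= ltnn; under eq_bigr => i _ do rewrite ltn_ord.
have := pdist_sum f (leq0n k); rewrite pim0 big_add1/= big_mkord => ->.
by rewrite subrK.
Qed.

Lemma pdist_pim j : pdist f j.+1 * f j.+1 = l * pim f l j.+1.
Proof.
rewrite /pdist /= -/l pimS; have := fp (ltn0Sn j) => fj.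
by field; rewrite gt_eqF// addr_gt0.
Qed.

Lemma vrow_act : dotv vrow act = l.
Proof.
rewrite /dotv; under eq_bigr do rewrite !mxE.
rewrite big_ord_recr/= ltnn; under eq_bigr => i _ do rewrite ltn_ord pdist_pim.
rewrite -mulr_sumr (cf (leqnSn k)).
have := Ql; rewrite /Qk big_add1/= big_mkord => Q.
have -> : pim f l k * f k = l * (pim f l k * f k / l) by field; rewrite gt_eqF.
by rewrite -mulrDr Q mulr1.
Qed.

(** Coordinate 0 receives contributions from all classes; comparing total masses instead leaves only
    the two-term balances of [mul_At_coord] to check. *)
Lemma row_eq_of_sum (x y : 'rV[R]_k.+1) : dotv x (const_mx 1) = dotv y (const_mx 1) ->
  (forall i, (0 < i <= k)%N -> x 0 (inord i) = y 0 (inord i)) -> x = y.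
Proof.
rewrite /dotv !big_ord_recl => S H.
have E (i : 'I_k) : x 0 (lift ord0 i) = y 0 (lift ord0 i).
  rewrite -(inord_val (lift ord0 i)); apply: H; rewrite lift0; exact: ltn_ord.
apply/rowP => i; have [->|i0] := eqVneq i ord0.
  move: S; under eq_bigr do rewrite E.
  by move=> /addIr; rewrite !mxE !mulr1.
by rewrite -(inord_val i); apply: H; rewrite lt0n i0 -ltnS ltn_ord.
Qed.

Lemma vrow_At : vrow *m At = l *: vrow.
Proof.
apply: row_eq_of_sum.
  by rewrite mul_At_sum vrow_act dotvZl vrow_sum mulr1.
move=> i ik; have /andP[i0 ik'] := ik; rewrite mul_At_coord// !mxE.
have i'k : (i.-1 < k)%N by lia.
rewrite !inordK//; last by lia.
rewrite i'k prednK//.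
have -> : pdist f i * f i = l * pim f l i by case: (i) i0 => // m _; exact: pdist_pim.
have [ik2|ik2] := ltnP i k.
  rewrite mul1r pdist_pim /pdist /= -/l; ring.
have -> : i = k by lia.
by rewrite mul0r subr0.
Qed.

(** The balance equations for the coordinates [i > 0] determine each from the preceding one, so
    every eigenvector is a multiple of [vrow], whose mass is 1. *)
Lemma At_simple (x : 'rV[R]_k.+1) : x *m At = l *: x -> dotv x (const_mx 1) = 0 -> x = 0.
Proof.
move=> xA x1.
have E i : (i <= k)%N -> x 0 (inord i) * vrow 0 0 = x 0 0 * vrow 0 (inord i).
  elim: i => [_|i IH ik]; first by rewrite (_ : inord 0 = 0)//; apply/val_inj; rewrite /= inordK.
  have Ex : (x *m At) 0 (inord i.+1) = l * x 0 (inord i.+1) by rewrite xA [LHS]mxE.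
  have Ev : (vrow *m At) 0 (inord i.+1) = l * vrow 0 (inord i.+1) by rewrite vrow_At [LHS]mxE.
  rewrite mul_At_coord//= in Ex; rewrite mul_At_coord//= in Ev.
  have {IH} := IH (ltnW ik).
  set xi := x 0 (inord i) in Ex *; set xs := x 0 (inord i.+1) in Ex *.
  set vi := vrow 0 (inord i) in Ev *; set vs := vrow 0 (inord i.+1) in Ev *.
  set c : R := ((i.+1 < k)%N)%:R * f i.+2.
  have c0 : 0 <= c by rewrite mulr_ge0 ?ler0n// ltW// fp.
  have {}Ex : (l + c) * xs = xi * f i.+1 by rewrite /c mulrDl -Ex; ring.
  have {}Ev : (l + c) * vs = vi * f i.+1 by rewrite /c mulrDl -Ev; ring.
  move=> IH; have lc : l + c != 0 by rewrite gt_eqF// ltr_pwDl.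
  by apply: (mulfI lc); rewrite mulrA Ex mulrCA Ev mulrAC IH; ring.
have v0 : vrow 0 0 != 0 by rewrite gt_eqF// vrow_gt0.
have xE : x = (x 0 0 / vrow 0 0) *: vrow.
  apply/rowP => i; rewrite mxE mulrAC -(inord_val i) -E; last by rewrite -ltnS ltn_ord.
  by rewrite mulfK.
by move: x1; rewrite xE dotvZl vrow_sum mulr1 => ->; rewrite scale0r.
Qed.

(** The other eigenvector, on the side of [urow_At]: the reproductive value of a node of degree
    [j + 1], as a normalised remainder of the series [Qk]. The equation [Qk = 1] says that a leaf
    has value 1. *)
Definition urow : 'rV[R]_k.+1 :=
  \row_j ((\sum_(j.+1 <= m < k.+1) pim f l m + pim f l k * f k / l) / pim f l j).

Lemma urow_gt0 j : 0 < urow 0 j.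
Proof.
rewrite mxE divr_gt0 ?pim_gt0// ltr_wpDl ?sumr_ge0//; first by move=> m _; exact/ltW/pim_gt0.
by rewrite divr_gt0// mulr_gt0 ?pim_gt0 ?fp.
Qed.

Lemma urow_At (j : 'I_k.+1) : f j.+1 * dotv (Del j) urow = l * urow 0 j.
Proof.
rewrite dotvC !dotvDr dotvNr !dotv_delta.
have -> : urow 0 0 = 1 by rewrite mxE /= pim0 divr1; exact: Ql.
have jk := ltn_ord j; rewrite ltnS leq_eqVlt in jk; case/orP: jk => [/eqP jk|jk].
  have -> : urow 0 (nxt j) = urow 0 j.
    by congr (urow 0 _); apply/val_inj; rewrite /= nxtE jk; lia.
  rewrite addrK mulr1 mxE jk big_geq// add0r (cf (leqnSn k)).
  by field; rewrite !gt_eqF// pim_gt0.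
have fj := fp (ltn0Sn j).
have -> : urow 0 (nxt j) = (\sum_(j.+2 <= m < k.+1) pim f l m + pim f l k * f k / l) / pim f l j.+1.
  by rewrite mxE nxtE (minn_idPl jk).
rewrite mxE (big_ltn (_ : (j.+1 < k.+1)%N))//.
set S := \sum_(_ <= _ < _) _; set c := _ * _ / l.
rewrite pimS; have := pim_gt0 j fp l0.
by move=> pj; field; rewrite !gt_eqF ?addr_gt0.
Qed.

Lemma act1 : const_mx 1 *m At^T = act.
Proof.
apply/rowP => j; have <- : dotv (row j At) (const_mx 1) = act 0 j.
  by rewrite row_At dotvZl Del_sum mulr1 mxE.
by rewrite mxE; apply: eq_bigr => i _; rewrite !mxE mulrC.
Qed.

Definition Bmx : 'M[R]_k.+1 := At - act^T *m vrow.

Lemma mul_Bmx x : x *m Bmx = x *m At - dotv x act *: vrow.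
Proof.
rewrite /Bmx mulmxBr mulmxA; congr (_ - _).
rewrite (_ : x *m act^T = (dotv x act)%:M) ?mul_scalar_mx//.
by rewrite [LHS]mx11_scalar; congr _%:M; rewrite mxE; apply: eq_bigr => i _; rewrite mxE.
Qed.

Lemma A_mx_offdiag_ge0 i j : i != j -> 0 <= A_mx f k i j.
Proof.
move=> ij; rewrite mxE /=; case: ifP => _; first by apply/ltW/fp.
case: ifP => [/andP[i2 _]|_]; first by apply/ltW/fp; lia.
rewrite [X in if X then _ else _](_ : _ = false)//; apply/negbTE/negP => /and3P[_ _ /eqP[ji]].
by move/eqP: ij; apply; apply/val_inj.
Qed.

Lemma spectral_package : spectral_gap f k -> exists (G : 'M[R]_k.+1) (b : R),
  [/\ G^T = G, forall x, x != 0 -> 0 < bil G x x, 0 <= b, b < l / 2 &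
      forall x, bil G (x *m Bmx) x <= b * bil G x x].
Proof.
move=> gap.
have [s0 s1] := top_eigenvalue vrow_gt0 vrow_At A_mx_offdiag_ge0 k1 gap l0.
have [Rr [Jj [R0 J0 Rk Jk RJ]]] := chain_exists s0.
set s := eigenvalues (A_mx f k) in s0 s1 RJ.
pose rho := complex.Re s`_1.
(* Half of the gap is spent on the coupling in the chain, the other half keeps [rho + e] below
   [l / 2]. *)
pose e := (l / 2 - rho) / 2.
have e0 : 0 < e by rewrite divr_gt0// subr_gt0.
have Re_le i : (i < k)%N -> complex.Re s`_i.+1 <= rho.
  by move=> ik; apply: eigenvalues_sorted.
exists (chain_form k Rr Jj (e ^- 2)), (Num.max 0 (rho + e)); split.
- exact: chain_form_sym.
- move=> x; apply: (@chain_form_pos _ _ k At l Rr Jj) => //.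
  + exact: At_simple.
  + by rewrite invr_gt0 exprn_gt0.
- by rewrite le_max lexx.
- by rewrite gt_max divr_gt0//= /e; lra.
move=> x; apply: (@chain_lyapunov _ _ k At Bmx vrow act l rho Rr Jj
  (fun i => complex.Re s`_i.+1) (fun i => complex.Im s`_i.+1)) => //.
- exact: vrow_At.
- exact: vrow_sum.
- exact: act1.
- by move=> i ik; have [] := RJ i ik.
- by move=> i ik; have [] := RJ i ik.
- by rewrite le_max lexx.
- by rewrite le_max lexx orbT.
Qed.

End SpectralData.

(** * The urn of degree counts *)

Section Counts.
Variables (R : realType) (f : nat -> R) (k : nat).
Hypothesis k1 : (1 <= k)%N.
Hypothesis fp : fpos f.
Hypothesis cf : constant_from f k.
Implicit Types (h : nat -> nat) (X : 'rV[R]_k.+1).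
Local Notation act := (act f k).
Local Notation Del := (@Del R k).
Local Notation vrow := (vrow f k).

Definition clr (d : nat) : 'I_k.+1 := inord (minn d.-1 k).

Definition Xn h n : 'rV[R]_k.+1 := \sum_(1 <= i < n.+1) delta_mx 0 (clr (deg h i n)).

Lemma clrE d : clr d = minn d.-1 k :> nat.
Proof. by rewrite inordK// ltnS geq_minr. Qed.

(** The place where constancy of [f] matters for the urn: all nodes in the top class have the same
    weight [f k]. *)
Lemma act_clr d : (1 <= d)%N -> act 0 (clr d) = f d.
Proof.
move=> d1; rewrite mxE clrE; have [dk|kd] := leqP d k.
  by rewrite (minn_idPl _) ?prednK// (leq_trans (leq_pred d)).
have [dk|dk] := ltnP d.-1 k.
  by rewrite prednK.
by rewrite (cf (leqnSn k)) (cf (ltnW kd)).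
Qed.

Lemma Xn_ge0 h n j : 0 <= Xn h n 0 j.
Proof. by rewrite summxE; apply: sumr_ge0 => i _; rewrite mxE ler0n. Qed.

Lemma Xn_sum h n : dotv (Xn h n) (const_mx 1) = n%:R.
Proof.
rewrite dotvC dotv_sumr; under eq_bigr do rewrite dotv_delta mxE.
by rewrite sumr_const_nat subn1.
Qed.

Lemma Xn_act h n : dotv (Xn h n) act = pa_weight f h n.
Proof.
rewrite dotvC dotv_sumr; apply: eq_bigr => i _.
by rewrite dotv_delta act_clr.
Qed.

Lemma deg_upd h n i j : (1 <= n)%N -> deg (upd h n i) j n.+1 = (deg h j n + (i == j))%N.
Proof.
move=> n1; rewrite /deg big_nat_recr//= addnA; congr (1 + _ + _)%N.
  by apply: eq_big_nat => m /andP[_ mn]; rewrite /upd (ltn_eqF mn).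
by rewrite /upd eqxx.
Qed.

Lemma deg_new h n i j : (1 <= n)%N -> valid n.-1 h -> (i <= n)%N -> (n < j)%N -> deg h j n = 1%N.
Proof.
move=> n1 vh ilen nj; rewrite /deg big_nat_cond big1 ?addn0// => m /andP[/andP[m1 mn] _].
have mn' : (m <= n.-1)%N by lia.
have /andP[_ hm] := vh m (introT andP (conj m1 mn')).
by apply/eqP; rewrite eqb0; apply/eqP; lia.
Qed.

Lemma Xn_upd h n i : (1 <= n)%N -> valid n.-1 h -> (1 <= i <= n)%N ->
  Xn (upd h n i) n.+1 = Xn h n + Del (clr (deg h i n)).
Proof.
move=> n1 vh /andP[i1 ilen]; rewrite /Xn big_nat_recr//=.
rewrite deg_upd// (deg_new n1 vh ilen (ltnSn n)) (ltn_eqF (_ : (i < n.+1)%N))// addn0.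
rewrite (_ : clr 1 = 0); last by apply/val_inj; rewrite /= clrE min0n.
have E j : (1 <= j < n.+1)%N -> delta_mx 0 (clr (deg (upd h n i) j n.+1)) =
   delta_mx 0 (clr (deg h j n)) + (if j == i then delta_mx 0 (nxt (clr (deg h j n))) - delta_mx 0 (clr (deg h j n)) else 0) :> 'rV[R]_k.+1.
  move=> _; rewrite deg_upd// [(i == j)%N]eq_sym; case: eqP => _; last by rewrite addn0 addr0.
  rewrite addrC subrK; congr (delta_mx 0 _); apply/val_inj; rewrite /= nxtE !clrE.
  by rewrite /deg; lia.
rewrite (eq_big_nat _ _ E) big_split/= -addrA; congr (_ + _).
rewrite (bigD1_seq i) ?iota_uniq ?mem_index_iota ?i1//= eqxx big1 ?addr0 => [|j /negbTE->//].
by rewrite addrC addrA.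
Qed.

Lemma Xn_coord h n j : Xn h n 0 j = \sum_(1 <= i < n.+1) (clr (deg h i n) == j)%:R.
Proof. by rewrite summxE; apply: eq_bigr => i _; rewrite mxE eqxx/= eq_sym. Qed.

Definition jump_prob X (j : 'I_k.+1) : R := X 0 j * f j.+1 / dotv X act.

(** Nodes of one class have equal weight and cause the same change, so the step of the tree lumps to
    a Markov step of the urn. *)
Lemma pa_step_Xn h n (phi : 'rV[R]_k.+1 -> R) : (1 <= n)%N -> valid n.-1 h ->
  pa_step f n (fun h' => phi (Xn h' n.+1)) h =
  \sum_j jump_prob (Xn h n) j * phi (Xn h n + Del j).
Proof.
move=> n1 vh; rewrite /pa_step /jump_prob.
transitivity (\sum_(1 <= i < n.+1) \sum_j (clr (deg h i n) == j)%:R * (f j.+1 / dotv (Xn h n) act * phi (Xn h n + Del j))).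
  apply: eq_big_nat => i /andP[i1 ilen]; rewrite ltnS in ilen.
  rewrite Xn_upd ?i1// (bigD1 (clr (deg h i n)))//= eqxx mul1r big1 ?addr0.
    by rewrite /pa_prob Xn_act -(act_clr (d := deg h i n))// [act 0 _]mxE.
  by move=> j /negbTE; rewrite eq_sym => ->; rewrite mul0r.
rewrite exchange_big/=; apply: eq_bigr => j _.
by rewrite -mulr_suml -Xn_coord !mulrA.
Qed.

Lemma EH_Xn_step n (phi : 'rV[R]_k.+1 -> R) :
  EH f n.+1 (fun h => phi (Xn h n.+2)) =
  EH f n (fun h => \sum_j jump_prob (Xn h n.+1) j * phi (Xn h n.+1 + Del j)).
Proof. by rewrite /=; apply: (EH_eq fp) => h vh; rewrite pa_step_Xn. Qed.

Lemma deg_le h i n : (1 <= n)%N -> (deg h i n <= n)%N.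
Proof.
move=> n1; rewrite /deg -{2}(prednK n1) add1n ltnS.
have : (\sum_(1 <= m < n) (h m == i) <= \sum_(1 <= m < n) 1)%N by apply: leq_sum => m _; exact: leq_b1.
by rewrite sum_nat_const_nat muln1 subn1.
Qed.

Lemma deg_count_Xn h n (j : 'I_k.+1) : (j < k)%N -> (deg_count h j.+1 n)%:R = Xn h n 0 j.
Proof.
move=> jk; rewrite Xn_coord /deg_count natr_sum; apply: eq_bigr => i _; congr (nat_of_bool _)%:R.
rewrite -val_eqE/= clrE /deg.
by apply/eqP/eqP; lia.
Qed.

Lemma deg_count_gt h l n : (1 <= n)%N -> (n < l)%N -> deg_count h l n = 0%N.
Proof.
move=> n1 nl; rewrite /deg_count big1// => i _; apply/eqP; rewrite eqb0.
by have := deg_le h i n1; lia.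
Qed.

Lemma deg_count_tail h n : (1 <= n)%N -> tail (@deg_prop R h n) k = Xn h n 0 ord_max / n%:R.
Proof.
move=> n1; apply: cvg_lim => //; apply: cvg_near_cst; exists (n + k).+1 => // N /= nN.
rewrite /deg_prop -mulr_suml Xn_coord; congr (_ / _).
rewrite -natr_sum /deg_count exchange_big/= natr_sum; apply: eq_bigr => i _.
rewrite -val_eqE/= clrE; have d1 : (0 < deg h i n)%N by [].
have dn := deg_le h i n1.
have [dk|kd] := leqP (deg h i n) k.
  rewrite (_ : (minn _ _ == k)%N = false); last by apply/eqP; lia.
  by rewrite big_nat_cond big1// => l /andP[/andP[lk _] _]; apply/eqP; rewrite eqb0; apply/eqP; lia.
rewrite (_ : (minn _ _ == k)%N = true); last by apply/eqP; lia.
rewrite (bigD1_seq (deg h i n)) ?iota_uniq ?mem_index_iota//=; last by apply/andP; split; lia.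
by rewrite eqxx big1 ?addn0// => l; rewrite eq_sym => /negbTE->.
Qed.

Definition Dn h n : 'rV[R]_k.+1 := Xn h n - n%:R *: vrow.

Lemma finite_fluctuations_Dn h n : (1 <= n)%N ->
  finite_fluctuations (pdist f) k h n = (Num.sqrt n%:R)^-1 *: Dn h n.
Proof.
move=> n1; have n0 : 0 < n%:R :> R by rewrite ltr0n.
have sn : Num.sqrt n%:R * Num.sqrt n%:R = n%:R :> R by rewrite -expr2 sqr_sqrtr// ltW.
have s0 : Num.sqrt (n%:R : R) != 0 by rewrite gt_eqF// sqrtr_gt0.
have E (x y : R) : Num.sqrt n%:R * (x / n%:R - y) = (Num.sqrt n%:R)^-1 * (x - n%:R * y).
  by move: s0 sn; set s := Num.sqrt _ => s0 <-; field.
apply/rowP => j; rewrite !mxE -E.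
case: ifPn => jk; first by rewrite /deg_prop deg_count_Xn// Xn_coord.
have -> : j = ord_max by apply/val_inj => /=; have := ltn_ord j; lia.
by rewrite deg_count_tail// pdist_tail// Xn_coord.
Qed.

End Counts.

(** * Second moments of the urn *)

Section State.
Variables (R : realType) (f : nat -> R) (k : nat).
Hypothesis k1 : (1 <= k)%N.
Hypothesis fp : fpos f.
Hypothesis cf : constant_from f k.
Implicit Types (X y : 'rV[R]_k.+1) (n : nat).
Local Notation act := (act f k).
Local Notation Del := (@Del R k).
Local Notation vrow := (vrow f k).
Local Notation urow := (urow f k).
Local Notation jump := (@jump_prob R f k).
Local Notation Bmx := (Bmx f k).
Let l := lam f.
Let l0 : 0 < l := (lamP fp k1 cf).1.

Definition state n X := (forall j, 0 <= X 0 j) /\ dotv X (const_mx 1) = n%:R.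

Definition xi (j : 'I_k.+1) : 'rV[R]_k.+1 := Del j - vrow.

Lemma state_Xn h n : state n (Xn R k h n).
Proof. by split; [exact: Xn_ge0|exact: Xn_sum]. Qed.

Lemma dotv_upper X y n : state n X -> (forall j, 0 <= y 0 j) -> dotv X y <= n%:R * dotv y (const_mx 1).
Proof.
move=> [X0 X1] y0; rewrite -X1 (dotvC y) /dotv mulr_suml; apply: ler_sum => i _.
rewrite mxE mulr1 ler_wpM2l// (bigD1 i)//= mxE mul1r lerDl.
by apply: sumr_ge0 => j _; rewrite mxE mul1r.
Qed.

Lemma dotv_lower y : (forall j, 0 < y 0 j) -> exists2 c, 0 < c & forall X n, state n X -> c * n%:R <= dotv X y.
Proof.
move=> yp; pose S := \sum_j (y 0 j)^-1.
have S0 : 0 < S.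
  by rewrite /S (bigD1 ord0)//= ltr_pwDl ?invr_gt0// sumr_ge0// => j _; rewrite invr_ge0 ltW.
exists S^-1 => [|X n [X0 <-]]; first by rewrite invr_gt0.
rewrite dotvC /dotv mulr_sumr [leRHS](eq_bigr (fun j => y 0 j * X 0 j)); last by move=> j _; rewrite mulrC.
apply: ler_sum => j _; rewrite mxE mul1r ler_wpM2r//.
rewrite -[leRHS]invrK lef_pV2 ?posrE ?invr_gt0//.
by rewrite /S (bigD1 j)//= lerDl sumr_ge0// => i _; rewrite invr_ge0 ltW.
Qed.

Lemma act_gt0 j : 0 < act 0 j.
Proof. by rewrite mxE fp. Qed.

Lemma weight_gt0 X n : (1 <= n)%N -> state n X -> 0 < dotv X act.
Proof.
move=> n1; have [c c0 H] := dotv_lower act_gt0; move=> /H; apply: lt_le_trans.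
by rewrite mulr_gt0// ltr0n.
Qed.

Lemma jump_ge0 X n j : (1 <= n)%N -> state n X -> 0 <= jump X j.
Proof.
move=> n1 st; rewrite /jump_prob divr_ge0 ?mulr_ge0 ?st.1 ?(ltW (fp _))//.
exact/ltW/(weight_gt0 n1 st).
Qed.

Lemma jump_sum X n : (1 <= n)%N -> state n X -> \sum_j jump X j = 1.
Proof.
move=> n1 st; rewrite /jump_prob -mulr_suml -[X in X / _](_ : dotv X act = _).
  by rewrite mulfV// gt_eqF// (weight_gt0 n1 st).
by apply: eq_bigr => j _; rewrite mxE.
Qed.

Lemma mul_Bmx_centered X n : state n X ->
  (X - n%:R *: vrow) *m Bmx = X *m At f k - dotv X act *: vrow.
Proof.
move=> st; rewrite mul_Bmx mulmxBl -scalemxAl (vrow_At k1 fp cf) dotvDl dotvNl dotvZl (vrow_act k1 fp cf) -/l.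
apply/rowP => i; rewrite !mxE; ring.
Qed.

(** Exact, with no linearisation: subtracting [vrow] from each jump turns [At] into [Bmx], and [Bmx]
    ignores the multiple [n%:R *: vrow]. Only the random denominator remains to be approximated. *)
Lemma jump_mean X n y : (1 <= n)%N -> state n X ->
  \sum_j jump X j * dotv (xi j) y = dotv ((X - n%:R *: vrow) *m Bmx) y / dotv X act.
Proof.
move=> n1 st; have V0 := weight_gt0 n1 st.
rewrite (mul_Bmx_centered st) /xi dotvDl dotvNl dotvZl.
under eq_bigr do rewrite dotvDl dotvNl mulrBr.
rewrite sumrB -mulr_suml (jump_sum n1 st) mul1r mulrBl mulrAC mulfV ?gt_eqF// mul1r; congr (_ - _).
rewrite mul_At// dotvC dotv_sumr mulr_suml; apply: eq_bigr => j _.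
by rewrite dotvZr (dotvC y) /jump_prob mulrAC.
Qed.

Lemma centered_coord_le X n j : state n X -> `|(X - n%:R *: vrow) 0 j| <= n%:R.
Proof.
move=> st; have [X0 X1] := st.
have Xj : X 0 j <= n%:R.
  rewrite -X1 -[leLHS]mulr1 /dotv (bigD1 j)//= mxE lerDl; apply: sumr_ge0 => i _.
  by rewrite mxE mulr1.
have vj : vrow 0 j <= 1.
  rewrite -(vrow_sum f k) -[leLHS]mulr1 /dotv (bigD1 j)//= [const_mx _ _ _]mxE lerDl; apply: sumr_ge0 => i _.
  by rewrite [const_mx _ _ _]mxE mulr1 ltW// vrow_gt0.
have vj0 := vrow_gt0 k1 fp cf j.
have : n%:R * vrow 0 j <= n%:R by rewrite ler_piMr.
have : 0 <= n%:R * vrow 0 j by rewrite mulr_ge0// ltW.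
have -> : (X - n%:R *: vrow) 0 j = X 0 j - n%:R * vrow 0 j by rewrite !mxE.
have := X0 j; move: vj vj0; set a := vrow 0 j => vj vj0 ? ? ?; rewrite ler_norml; apply/andP; split; lra.
Qed.

Section Form.
Variables (G : 'M[R]_k.+1) (b : R).
Hypothesis Gsym : G^T = G.
Hypothesis Gpos : forall x : 'rV[R]_k.+1, x != 0 -> 0 < bil G x x.
Hypothesis b0 : 0 <= b.
Hypothesis bl : b < l / 2.
Hypothesis GB : forall x : 'rV[R]_k.+1, bil G (x *m Bmx) x <= b * bil G x x.

Lemma form_crude : exists2 c, 0 <= c & forall X n, state n X ->
  bil G (X - n%:R *: vrow) (X - n%:R *: vrow) <= c * n%:R ^+ 2.
Proof.
exists (\sum_i \sum_j `|G i j|); first by do 2 (apply: sumr_ge0 => ? _).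
move=> X n st; rewrite bilE mulr_suml; apply: ler_sum => i _.
rewrite mulr_suml; apply: ler_sum => j _.
rewrite (le_trans (ler_norm _))// -mulrA normrM ler_wpM2l// normrM expr2.
by rewrite ler_pM// centered_coord_le.
Qed.

(* Dividing by [dotv X urow], which grows like n, turns the growth of the
   quadratic form into boundedness; [b < lam / 2] makes the drift of the ratio
   negative. *)
Definition psi n X : R := bil G (X - n%:R *: vrow) (X - n%:R *: vrow) / dotv X urow.

(** The second-order expansion of [1 / (U + u)] is an upper bound for every [u >= 0], since the
    remainder has a sign. *)
Lemma recip_bound (U u s : R) : 0 < U -> 0 <= u -> 0 <= s ->
  s / (U + u) <= s * (U^-1 - u / U ^+ 2 + u ^+ 2 / U ^+ 3).
Proof.
move=> U0 u0 s0; rewrite ler_wpM2l// -subr_ge0.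
have -> : U^-1 - u / U ^+ 2 + u ^+ 2 / U ^+ 3 - (U + u)^-1 = u ^+ 3 / (U ^+ 3 * (U + u)).
  by field; rewrite !gt_eqF// ltr_wpDr.
by rewrite divr_ge0 ?exprn_ge0// mulr_ge0 ?exprn_ge0 ?addr_ge0// ltW.
Qed.

Lemma psi_term (g bj gj U u n Cg Cb C1 u1 m : R) : 1 <= n -> 0 < m -> m * n <= U -> 0 <= u <= u1 ->
  0 <= g <= C1 * n ^+ 2 -> 0 <= gj <= Cg -> `|2 * bj| <= Cb * n -> 0 <= g + 2 * bj + gj ->
  (g + 2 * bj + gj) / (U + u) <= g / U + 2 * bj / U - g * u / U ^+ 2 +
    (Cg / m + Cb * u1 / m ^+ 2 + (C1 + Cb + Cg) * u1 ^+ 2 / m ^+ 3) / n.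
Proof.
move=> n1 m0 mU /andP[u0 uu1] /andP[g0 gC] /andP[gj0 gjC] bC s0.
have n0 : 0 < n by lra.
have mn : 0 < m * n by exact: mulr_gt0.
have U0 : 0 < U by lra.
have u10 : 0 <= u1 by exact: le_trans uu1.
apply: le_trans (recip_bound U0 u0 s0) _.
have Cb0 : 0 <= Cb by have := le_trans (normr_ge0 _) bC; rewrite pmulr_lge0.
have iU : U^-1 <= (m * n)^-1 by rewrite lef_pV2.
have iU0 : 0 < U^-1 by rewrite invr_gt0.
have T1 : gj / U <= Cg / m / n.
  by rewrite -mulrA -invfM ler_pM// ltW.
have iU2 : U ^- 2 <= (m * n) ^- 2 by rewrite -!exprVn lerXn2r ?nnegrE ?(ltW iU0) ?invr_ge0 ?(ltW mn).
have iU3 : U ^- 3 <= (m * n) ^- 3 by rewrite -!exprVn lerXn2r ?nnegrE ?(ltW iU0) ?invr_ge0 ?(ltW mn).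
have iU20 : 0 <= U ^- 2 by rewrite invr_ge0 exprn_ge0// ltW.
have iU30 : 0 <= U ^- 3 by rewrite invr_ge0 exprn_ge0// ltW.
have T2 : - (2 * bj) * u / U ^+ 2 <= Cb * u1 / m ^+ 2 / n.
  have -> : Cb * u1 / m ^+ 2 / n = (Cb * n) * u1 * (m * n) ^- 2 by field; rewrite !gt_eqF.
  apply: (@le_trans _ _ (`|2 * bj| * u / U ^+ 2)).
    by rewrite ler_wpM2r// ler_wpM2r// -normrN ler_norm.
  by rewrite ler_pM// ?mulr_ge0// ler_pM.
have T3 : (g + 2 * bj + gj) * (u ^+ 2 / U ^+ 3) <= (C1 + Cb + Cg) * u1 ^+ 2 / m ^+ 3 / n.
  have -> : (C1 + Cb + Cg) * u1 ^+ 2 / m ^+ 3 / n = (C1 + Cb + Cg) * n ^+ 2 * (u1 ^+ 2 * (m * n) ^- 3).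
    by field; rewrite !gt_eqF.
  rewrite ler_pM//.
  - by rewrite mulr_ge0// exprn_ge0.
  - have n2 : n <= n ^+ 2 by rewrite expr2 ler_peMr// ltW.
    have n21 : 1 <= n ^+ 2 by exact: le_trans n2.
    have Cg0 : 0 <= Cg by exact: le_trans gjC.
    have := ler_wpM2l Cb0 n2; have := ler_wpM2l Cg0 n21; have := le_trans (ler_norm _) bC.
    by move: gC gjC; rewrite mulr1; lra.
  - by rewrite ler_pM ?exprn_ge0// lerXn2r.
have T4 : 0 <= gj * u / U ^+ 2 by rewrite mulr_ge0// mulr_ge0.
have -> : (g + 2 * bj + gj) * (U^-1 - u / U ^+ 2 + u ^+ 2 / U ^+ 3) =
  g / U + 2 * bj / U - g * u / U ^+ 2 + gj / U + (- (2 * bj) * u / U ^+ 2) - gj * u / U ^+ 2 +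
  (g + 2 * bj + gj) * (u ^+ 2 / U ^+ 3) by ring.
move: T1 T2 T3 T4; rewrite [X in _ -> _ -> _ -> _ -> _ <= _ + X]mulrDl [X in _ -> _ -> _ -> _ -> _ <= _ + (X + _)]mulrDl.
lra.
Qed.

(** To first order the numerator grows at relative rate at most [2 * b / V] and the denominator at
    exactly [l / V]. The weight [V] is at most [n * fmax], which turns the negative difference into
    [- c / n]; all other terms are [O(1 / n)] by [psi_term]. *)
Lemma psi_step : exists c C : R, [/\ 0 < c, c <= 1, 0 <= C & forall X n, (1 <= n)%N -> state n X ->
  \sum_j jump X j * psi n.+1 (X + Del j) <= (1 - c / n%:R) * psi n X + C / n%:R].
Proof.
have [m m0 Um] := dotv_lower (urow_gt0 k1 fp cf).
have [C1 C10 HC1] := form_crude.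
pose fmax := dotv act (const_mx 1).
have fmax0 : 0 < fmax.
  by rewrite /fmax /dotv (bigD1 ord0)//= mxE mxE mulr1 ltr_pwDl ?fp// sumr_ge0// => i _; rewrite !mxE mulr1 ltW// fp.
have lf : l <= fmax.
  rewrite /l -(vrow_act k1 fp cf) /fmax /dotv; apply: ler_sum => i _.
  rewrite [const_mx _ _ _]mxE mulrC ler_wpM2l ?(ltW (act_gt0 _))//.
  rewrite -(vrow_sum f k) -[leLHS]mulr1 /dotv (bigD1 i)//= [const_mx _ _ _]mxE lerDl; apply: sumr_ge0 => j _.
  by rewrite [const_mx _ _ _]mxE mulr1 ltW// vrow_gt0.
pose Cg := \sum_j bil G (xi j) (xi j).
have gC j : 0 <= bil G (xi j) (xi j) <= Cg.
  rewrite (Gge0 Gpos)/= /Cg (bigD1 j)//= lerDl sumr_ge0// => i _; exact: (Gge0 Gpos).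
have Cg0 : 0 <= Cg by have /andP[H /(le_trans H)] := gC ord0.
pose u1 := \sum_j dotv (Del j) urow.
have du j : dotv (Del j) urow = l * urow 0 j / f j.+1.
  have := urow_At k1 fp cf j; rewrite -/l => <-; have := fp (ltn0Sn j) => fj.
  by field; rewrite gt_eqF.
have du0 j : 0 <= dotv (Del j) urow.
  by rewrite du divr_ge0 ?mulr_ge0 ?ltW ?(urow_gt0 k1 fp cf) ?fp.
have uu1 j : 0 <= dotv (Del j) urow <= u1.
  by rewrite du0/= /u1 (bigD1 j)//= lerDl sumr_ge0.
pose Cb := C1 + Cg.
pose C := Cg / m + Cb * u1 / m ^+ 2 + (C1 + Cb + Cg) * u1 ^+ 2 / m ^+ 3.
have u10 : 0 <= u1 by rewrite /u1 sumr_ge0.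
have C0 : 0 <= C.
  by rewrite /C !addr_ge0 ?divr_ge0 ?mulr_ge0 ?exprn_ge0 ?addr_ge0 ?(ltW m0).
exists ((l - 2 * b) / fmax), C; split => //.
- by apply: divr_gt0 => //; rewrite subr_gt0 mulrC -ltr_pdivlMr.
- by rewrite ler_pdivrMr// mul1r (le_trans _ lf)// gerBl mulr_ge0.
move=> X n n1 st; set D := X - n%:R *: vrow.
have nR1 : 1 <= n%:R :> R by rewrite ler1n.
have n0 : 0 < n%:R :> R by rewrite ltr0n.
set V := dotv X act; set U := dotv X urow.
have V0 : 0 < V by exact: weight_gt0 st.
have Vf : V <= n%:R * fmax by apply: dotv_upper => // j; exact/ltW/act_gt0.
have mU : m * n%:R <= U by exact: Um.
have U0 : 0 < U by apply: lt_le_trans mU; exact: mulr_gt0.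
have gD : 0 <= bil G D D <= C1 * n%:R ^+ 2 by rewrite (Gge0 Gpos)/= HC1.
have DE j : X + Del j - n.+1%:R *: vrow = D + 1 *: xi j.
  by rewrite /D /xi; apply/rowP => i; rewrite !mxE -natr1; ring.
have term j : psi n.+1 (X + Del j) <= bil G D D / U + 2 * bil G D (xi j) / U -
    bil G D D * dotv (Del j) urow / U ^+ 2 + C / n%:R.
  have E : bil G (D + 1 *: xi j) (D + 1 *: xi j) = bil G D D + 2 * bil G D (xi j) + bil G (xi j) (xi j).
    by rewrite bil_addM// expr1n mulr1 mul1r.
  rewrite /psi DE dotvDl E; apply: psi_term => //.
    have cs := G_cauchy_schwarz Gsym Gpos D (xi j).
    have /andP[gj0 gjC] := gC j; have /andP[gD0 gDC] := gD.
    have H : (2 * bil G D (xi j)) ^+ 2 <= (Cb * n%:R) ^+ 2.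
      apply: (@le_trans _ _ (4 * ((C1 * n%:R ^+ 2) * Cg))).
        have -> : (2 * bil G D (xi j)) ^+ 2 = 4 * bil G D (xi j) ^+ 2 by ring.
        rewrite ler_wpM2l//; apply: le_trans cs _; exact: ler_pM.
      rewrite -subr_ge0 /Cb; have -> : ((C1 + Cg) * n%:R) ^+ 2 - 4 * ((C1 * n%:R ^+ 2) * Cg) = (n%:R * (C1 - Cg)) ^+ 2 by ring.
      exact: sqr_ge0.
    rewrite -[leLHS]sqrtr_sqr -[leRHS]ger0_norm ?mulr_ge0 ?addr_ge0 ?(ltW n0)//.
    by rewrite -sqrtr_sqr ler_wsqrtr.
  by rewrite -E (Gge0 Gpos).
apply: (@le_trans _ _ (\sum_j jump X j * (bil G D D / U + 2 * bil G D (xi j) / U -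
    bil G D D * dotv (Del j) urow / U ^+ 2 + C / n%:R))).
  by apply: ler_sum => j _; rewrite ler_wpM2l// (jump_ge0 _ n1 st).
have S1 : \sum_j jump X j * bil G D (xi j) = bil G (D *m Bmx) D / V.
  rewrite /bil; under eq_bigr do rewrite dotvC.
  by rewrite (jump_mean _ n1 st) -/D [in RHS]dotv_mul Gsym.
have S2 : \sum_j jump X j * dotv (Del j) urow = l * U / V.
  rewrite /U /dotv mulr_sumr mulr_suml; apply: eq_bigr => j _.
  rewrite -/(dotv (Del j) urow) du /jump_prob -/V; have := fp (ltn0Sn j) => fj.
  by field; rewrite !gt_eqF.
have -> : \sum_j jump X j * (bil G D D / U + 2 * bil G D (xi j) / U -
    bil G D D * dotv (Del j) urow / U ^+ 2 + C / n%:R) =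
  (bil G D D / U + C / n%:R) + 2 / U * (bil G (D *m Bmx) D / V) - bil G D D / U ^+ 2 * (l * U / V).
  rewrite -S1 -S2 -[X in X + _ - _]mulr1 -(jump_sum n1 st) !mulr_sumr -sumrN -!big_split/=.
  by apply: eq_bigr => j _; ring.
have HB := GB D.
have -> : psi n X = bil G D D / U by [].
have -> : bil G D D / U ^+ 2 * (l * U / V) = bil G D D / U * (l / V) by field; rewrite !gt_eqF.
have H1 : 2 / U * (bil G (D *m Bmx) D / V) <= bil G D D / U * (2 * b / V).
  have -> : bil G D D / U * (2 * b / V) = 2 / U * (b * bil G D D / V) by ring.
  by rewrite ler_wpM2l ?divr_ge0 ?(ltW U0)// ler_wpM2r ?invr_ge0 ?(ltW V0).
have H2 : bil G D D / U * ((l - 2 * b) / fmax / n%:R) <= bil G D D / U * ((l - 2 * b) / V).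
  rewrite ler_wpM2l ?divr_ge0 ?(ltW U0) ?(Gge0 Gpos)// -mulrA -invfM.
  apply: ler_wpM2l; first by rewrite subr_ge0 mulrC -ler_pdivlMr// ltW.
  by rewrite lef_pV2 ?posrE ?mulr_gt0// mulrC.
have F (p c a1 a2 a3 a4 : R) : a1 <= a3 -> a4 <= a2 - a3 -> p + c + a1 - a2 <= p - a4 + c by lra.
have E2 : bil G D D / U * ((l - 2 * b) / V) = bil G D D / U * (l / V) - bil G D D / U * (2 * b / V) by ring.
rewrite E2 in H2; apply: le_trans (F _ (C / n%:R) _ _ _ _ H1 H2) _.
by rewrite lerD2r [leRHS]mulrBl mul1r lerD2l lerN2 [leLHS]mulrC.
Qed.

Lemma second_moment : exists2 K : R, 0 <= K & forall n,
  EH f n (fun h => bil G (Dn f k h n.+1) (Dn f k h n.+1)) <= K * n.+1%:R.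
Proof.
have [c [C [c0 c1 C0 H]]] := psi_step.
have U0 X n : (1 <= n)%N -> state n X -> 0 < dotv X urow.
  have [m m0 Um] := dotv_lower (urow_gt0 k1 fp cf) => n1 /Um; apply: lt_le_trans.
  by rewrite mulr_gt0// ltr0n.
pose a n := EH f n (fun h => psi n.+1 (Xn R k h n.+1)).
(* The bound is invariant under the recursion as soon as [C <= c * K]; [c <= 1] keeps the factor
   [1 - c / n] nonnegative. *)
pose K := Num.max (a 0%N) (C / c).
have K0 : 0 <= K by rewrite le_max (divr_ge0 C0 (ltW c0)) orbT.
have aK n : a n <= K.
  elim: n => [|n IH]; first by rewrite le_max lexx.
  have [eD eZ eM e1] := EH_expect fp n.
  rewrite /a (EH_Xn_step k1 fp cf).
  have n0 : 0 < n.+1%:R :> R by [].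
  have cn : c / n.+1%:R <= 1 by rewrite ler_pdivrMr// mul1r (le_trans c1)// ler1n.
  apply: (@le_trans _ _ ((1 - c / n.+1%:R) * a n + C / n.+1%:R)).
    rewrite -eZ -(e1 (C / n.+1%:R)) -eD; apply: eM => h.
    by apply: H => //; exact: state_Xn.
  apply: (@le_trans _ _ ((1 - c / n.+1%:R) * K + C / n.+1%:R)).
    by rewrite lerD2r ler_wpM2l// subr_ge0.
  have CK : C <= c * K by rewrite mulrC -ler_pdivrMr// le_max lexx orbT.
  have : C / n.+1%:R <= c * K / n.+1%:R by rewrite ler_pM2r ?invr_gt0.
  have -> : (1 - c / n.+1%:R) * K = K - c * K / n.+1%:R by ring.
  by move=> CKn; rewrite -addrA gerDl addrC subr_le0.
pose um := dotv urow (const_mx 1).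
have um0 : 0 <= um by rewrite sumr_ge0// => j _; rewrite [const_mx _ _ _]mxE mulr1 ltW// (urow_gt0 k1 fp cf).
exists (K * um) => [|n]; first exact: mulr_ge0.
have [eD eZ eM e1] := EH_expect fp n.
have := ler_wpM2l (mulr_ge0 (ler0n R n.+1) um0) (aK n).
rewrite (_ : K * um * n.+1%:R = n.+1%:R * um * K); last by ring.
apply: le_trans; rewrite /a -eZ; apply: eM => h.
have st := state_Xn h n.+1; have Up := U0 _ _ (ltn0Sn n) st.
rewrite /psi -/(Dn f k h n.+1).
have gD := Gge0 Gpos (Dn f k h n.+1).
rewrite mulrA ler_pdivlMr// mulrC ler_wpM2r//.
by apply: dotv_upper => // j; exact/ltW/(urow_gt0 k1 fp cf).
Qed.

End Form.
End State.

(** * Central limit theorem *)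

Section Rate.
Variable R : realType.
Implicit Types (a : R) (n : nat).

(* [growth a n] is of order n^a: the expansion of the frequency along n steps. The
   condition [1/3 <= a] below makes the cubic errors summable. *)
Fixpoint growth a n : R := if n is n'.+1 then growth a n' * (1 + a / n%:R) else 1.

Lemma growth_ge1 a n : 0 <= a -> 1 <= growth a n.
Proof.
move=> a0; elim: n => [//|n IH] /=; rewrite -[leLHS]mulr1 ler_pM//.
by rewrite lerDl divr_ge0.
Qed.

Lemma growth_cube a n : 1 / 3 <= a -> n.+1%:R <= growth a n ^+ 3.
Proof.
move=> a3; have a0 : 0 <= a by lra.
elim: n => [|n IH]; first by rewrite /= expr1n.
rewrite [growth a _]/= exprMn.
have n0 : 0 < n.+1%:R :> R by [].
set x := a / n.+1%:R; have x0 : 0 <= x by rewrite divr_ge0.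
have x3 : n.+1%:R^-1 <= 3 * x by rewrite /x mulrA ler_pdivlMr// mulVf ?gt_eqF//; lra.
have H : 1 + n.+1%:R^-1 <= (1 + x) ^+ 3.
  by rewrite (le_trans (_ : _ <= 1 + 3 * x)) ?lerD2l//; nra.
apply: (@le_trans _ _ (n.+1%:R * (1 + n.+1%:R^-1))); first by rewrite mulrDr mulr1 mulfV ?gt_eqF// natr1.
by apply: ler_pM => //; rewrite addr_ge0// invr_ge0.
Qed.

Lemma growth_sqr a n : 1 / 3 <= a -> Num.sqrt n.+1%:R <= growth a n ^+ 2.
Proof.
move=> a3; have a0 : 0 <= a by lra.
have g1 := growth_ge1 n a0; have g0 : 0 <= growth a n by exact: le_trans g1.
rewrite -[leRHS]ger0_norm ?sqr_ge0// -sqrtr_sqr ler_wsqrtr// (le_trans (growth_cube n a3))//.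
by rewrite -exprM ler_weXn2l.
Qed.

(** [1 + x <= expR x], and the harmonic sum is compared with the logarithm. *)
Lemma growth_expR a n : 0 <= a -> growth a n.+1 <= expR (a * (1 + ln n.+1%:R)).
Proof.
move=> a0; elim: n => [|n IH].
  by rewrite /= ln1 addr0 mul1r divr1 mulr1 expR_ge1Dx.
rewrite -[growth a n.+2]/(growth a n.+1 * (1 + a / n.+2%:R)).
apply: (@le_trans _ _ (expR (a * (1 + ln n.+1%:R)) * expR (a / n.+2%:R))).
  apply: ler_pM => //; first exact: le_trans (growth_ge1 _ a0).
    by rewrite addr_ge0// divr_ge0.
  exact: expR_ge1Dx.
rewrite -expRD ler_expR -mulrDr ler_wpM2l// -addrA lerD2l.
have n1 : 0 < n.+1%:R :> R by [].
have n2 : 0 < n.+2%:R :> R by [].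
have : ln (1 + - n.+2%:R^-1) <= - n.+2%:R^-1 :> R.
  by apply: le_ln1Dx; rewrite ltrN2 invf_lt1// ltr1n.
have -> : 1 + - n.+2%:R^-1 = n.+1%:R / n.+2%:R :> R.
  by apply: (mulIf (lt0r_neq0 n2)); rewrite mulrBl mulVf ?gt_eqF// mulfVK ?gt_eqF// mul1r -natr1 addrK.
have -> : ln (n.+1%:R / n.+2%:R) = ln n.+1%:R - ln n.+2%:R :> R.
  by rewrite lnM ?posrE ?invr_gt0// lnV ?posrE.
have F (u v w : R) : u - v <= - w -> u + w <= v by lra.
exact: F.
Qed.

Lemma cvg_growth a : 0 <= a -> a < 1 / 2 -> (fun n => growth a n / Num.sqrt n.+1%:R) @ \oo --> 0.
Proof.
move=> a0 a12; pose d := 1 / 2 - a; have d0 : 0 < d by rewrite subr_gt0.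
rewrite -(cvg_shiftS (fun n => growth a n / Num.sqrt n.+1%:R)).
have H : (fun n => expR a * expR (- (d * ln n.+1%:R))) @ \oo --> expR a * 0.
  apply: cvgMl_tmp; apply/cvgrPdist_le => e e0.
  exists (Num.truncn (expR (- ln e / d))).+1 => // n /= nN.
  rewrite sub0r normrN ger0_norm ?expR_ge0// -[leRHS]lnK ?posrE// ler_expR lerNl mulrC -ler_pdivrMr//.
  rewrite -ler_expR lnK ?posrE// ltW// (lt_le_trans (Num.Theory.truncnS_gt _))// ler_nat.
  exact: leq_trans nN _.
rewrite mulr0 in H; apply: (squeeze_cvgr _ (cvg_cst 0) H); apply: nearW => n.
have s0 : 0 < Num.sqrt n.+2%:R :> R by rewrite sqrtr_gt0.
have s1 : 0 < Num.sqrt n.+1%:R :> R by rewrite sqrtr_gt0.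
rewrite divr_ge0 ?(le_trans _ (growth_ge1 _ a0)) ?(ltW s0)//=.
have sE : Num.sqrt n.+1%:R = expR (1 / 2 * ln n.+1%:R) :> R.
  have e0 : 0 <= expR (1 / 2 * ln n.+1%:R : R) by exact: expR_ge0.
  rewrite -[RHS]ger0_norm// -sqrtr_sqr; congr Num.sqrt.
  by rewrite expr2 -expRD -mulrDl -mulr2n -[X in X * _]mulr_natr mulfVK// mul1r lnK// posrE.
apply: (@le_trans _ _ (growth a n.+1 * (Num.sqrt n.+1%:R)^-1)).
  apply: ler_wpM2l; first exact: le_trans ler01 (growth_ge1 n.+1 a0).
  by rewrite lef_pV2 ?posrE// ler_wsqrtr// ler_nat.
rewrite ler_pdivrMr// (le_trans (growth_expR n a0))// sE -!expRD ler_expR /d le_eqVlt; apply/orP; left; apply/eqP; field.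
by [].
Qed.

(** With [s = p * x] and [p] the growth so far, [p ^+ 3 >= m] and [p ^+ 2 >= Num.sqrt m] bound the
    three error terms by [s ^+ 3 / m], [s ^+ 2 / m] and [s / m]. Expanding at rate [a] instead of
    [a'] gains at least [(a - a') / m] times each power, which covers them. *)
Lemma rate_step (a a' K p m x y : R) : 0 <= a' -> a' <= a -> 0 <= K -> 1 <= m -> 0 <= x -> 1 <= p ->
  m <= p ^+ 3 -> Num.sqrt m <= p ^+ 2 -> 0 <= y -> y <= (1 + a' / m) * x ->
  K * (p * y + (p * y) ^+ 2 + (p * y) ^+ 3) + K * (a - a') * (x ^+ 3 + x ^+ 2 / Num.sqrt m + x / m) <=
  K * (p * (1 + a / m) * x + (p * (1 + a / m) * x) ^+ 2 + (p * (1 + a / m) * x) ^+ 3).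
Proof.
move=> a'0 a'a K0 m1 x0 p1 p3 p2 y0 yx.
have m0 : 0 < m by lra.
have sm0 : 0 < Num.sqrt m by rewrite sqrtr_gt0.
have p0 : 0 < p by lra.
rewrite -mulrA -mulrDr ler_wpM2l//.
set s := p * x; have s0 : 0 <= s by rewrite mulr_ge0// ltW.
set c := a / m; set c' := a' / m.
have c'0 : 0 <= c' by rewrite divr_ge0// ltW.
have c'c : c' <= c by rewrite ler_wpM2r// invr_ge0 ltW.
have py : p * y <= (1 + c') * s by rewrite /s mulrCA ler_wpM2l// ltW.
have py0 : 0 <= p * y by rewrite mulr_ge0// ltW.
have -> : p * (1 + c) * x = (1 + c) * s by rewrite /s; ring.
have B1 : x / m <= s / m by rewrite ler_wpM2r ?invr_ge0 ?(ltW m0)// /s ler_peMl.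
have B2 : x ^+ 2 / Num.sqrt m <= s ^+ 2 / m.
  rewrite ler_pdivrMr// /s exprMn.
  have -> : p ^+ 2 * x ^+ 2 / m * Num.sqrt m = x ^+ 2 * (p ^+ 2 * Num.sqrt m / m) by ring.
  rewrite ler_peMr ?sqr_ge0// ler_pdivlMr// mul1r -[leLHS](sqr_sqrtr (ltW m0)) expr2.
  by rewrite ler_wpM2r// ltW.
have B3 : x ^+ 3 <= s ^+ 3 / m.
  rewrite /s exprMn ler_pdivlMr// mulrC; apply: ler_wpM2r => //; exact: exprn_ge0.
clearbody s.
have S2 : (p * y) ^+ 2 <= ((1 + c') * s) ^+ 2 by rewrite lerXn2r ?nnegrE// mulr_ge0// addr_ge0.
have S3 : (p * y) ^+ 3 <= ((1 + c') * s) ^+ 3 by rewrite lerXn2r ?nnegrE// mulr_ge0// addr_ge0.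
have Q1 : (c - c') * s + (1 + c') * s = (1 + c) * s by ring.
have Q2 : (c - c') * s ^+ 2 + ((1 + c') * s) ^+ 2 <= ((1 + c) * s) ^+ 2.
  rewrite !exprMn -mulrDl ler_wpM2r ?sqr_ge0//; nra.
have Q3 : (c - c') * s ^+ 3 + ((1 + c') * s) ^+ 3 <= ((1 + c) * s) ^+ 3.
  rewrite !exprMn -mulrDl; apply: ler_wpM2r; first exact: exprn_ge0.
  rewrite -subr_ge0.
  have -> : (1 + c) ^+ 3 - (c - c' + (1 + c') ^+ 3) = (c - c') * (2 + 3 * (c + c') + (c ^+ 2 + c * c' + c' ^+ 2)) by ring.
  have c0 : 0 <= c by lra.
  have cc0 : 0 <= c + c' by exact: addr_ge0.
  have cm0 : 0 <= c * c' by exact: mulr_ge0.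
  apply: mulr_ge0; first by rewrite subr_ge0.
  by apply: addr_ge0; apply: addr_ge0; rewrite ?sqr_ge0// ?mulr_ge0// addr_ge0// sqr_ge0.
have cc : c - c' = (a - a') / m by rewrite /c /c' mulrBl.
have aa : 0 <= a - a' by rewrite subr_ge0.
have W1 : (a - a') * (x / m) <= (c - c') * s.
  by rewrite cc -mulrA [m^-1 * _]mulrC ler_wpM2l.
have W2 : (a - a') * (x ^+ 2 / Num.sqrt m) <= (c - c') * s ^+ 2.
  by rewrite cc -mulrA [m^-1 * _]mulrC ler_wpM2l.
have W3 : (a - a') * x ^+ 3 <= (c - c') * s ^+ 3.
  by rewrite cc -mulrA [m^-1 * _]mulrC ler_wpM2l.
rewrite !mulrDr; lra.
Qed.

Lemma rate_induction (V : Type) (Dl : nat -> V -> R) (N : V -> R) (tr : nat -> V -> V) (a a' C r L : R) (n0 : nat) :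
  0 <= a' -> a' < a -> 1 / 3 <= a -> 0 < r -> 0 <= C -> 0 <= L -> (forall t, 0 <= N t) ->
  (forall n t, Dl n t <= 2) ->
  (forall n t, N t <= r -> Dl n.+1 t <= Dl n (tr n t) +
     C * (N t ^+ 3 + N t ^+ 2 / Num.sqrt n.+1%:R + N t / n.+1%:R)) ->
  (forall n t, (n0 <= n)%N -> N (tr n t) <= (1 + a' / n.+1%:R) * N t) ->
  (forall t, Dl n0 t <= L * (N t + N t ^+ 2)) ->
  exists2 K, 0 <= K & forall n t, (n0 <= n)%N ->
    Dl n t <= K * (growth a n * N t + (growth a n * N t) ^+ 2 + (growth a n * N t) ^+ 3).
Proof.
move=> a'0 a'a a3 r0 C0 L0 N0 D2 Dstep Ntr Dn0.
have a0 : 0 <= a by lra.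
have g1 n := growth_ge1 n a0.
have g0 n : 0 <= growth a n by exact: le_trans (g1 n).
(* One summand for each case: the start at [n0], frequencies beyond [r] where the trivial bound 2
   suffices, and the errors of the recursion. *)
pose K := L + 2 / r ^+ 3 + C / (a - a').
have d0 : 0 < a - a' by rewrite subr_gt0.
have r3 : 0 < r ^+ 3 by rewrite exprn_gt0.
have q1 : 0 <= 2 / r ^+ 3 by apply: divr_ge0 => //; exact: ltW.
have q2 : 0 <= C / (a - a') by apply: divr_ge0 => //; exact: ltW.
have KL : L <= K by rewrite /K -addrA lerDl addr_ge0.
have Kr : 2 / r ^+ 3 <= K by rewrite /K addrAC addrC lerDl addr_ge0.
have KC : C <= K * (a - a').
  by rewrite -ler_pdivrMr// /K lerDr addr_ge0// divr_ge0// ltW.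
have K0 : 0 <= K by exact: le_trans KL.
exists K => // n t; elim: n t => [|n IH] t nn0.
  move: nn0; rewrite leqn0 => /eqP n00; have := Dn0 t; rewrite n00 => /le_trans; apply.
  apply: ler_pM => //; first by rewrite addr_ge0// sqr_ge0.
  by rewrite /= !mul1r lerDl exprn_ge0.
have x0 := N0 t; set x := N t in x0 *.
have s0 m : 0 <= growth a m * x by rewrite mulr_ge0.
have [nn|nn] := eqVneq n0 n.+1.
  have := Dn0 t; rewrite nn -/x => /le_trans; apply; apply: ler_pM => //; first by rewrite addr_ge0// sqr_ge0.
  have xs : x <= growth a n.+1 * x by rewrite ler_peMl.
  apply: (@le_trans _ _ (growth a n.+1 * x + (growth a n.+1 * x) ^+ 2)); last by rewrite lerDl exprn_ge0.
  by rewrite lerD// lerXn2r ?nnegrE.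
have n0n : (n0 <= n)%N by move: nn0; rewrite leq_eqVlt (negbTE nn).
have [xr|rx] := leP x r; last first.
  apply: le_trans (D2 _ _) _; apply: (@le_trans _ _ (K * (growth a n.+1 * x) ^+ 3)).
    apply: (@le_trans _ _ (2 / r ^+ 3 * r ^+ 3)); first by rewrite mulfVK// gt_eqF.
    apply: ler_pM => //; first exact: ltW.
    by rewrite lerXn2r ?nnegrE ?(ltW r0)// (le_trans (ltW rx))// ler_peMl.
  by rewrite ler_wpM2l// lerDr addr_ge0// sqr_ge0.
apply: le_trans (Dstep n t xr) _.
have H := rate_step a'0 (ltW a'a) K0 (_ : 1 <= n.+1%:R) x0 (g1 n) (growth_cube n a3) (growth_sqr n a3) (N0 (tr n t)) (Ntr n t n0n).
apply: le_trans (H _); last by rewrite ler1n.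
apply: lerD; first exact: IH.
rewrite ler_wpM2r//.
by rewrite !addr_ge0 ?divr_ge0 ?exprn_ge0 ?sqrtr_ge0.
Qed.

End Rate.

Section CLT.
Variables (R : realType) (f : nat -> R) (k : nat).
Hypothesis k1 : (1 <= k)%N.
Hypothesis fp : fpos f.
Hypothesis cf : constant_from f k.
Implicit Types (X t : 'rV[R]_k.+1) (n : nat).
Local Notation act := (act f k).
Local Notation Del := (@Del R k).
Local Notation vrow := (vrow f k).
Local Notation xi := (xi f (k := k)).
Local Notation jump := (@jump_prob R f k).
Local Notation Bmx := (Bmx f k).
Let l := lam f.
Let l0 : 0 < l := (lamP fp k1 cf).1.

Definition Mmx : 'M[R]_k.+1 := l^-1 *: Bmx.

(** The covariance of one centered jump in the limit: [vrow 0 j * f j.+1 / l] are the jump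
    probabilities when the urn has the proportions [vrow]. *)
Definition Gam : 'M[R]_k.+1 := \sum_j (vrow 0 j * f j.+1 / l) *: ((xi j)^T *m xi j).

Lemma Gam_sym : Gam^T = Gam.
Proof.
rewrite /Gam linear_sum/=; apply: eq_bigr => j _.
by rewrite linearZ/= trmx_mul trmxK.
Qed.

Lemma bil_Gam t : bil Gam t t = \sum_j vrow 0 j * f j.+1 / l * dotv t (xi j) ^+ 2.
Proof.
rewrite /bil /Gam mulmx_sumr dotvC dotv_sumr; apply: eq_bigr => j _.
rewrite -scalemxAr dotvZr mulmxA; congr (_ * _).
rewrite (_ : t *m (xi j)^T = (dotv t (xi j))%:M); last first.
  by rewrite [LHS]mx11_scalar; congr _%:M; rewrite mxE; apply: eq_bigr => i _; rewrite mxE.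
by rewrite mul_scalar_mx dotvZr expr2.
Qed.

Lemma bil_Gam_ge0 t : 0 <= bil Gam t t.
Proof.
rewrite bil_Gam; apply: sumr_ge0 => j _; rewrite mulr_ge0 ?sqr_ge0//.
by rewrite divr_ge0 ?mulr_ge0 ?ltW ?(vrow_gt0 k1 fp cf) ?fp.
Qed.

Section Form.
Variables (G : 'M[R]_k.+1) (b : R).
Hypothesis Gsym : G^T = G.
Hypothesis Gpos : forall x : 'rV[R]_k.+1, x != 0 -> 0 < bil G x x.
Hypothesis b0 : 0 <= b.
Hypothesis bl : b < l / 2.
Hypothesis GB : forall x : 'rV[R]_k.+1, bil G (x *m Bmx) x <= b * bil G x x.

Local Notation N t := (Num.sqrt (N2 G t)).
Local Notation g X := (bil G X X).

Lemma dotv_le t X : `|dotv t X| <= N t * Num.sqrt (g X).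
Proof.
rewrite -sqrtrM ?N2_ge0// -sqrtr_sqr ler_wsqrtr//.
exact: N2_cauchy_schwarz.
Qed.

Lemma N2_mul (A : 'M[R]_k.+1) : exists2 c, 0 <= c & forall t, N (t *m A) <= c * N t.
Proof.
have [c c0 H] := bil_bound_dual Gsym Gpos (A *m invmx G *m A^T).
exists (Num.sqrt c) => [|t]; first exact: sqrtr_ge0.
rewrite -sqrtrM// ler_wsqrtr// (le_trans _ (H t))// (le_trans _ (ler_norm _))//.
by rewrite -bil_mulmx2.
Qed.

Lemma act_le : exists2 c, 0 <= c & forall X, `|dotv X act| <= c * Num.sqrt (g X).
Proof. by exists (N act) => [|X]; [exact: sqrtr_ge0|rewrite dotvC dotv_le]. Qed.

Lemma coord_le : exists2 c, 0 <= c & forall X j, `|X 0 j| <= c * Num.sqrt (g X).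
Proof.
exists (\sum_i N (delta_mx 0 i : 'rV[R]_k.+1)) => [|X j]; first by apply: sumr_ge0 => i _; exact: sqrtr_ge0.
rewrite -dotv_delta dotvC (le_trans (dotv_le _ _))// ler_wpM2r ?sqrtr_ge0//.
by rewrite (bigD1 j)//= lerDl sumr_ge0// => i _; exact: sqrtr_ge0.
Qed.

Lemma xi_le : exists2 c, 0 <= c & forall t j, `|dotv t (xi j)| <= c * N t.
Proof.
exists (\sum_i Num.sqrt (g (xi i))) => [|t j]; first by apply: sumr_ge0 => i _; exact: sqrtr_ge0.
rewrite (le_trans (dotv_le _ _))// mulrC ler_wpM2r ?sqrtr_ge0//.
by rewrite (bigD1 j)//= lerDl sumr_ge0// => i _; exact: sqrtr_ge0.
Qed.

Lemma form_sqrt_crude : exists2 c, 0 <= c & forall X n, state n X ->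
  Num.sqrt (g (X - n%:R *: vrow)) <= c * n%:R.
Proof.
have [c c0 H] := form_crude k1 fp cf G; exists (Num.sqrt c) => [|X n st]; first exact: sqrtr_ge0.
rewrite -[n%:R in leRHS]ger0_norm// -sqrtr_sqr -sqrtrM// ler_wsqrtr//; exact: H.
Qed.

Lemma cos_sum_expansion (I : finType) (w h : I -> R) (a r : R) : (forall j, 0 <= w j) -> \sum_j w j = 1 ->
  (forall j, `|h j| <= r) ->
  `|\sum_j w j * cos (a + h j) - (cos a - (\sum_j w j * h j) * sin a - (\sum_j w j * h j ^+ 2) / 2 * cos a)|
  <= 2 * r ^+ 3.
Proof.
move=> w0 w1 hr.
have -> : \sum_j w j * cos (a + h j) - (cos a - (\sum_j w j * h j) * sin a - (\sum_j w j * h j ^+ 2) / 2 * cos a) =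
  \sum_j w j * (cos (a + h j) - cos a + h j * sin a + h j ^+ 2 / 2 * cos a).
  rewrite -[X in _ - (X - _ - _)]mul1r -{1}w1 !mulr_suml -!sumrB.
  by apply: eq_bigr => j _; ring.
apply: le_trans (ler_norm_sum _ _ _) _.
have -> : 2 * r ^+ 3 = \sum_j w j * (2 * r ^+ 3) by rewrite -mulr_suml w1 mul1r.
apply: ler_sum => j _.
rewrite normrM (ger0_norm (w0 j)) ler_wpM2l//.
apply: le_trans (cosD_taylor2 _ _) _; rewrite ler_wpM2l// lerXn2r ?nnegrE//.
exact: le_trans (hr j).
Qed.

(* The drift [D * B / (lam n)] of one step is moved onto the frequency, as
   [t * M^T / n]; this turns the step into a recursion between characteristic
   functions. *)
Lemma cf_cond_step : exists2 C, 0 <= C & forall X n t a, (1 <= n)%N -> state n X ->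
  forall D, D = X - n%:R *: vrow ->
  `|\sum_j jump X j * cos (a + dotv t (xi j)) - (1 - bil Gam t t / 2) * cos (a + dotv D (t *m Mmx^T) / n%:R)|
  <= C * (N t ^+ 3 + N t * (g D / n%:R ^+ 2) + N t ^+ 2 * (Num.sqrt (g D) / n%:R + g D / n%:R ^+ 2)).
Proof.
have [cx cx0 Hx] := xi_le.
have [ca ca0 Ha] := act_le.
have [cc cc0 Hc] := coord_le.
have [cb cb0 Hb] := N2_mul Bmx^T.
have [cm cm0 Hm] := form_sqrt_crude.
have [cg cg0 Hg] := bil_bound_dual Gsym Gpos Gam.
have [m m0 Vm] := @dotv_lower R k act (@act_gt0 R f k fp).
pose q1 := cb * ca / (m * l).
pose cj := \sum_(j < k.+1) f j.+1.
have cj0 : 0 <= cj by apply: sumr_ge0 => j _; exact/ltW/fp.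
pose q2 := cx ^+ 2 * cj * ((l * cc + ca) / (m * l)).
pose q3 := cb / l.
have ml0 : 0 <= (m * l)^-1 by rewrite invr_ge0 ltW// mulr_gt0.
have K1 : 0 <= 2 * cx ^+ 3 by apply: mulr_ge0 => //; exact: exprn_ge0.
have K2 : 0 <= q1 by apply: mulr_ge0 => //; exact: mulr_ge0.
have K3 : 0 <= q2.
  apply: mulr_ge0; first by apply: mulr_ge0 => //; exact: sqr_ge0.
  by apply: mulr_ge0 => //; apply: addr_ge0 => //; apply: mulr_ge0 => //; exact: ltW.
have q30 : 0 <= q3 by apply: divr_ge0 => //; exact: ltW.
have K4 : 0 <= 2 * q3 ^+ 2 by apply: mulr_ge0 => //; exact: sqr_ge0.
have K5 : 0 <= cg * q3 * cm by exact: mulr_ge0 (mulr_ge0 cg0 q30) cm0.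
exists (2 * cx ^+ 3 + q1 + q2 + 2 * q3 ^+ 2 + cg * q3 * cm).
  by rewrite !addr_ge0.
move=> X n t a n1 st D DE.
have V0 := weight_gt0 fp n1 st; set V := dotv X act in V0.
have n0 : 0 < n%:R :> R by rewrite ltr0n.
have mV : m * n%:R <= V by exact: Vm.
have mn0 : 0 < m * n%:R by exact: mulr_gt0.
set NN := N t; have N0 : 0 <= NN by exact: sqrtr_ge0.
set s := Num.sqrt (g D); have s0 : 0 <= s by exact: sqrtr_ge0.
have gs : g D = s ^+ 2 by rewrite sqr_sqrtr// (Gge0 Gpos).
have iV : V^-1 <= (m * n%:R)^-1 by rewrite lef_pV2.
have VE : V = l * n%:R + dotv D act.
  rewrite DE dotvDl dotvNl dotvZl (vrow_act k1 fp cf) -/l -/V; ring.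
have XE j : X 0 j = n%:R * vrow 0 j + D 0 j.
  have -> : D 0 j = X 0 j - n%:R * vrow 0 j by rewrite DE !mxE.
  by ring.
pose h j := dotv t (xi j).
have hr j : `|h j| <= cx * NN by exact: Hx.
have w0 j : 0 <= jump X j := jump_ge0 fp j n1 st.
have E1 := cos_sum_expansion a w0 (jump_sum fp n1 st) hr.
set S1 := \sum_j jump X j * h j in E1.
set S2 := \sum_j jump X j * h j ^+ 2 in E1.
pose q := dotv (D *m Bmx) t.
pose e := dotv D (t *m Mmx^T) / n%:R.
have eE : e = q / (l * n%:R).
  rewrite /e /q /Mmx linearZ/= -scalemxAr dotvZr dotv_mul invfM; ring.
have qle : `|q| <= cb * NN * s.
  rewrite /q dotv_mul dotvC (le_trans (dotv_le _ _))// ler_wpM2r//; exact: Hb.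
have S1E : S1 = q / V.
  rewrite /S1 /h; under eq_bigr do rewrite dotvC.
  by rewrite (jump_mean k1 fp cf _ n1 st) -DE.
(* [S1] and [e] have the same numerator, and their denominators [V] and [l * n] differ by
   [dotv D act]; the error is quadratic in [D]. *)
have F1 : `|S1 - e| <= q1 * (NN * (g D / n%:R ^+ 2)).
  have -> : S1 - e = - (q * dotv D act / (V * (l * n%:R))).
    rewrite S1E eE; have -> : dotv D act = V - l * n%:R by rewrite VE; ring.
    by field; rewrite !gt_eqF.
  rewrite normrN normrM normfV (gtr0_norm (mulr_gt0 V0 (mulr_gt0 l0 n0))) normrM.
  have -> : q1 * (NN * (g D / n%:R ^+ 2)) = (cb * NN * s) * (ca * s) * ((m * n%:R)^-1 * (l * n%:R)^-1).
    by rewrite gs /q1; field; rewrite !gt_eqF.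
  apply: ler_pM.
  - exact: mulr_ge0.
  - by rewrite invr_ge0 mulr_ge0 ?mulr_ge0 ?ltW.
  - by apply: ler_pM => //; exact: Ha.
  - by rewrite invfM ler_wpM2r// invr_ge0 mulr_ge0 ?ltW.
(* Actual jump probabilities against the limiting ones in [Gam]: the difference is linear in [D] and
   of order [1 / n]. *)
have F2 : `|S2 - bil Gam t t| <= q2 * (NN ^+ 2 * (s / n%:R)).
  rewrite bil_Gam -/h -sumrB.
  apply: le_trans (ler_norm_sum _ _ _) _.
  have -> : q2 * (NN ^+ 2 * (s / n%:R)) = \sum_(j < k.+1) f j.+1 * ((cx * NN) ^+ 2 * ((l * (cc * s) + ca * s) / (m * n%:R * l))).
    by rewrite -mulr_suml -/cj /q2; field; rewrite !gt_eqF.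
  apply: ler_sum => j _; have fj := fp (ltn0Sn j).
  have -> : jump X j * h j ^+ 2 - vrow 0 j * f j.+1 / l * dotv t (xi j) ^+ 2 =
    f j.+1 * (h j ^+ 2 * ((l * D 0 j - dotv D act * vrow 0 j) / (V * l))).
    have -> : l * D 0 j - dotv D act * vrow 0 j = l * X 0 j - V * vrow 0 j by rewrite XE VE; ring.
    by rewrite /jump_prob -/V -/(h j); field; rewrite !gt_eqF.
  rewrite normrM (gtr0_norm fj) ler_wpM2l ?(ltW fj)// normrM ger0_norm ?sqr_ge0//.
  apply: ler_pM => //; first exact: sqr_ge0.
    by rewrite -(real_normK (num_real (h j))) lerXn2r ?nnegrE ?mulr_ge0.
  have Vl : 0 < V * l by exact: mulr_gt0.
  rewrite normrM normfV (gtr0_norm Vl); apply: ler_pM => //.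
  - by rewrite invr_ge0 ltW.
  - apply: le_trans (ler_normB _ _) _; rewrite !normrM (gtr0_norm l0); apply: lerD.
      by rewrite ler_wpM2l ?(ltW l0).
    rewrite -[leRHS]mulr1; apply: ler_pM => //.
    have vj := vrow_gt0 k1 fp cf j; rewrite (gtr0_norm vj).
    rewrite -(vrow_sum f k) -[leLHS]mulr1 /dotv (bigD1 j)//= [const_mx _ _ _]mxE lerDl; apply: sumr_ge0 => i _.
    by rewrite [const_mx _ _ _]mxE mulr1 ltW// (vrow_gt0 k1 fp cf).
  - by rewrite lef_pV2 ?posrE ?mulr_gt0// ler_wpM2r ?(ltW l0).
have ele : `|e| <= q3 * (NN * s / n%:R).
  rewrite eE normrM normfV (gtr0_norm (mulr_gt0 l0 n0)) ler_pdivrMr ?mulr_gt0//.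
  apply: le_trans qle _; rewrite /q3 le_eqVlt; apply/orP; left; apply/eqP.
  by field; rewrite !gt_eqF.
have F3 : `|cos (a + e) - cos a + e * sin a| <= 2 * q3 ^+ 2 * (NN ^+ 2 * (g D / n%:R ^+ 2)).
  apply: le_trans (cosD_taylor1 _ _) _.
  have -> : 2 * q3 ^+ 2 * (NN ^+ 2 * (g D / n%:R ^+ 2)) = 2 * (q3 * (NN * s / n%:R)) ^+ 2.
    by rewrite gs; field; rewrite !gt_eqF.
  rewrite ler_wpM2l// -(real_normK (num_real e)) lerXn2r ?nnegrE// mulr_ge0 ?divr_ge0 ?mulr_ge0 ?(ltW l0)//.
have gam0 := bil_Gam_ge0 t.
have gamN : bil Gam t t <= cg * NN ^+ 2.
  by rewrite sqr_sqrtr ?(N2_ge0 Gpos)// (le_trans (ler_norm _))// Hg.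
have F4 : `|bil Gam t t / 2 * (cos (a + e) - cos a)| <= cg * q3 * cm * NN ^+ 3.
  rewrite normrM ger0_norm ?divr_ge0//.
  have e2 : `|e| <= q3 * (NN * cm).
    apply: le_trans ele _; rewrite ler_wpM2l ?divr_ge0 ?(ltW l0)// -mulrA ler_wpM2l//.
    by rewrite ler_pdivrMr// /s DE; exact: Hm.
  have -> : cg * q3 * cm * NN ^+ 3 = (cg * NN ^+ 2) * (q3 * (NN * cm)) by ring.
  apply: ler_pM => //; first exact: divr_ge0.
    by rewrite (le_trans _ gamN)// ler_pdivrMr// mulr_natr mulr2n lerDl.
  exact: le_trans (cosD_lip _ _) e2.
set Z := \sum_j _ in E1 *.
have -> : Z - (1 - bil Gam t t / 2) * cos (a + e) =
  (Z - (cos a - S1 * sin a - S2 / 2 * cos a)) - (S1 - e) * sin a - (S2 - bil Gam t t) / 2 * cos a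
  - (cos (a + e) - cos a + e * sin a) + bil Gam t t / 2 * (cos (a + e) - cos a) by field.
have G1 : `|(S1 - e) * sin a| <= q1 * (NN * (g D / n%:R ^+ 2)).
  by rewrite normrM (le_trans _ F1)// ler_piMr// sin_max.
have G2 : `|(S2 - bil Gam t t) / 2 * cos a| <= q2 * (NN ^+ 2 * (s / n%:R)).
  rewrite -mulrA normrM (le_trans _ F2)// ler_piMr// normrM ger0_norm//.
  by rewrite mulr_ile1// ?cos_max// invf_le1// ler1n.
have G0 : `|Z - (cos a - S1 * sin a - S2 / 2 * cos a)| <= 2 * cx ^+ 3 * NN ^+ 3.
  by rewrite (le_trans E1)// exprMn mulrA.
apply: (@le_trans _ _ (2 * cx ^+ 3 * NN ^+ 3 + q1 * (NN * (g D / n%:R ^+ 2)) + q2 * (NN ^+ 2 * (s / n%:R))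
  + 2 * q3 ^+ 2 * (NN ^+ 2 * (g D / n%:R ^+ 2)) + cg * q3 * cm * NN ^+ 3)).
  apply: le_trans (ler_normD _ _) _; apply: lerD => //.
  apply: le_trans (ler_normB _ _) _; apply: lerD => //.
  apply: le_trans (ler_normB _ _) _; apply: lerD => //.
  by apply: le_trans (ler_normB _ _) _; apply: lerD.
have P1 : 0 <= NN ^+ 3 by rewrite exprn_ge0.
have P2 : 0 <= NN * (g D / n%:R ^+ 2) by rewrite mulr_ge0// divr_ge0 ?(Gge0 Gpos)// sqr_ge0.
have P3 : 0 <= NN ^+ 2 * (s / n%:R) by rewrite mulr_ge0 ?sqr_ge0// divr_ge0.
have P4 : 0 <= NN ^+ 2 * (g D / n%:R ^+ 2) by rewrite mulr_ge0 ?sqr_ge0// divr_ge0 ?(Gge0 Gpos)// sqr_ge0.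
have F (a1 a2 a3 a4 a5 x1 x2 x3 x4 : R) : 0 <= a1 -> 0 <= a2 -> 0 <= a3 -> 0 <= a4 -> 0 <= a5 ->
  0 <= x1 -> 0 <= x2 -> 0 <= x3 -> 0 <= x4 ->
  a1 * x1 + a2 * x2 + a3 * x3 + a4 * x4 + a5 * x1 <= (a1 + a2 + a3 + a4 + a5) * (x1 + x2 + (x3 + x4)).
  move=> ? ? ? ? ? ? ? ? ?; rewrite -subr_ge0.
  have -> : (a1 + a2 + a3 + a4 + a5) * (x1 + x2 + (x3 + x4)) - (a1 * x1 + a2 * x2 + a3 * x3 + a4 * x4 + a5 * x1)
    = (a2 + a3 + a4) * x1 + (a1 + a3 + a4 + a5) * x2 + (a1 + a2 + a4 + a5) * x3 + (a1 + a2 + a3 + a5) * x4 by ring.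
  by rewrite !addr_ge0// mulr_ge0// !addr_ge0.
rewrite [NN ^+ 2 * (_ + _)]mulrDr; exact: F.
Qed.

End Form.
End CLT.

(** * Recursion for the characteristic functions and its limit *)

Section Limit.
Variables (R : realType) (f : nat -> R) (k : nat).
Hypothesis k1 : (1 <= k)%N.
Hypothesis fp : fpos f.
Hypothesis cf : constant_from f k.
Implicit Types (X t : 'rV[R]_k.+1) (n : nat).
Local Notation vrow := (vrow f k).
Local Notation xi := (xi f (k := k)).
Local Notation Bmx := (Bmx f k).
Local Notation Mmx := (Mmx f k).
Local Notation Gam := (Gam f k).
Let l0 : 0 < lam f := (lamP fp k1 cf).1.
Variables (G : 'M[R]_k.+1) (b : R).
Hypothesis Gsym : G^T = G.
Hypothesis Gpos : forall x : 'rV[R]_k.+1, x != 0 -> 0 < bil G x x.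
Hypothesis b0 : 0 <= b.
Hypothesis bl : b < lam f / 2.
Hypothesis GB : forall x : 'rV[R]_k.+1, bil G (x *m Bmx) x <= b * bil G x x.

Local Notation N t := (Num.sqrt (N2 G t)).
Local Notation g X := (bil G X X).

Definition Sig : 'M[R]_k.+1 := lyap Mmx Gam.
Local Notation q t := (bil Sig t t).

Lemma Mmx_bound : [/\ 0 <= b / lam f, b / lam f < 1 / 2 &
  forall x : 'rV[R]_k.+1, bil G (x *m Mmx) x <= b / lam f * g x].
Proof.
split => [||x]; first by apply: divr_ge0 => //; exact: ltW.
  by rewrite ltr_pdivrMr// mul1r mulrC.
rewrite /Mmx -scalemxAr bilZl [b / _]mulrC -mulrA ler_wpM2l ?invr_ge0 ?(ltW l0)//.
Qed.

Lemma SigP : Sig^T = Sig /\ Sig = Sig *m Mmx + Mmx^T *m Sig + Gam.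
Proof.
have [B1 B2 B3] := Mmx_bound.
exact: (lyapP Gsym Gpos B1 B2 B3 (Gam_sym f k)).
Qed.

Lemma Sig_ge0 t : 0 <= q t.
Proof.
have [B1 B2 B3] := Mmx_bound.
exact: (lyap_psd Gsym Gpos B1 B2 B3 (Gam_sym f k) (bil_Gam_ge0 k1 fp cf)).
Qed.

Definition Fn b' n t := EH f n (fun h => cos (b' + dotv t (Dn f k h n.+1))).

Definition Tn b' n t := cos b' * expR (- (n.+1%:R * q t / 2)).

Local Notation tr n t := (t + n.+1%:R^-1 *: (t *m Mmx^T)).

Lemma Fn_step b' : exists2 C, 0 <= C & forall n t,
  `|Fn b' n.+1 t - (1 - bil Gam t t / 2) * Fn b' n (tr n t)| <=
  C * (N t ^+ 3 + N t ^+ 2 / Num.sqrt n.+1%:R + N t / n.+1%:R).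
Proof.
have [C C0 H] := cf_cond_step k1 fp cf Gsym Gpos.
have [K K0 HK] := second_moment k1 fp cf Gsym Gpos b0 bl GB.
exists (C * (1 + 2 * K)) => [|n t]; first by rewrite mulr_ge0// addr_ge0// mulr_ge0.
have EE := EH_expect fp n; have [eD eZ eM e1] := EE.
pose phi X := cos (b' + dotv t (X - n.+2%:R *: vrow)).
rewrite {1}/Fn -[EH f n.+1 _]/(EH f n.+1 (fun h => phi (Xn R k h n.+2))) (EH_Xn_step k1 fp cf) /Fn -eZ -expect_opB//.
apply: le_trans (expect_op_norm _ EE) _.
set m : R := n.+1%:R; have m1 : 1 <= m by rewrite ler1n.
have m0 : 0 < m by rewrite ltr0n.
set s := Num.sqrt m; have s0 : 0 < s by rewrite sqrtr_gt0.
have sm : s ^+ 2 = m by rewrite sqr_sqrtr// ltW.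
set x := N t; have x0 : 0 <= x by exact: sqrtr_ge0.
pose B0 := C * (x ^+ 3 + x ^+ 2 / s).
pose B1 := C * (x / m ^+ 2 + x ^+ 2 / (m * s) + x ^+ 2 / m ^+ 2).
have s1 : 1 <= s by rewrite -sqrtr1 ler_wsqrtr.
have is1 : s^-1 <= 1 by rewrite invf_le1.
have B10 : 0 <= B1.
  apply: mulr_ge0 => //; apply: addr_ge0; last by rewrite divr_ge0 ?sqr_ge0.
  by apply: addr_ge0; apply: divr_ge0; rewrite ?sqr_ge0// mulr_ge0// ltW.
apply: (@le_trans _ _ (B0 + B1 * (K * m))); last first.
  have -> : B0 + B1 * (K * m) = C * (x ^+ 3 + (1 + K) * (x ^+ 2 / s) + K * (x / m) + K * (x ^+ 2 / s * s^-1)).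
    by rewrite /B0 /B1 -sm; field; rewrite gt_eqF.
  rewrite -[leRHS]mulrA; apply: ler_wpM2l => //.
  set y := x ^+ 2 / s; have y0 : 0 <= y by rewrite divr_ge0 ?sqr_ge0// ltW.
  have yy : y * s^-1 <= y by rewrite ler_piMr.
  have x3 : 0 <= x ^+ 3 by exact: exprn_ge0.
  have xm : 0 <= x / m by rewrite divr_ge0// ltW.
  have F (u v w z L : R) : 0 <= L -> 0 <= u -> 0 <= w -> 0 <= v -> z <= v ->
    u + (1 + L) * v + L * w + L * z <= (1 + 2 * L) * (u + v + w).
    move=> L0 u0 w0 v0 zv; have : L * z <= L * v by rewrite ler_wpM2l.
    have : 0 <= L * u by rewrite mulr_ge0.
    have : 0 <= L * w by rewrite mulr_ge0.
    have -> : (1 + 2 * L) * (u + v + w) = u + v + w + 2 * (L * u) + 2 * (L * v) + 2 * (L * w) by ring.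
    by rewrite mulrDl mul1r; lra.
  exact: F.
apply: (@le_trans _ _ (B0 + B1 * EH f n (fun h => g (Dn f k h n.+1)))); last first.
  by rewrite lerD2l ler_wpM2l.
rewrite -(e1 B0) -eZ -eD; apply: eM => h.
set D := Dn f k h n.+1.
have := H _ n.+1 t (b' + dotv t D) (ltn0Sn n) (state_Xn R k h n.+1) D erefl.
have E1 : b' + dotv t D + dotv D (t *m Mmx^T) / n.+1%:R = b' + dotv (tr n t) D.
  by rewrite dotvDl dotvZl addrA [dotv D _]dotvC [_^-1 * _]mulrC.
rewrite E1 => H1.
have -> : \sum_j jump_prob f (Xn R k h n.+1) j * phi (Xn R k h n.+1 + Del R j) =
  \sum_j jump_prob f (Xn R k h n.+1) j * cos (b' + dotv t D + dotv t (xi j)).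
  apply: eq_bigr => j _; rewrite /phi; congr (_ * cos _); rewrite -[RHS]addrA -dotvDr; congr (_ + dotv t _).
  rewrite /D /Dn /xi -natr1 scalerDl scale1r; apply/rowP => i; rewrite !mxE; ring.
apply: le_trans H1 _; rewrite -/m.
have gD := Gge0 Gpos D; set gg := g D in gD *.
rewrite -/x.
(* Only the mean of [g D] is controlled; the square root is traded for it by the
   arithmetic-geometric mean inequality, at the price of [1 / Num.sqrt m]. *)
have S1 : Num.sqrt gg / m <= (gg / m + 1) / s.
  rewrite -(sqr_sqrtr gD); set w := Num.sqrt gg; have w0 : 0 <= w by exact: sqrtr_ge0.
  rewrite sqrtr_sqr ger0_norm//.
  rewrite -sm ler_pdivlMr//.
  have -> : w / s ^+ 2 * s = w / s by field; rewrite gt_eqF.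
  have -> : w ^+ 2 / s ^+ 2 = (w / s) ^+ 2 by rewrite expr_div_n.
  by set z := w / s; nra.
have -> : B0 + B1 * gg = C * (x ^+ 3 + x * (gg / m ^+ 2) + x ^+ 2 * ((gg / m + 1) / s + gg / m ^+ 2)).
  by rewrite /B0 /B1; field; rewrite !gt_eqF.
by rewrite ler_wpM2l// lerD2l ler_wpM2l ?sqr_ge0// lerD2r.
Qed.

Lemma Tn_step b' : exists2 C, 0 <= C & forall n t, N t <= 1 ->
  `|Tn b' n.+1 t - (1 - bil Gam t t / 2) * Tn b' n (tr n t)| <=
  C * (N t ^+ 3 + N t ^+ 2 / Num.sqrt n.+1%:R + N t / n.+1%:R).
Proof.
have [cg cg0 Hg] := bil_bound_dual Gsym Gpos Gam.
have [cs cs0 Hs] := bil_bound_dual Gsym Gpos (Mmx^T *m Sig *m Mmx).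
have [Ss SE] := SigP.
exists (cg ^+ 2 + cs) => [|n t]; first by rewrite addr_ge0 ?sqr_ge0.
set m : R := n.+1%:R; have m1 : 1 <= m by rewrite ler1n.
have m0 : 0 < m by rewrite ltr0n.
set s := Num.sqrt m; have s0 : 0 < s by rewrite sqrtr_gt0.
have s1 : 1 <= s by rewrite -sqrtr1 ler_wsqrtr.
have sm : s ^+ 2 = m by rewrite sqr_sqrtr// ltW.
set x := N t => x1; have x0 : 0 <= x by exact: sqrtr_ge0.
have x2 : x ^+ 2 = N2 G t by rewrite sqr_sqrtr// (N2_ge0 Gpos).
pose z := bil Gam t t / 2.
have gam0 := bil_Gam_ge0 k1 fp cf t.
have z0 : 0 <= z by exact: divr_ge0.
have zle : z <= cg * x ^+ 2.
  rewrite x2 (le_trans _ (Hg t))// (le_trans _ (ler_norm _))// ler_pdivrMr// mulr_natr mulr2n lerDl//.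
pose e := q (t *m Mmx^T) / m.
have e0 : 0 <= e by apply: divr_ge0; [exact: Sig_ge0|exact: ltW].
have ele : e <= cs * x ^+ 2 / m.
  rewrite /e ler_pM2r ?invr_gt0// x2 bil_mulmx2 trmxK.
  by rewrite (le_trans _ (Hs t))// ler_norm.
pose A := n.+2%:R * q t / 2; pose B := m * q (tr n t) / 2.
have A0 : 0 <= A by rewrite divr_ge0// mulr_ge0// Sig_ge0.
have B0 : 0 <= B by rewrite divr_ge0// mulr_ge0 ?Sig_ge0// ltW.
(* The Lyapunov equation for [Sig] makes the exponents match exactly, except for the term [e] that
   is quadratic in the move of the frequency. *)
have BE : B + z = A + e / 2.
  have L := lyap_quad Mmx t Ss.
  have L2 : bil Gam t t = q t - 2 * bil Sig t (t *m Mmx^T).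
    rewrite -L; congr (bil _ t t).
    by rewrite {1}SE addrAC; apply/matrixP => i j; rewrite !mxE; ring.
  rewrite /B /z /A /e (bil_addM _ _ _ Ss) L2 -(natr1 _ : _ = n.+2%:R) -/m.
  by field; rewrite gt_eqF.
rewrite /Tn -/A -/m -/z -/B.
have -> : cos b' * expR (- A) - (1 - z) * (cos b' * expR (- B)) =
  cos b' * ((expR (- A) - expR (- (B + z))) + (expR (- z) - 1 + z) * expR (- B)).
  by rewrite opprD expRD; ring.
rewrite normrM (@le_trans _ _ (`|expR (- A) - expR (- (B + z)) + (expR (- z) - 1 + z) * expR (- B)|))//.
  by rewrite ler_piMl// cos_max.
apply: le_trans (ler_normD _ _) _.
have E1 : `|expR (- A) - expR (- (B + z))| <= cs * (x ^+ 2 / s).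
  apply: le_trans (expRN_lip A0 (addr_ge0 B0 z0)) _.
  rewrite BE opprD addrA subrr add0r normrN ger0_norm; last by apply: divr_ge0.
  apply: (@le_trans _ _ e); first by rewrite ler_pdivrMr// mulr_natr mulr2n lerDl.
  apply: le_trans ele _; rewrite -mulrA ler_wpM2l// ler_wpM2l ?sqr_ge0// lef_pV2 ?posrE//.
  by rewrite -sm expr2 ler_peMr// ltW.
have E2 : `|(expR (- z) - 1 + z) * expR (- B)| <= cg ^+ 2 * x ^+ 3.
  rewrite normrM (ger0_norm (expR_ge0 _)).
  apply: (@le_trans _ _ (z ^+ 2)).
    rewrite (le_trans _ (expRN_taylor z0))// ler_piMr// expR_le1 oppr_le0//.
  apply: (@le_trans _ _ ((cg * x ^+ 2) ^+ 2)).
    by rewrite lerXn2r ?nnegrE// mulr_ge0 ?sqr_ge0.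
  rewrite exprMn ler_wpM2l ?sqr_ge0// -exprM [x ^+ 4]exprS ler_piMl// exprn_ge0//.
apply: le_trans (lerD E1 E2) _.
have y0 : 0 <= x ^+ 2 / s by rewrite divr_ge0 ?sqr_ge0// ltW.
have x3 : 0 <= x ^+ 3 by exact: exprn_ge0.
have xm : 0 <= x / m by rewrite divr_ge0// ltW.
have F (c d u v w : R) : 0 <= c -> 0 <= d -> 0 <= u -> 0 <= v -> 0 <= w -> d * v + c * u <= (c + d) * (u + v + w).
  move=> c0 d0 u0 v0 w0.
  have -> : (c + d) * (u + v + w) = d * v + c * u + (c * v + c * w + d * u + d * w) by ring.
  by rewrite lerDl !addr_ge0// mulr_ge0.
by apply: F => //; exact: sqr_ge0.
Qed.

Lemma Fn_Tn_base b' n : exists2 L, 0 <= L & forall t, `|Fn b' n t - Tn b' n t| <= L * (N t + N t ^+ 2).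
Proof.
have [K K0 HK] := second_moment k1 fp cf Gsym Gpos b0 bl GB.
have [cs cs0 Hs] := bil_bound_dual Gsym Gpos Sig.
have EE := EH_expect fp n; have [eD eZ eM e1] := EE.
have m0 : 0 < n.+1%:R :> R by [].
exists (1 + K * n.+1%:R + n.+1%:R * cs) => [|t]; first by rewrite !addr_ge0 ?mulr_ge0.
set x := N t; have x0 : 0 <= x by exact: sqrtr_ge0.
have E1 : `|Fn b' n t - cos b'| <= x * (1 + K * n.+1%:R).
  rewrite -(e1 (cos b')) /Fn -expect_opB// (le_trans (expect_op_norm _ EE))//.
  apply: (@le_trans _ _ (x * (1 + EH f n (fun h => g (Dn f k h n.+1))))).
    have -> : 1 + EH f n (fun h => g (Dn f k h n.+1)) = EH f n (fun h => 1 + g (Dn f k h n.+1)) by rewrite eD e1.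
    rewrite -eZ; apply: eM => h.
    apply: le_trans (cosD_lip _ _) _.
    apply: le_trans (dotv_le Gsym Gpos _ _) _; rewrite ler_wpM2l//.
    have gD := Gge0 Gpos (Dn f k h n.+1).
    set w := Num.sqrt _; rewrite -(sqr_sqrtr gD) -/w; nra.
  by rewrite ler_wpM2l// lerD2l.
have E2 : `|Tn b' n t - cos b'| <= n.+1%:R * cs * x ^+ 2.
  have -> : Tn b' n t - cos b' = cos b' * (expR (- (n.+1%:R * q t / 2)) - expR (- 0)).
    by rewrite oppr0 expR0 /Tn; ring.
  have z0 : 0 <= n.+1%:R * q t / 2 by rewrite divr_ge0// mulr_ge0// Sig_ge0.
  rewrite normrM; apply: (@le_trans _ _ `|expR (- (n.+1%:R * q t / 2)) - expR (- 0)|).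
    by rewrite ler_piMl// cos_max.
  apply: le_trans (expRN_lip z0 (lexx 0)) _; rewrite subr0 ger0_norm//.
  apply: (@le_trans _ _ (n.+1%:R * q t)).
    by rewrite ler_pdivrMr// mulr_natr mulr2n lerDl mulr_ge0// Sig_ge0.
  rewrite -mulrA ler_wpM2l// sqr_sqrtr ?(N2_ge0 Gpos)//; exact: le_trans (ler_norm _) (Hs t).
have -> : Fn b' n t - Tn b' n t = Fn b' n t - cos b' - (Tn b' n t - cos b') by ring.
apply: le_trans (ler_normB _ _) _; apply: le_trans (lerD E1 E2) _.
have K1 : 0 <= 1 + K * n.+1%:R by rewrite addr_ge0// mulr_ge0.
have K2 : 0 <= n.+1%:R * cs by rewrite mulr_ge0.
have F (c d u v : R) : 0 <= c -> 0 <= d -> 0 <= u -> 0 <= v -> u * c + d * v <= (c + d) * (u + v).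
  move=> c0 d0 u0 v0.
  have -> : (c + d) * (u + v) = u * c + d * v + (c * v + d * u) by ring.
  by rewrite lerDl addr_ge0// mulr_ge0.
by apply: F => //; exact: sqr_ge0.
Qed.

Lemma Fn_Tn_le2 b' n t : `|Fn b' n t - Tn b' n t| <= 2.
Proof.
have EE := EH_expect fp n; have [eD eZ eM e1] := EE.
apply: le_trans (ler_normB _ _) _; rewrite -[2%:R]/(1 + 1); apply: lerD.
  rewrite (le_trans (expect_op_norm _ EE))// -(e1 1); apply: eM => h; exact: cos_max.
rewrite normrM mulr_ile1// ?cos_max// ger0_norm ?expR_ge0// expR_le1 oppr_le0.
by rewrite divr_ge0// mulr_ge0// Sig_ge0.
Qed.

Lemma N_contraction : exists a' a : R, [/\ 0 <= a', a' < a, 1 / 3 <= a, a < 1 / 2 &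
  exists n0, forall n t, (n0 <= n)%N -> N (tr n t) <= (1 + a' / n.+1%:R) * N t].
Proof.
have [B1 B2 B3] := Mmx_bound.
(* Raising the rate to [1 / 3] keeps it below [1 / 2] and meets the condition of [growth_cube]. *)
pose be := Num.max (b / lam f) (1 / 3).
have be1 : b / lam f <= be by rewrite le_max lexx.
have be3 : 1 / 3 <= be by rewrite le_max lexx orbT.
have be2 : be < 1 / 2 by rewrite gt_max B2; lra.
clearbody be.
have be0 : 0 <= be by lra.
have B4 x : bil G (x *m Mmx) x <= be * g x.
  by rewrite (le_trans (B3 x))// ler_wpM2r// (Gge0 Gpos).
have [c c0 H] := N2_contraction Gsym Gpos be0 B4.
(* The room between [be] and [a'] absorbs the second-order term of the contraction once [n] is
   large; the room between [a'] and [a] pays for the errors. *)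
pose a := (be + 1 / 2) / 2; pose a' := (be + a) / 2.
have aE : be < a' /\ a' < a /\ a < 1 / 2.
  by rewrite /a' /a; lra.
clearbody a a'; case: aE => ba' [a'a a2].
exists a', a; split => //; [lra|lra|].
pose d := 2 * (a' - be); have d0 : 0 < d by rewrite /d mulr_gt0// subr_gt0.
exists (Num.truncn (c / d)) => n t nn.
have h0 : 0 < n.+1%:R^-1 :> R by rewrite invr_gt0.
have hc : c * n.+1%:R^-1 <= d.
  rewrite ler_pdivrMr// mulrC -ler_pdivrMr// ltW// (lt_le_trans (Num.Theory.truncnS_gt _))//.
  by rewrite ler_nat.
set h := n.+1%:R^-1 in h0 hc *.
have a'0 : 0 <= 1 + a' * h by rewrite addr_ge0// mulr_ge0 ?(ltW h0)//; lra.
rewrite -[1 + a' * h]ger0_norm// -sqrtr_sqr -sqrtrM ?sqr_ge0// ler_wsqrtr//.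
apply: le_trans (H h t (ltW h0)) _; rewrite ler_wpM2r ?(N2_ge0 Gpos)//.
have : c * h * h <= d * h by rewrite ler_wpM2r// ltW.
have : 0 <= (a' * h) ^+ 2 by exact: sqr_ge0.
have F (u v w y : R) : 0 <= (w * y) ^+ 2 -> u * y * y <= 2 * (w - v) * y -> 1 + 2 * v * y + u * y ^+ 2 <= (1 + w * y) ^+ 2.
  move=> p1 p2; rewrite sqrrD expr1n mul1r.
  have -> : u * y ^+ 2 = u * y * y by ring.
  rewrite -subr_ge0.
  have -> : 1 + w * y *+ 2 + (w * y) ^+ 2 - (1 + 2 * v * y + u * y * y) = (w * y) ^+ 2 + (2 * (w - v) * y - u * y * y) by ring.
  by rewrite addr_ge0// subr_ge0.
exact: F.
Qed.

Lemma clt_cf (t : 'rV[R]_k.+1) b' :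
  (fun n => EH f n (fun h => cos (b' + dotv t ((Num.sqrt n.+1%:R)^-1 *: Dn f k h n.+1)))) @ \oo -->
  cos b' * expR (- (q t / 2)).
Proof.
have [a' [a [a'0 a'a a3 a2 [n0 Hn0]]]] := N_contraction.
have [CF CF0 HF] := Fn_step b'.
have [CT CT0 HT] := Tn_step b'.
have [L L0 HL] := Fn_Tn_base b' n0.
have [cg cg0 Hg] := bil_bound_dual Gsym Gpos Gam.
(* For [N x <= r] one has [bil Gam x x <= 1], so the factor [1 - bil Gam x x / 2] does not enlarge
   the difference. *)
pose r : R := (1 + cg)^-1.
have cg1 : 0 < 1 + cg by rewrite ltr_pwDl.
have r0 : 0 < r by rewrite invr_gt0.
have r1 : r <= 1 by rewrite invf_le1// lerDl.
have cgr : cg * r <= 1 by rewrite /r ler_pdivrMr// mul1r lerDr.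
have N0 x : 0 <= N x by exact: sqrtr_ge0.
have step n x : N x <= r -> `|Fn b' n.+1 x - Tn b' n.+1 x| <= `|Fn b' n (tr n x) - Tn b' n (tr n x)| +
  (CF + CT) * (N x ^+ 3 + N x ^+ 2 / Num.sqrt n.+1%:R + N x / n.+1%:R).
  move=> xr; have x1 : N x <= 1 by exact: le_trans xr r1.
  have := HF n x; have := HT n x x1.
  set e := _ + _ + N x / _; set z := 1 - _ => eT eF.
  have z1 : `|z| <= 1.
    have gm0 := bil_Gam_ge0 k1 fp cf x.
    have gm1 : bil Gam x x <= 1.
      apply: le_trans (ler_norm _) _; apply: le_trans (Hg x) _; apply: le_trans cgr; rewrite ler_wpM2l//.
      rewrite -(sqr_sqrtr (N2_ge0 Gpos x)) expr2 (le_trans _ xr)// ler_piMr//.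
    by rewrite /z ler_norml; lra.
  have -> : Fn b' n.+1 x - Tn b' n.+1 x = (Fn b' n.+1 x - z * Fn b' n (tr n x)) + z * (Fn b' n (tr n x) - Tn b' n (tr n x))
     - (Tn b' n.+1 x - z * Tn b' n (tr n x)) by ring.
  apply: le_trans (ler_normB _ _) _; apply: le_trans (lerD (ler_normD _ _) (lexx _)) _.
  have F (u v w u' v' w' : R) : u <= u' -> v <= v' -> w <= w' -> u + v + w <= v' + (u' + w') by lra.
  rewrite [(CF + CT) * e]mulrDl; apply: F => //.
  by rewrite normrM ler_piMl.
have [K K0 HK] := rate_induction (tr := fun n x => tr n x) (Dl := fun n x => `|Fn b' n x - Tn b' n x|) (N := fun x => N x)
  a'0 a'a a3 r0 (addr_ge0 CF0 CT0) L0 N0 (Fn_Tn_le2 b') step Hn0 HL.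
have FE n : EH f n (fun h => cos (b' + dotv t ((Num.sqrt n.+1%:R)^-1 *: Dn f k h n.+1))) = Fn b' n ((Num.sqrt n.+1%:R)^-1 *: t).
  by apply: (EH_eq fp) => h _; rewrite dotvZr dotvZl.
have TE n : Tn b' n ((Num.sqrt n.+1%:R)^-1 *: t) = cos b' * expR (- (q t / 2)).
  rewrite /Tn bilZl bilZr; congr (_ * expR (- (_ / 2))).
  by rewrite -{1}(sqr_sqrtr (ler0n R n.+1)); field; rewrite gt_eqF// sqrtr_gt0.
have NE n : N ((Num.sqrt n.+1%:R)^-1 *: t) = N t / Num.sqrt n.+1%:R.
  rewrite /N2 -scalemxAl dotvZl dotvZr mulrA -expr2 sqrtrM ?sqr_ge0// sqrtr_sqr ger0_norm ?invr_ge0 ?sqrtr_ge0//.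
  by rewrite mulrC.
have a0 : 0 <= a by lra.
pose y n := growth a n / Num.sqrt n.+1%:R * N t.
have cy : y @ \oo --> 0.
  by rewrite -[X in _ --> X](mul0r (N t)); apply: cvgM; [exact: cvg_growth|exact: cvg_cst].
have cyX j : (fun n => y n ^+ j) @ \oo --> (0 : R) ^+ j.
  elim: j => [|j IH]; first exact: cvg_cst.
  by rewrite exprS; under eq_fun do rewrite exprS; exact: cvgM.
have cH : (fun n => K * (y n + y n ^+ 2 + y n ^+ 3)) @ \oo --> K * (0 + 0 ^+ 2 + 0 ^+ 3).
  by apply: cvgMl_tmp; apply: cvgD; [apply: cvgD|].
rewrite !expr0n/= !addr0 mulr0 in cH.
apply/cvgrPdist_le => e e0.
have /cvgrPdist_le/(_ _ e0) He := cH.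
near=> n.
rewrite FE -(TE n) distrC.
have n0n : (n0 <= n)%N by near: n; exact: nbhs_infty_ge.
apply: le_trans (HK n _ n0n) _; rewrite NE.
have -> : growth a n * (N t / Num.sqrt n.+1%:R) = y n by rewrite /y /= mulrCA mulrC.
apply: le_trans (ler_norm _) _; rewrite -normrN -sub0r.
by near: n.
Unshelve. all: by end_near.
Qed.

End Limit.

(** * Dependence on the parameter *)

Section MatrixLimits.
Variables (R : realType) (T : Type) (F : set_system T).
Hypothesis FF : Filter F.

Definition mx_cvg m n (A : T -> 'M[R]_(m, n)) (A0 : 'M[R]_(m, n)) : Prop :=
  forall i j, (fun x => A x i j) @ F --> A0 i j.

Lemma cvg_finsum (I : Type) (r : seq I) (a : T -> I -> R) (a0 : I -> R) :
  (forall i, (fun x => a x i) @ F --> a0 i) -> (fun x => \sum_(i <- r) a x i) @ F --> \sum_(i <- r) a0 i.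
Proof.
move=> H; elim: r => [|i r IH].
  by rewrite big_nil; under eq_fun do rewrite big_nil; exact: cvg_cst.
by rewrite big_cons; under eq_fun do rewrite big_cons; exact: cvgD.
Qed.

Lemma cvg_finprod (I : Type) (r : seq I) (a : T -> I -> R) (a0 : I -> R) :
  (forall i, (fun x => a x i) @ F --> a0 i) -> (fun x => \prod_(i <- r) a x i) @ F --> \prod_(i <- r) a0 i.
Proof.
move=> H; elim: r => [|i r IH].
  by rewrite big_nil; under eq_fun do rewrite big_nil; exact: cvg_cst.
by rewrite big_cons; under eq_fun do rewrite big_cons; exact: cvgM.
Qed.

Lemma mx_cvg_cst m n (A : 'M[R]_(m, n)) : mx_cvg (fun=> A) A.
Proof. by move=> i j; exact: cvg_cst. Qed.

Lemma mx_cvgD m n (A B : T -> 'M[R]_(m, n)) A0 B0 : mx_cvg A A0 -> mx_cvg B B0 -> mx_cvg (fun x => A x + B x) (A0 + B0).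
Proof. by move=> HA HB i j; rewrite mxE; under eq_fun do rewrite mxE; exact: cvgD. Qed.

Lemma mx_cvgN m n (A : T -> 'M[R]_(m, n)) A0 : mx_cvg A A0 -> mx_cvg (fun x => - A x) (- A0).
Proof. by move=> HA i j; rewrite mxE; under eq_fun do rewrite mxE; exact: cvgN. Qed.

Lemma mx_cvgZ m n (c : T -> R) (c0 : R) (A : T -> 'M[R]_(m, n)) A0 : c @ F --> c0 -> mx_cvg A A0 -> mx_cvg (fun x => c x *: A x) (c0 *: A0).
Proof. by move=> Hc HA i j; rewrite mxE; under eq_fun do rewrite mxE; exact: cvgM. Qed.

Lemma mx_cvg_tr m n (A : T -> 'M[R]_(m, n)) A0 : mx_cvg A A0 -> mx_cvg (fun x => (A x)^T) A0^T.
Proof. by move=> HA i j; rewrite mxE; under eq_fun do rewrite mxE; exact: HA. Qed.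

Lemma mx_cvg_mul m n p (A : T -> 'M[R]_(m, n)) A0 (B : T -> 'M[R]_(n, p)) B0 :
  mx_cvg A A0 -> mx_cvg B B0 -> mx_cvg (fun x => A x *m B x) (A0 *m B0).
Proof.
move=> HA HB i j; rewrite mxE; under eq_fun do rewrite mxE.
by apply: cvg_finsum => l; exact: cvgM.
Qed.

Lemma mx_cvg_sum m n (I : finType) (A : I -> T -> 'M[R]_(m, n)) A0 :
  (forall l, mx_cvg (A l) (A0 l)) -> mx_cvg (fun x => \sum_l A l x) (\sum_l A0 l).
Proof.
move=> HA i j; rewrite summxE; under eq_fun do rewrite summxE.
by apply: cvg_finsum => l; exact: HA.
Qed.

Lemma cvg_det n (A : T -> 'M[R]_n) A0 : mx_cvg A A0 -> (fun x => \det (A x)) @ F --> \det A0.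
Proof.
move=> HA; rewrite /determinant; apply: cvg_finsum => s.
by apply: cvgM; [exact: cvg_cst|apply: cvg_finprod => i; exact: HA].
Qed.

(** Cofactors over the determinant. Invertibility at every parameter selects the true branch of
    [invmx]. *)
Lemma mx_cvg_inv n (A : T -> 'M[R]_n) A0 : (forall x, A x \in unitmx) -> A0 \in unitmx ->
  mx_cvg A A0 -> mx_cvg (fun x => invmx (A x)) (invmx A0).
Proof.
move=> uA uA0 HA; rewrite /invmx uA0; under eq_fun do rewrite uA.
apply: mx_cvgZ.
  by apply: cvgV; [move: uA0; rewrite unitmxE unitfE|exact: cvg_det].
move=> i j; rewrite mxE; under eq_fun do rewrite mxE.
rewrite /cofactor; apply: cvgM; first exact: cvg_cst.
apply: cvg_det => a b; rewrite !mxE; under eq_fun do rewrite !mxE.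
exact: HA.
Qed.

Lemma mx_cvg_lin_mx m n p q (h : T -> 'M[R]_(m, n) -> 'M[R]_(p, q)) h0 :
  (forall D, mx_cvg (fun x => h x D) (h0 D)) -> mx_cvg (fun x => lin_mx (h x)) (lin_mx h0).
Proof.
move=> H i j; case/mxvec_indexP: j => a b.
rewrite mxE /= mxvecE; under eq_fun do rewrite mxE /= mxvecE.
exact: H.
Qed.

Lemma mx_cvg_lyap n (M Gam : T -> 'M[R]_n) M0 Gam0 :
  (forall x, lin_mx (lyap_op (M x)) \in unitmx) -> lin_mx (lyap_op M0) \in unitmx ->
  mx_cvg M M0 -> mx_cvg Gam Gam0 -> mx_cvg (fun x => lyap (M x) (Gam x)) (lyap M0 Gam0).
Proof.
move=> uM uM0 HM HG.
have E (A B : 'M[R]_n) : lyap A B = 2 *: vec_mx (mxvec B *m invmx (lin_mx (lyap_op A))).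
  by rewrite /lyap scaler_nat.
rewrite E; under eq_fun do rewrite E.
apply: mx_cvgZ; first exact: cvg_cst.
move=> i j; rewrite mxE; under eq_fun do rewrite mxE.
suff : mx_cvg (fun x => mxvec (Gam x) *m invmx (lin_mx (lyap_op (M x)))) (mxvec Gam0 *m invmx (lin_mx (lyap_op M0))) by exact.
apply: mx_cvg_mul.
  by move=> a c; rewrite !ord1; case/mxvec_indexP: c => c d; rewrite mxvecE; under eq_fun do rewrite mxvecE; exact: HG.
apply: mx_cvg_inv => //; apply: mx_cvg_lin_mx => D; rewrite /lyap_op.
apply: mx_cvgD; first exact: mx_cvg_cst.
apply: mx_cvgD; [apply: mx_cvgD; [exact: mx_cvg_cst|]|]; apply: mx_cvgN; apply: mx_cvg_mul => //; try exact: mx_cvg_cst.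
exact: mx_cvg_tr.
Qed.

End MatrixLimits.

Section Continuity.
Variables (R : realType) (T : Type) (F : set_system T).
Hypothesis FF : Filter F.
Variables (k : nat) (f : nat -> R) (fs : T -> nat -> R).
Hypothesis k1 : (1 <= k)%N.
Hypothesis fp : fpos f.
Hypothesis cf : constant_from f k.
Hypothesis fsp : forall x, fpos (fs x).
Hypothesis csf : forall x, constant_from (fs x) k.
Hypothesis gap : spectral_gap f k.
Hypothesis gaps : forall x, spectral_gap (fs x) k.
Hypothesis cvf : forall j, (1 <= j)%N -> (fun x => fs x j) @ F --> f j.

Let l0 : 0 < lam f := (lamP fp k1 cf).1.

Lemma cvg_pim_lam m : (fun x => pim (fs x) (lam (fs x)) m) @ F --> pim f (lam f) m.
Proof. by apply: cvg_pim => //; exact: (cvg_lam FF fp k1 cf fsp csf cvf). Qed.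

Lemma cvg_pdist m : (fun x => pdist (fs x) m) @ F --> pdist f m.
Proof. by apply: cvgB; exact: cvg_pim_lam. Qed.

Lemma mx_cvg_vrow : mx_cvg F (fun x => vrow (fs x) k) (vrow f k).
Proof.
move=> i j; rewrite mxE; under eq_fun do rewrite mxE.
by case: ifP => _; [exact: cvg_pdist|exact: cvg_pim_lam].
Qed.

Lemma mx_cvg_act : mx_cvg F (fun x => act (fs x) k) (act f k).
Proof. by move=> i j; rewrite mxE; under eq_fun do rewrite mxE; exact: cvf. Qed.

Lemma mx_cvg_At : mx_cvg F (fun x => At (fs x) k) (At f k).
Proof.
apply: mx_cvg_tr => i j; rewrite mxE; under eq_fun do rewrite mxE.
cbv zeta; case: ifP => _; first exact: cvf.
case: ifP => [/andP[i2 _]|_]; first by apply: cvf; rewrite -ltnS prednK// ltnW.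
case: ifP => _; last exact: cvg_cst.
by apply: cvgN; exact: cvf.
Qed.

Lemma mx_cvg_Mmx : mx_cvg F (fun x => Mmx (fs x) k) (Mmx f k).
Proof.
apply: mx_cvgZ; first by apply: cvgV; [rewrite gt_eqF|exact: (cvg_lam FF fp k1 cf fsp csf cvf)].
apply: mx_cvgD; first exact: mx_cvg_At.
apply: mx_cvgN; apply: mx_cvg_mul; last exact: mx_cvg_vrow.
by apply: mx_cvg_tr; exact: mx_cvg_act.
Qed.

Lemma mx_cvg_Gam : mx_cvg F (fun x => Gam (fs x) k) (Gam f k).
Proof.
apply: mx_cvg_sum => j; apply: mx_cvgZ.
  apply: cvgM; last by apply: cvgV; [rewrite gt_eqF|exact: (cvg_lam FF fp k1 cf fsp csf cvf)].
  by apply: cvgM; [exact: mx_cvg_vrow|exact: cvf].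
have H : mx_cvg F (fun x => xi (fs x) j) (xi f j).
  apply: mx_cvgD; first exact: mx_cvg_cst.
  by apply: mx_cvgN; exact: mx_cvg_vrow.
by apply: mx_cvg_mul => //; exact: mx_cvg_tr.
Qed.

(** The spectral gap at each parameter makes the Lyapunov operator invertible there, which
    [mx_cvg_inv] requires along the filter as well as at its limit. *)
Lemma lin_lyap_unit (h : nat -> R) : fpos h -> constant_from h k -> spectral_gap h k -> lin_mx (lyap_op (Mmx h k)) \in unitmx.
Proof.
move=> hp ch hg; have [G [b [Gsym Gpos b0 bl GB]]] := spectral_package k1 hp ch hg.
have [B1 B2 B3] := Mmx_bound k1 hp ch b0 bl GB.
exact: (lyap_op_unit Gsym Gpos B1 B2 B3).
Qed.

Lemma mx_cvg_Sig : mx_cvg F (fun x => Sig (fs x) k) (Sig f k).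
Proof.
have u0 : lin_mx (lyap_op (Mmx f k)) \in unitmx by exact: (lin_lyap_unit fp cf gap).
have us x : lin_mx (lyap_op (Mmx (fs x) k)) \in unitmx by exact: (lin_lyap_unit (@fsp x) (@csf x) (@gaps x)).
exact: (mx_cvg_lyap FF us u0 mx_cvg_Mmx mx_cvg_Gam).
Qed.

End Continuity.

(** * Convergence in distribution *)

Section Transfer.
Variables (R : realType) (f : nat -> R).
Hypothesis fp : fpos f.

Lemma past_deg_count n h h' l : past_eq n h h' -> deg_count h l n.+1 = deg_count h' l n.+1.
Proof. by move=> hh; apply: eq_bigr => i _; rewrite (eq_deg _ hh). Qed.

Lemma pa_cvg_in_distribution (S : ptopologicalType) (mu : probability (borel S) R) (Phi : nat -> (nat -> nat) -> S)
    d (T : measurableType d) (P : probability T R) (c : nat -> {RV P >-> nat}) :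
  (forall n, past_fun n (Phi n.+1)) ->
  (forall g : S -> R, continuous g -> (exists B, forall x, `|g x| <= B) ->
    (fun n => EH f n (fun h => g (Phi n.+1 h))) @ \oo --> \int[mu]_x g x) ->
  pa_process f c -> cvg_in_distribution P (fun n w => Phi n (c ^~ w)) mu.
Proof.
move=> pPhi H pa g cg bg; have [B gB] := bg.
have -> : ('E_mu[g] = (\int[mu]_x g x)%:E)%E.
  rewrite unlock -[LHS]fineK//; apply: integrable_fin_num => //.
  by apply: bounded_integrable; [exact: continuous_borel_fun|exists B].
rewrite -(cvg_shiftS (fun n => ('E_P[(g \o (fun w => Phi n (c ^~ w)))])%E)).
have E n : ('E_P[(g \o (fun w => Phi n.+1 (c ^~ w)))] = (EH f n (fun h => g (Phi n.+1 h)))%:E)%E.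
  apply: (pa_expectation fp pa (phi := fun h => g (Phi n.+1 h)) (M := B)) => //.
  by move=> h h' hh; congr g; exact: pPhi.
rewrite (_ : [sequence _]_n = EFin \o (fun n => EH f n (fun h => g (Phi n.+1 h)))); last by apply/funext => n /=.
by apply: cvg_EFin; [exact: nearW|exact: H].
Qed.

End Transfer.

Section Gap.
Variables (R : realType) (f : nat -> R) (k : nat).
Hypothesis k1 : (1 <= k)%N.
Hypothesis fp : fpos f.
Hypothesis cf : constant_from f k.
Hypothesis gap : spectral_gap f k.

Definition Zn n h : 'rV[R]_k.+1 := (Num.sqrt n.+1%:R)^-1 *: Dn f k h n.+1.

Lemma gap_Sig : [/\ (Sig f k)^T = Sig f k, (forall t, 0 <= bil (Sig f k) t t) &
  forall (t : 'rV[R]_k.+1) b, (fun n => EH f n (fun h => cos (dotv t (Zn n h) + b))) @ \oo -->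
    cos b * expR (- (bil (Sig f k) t t / 2))].
Proof.
have [G [b [Gsym Gpos b0 bl GB]]] := spectral_package k1 fp cf gap.
split; first by have [] := SigP k1 fp cf Gsym Gpos b0 bl GB.
  exact: (Sig_ge0 k1 fp cf Gsym Gpos b0 bl GB).
move=> t b'; have := clt_cf k1 fp cf Gsym Gpos b0 bl GB (t := t) (b' := b').
by under eq_fun do under [fun h => _]funext do rewrite addrC.
Qed.

Lemma gap_moment : exists K, forall n j, EH f n (fun h => Zn n h 0 j ^+ 2) <= K.
Proof.
have [G [b [Gsym Gpos b0 bl GB]]] := spectral_package k1 fp cf gap.
have [K K0 HK] := second_moment k1 fp cf Gsym Gpos b0 bl GB.
have [c c0 Hc] := coord_le Gsym Gpos.
exists (c ^+ 2 * K) => n j.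
have [eD eZ eM e1] := EH_expect fp n.
have n0 : 0 < n.+1%:R :> R by [].
apply: (@le_trans _ _ (c ^+ 2 / n.+1%:R * EH f n (fun h => bil G (Dn f k h n.+1) (Dn f k h n.+1)))).
  rewrite -eZ; apply: eM => h.
  rewrite mxE exprMn exprVn sqr_sqrtr// mulrAC [leRHS]mulrC ler_wpM2l ?invr_ge0//.
  rewrite -(real_normK (num_real _)).
  have gD := Gge0 Gpos (Dn f k h n.+1).
  rewrite -[X in _ * X](sqr_sqrtr gD) -exprMn lerXn2r ?nnegrE// mulr_ge0// sqrtr_ge0.
by rewrite -mulrA ler_wpM2l ?sqr_ge0// ler_pdivrMl// mulrC.
Qed.

End Gap.

Section Truncation.
Variable R : realType.
Implicit Types (t : nat -> R).

Lemma sum_ord_support (F : nat -> R) m K : (forall i, (K <= i)%N -> F i = 0) ->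
  \sum_(i < m) F i = \sum_(i < K) (if (i < m)%N then F i else 0).
Proof.
move=> F0; elim: m => [|m IH]; first by rewrite big_ord0 big1.
rewrite big_ord_recr/= IH.
have -> : \sum_(i < K) (if (i < m.+1)%N then F i else 0) =
  \sum_(i < K) (if (i < m)%N then F i else 0) + \sum_(i < K) (if (i == m :> nat) then F i else 0).
  rewrite -big_split; apply: eq_bigr => i _ /=.
  by rewrite ltnS leq_eqVlt; case: ltngtP => im; rewrite ?addr0 ?add0r.
congr (_ + _); have [mK|Km] := ltnP m K.
  by rewrite -big_mkcond (big_pred1 (Ordinal mK)).
rewrite F0// big1// => i _; case: eqP => // im; have := ltn_ord i; rewrite im; lia.
Qed.

Definition trunc k m t : 'rV[R]_k.+1 := \row_j (if (j < m)%N then t j else 0).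

Lemma dotv_trunc k m t (Y : nat -> R) (Z : 'rV[R]_k.+1) :
  (forall j : 'I_k.+1, (j < m)%N -> Y j = Z 0 j) -> (forall j, (k < j)%N -> (j < m)%N -> Y j = 0) ->
  \sum_(j < m) t j * Y j = dotv (trunc k m t) Z.
Proof.
move=> YZ Y0.
have -> : \sum_(j < m) t j * Y j = \sum_(j < m) (if (j < m)%N then t j * Y j else 0).
  by apply: eq_bigr => j _; rewrite ltn_ord.
rewrite (@sum_ord_support (fun j => if (j < m)%N then t j * Y j else 0) m k.+1); last first.
  by move=> i ki; case: ifP => // im; rewrite Y0// mulr0.
by rewrite /dotv; apply: eq_bigr => j _; rewrite mxE; case: ifP => jm; rewrite ?jm ?mul0r ?YZ.
Qed.

Lemma bil_trunc k (S : 'M[R]_k.+1) (C : nat -> nat -> R) m t :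
  (forall i j : 'I_k.+1, (i < m)%N -> (j < m)%N -> C i j = S i j) ->
  (forall i j, (i < m)%N -> (j < m)%N -> (k < i)%N || (k < j)%N -> C i j = 0) ->
  qform C m t = bil S (trunc k m t) (trunc k m t).
Proof.
move=> CS C0; rewrite bilE /qform.
have E1 i : (i < m)%N -> \sum_(j < m) C i j * t i * t j =
    \sum_(j < k.+1) (if (j < m)%N then C i j * t i * t j else 0).
  move=> im.
  have -> : \sum_(j < m) C i j * t i * t j = \sum_(j < m) (if (j < m)%N then C i j * t i * t j else 0).
    by apply: eq_bigr => j _; rewrite ltn_ord.
  rewrite (@sum_ord_support (fun j => if (j < m)%N then C i j * t i * t j else 0) m k.+1).
    by apply: eq_bigr => j _; case: ifP => // ->.
  by move=> j kj; case: ifP => // jm; rewrite C0 ?mul0r// kj orbT.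
pose F i := if (i < m)%N then \sum_(j < k.+1) (if (j < m)%N then C i j * t i * t j else 0) else 0.
rewrite (eq_bigr (fun i : 'I_m => F i)); last by move=> i _; rewrite /F ltn_ord E1.
rewrite (@sum_ord_support F m k.+1); last first.
  move=> i ki; rewrite /F; case: ifP => // im; apply: big1 => j _; case: ifP => // jm.
  by rewrite C0 ?mul0r// ki.
apply: eq_bigr => i _; rewrite /F; case im : (i < m)%N; last first.
  by rewrite big1// => j _; rewrite !mxE im mulr0 mul0r.
apply: eq_bigr => j _; rewrite !mxE im; case: ifP => jm; last by rewrite mulr0.
by rewrite CS.
Qed.

End Truncation.

Section Finite.
Variables (R : realType) (k : nat).

(** The limit covariance padded with zeros to an array on all of nat, since Gaussian measures are
    built on sequences. *)
Definition Cfin (f : nat -> R) (i j : nat) : R :=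
  if (i < k.+1)%N && (j < k.+1)%N then Sig f k (inord i) (inord j) else 0.

Lemma Cfin_qform f m t : qform (Cfin f) m t = bil (Sig f k) (trunc k m t) (trunc k m t).
Proof.
apply: bil_trunc => i j im jm; first by rewrite /Cfin !ltn_ord !inord_val.
by rewrite /Cfin [(i < k.+1)%N]ltnNge [(j < k.+1)%N]ltnNge -negb_or => ->.
Qed.

Variable f : nat -> R.
Hypothesis k1 : (1 <= k)%N.
Hypothesis fp : fpos f.
Hypothesis cf : constant_from f k.
Hypothesis gap : spectral_gap f k.

Lemma psd_Cfin : psd (Cfin f).
Proof.
have [S1 S2 _] := gap_Sig k1 fp cf gap.
split=> [i j|m t]; last by rewrite Cfin_qform.
by rewrite /Cfin andbC; case: ifP => // _; rewrite -{1}S1 mxE.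
Qed.

Lemma cvg_finite_fluctuations (g : 'rV[R]_k.+1 -> R) : continuous g -> (exists B, forall x, `|g x| <= B) ->
  (fun n => EH f n (fun h => g (finite_fluctuations (pdist f) k h n.+1))) @ \oo --> \int[gauss_row k (Cfin f)]_x g x.
Proof.
move=> cg bg; rewrite gauss_row_integral//.
(* The vector is embedded as a sequence with zeros after index [k], so that the continuity theorem
   on R^infty also covers the finite case. *)
pose Y n h j := if (j < k.+1)%N then Zn f k n h 0 (inord j) else 0.
have gE n h : g (finite_fluctuations (pdist f) k h n.+1) = g (to_row k (Y n h)).
  rewrite (finite_fluctuations_Dn k1 fp cf)//; congr g; apply/rowP => j.
  by rewrite [RHS]mxE /Y ltn_ord inord_val.
under eq_fun do under [fun h => _]funext do rewrite gE.
have [S1 S2 S3] := gap_Sig k1 fp cf gap.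
have [K HK] := gap_moment k1 fp cf gap.
apply: (levy_continuity (H := fun=> nat -> nat) (E := fun n => EH f n) (Y := Y) (Cv := fun=> Num.max K 0)
  (mu := gauss_measure (Cfin f)) _ _ _ _ (g := g \o to_row k)).
- by move=> n; exact: EH_expect.
- move=> n j; have [eD eZ eM e1] := EH_expect fp n; rewrite /Y le_max; case jk : (j < k.+1)%N; first by rewrite HK.
  by rewrite expr0n/= (e1 0) lexx orbT.
- by move=> n; exists k.+1 => h j kj; rewrite /Y ltnNge kj normr0.
- move=> m t b; rewrite (gauss_measure_cf m t b psd_Cfin) Cfin_qform.
  have E n h : \sum_(j < m) t j * Y n h j = dotv (trunc k m t) (Zn f k n h).
    apply: dotv_trunc => j; first by rewrite /Y ltn_ord inord_val.
    by move=> kj _; rewrite /Y ltnS leqNgt kj.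
  by under eq_fun do under [fun h => _]funext do rewrite E; exact: S3.
- by move=> x; apply: continuous_comp; [exact: continuous_to_row|exact: cg].
- by have [B gB] := bg; exists B => x; exact: gB.
Qed.

End Finite.

Section Infinite.
Variables (R : realType) (f : nat -> R) (K1 : nat).
Hypothesis K11 : (1 <= K1)%N.
Hypothesis fp : fpos f.
Hypothesis cf : forall k, (K1 <= k)%N -> constant_from f k.
Hypothesis gap : forall k, (K1 <= k)%N -> spectral_gap f k.

(** The inequality [j < k] is strict because coordinate [k] of the urn holds the whole tail and not
    degree [k + 1]. *)
Lemma fluctuations_Zn n h k j : (K1 <= k)%N -> (j < k)%N -> fluctuations (pdist f) h n.+1 j = Zn f k n h 0 (inord j).
Proof.
move=> Kk jk; rewrite /Zn -(finite_fluctuations_Dn (leq_trans K11 Kk) fp (cf Kk))// mxE inordK ?jk//.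
by rewrite ltnS ltnW.
Qed.

Lemma fluctuations_cf k m (t : nat -> R) b : (K1 <= k)%N -> (m <= k)%N ->
  (fun n => EH f n (fun h => cos (\sum_(j < m) t j * fluctuations (pdist f) h n.+1 j + b))) @ \oo -->
  cos b * expR (- (bil (Sig f k) (trunc k m t) (trunc k m t) / 2)).
Proof.
move=> Kk mk; have [S1 S2 S3] := gap_Sig (leq_trans K11 Kk) fp (cf Kk) (gap Kk).
have E n h : \sum_(j < m) t j * fluctuations (pdist f) h n.+1 j = dotv (trunc k m t) (Zn f k n h).
  apply: dotv_trunc => j jm; last by move: jm; lia.
  by rewrite (@fluctuations_Zn _ _ k)// ?inord_val//; exact: leq_trans jm mk.
by under eq_fun do under [fun h => _]funext do rewrite E; exact: S3.
Qed.

Lemma Sig_trunc_consistent k k' m (t : nat -> R) : (K1 <= k)%N -> (K1 <= k')%N -> (m <= k)%N -> (m <= k')%N ->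
  bil (Sig f k) (trunc k m t) (trunc k m t) = bil (Sig f k') (trunc k' m t) (trunc k' m t).
Proof.
move=> Kk Kk' mk mk'.
have : cos 0 * expR (- (bil (Sig f k) (trunc k m t) (trunc k m t) / 2)) =
    cos 0 * expR (- (bil (Sig f k') (trunc k' m t) (trunc k' m t) / 2)).
  have A := fluctuations_cf (t := t) (b := 0) Kk mk; have B := fluctuations_cf (t := t) (b := 0) Kk' mk'.
  by rewrite -(cvg_lim (@norm_hausdorff _ R) A) -(cvg_lim (@norm_hausdorff _ R) B).
rewrite cos0 !mul1r => /expR_inj /oppr_inj; apply: mulIf.
by rewrite invr_eq0 pnatr_eq0.
Qed.

(** Polarisation: the diagonal forms agree on [e i], [e j] and their sum, hence so do the
    entries. *)
Lemma Sig_consistent k k' i j : (K1 <= k)%N -> (K1 <= k')%N -> (i < k)%N -> (i < k')%N -> (j < k)%N -> (j < k')%N ->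
  Sig f k (inord i) (inord j) = Sig f k' (inord i) (inord j).
Proof.
move=> Kk Kk' ik ik' jk jk'.
pose e (a : nat) (l : nat) : R := (l == a)%:R.
pose m := (maxn i j).+1.
have mk : (m <= k)%N by rewrite gtn_max ik.
have mk' : (m <= k')%N by rewrite gtn_max ik'.
have im : (i < m)%N by rewrite ltnS leq_maxl.
have jm : (j < m)%N by rewrite ltnS leq_maxr.
have tr_e r a : (m <= r)%N -> (a < m)%N -> trunc r m (e a) = delta_mx 0 (inord a).
  move=> mr am; have ar : (a < r.+1)%N by lia.
  apply/rowP => l; rewrite !mxE eqxx /= /e -val_eqE /= inordK//.
  by case: ltnP => // ml; case: eqP => // la; move: am; rewrite -la ltnNge ml.
have tr_s r : trunc r m (fun l => e i l + 1 * e j l) = trunc r m (e i) + 1 *: trunc r m (e j).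
  by apply/rowP => l; rewrite !mxE; case: ifP => // _; rewrite mulr0 addr0.
have [S1 _ _] := gap_Sig (leq_trans K11 Kk) fp (cf Kk) (gap Kk).
have [S1' _ _] := gap_Sig (leq_trans K11 Kk') fp (cf Kk') (gap Kk').
have := Sig_trunc_consistent (fun l => e i l + 1 * e j l) Kk Kk' mk mk'.
have := Sig_trunc_consistent (e i) Kk Kk' mk mk'.
have := Sig_trunc_consistent (e j) Kk Kk' mk mk'.
rewrite !tr_s !bil_addM// !tr_e// !bil_delta expr1n !mul1r mulr1 => -> ->.
by move=> /addIr /addrI /(mulfI _); apply; rewrite pnatr_eq0.
Qed.

(** Each entry is read in a truncation at least [K1], where the gap holds, and beyond both indices,
    so that neither falls into the tail class. *)
Definition Cinf (i j : nat) : R := Sig f (maxn K1 (maxn i j).+1) (inord i) (inord j).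

Lemma Cinf_qform k m (t : nat -> R) : (K1 <= k)%N -> (m <= k)%N ->
  qform Cinf m t = bil (Sig f k) (trunc k m t) (trunc k m t).
Proof.
move=> Kk mk; apply: bil_trunc => i j im jm; last by lia.
rewrite /Cinf (@Sig_consistent _ k) ?inord_val ?leq_maxl//; lia.
Qed.

Lemma psd_Cinf : psd Cinf.
Proof.
split=> [i j|m t].
  rewrite /Cinf [maxn j i]maxnC; set k := maxn _ _.
  have Kk : (K1 <= k)%N by exact: leq_maxl.
  have [S1 _ _] := gap_Sig (leq_trans K11 Kk) fp (cf Kk) (gap Kk).
  by rewrite -{1}S1 mxE.
have Kk : (K1 <= maxn K1 m)%N by exact: leq_maxl.
have [_ S2 _] := gap_Sig (leq_trans K11 Kk) fp (cf Kk) (gap Kk).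
by rewrite (@Cinf_qform (maxn K1 m))// leq_maxr.
Qed.

(** At a fixed time no degree exceeds the number of nodes, so late coordinates reduce to
    [- sqrt n * p_j], which tends to 0 in [j]. This provides the bound on late coordinates in
    [levy_continuity]. *)
Lemma fluctuations_tail n : exists m, forall h j, (m <= j)%N -> `|fluctuations (pdist f) h n.+1 j| <= 1.
Proof.
have [l0 _] := lamP fp K11 (cf (leqnn K1)).
have s0 : 0 < Num.sqrt n.+1%:R :> R by rewrite sqrtr_gt0.
have /cvgrPdist_le/(_ (Num.sqrt n.+1%:R)^-1) := cvg_pim0 fp l0 (cf (leqnn K1)) K11.
rewrite invr_gt0 => /(_ s0) [M _ HM].
exists (maxn M n.+1) => h j; rewrite geq_max => /andP[Mj nj].
rewrite /fluctuations /deg_prop (deg_count_gt (leqnn 1))//.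
rewrite mul0r sub0r normrM normrN (ger0_norm (ltW s0)) mulrC -ler_pdivlMr// mul1r.
have d0 : pim f (lam f) j.+1 < pim f (lam f) j by exact: pim_decr.
have p0 := pim_gt0 j fp l0; have p1 := pim_gt0 j.+1 fp l0.
have := HM j Mj; rewrite /= sub0r normrN (gtr0_norm p0) => /(le_trans _); apply.
by rewrite /pdist /= ger0_norm ?subr_ge0 ?(ltW d0)// gerBl ltW.
Qed.

Lemma cvg_fluctuations (g : {ptws nat -> R} -> R) : continuous g -> (exists B, forall x, `|g x| <= B) ->
  (fun n => EH f n (fun h => g (fluctuations (pdist f) h n.+1))) @ \oo --> \int[gauss_measure Cinf]_x g x.
Proof.
move=> cg bg.
have /choice[Cv HCv] j : exists C, forall n, EH f n (fun h => (fluctuations (pdist f) h n.+1 j) ^+ 2) <= C.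
  pose k := maxn K1 j.+1; have Kk : (K1 <= k)%N by exact: leq_maxl.
  have [C HC] := gap_moment (leq_trans K11 Kk) fp (cf Kk) (gap Kk).
  exists C => n; under [fun h => _]funext do rewrite (@fluctuations_Zn _ _ k) ?leq_maxr//.
  exact: HC.
apply: (levy_continuity (H := fun=> nat -> nat) (E := fun n => EH f n)
  (Y := fun n h => fluctuations (pdist f) h n.+1) (Cv := Cv) (mu := gauss_measure Cinf)) => //.
- by move=> n; exact: EH_expect.
- by move=> n; exact: fluctuations_tail.
- move=> m t b; have Kk : (K1 <= maxn K1 m)%N by exact: leq_maxl.
  rewrite (gauss_measure_cf m t b psd_Cinf) (@Cinf_qform (maxn K1 m)) ?leq_maxr//.
  by apply: fluctuations_cf => //; exact: leq_maxr.
Qed.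

End Infinite.

Theorem propositionB4 (R : realType) :
  exists (p : (nat -> R) -> nat -> R)
         (nu : forall kappa : nat,
            (nat -> R) -> probability (borel 'rV[R]_kappa.+1) R),
  [/\ forall (f : nat -> R) (kappa : nat),
        (1 <= kappa)%N -> pa_function f -> constant_from f kappa ->
        spectral_gap f kappa ->
        [/\ is_distribution (p f),
            centered_normal (nu kappa f) &
            forall (d : measure_display) (T : measurableType d)
                   (P : probability T R) (c : nat -> {RV P >-> nat}),
              pa_process f c ->
              cvg_in_distribution P
                (fun n w => finite_fluctuations (p f) kappa (c ^~ w) n)
                (nu kappa f)],
      forall (kappa : nat) (Theta : topologicalType) (F : Theta -> nat -> R),
        (1 <= kappa)%N ->
        (forall theta, [/\ pa_function (F theta),
                           constant_from (F theta) kappa &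
                           spectral_gap (F theta) kappa]) ->
        (forall k, (1 <= k)%N -> continuous (fun theta => F theta k)) ->
        (forall k, (1 <= k)%N -> continuous (fun theta => p (F theta) k)) /\
        (forall i j, continuous
           (fun theta => covariance_mx (nu kappa (F theta)) i j)) &
      forall (f : nat -> R) (kappa0 : nat),
        (1 <= kappa0)%N -> pa_function f -> constant_from f kappa0 ->
        (\forall kappa \near \oo, spectral_gap f kappa) ->
        exists mu : probability (borel {ptws nat -> R}) R,
        forall (d : measure_display) (T : measurableType d)
               (P : probability T R) (c : nat -> {RV P >-> nat}),
          pa_process f c ->
          cvg_in_distribution P (fun n w => fluctuations (p f) (c ^~ w) n) mu].
Proof.
exists (@pdist R), (fun k f => gauss_row k (Cfin k f)); split.
- move=> f k k1 [fp _] cf gap; split.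
  + exact: pdist_distribution fp k1 cf.
  + exact/centered_normal_gauss_row/psd_Cfin.
  + move=> d T P c.
    apply: (pa_cvg_in_distribution fp (Phi := fun n h => finite_fluctuations (pdist f) k h n)); last exact: cvg_finite_fluctuations.
    move=> n h h' hh; rewrite /finite_fluctuations.
    rewrite (_ : @deg_prop R h n.+1 = @deg_prop R h' n.+1)//.
    by apply/funext => l; rewrite /deg_prop (past_deg_count l hh).
- move=> k Theta F k1 HF cF.
  have fpF x : fpos (F x) by have [[]] := HF x.
  have cfF x : constant_from (F x) k by have [] := HF x.
  have gF x : spectral_gap (F x) k by have [] := HF x.
  split=> [m _|i j] x.
    by apply: (cvg_pdist _ k1) => // l l1; exact: cF.
  rewrite (_ : (fun theta => covariance_mx (gauss_row k (Cfin k (F theta))) i j) = fun theta => Sig (F theta) k i j).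
    by apply: (mx_cvg_Sig _ k1) => // l l1; exact: cF.
  apply/funext => y; rewrite gauss_row_covariance; last exact: psd_Cfin.
  by rewrite /Cfin !ltn_ord !inord_val.
- move=> f k0 k01 [fp _] cf [M _ HM].
  (* From [K] on, both the spectral gap and the constancy of [f] hold, so every larger truncation
     can be used. *)
  pose K := maxn M k0; have K1 : (1 <= K)%N by rewrite (leq_trans k01)// leq_maxr.
  have cfK k : (K <= k)%N -> constant_from f k.
    by rewrite geq_max => /andP[_ k0k] j kj; rewrite (cf j (leq_trans k0k kj)) (cf k k0k).
  have gK k : (K <= k)%N -> spectral_gap f k by rewrite geq_max => /andP[Mk _]; exact: HM.
  exists (gauss_measure (Cinf f K)) => d T P c.
  apply: (pa_cvg_in_distribution fp (S := {ptws nat -> R}) (Phi := fun n h => fluctuations (pdist f) h n)).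
    by move=> n h h' hh; apply/funext => l; rewrite /fluctuations /deg_prop (past_deg_count _ hh).
  by move=> g cg bg; exact: cvg_fluctuations.
Qed.
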